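(* Let $\alpha>0$ and $L>0$. Then $$\max_{|\Sigma|=L}\lambda_1^\alpha(\Sigma)=\lambda_1^\alpha(\Gamma_L),$$ where the maximum is taken over all smooth open arcs $\Sigma\subset\mathbb{R}^2$ of length $|\Sigma|=L$, and $\Gamma_L\subset\mathbb{R}^2$ is a line segment of length $L$. Moreover, for a smooth open arc $\Sigma$ of length $L$, the equality $\lambda_1^\alpha(\Sigma)=\lambda_1^\alpha(\Gamma_L)$ holds if and only if $\Sigma$ and $\Gamma_L$ are congruent.
   Context: A smooth open arc is a compact non-closed $C^\infty$-smooth curve $\Sigma\subset\mathbb{R}^2$ of finite positive length with two (distinct) free endpoints which can be continued up to the boundary of a $C^\infty$-smooth bounded simply connected domain; that is, $\Sigma$ is a compact sub-arc with two distinct endpoints of $\partial\Omega_+$ for some bounded simply connected domain $\Omega_+\subset\mathbb{R}^2$ with $C^\infty$-smooth boundary (in particular $\Sigma$ has no self-intersections). $|\Sigma|$ denotes its length. Line segments are smooth open arcs. Two arcs are congruent if one is mapped onto the other by an isometry of $\mathbb{R}^2$. For a smooth open arc $\Sigma$ and $\alpha>0$, let $H_{\delta,\alpha}^\Sigma$ be the self-adjoint operator in $L^2(\mathbb{R}^2)$ associated via the first representation theorem with the closed, densely defined, symmetric, semi-bounded quadratic form $$\mathfrak{h}_{\delta,\alpha}^\Sigma[u]=\|\nabla u\|^2_{L^2(\mathbb{R}^2;\mathbb{C}^2)}-\alpha\|u|_\Sigma\|^2_{L^2(\Sigma)},\qquad \mathrm{dom}\,\mathfrak{h}_{\delta,\alpha}^\Sigma=H^1(\mathbb{R}^2),$$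 where $u|_\Sigma$ is the trace of $u$ on $\Sigma$ and $L^2(\Sigma)$ is taken with respect to arc length. The essential spectrum of $H_{\delta,\alpha}^\Sigma$ is $[0,\infty)$ and its negative discrete spectrum is non-empty and finite; $\lambda_1^\alpha(\Sigma)<0$ denotes the lowest eigenvalue of $H_{\delta,\alpha}^\Sigma$. *)

(* Defs.v *)
From HB Require Import structures.
From mathcomp Require Import all_boot all_order all_algebra.
From mathcomp Require Import all_classical all_reals all_analysis.
From mathcomp Require Import complex.
Set Implicit Arguments.
Unset Strict Implicit.
Unset Printing Implicit Defensive.
Import Order.TTheory GRing.Theory Num.Theory.
Import numFieldNormedType.Exports.
Local Open Scope classical_set_scope.
Local Open Scope ring_scope.
Local Open Scope complex_scope.

Section Defs.
Context (R : realType).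

(* The library norm on [R * R] is the max norm; it is used for topology,
   boundedness and differentiability only.  Lengths, distances and isometries
   use the Euclidean norm [enorm]. *)
Definition enorm (x : R * R) : R := Num.sqrt (x.1 ^+ 2 + x.2 ^+ 2).

(* C^oo: every iterated directional derivative is differentiable everywhere. *)
Definition smooth (V W : normedModType R) (f : V -> W) : Prop :=
  forall (s : seq V) (x : V),
    differentiable (foldr (fun v (g : V -> W) y => 'D_v g y) f s) x.

Definition boundary (A : set (R * R)) : set (R * R) := closure A `\` interior A.

Definition loops_contract (A : set (R * R)) : Prop :=
  forall c : R -> R * R,
    {within `[0, 1], continuous c} -> c @` `[0, 1] `<=` A -> c 0 = c 1 ->
  exists H : R * R -> R * R,
    [/\ {within `[0, 1] `*` `[0, 1], continuous H},
        H @` (`[0, 1] `*` `[0, 1]) `<=` A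
      & forall t : R, t \in `[0, 1] ->
          [/\ H (0, t) = c t, H (1, t) = c 0, H (t, 0) = c 0 & H (t, 1) = c 0]].

(* Near each boundary point, [A] is the sublevel set of a smooth function
   with nonvanishing differential at that point. *)
Definition smooth_boundary (A : set (R * R)) : Prop :=
  forall p, boundary A p ->
  exists rho : R * R -> R,
    [/\ smooth rho, exists v, 'D_v rho p != 0
      & \forall x \near p, A x <-> rho x < 0].

Definition smooth_bounded_sc_domain (A : set (R * R)) : Prop :=
  [/\ open A, connected A, A !=set0, bounded_set A
    & loops_contract A /\ smooth_boundary A].

(* [p.2] restricted to [0, p.1] is an arc-length parametrization of [S]. *)
Definition arclength_param (S : set (R * R)) (p : R * (R -> R * R)) : Prop :=
  let l := p.1 in let g := p.2 in
  [/\ 0 < l, smooth g, forall t, t \in `[0, l] -> enorm ('D_1 g t) = 1,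
      set_inj `[0, l] g & g @` `[0, l] = S].

Definition smooth_open_arc (S : set (R * R)) : Prop :=
  (exists p, arclength_param S p) /\
  exists2 A, smooth_bounded_sc_domain A & S `<=` boundary A.

(* For a smooth open arc the parametrization is unique on [0, |S|] up to
   orientation, so neither the length nor the objects defined below from
   [arc_param] depend on the choice. *)
Definition arc_param (S : set (R * R)) : R * (R -> R * R) :=
  xget (0, cst 0) [set p | arclength_param S p].

Definition arc_length (S : set (R * R)) : R := (arc_param S).1.

Definition congruent (S T : set (R * R)) : Prop :=
  exists2 f : R * R -> R * R,
    forall x y, enorm (f x - f y) = enorm (x - y) & f @` S = T.

Definition line_segment (L : R) (S : set (R * R)) : Prop :=
  exists a b : R * R,
    enorm (b - a) = L /\
    S = [set x | exists2 t : R, t \in `[0, 1] & x = a + t *: (b - a)].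

Definition leb2 :
    {measure set (measurableTypeR R * measurableTypeR R) -> \bar R} :=
  (@lebesgue_measure R \x @lebesgue_measure R)%E.

Section L2.
Context d (T : measurableType d) (mu : {measure set T -> \bar R}) (D : set T).

Definition cintegral (f : T -> R[i]) : R[i] :=
  Rintegral mu D (fun x => complex.Re (f x)) +i*
  Rintegral mu D (fun x => complex.Im (f x)).

Definition inner (f g : T -> R[i]) : R[i] :=
  cintegral (fun x => f x * (g x)^*).

Definition sqnorm2 (f : T -> R[i]) : \bar R :=
  (\int[mu]_(x in D) ((complex.Re (f x)) ^+ 2 + (complex.Im (f x)) ^+ 2)%:E)%E.

Definition L2 (f : T -> R[i]) : Prop :=
  [/\ measurable_fun D (fun x => complex.Re (f x)),
      measurable_fun D (fun x => complex.Im (f x))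
    & (sqnorm2 f < +oo)%E].

End L2.

Definition test_fun (phi : R * R -> R) : Prop :=
  smooth phi /\ compact (closure [set x | phi x != 0]).

Definition ctest_fun (phi : R * R -> R[i]) : Prop :=
  test_fun (fun x => complex.Re (phi x)) /\
  test_fun (fun x => complex.Im (phi x)).

Definition cpartial (v : R * R) (phi : R * R -> R[i]) (x : R * R) : R[i] :=
  'D_v (fun y => complex.Re (phi y)) x +i* 'D_v (fun y => complex.Im (phi y)) x.

Definition weak_partials (v : R * R) (u : R * R -> R[i]) : set (R * R -> R[i]) :=
  [set g | L2 leb2 setT g /\
     forall phi, test_fun phi ->
       cintegral leb2 setT (fun x => u x * ('D_v phi x)%:C) =
       - cintegral leb2 setT (fun x => g x * (phi x)%:C)].

Definition weak_partial (v : R * R) (u : R * R -> R[i]) : R * R -> R[i] :=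
  xget (cst 0) (weak_partials v u).

Definition e1 : R * R := (1, 0).
Definition e2 : R * R := (0, 1).

Definition H1 (u : R * R -> R[i]) : Prop :=
  [/\ L2 leb2 setT u, weak_partials e1 u !=set0 & weak_partials e2 u !=set0].

(* L^2(S) is realized as L^2(0, |S|) through the arc-length parametrization. *)
Definition L2_arc (S : set (R * R)) (f : R -> R[i]) : Prop :=
  L2 (@lebesgue_measure R) `[0, arc_length S] f.

Definition inner_arc (S : set (R * R)) (f g : R -> R[i]) : R[i] :=
  inner (@lebesgue_measure R) `[0, arc_length S] f g.

Definition sqnorm2_arc (S : set (R * R)) (f : R -> R[i]) : \bar R :=
  sqnorm2 (@lebesgue_measure R) `[0, arc_length S] f.

(* The trace is the extension by density, continuous from H^1 to L^2(S), of
   the restriction to [S] of compactly supported smooth functions. *)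
Definition traces (S : set (R * R)) (u : R * R -> R[i]) : set (R -> R[i]) :=
  [set tau | L2_arc S tau /\
     exists phi : nat -> R * R -> R[i],
       [/\ forall n, ctest_fun (phi n),
           (fun n => sqnorm2 leb2 setT (fun x => phi n x - u x)) @ \oo
             --> 0%E,
           (fun n => sqnorm2 leb2 setT
              (fun x => cpartial e1 (phi n) x - weak_partial e1 u x)) @ \oo
             --> 0%E,
           (fun n => sqnorm2 leb2 setT
              (fun x => cpartial e2 (phi n) x - weak_partial e2 u x)) @ \oo
             --> 0%E
         & (fun n => sqnorm2_arc S
              (fun t => phi n ((arc_param S).2 t) - tau t)) @ \oo
             --> 0%E]].

Definition trace (S : set (R * R)) (u : R * R -> R[i]) : R -> R[i] :=
  xget (cst 0) (traces S u).

(* The sesquilinear form on H^1 whose diagonal is the quadratic form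
   h[u] = |grad u|^2 - alpha |u|_S|^2. *)
Definition form (alpha : R) (S : set (R * R)) (u v : R * R -> R[i]) : R[i] :=
  inner leb2 setT (weak_partial e1 u) (weak_partial e1 v) +
  inner leb2 setT (weak_partial e2 u) (weak_partial e2 v) -
  alpha%:C * inner_arc S (trace S u) (trace S v).

(* Graph of the operator associated with [form] by the first representation
   theorem: [u] is in its domain and is mapped to [f]. *)
Definition H_graph (alpha : R) (S : set (R * R)) (u f : R * R -> R[i]) : Prop :=
  [/\ H1 u, L2 leb2 setT f
    & forall v, H1 v -> form alpha S u v = inner leb2 setT f v].

(* Only real values are considered, the operator being self-adjoint. *)
Definition eigenvalues (alpha : R) (S : set (R * R)) : set R :=
  [set lambda | exists u : R * R -> R[i],
     ~ {ae leb2, forall x, u x = 0} /\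
     H_graph alpha S u (fun x => lambda%:C * u x)].

Definition lambda1 (alpha : R) (S : set (R * R)) : R :=
  xget 0 (eigenvalues alpha S `&` lbound (eigenvalues alpha S)).

End Defs.

(* Main.v *)
(** For E > 0 the free Green function of -Laplacian + E is
    G_E(y) = int_0^oo e^(-E t) (4 pi t)^-1 e^(-|y|^2 / 4 t) dt.  With sigma the
    arc-length parametrization of the arc and Q_E the integral operator on
    L^2([0, L]) of kernel G_E(sigma s - sigma u), a number -E < 0 is an
    eigenvalue iff alpha^-1 is an eigenvalue of Q_E (Birman-Schwinger): the
    eigenfunctions are the potentials of densities on the arc.  Since Q_E is
    positivity improving, S(E) = sup <Q_E f, f> / |f|^2 is attained at a
    positive function (Perron), S decreases continuously from oo to 0, and
    lambda_1 = -E with alpha S(E) = 1.  A chord is at most as long as its arc and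
    G_E decreases with the distance, so the kernel of an arc dominates that of the
    segment, strictly on a set of positive measure unless the endpoints are at
    distance L, that is, unless the arc is straight. *)

Require Import Defs.
From HB Require Import structures.
From mathcomp Require Import all_boot all_order all_algebra.
From mathcomp Require Import all_classical all_reals all_analysis.
From mathcomp Require Import complex.
From mathcomp Require Import measurable_realfun ring lra.
Set Implicit Arguments.
Unset Strict Implicit.
Unset Printing Implicit Defensive.
Import Order.TTheory GRing.Theory Num.Theory.
Import numFieldNormedType.Exports.
Local Open Scope classical_set_scope.
Local Open Scope ring_scope.

Local Notation mEFinP := measurable_EFinP.

(** The Green function has a logarithmic singularity, so the gradient of a potential of a density on
    an arc cannot be handled directly. The remedy is a cutoff [eta]: only times t >= eta enter, the
    kernel becomes bounded, and by the heat semigroup the energy product of two regularised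
    potentials depends only on the sum of their cutoffs. Letting the cutoffs tend to zero makes the
    potentials Cauchy in H^1, and the limit represents the functional that integrates a test
    function against the density on the arc. The logarithm is dominated by |y|^(-1/4), which along
    an arc is integrable (this gives a Schur bound) and square integrable (this bounds images
    pointwise). The trace inequality comes from expanding the energy of a test function minus a
    potential. The Perron function comes from a maximising sequence, the equicontinuity of the
    images and an ultrafilter limit. All arcs of one length are parametrised by the same interval,
    so two kernels can be compared pointwise and tested on the same density. The segment itself has
    to be placed on the boundary of a smooth domain; a convex sublevel set is built for this. *)

Lemma le_of_eq disp (T : porderType disp) (x y : T) : x = y -> (x <= y)%O.
Proof. by move=> ->. Qed.

(** * The space L2 *)

Section L2toolkit.
Context (R : realType) d (T : measurableType d) (mu : {measure set T -> \bar R}).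
Context (D : set T) (mD : measurable D).
Implicit Types f g h : T -> R.

(** Real functions rather than classes: the complex functions of the statement are split into real
    and imaginary parts only when eigenvalues are treated, and equality almost everywhere is stated
    where it is used. *)
Definition L2r f := measurable_fun D f /\
  (\int[mu]_(x in D) ((f x) ^+ 2)%:E < +oo)%E.

Definition ip f g : R := \int[mu]_(x in D) (f x * g x).

Lemma L2r_int_sqr f : L2r f -> mu.-integrable D (EFin \o (fun x => f x ^+ 2)).
Proof.
move=> [mf fy]; apply/integrableP; split.
  by apply/mEFinP; exact: measurable_funX.
rewrite (le_lt_trans _ fy)//; apply: le_of_eq.
by apply: eq_integral => x _; rewrite /= ger0_norm// sqr_ge0.
Qed.

Lemma L2r_le f g : measurable_fun D f -> (forall x, D x -> `|f x| <= `|g x|) ->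
  L2r g -> L2r f.
Proof.
move=> mf fg [mg gy]; split=> //; apply: le_lt_trans gy.
apply: ge0_le_integral => //.
- by move=> x _; rewrite lee_fin sqr_ge0.
- by apply/mEFinP; exact: measurable_funX.
- by apply/mEFinP; exact: measurable_funX.
- move=> x Dx; rewrite lee_fin -[leLHS]real_normK ?num_real//.
  by rewrite -[leRHS]real_normK ?num_real// lerXn2r ?nnegrE ?fg.
Qed.

Lemma int_le f g : measurable_fun D f -> (forall x, D x -> `|f x| <= g x) ->
  mu.-integrable D (EFin \o g) -> mu.-integrable D (EFin \o f).
Proof.
move=> mf fg; apply: le_integrable => //; first exact/mEFinP.
by move=> x Dx /=; rewrite lee_fin (le_trans (fg _ Dx))// ler_norm.
Qed.

Lemma int_indic (A : set T) : measurable A -> (mu A < +oo)%E ->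
  mu.-integrable setT (EFin \o (\1_A : T -> R)).
Proof.
move=> mA Ay; apply/integrableP; split.
  by apply/mEFinP; exact: measurable_indic.
rewrite (_ : (\int[mu]_x _)%E = (\int[mu]_x (\1_A x)%:E)%E).
  by rewrite integral_indic// setIT.
by apply: eq_integral => x _; rewrite /= ger0_norm.
Qed.

Lemma L2r_mul f g : L2r f -> L2r g -> mu.-integrable D (EFin \o (f \* g)).
Proof.
move=> Lf Lg; apply: (@int_le _ (fun x => f x ^+ 2 + g x ^+ 2)).
- by apply: measurable_funM; [case: Lf|case: Lg].
- move=> x Dx /=; rewrite normrM.
  rewrite -[f x ^+ 2]real_normK ?num_real// -[g x ^+ 2]real_normK ?num_real//.
  by move: `|f x| `|g x| => a b; nra.
- by have := integrableD mD (L2r_int_sqr Lf) (L2r_int_sqr Lg).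
Qed.

Lemma int_L2r f : measurable_fun D f ->
  mu.-integrable D (EFin \o (fun x => f x ^+ 2)) -> L2r f.
Proof.
move=> mf /integrableP[_ fy]; split => //; apply: le_lt_trans fy.
apply: le_of_eq.
by apply: eq_integral => x _; rewrite /= ger0_norm// sqr_ge0.
Qed.

Lemma L2rD f g : L2r f -> L2r g -> L2r (f \+ g).
Proof.
move=> Lf Lg; have [mf _] := Lf; have [mg _] := Lg.
apply: int_L2r; first exact: measurable_funD.
apply: (@int_le _ (fun x => (f x ^+ 2 + g x ^+ 2) + (f x ^+ 2 + g x ^+ 2))).
- by apply: measurable_funX; exact: measurable_funD.
- move=> x _; rewrite ger0_norm ?sqr_ge0//=.
  by have := sqr_ge0 (f x - g x); move: (f x) (g x) => a b; nra.
- have I := integrableD mD (L2r_int_sqr Lf) (L2r_int_sqr Lg).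
  exact: (integrableD mD I I).
Qed.

Lemma L2rZ f (c : R) : L2r f -> L2r (fun x => c * f x).
Proof.
move=> Lf; have [mf _] := Lf; apply: int_L2r; first exact: measurable_funM.
have := integrableZl mD (c ^+ 2) (L2r_int_sqr Lf).
by apply: eq_integrable => // x _ /=; rewrite exprMn.
Qed.

Lemma L2rN f : L2r f -> L2r (\- f).
Proof.
move=> /(L2rZ (-1)); rewrite (_ : (fun x => -1 * f x) = \- f)//.
by apply/funext => x /=; rewrite mulN1r.
Qed.

Lemma L2rB f g : L2r f -> L2r g -> L2r (f \- g).
Proof.
move=> Lf /L2rN Lg; have := L2rD Lf Lg.
by rewrite (_ : f \+ (\- g) = f \- g).
Qed.

Lemma L2r_norm f : L2r f -> L2r (fun x => `|f x|).
Proof.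
move=> Lf; have [mf _] := Lf; apply: L2r_le Lf; last by move=> x _; rewrite normr_id.
exact: measurableT_comp.
Qed.

Lemma ipC f g : ip f g = ip g f.
Proof. by apply: eq_Rintegral => x _; rewrite mulrC. Qed.

Lemma ipDl f g h : L2r f -> L2r g -> L2r h -> ip (f \+ g) h = ip f h + ip g h.
Proof.
move=> Lf Lg Lh; rewrite /ip -RintegralD//; try exact: L2r_mul.
by apply: eq_Rintegral => x _ /=; rewrite mulrDl.
Qed.

Lemma ipZl f g c : L2r f -> L2r g -> ip (fun x => c * f x) g = c * ip f g.
Proof.
move=> Lf Lg; rewrite /ip -RintegralZl//; try exact: L2r_mul.
by apply: eq_Rintegral => x _ /=; rewrite mulrA.
Qed.

Lemma ipNl f g : L2r f -> L2r g -> ip (\- f) g = - ip f g.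
Proof.
move=> Lf Lg; rewrite -mulN1r -ipZl//.
by apply: eq_Rintegral => x _ /=; rewrite mulN1r.
Qed.

Lemma ipBl f g h : L2r f -> L2r g -> L2r h -> ip (f \- g) h = ip f h - ip g h.
Proof. by move=> *; rewrite -ipNl// -ipDl//; exact: L2rN. Qed.

Lemma ipDr f g h : L2r f -> L2r g -> L2r h -> ip h (f \+ g) = ip h f + ip h g.
Proof. by move=> *; rewrite ipC ipDl// ipC (ipC g). Qed.

Lemma ipBr f g h : L2r f -> L2r g -> L2r h -> ip h (f \- g) = ip h f - ip h g.
Proof. by move=> *; rewrite ipC ipBl// ipC (ipC g). Qed.

Lemma ipZr f g c : L2r f -> L2r g -> ip g (fun x => c * f x) = c * ip g f.
Proof. by move=> *; rewrite ipC ipZl// ipC. Qed.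

Lemma ip_ge0 f : 0 <= ip f f.
Proof. by apply: Rintegral_ge0 => x _; rewrite -expr2 sqr_ge0. Qed.

Lemma ip_sqr f : L2r f -> (ip f f)%:E = (\int[mu]_(x in D) ((f x) ^+ 2)%:E)%E.
Proof.
move=> Lf; rewrite /ip /Rintegral fineK//.
  by apply: integrable_fin_num => //; exact: (L2r_mul Lf Lf).
Qed.

(* the discriminant of [t |-> ip (f + t g) (f + t g)] *)
Lemma ip_CS f g : L2r f -> L2r g -> (ip f g) ^+ 2 <= ip f f * ip g g.
Proof.
move=> Lf Lg.
have q t : 0 <= ip f f + 2 * t * ip f g + t ^+ 2 * ip g g.
  have := ip_ge0 (f \+ (fun x => t * g x)).
  have Lt := L2rZ t Lg.
  rewrite ipDl ?ipDr ?ipZl ?ipZr//; try exact: L2rD.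
  rewrite (ipC g f); congr (0 <= _); ring.
have [g0|g0] := eqVneq (ip g g) 0.
  rewrite g0 mulr0.
  have [->|n0] := eqVneq (ip f g) 0; first by rewrite expr0n.
  have := q (- (ip f f + 1) / (2 * ip f g)); rewrite g0 mulr0 addr0.
  rewrite (_ : _ + _ = -1); last by field.
  by rewrite lerNr oppr0 ler10.
have gp : 0 < ip g g by rewrite lt_neqAle eq_sym g0 ip_ge0.
have := q (- ip f g / ip g g).
rewrite (_ : _ + _ = (ip f f * ip g g - ip f g ^+ 2) / ip g g); last by field.
by rewrite pmulr_lge0 ?invr_gt0// subr_ge0.
Qed.

Lemma ip_sub f g : L2r f -> L2r g ->
  ip (f \- g) (f \- g) = ip f f - 2 * ip f g + ip g g.
Proof.
move=> Lf Lg; have Lfg := L2rB Lf Lg.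
rewrite (ipBl Lf Lg Lfg) (ipBr Lf Lg Lf) (ipBr Lf Lg Lg) (ipC g f); ring.
Qed.

Lemma ip_subC f g : ip (f \- g) (f \- g) = ip (g \- f) (g \- f).
Proof. by apply: eq_Rintegral => x _ /=; rewrite -opprB mulNr mulrN opprK. Qed.

Lemma ip_add f g : L2r f -> L2r g ->
  ip (f \+ g) (f \+ g) = ip f f + 2 * ip f g + ip g g.
Proof.
move=> Lf Lg; have Lfg := L2rD Lf Lg.
rewrite (ipDl Lf Lg Lfg) (ipDr Lf Lg Lf) (ipDr Lf Lg Lg) (ipC g f); ring.
Qed.

(** A consequence of the parallelogram law. It takes the place of the triangle inequality, so that
    convergence is measured by squared norms throughout. *)
Lemma ip_sub_le2 f g h : L2r f -> L2r g -> L2r h ->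
  ip (f \- h) (f \- h) <= 2 * ip (f \- g) (f \- g) + 2 * ip (g \- h) (g \- h).
Proof.
move=> Lf Lg Lh; have Lfg := L2rB Lf Lg; have Lgh := L2rB Lg Lh.
rewrite (_ : f \- h = (f \- g) \+ (g \- h)); last first.
  by apply/funext => x /=; rewrite addrA subrK.
have := ip_ge0 ((f \- g) \- (g \- h)).
rewrite (ip_sub Lfg Lgh) (ip_add Lfg Lgh); lra.
Qed.

Definition cvg2 (f_ : nat -> T -> R) f :=
  (fun n => ip (f_ n \- f) (f_ n \- f)) @ \oo --> (0 : R).

Lemma ip_eq0_ae f : L2r f -> ip f f = 0 -> ae_eq mu D f (cst 0).
Proof.
move=> Lf f0.
have mf2 : measurable_fun D (EFin \o (fun x => f x ^+ 2)).
  by apply/mEFinP; apply: measurable_funX; case: Lf.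
have : ae_eq mu D (EFin \o (fun x => f x ^+ 2)) (cst 0%E).
  apply/(ae_eq_integral_abs mu mD mf2).
  under eq_integral do rewrite /= ger0_norm ?sqr_ge0//.
  by rewrite -(ip_sqr Lf) f0.
apply: filterS => x /= + Dx => /(_ Dx) -[/eqP].
by rewrite sqrf_eq0 => /eqP.
Qed.

Lemma ip_ae_eq f f' g : measurable_fun D f -> measurable_fun D f' ->
  measurable_fun D g -> ae_eq mu D f f' -> ip f g = ip f' g.
Proof.
move=> mf mf' mg ff'; congr fine; apply: ae_eq_integral => //.
- by apply/mEFinP; exact: measurable_funM.
- by apply/mEFinP; exact: measurable_funM.
- by apply: filterS ff' => x /= + Dx => /(_ Dx) ->.
Qed.

Lemma cvg_sqr0 (u : nat -> R) : (fun n => u n ^+ 2) @ \oo --> (0:R) ->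
  u @ \oo --> (0:R).
Proof.
move=> u2; apply/norm_cvg0P.
have : (fun n => Num.sqrt (u n ^+ 2)) @ \oo --> Num.sqrt (0:R).
  by apply: continuous_cvg => //; exact: sqrt_continuous.
by rewrite sqrtr0; under eq_fun do rewrite sqrtr_sqr.
Qed.

Lemma cvg2_ipr (f_ : nat -> T -> R) f g : (forall n, L2r (f_ n)) -> L2r f -> L2r g ->
  cvg2 f_ f -> (fun n => ip (f_ n) g) @ \oo --> ip f g.
Proof.
move=> Lf_ Lf Lg ff; apply/subr_cvg0/cvg_sqr0.
apply: (@squeeze_cvgr _ _ _ _ (cst 0) (fun n => ip (f_ n \- f) (f_ n \- f) * ip g g)).
- apply: nearW => n /=; rewrite sqr_ge0/= -(ipBl (Lf_ n) Lf Lg).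
  by apply: ip_CS => //; exact: L2rB.
- exact: cvg_cst.
- by rewrite -(mul0r (ip g g)); apply: cvgMr_tmp.
Qed.

Lemma ip_young f g : L2r f -> L2r g -> `|ip f g| <= ip f f + ip g g.
Proof.
move=> Lf Lg; have := ip_ge0 (f \+ g); have := ip_ge0 (f \- g).
rewrite (ip_add Lf Lg) (ip_sub Lf Lg) ler_norml; have := ip_ge0 f; have := ip_ge0 g.
move=> *; apply/andP; split; lra.
Qed.

Lemma cvg2_ip (f_ : nat -> T -> R) f (g_ : nat -> T -> R) g : (forall n, L2r (f_ n)) -> L2r f ->
  (forall n, L2r (g_ n)) -> L2r g ->
  cvg2 f_ f -> cvg2 g_ g -> (fun n => ip (f_ n) (g_ n)) @ \oo --> ip f g.
Proof.
move=> Lf_ Lf Lg_ Lg ff gg.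
(* Apart from the product of the two errors, every term is linear in a single sequence. *)
rewrite (_ : (fun n => _) = (fun n => ip (f_ n \- f) (g_ n \- g) +
   (ip (f_ n) g + ip (g_ n) f - ip f g))); last first.
  apply/funext => n; have Lgg := L2rB (Lg_ n) Lg.
  rewrite (ipBl (Lf_ n) Lf Lgg) (ipBr (Lg_ n) Lg (Lf_ n)) (ipBr (Lg_ n) Lg Lf).
  by rewrite (ipC f (g_ n)); ring.
rewrite -[X in _ --> X]add0r; apply: cvgD.
  apply/norm_cvg0P.
  apply: (@squeeze_cvgr _ _ _ _ (cst 0) (fun n => ip (f_ n \- f) (f_ n \- f) +
    ip (g_ n \- g) (g_ n \- g))).
  - apply: nearW => n /=; rewrite normr_ge0/=.
    by apply: ip_young; exact: L2rB.
  - exact: cvg_cst.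
  - by rewrite -[X in _ --> X](addr0 0); exact: cvgD.
have E : ip f g + ip g f - ip f g = ip f g by rewrite (ipC g f); ring.
rewrite -[X in _ --> X]E.
by apply: cvgB; [apply: cvgD; exact: cvg2_ipr|exact: cvg_cst].
Qed.

Definition cauchy2 (f_ : nat -> T -> R) := forall e : R, 0 < e ->
  exists N, forall m n, (N <= m)%N -> (N <= n)%N ->
    ip (f_ m \- f_ n) (f_ m \- f_ n) <= e.

Lemma cvg2_cauchy2 (f_ : nat -> T -> R) f : (forall n, L2r (f_ n)) -> L2r f -> cvg2 f_ f -> cauchy2 f_.
Proof.
move=> Lf_ Lf /cvgr0Pnorm_lt ff e e0.
have e4 : 0 < e / 4 by rewrite divr_gt0.
have [N _ HN] := ff _ e4; exists N => m n Nm Nn.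
apply: (le_trans (ip_sub_le2 (Lf_ m) Lf (Lf_ n))).
have -> : ip (f \- f_ n) (f \- f_ n) = ip (f_ n \- f) (f_ n \- f).
  rewrite (ip_sub Lf (Lf_ n)) (ip_sub (Lf_ n) Lf) (ipC f); ring.
have := HN _ Nm; have := HN _ Nn.
rewrite !ger0_norm ?ip_ge0//; lra.
Qed.

Lemma cvgn_geometric_incr (u : nat -> R) (C : R) :
  (forall k, `|u k.+1 - u k| <= C * 2^-1 ^+ k) -> cvgn u.
Proof.
move=> uC.
rewrite (_ : u = (fun n => u 0%N + series (telescope u) n)); last first.
  by apply/funext => n; exact: eq_sum_telescope.
apply: is_cvgD; first exact: is_cvg_cst.
apply: normed_cvg.
apply: (@series_le_cvg _ _ (geometric C 2^-1)) => //.
- by move=> n /=.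
- by move=> n /=; apply: le_trans (uC n).
- by apply: is_cvg_geometric_series; rewrite ger0_norm ?invr_ge0// invf_lt1 ?ltr1n.
Qed.

(** Weighting the squared increments by 4^k turns the bounds 8^-k into the summable 2^-k, so the
    weighted series is finite almost everywhere. Where it has a finite sum h, the increments are at
    most sqrt h times 2^-k. *)
Lemma ae_cvgn_of_fast (g_ : nat -> T -> R) : (forall n, L2r (g_ n)) ->
  (forall k, ip (g_ k.+1 \- g_ k) (g_ k.+1 \- g_ k) <= 8^-1 ^+ k) ->
  {ae mu, forall x, D x -> cvgn (fun k => g_ k x)}.
Proof.
move=> Lg fast.
pose w (k : nat) (x : T) : R := 4 ^+ k * (g_ k.+1 x - g_ k x) ^+ 2.
have w0 k x : 0 <= w k x by apply: mulr_ge0; [exact: exprn_ge0|exact: sqr_ge0].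
have mw k : measurable_fun D (EFin \o w k).
  apply/mEFinP; apply: measurable_funM => //.
  by apply: measurable_funX; apply: measurable_funB; case: (Lg k.+1); case: (Lg k).
pose h x := (\sum_(k <oo) (w k x)%:E)%E.
have hI : (\int[mu]_(x in D) h x < +oo)%E.
  rewrite integral_nneseries//; last by move=> n x _; rewrite lee_fin.
  have wk k : (\int[mu]_(x in D) (w k x)%:E <= (2^-1 ^+ k)%:E)%E.
    under eq_integral do rewrite EFinM.
    have LB := L2rB (Lg k.+1) (Lg k).
    rewrite ge0_integralZl//; last 2 first.
    - by apply/mEFinP; apply: measurable_funX; case: LB.
    - by move=> x _; rewrite lee_fin sqr_ge0.
    rewrite -(ip_sqr LB) -EFinM lee_fin.
    apply: le_trans (ler_wpM2l _ (fast k)) _; first by rewrite exprn_ge0.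
    rewrite -exprMn; rewrite (_ : 4 * 8^-1 = 2^-1 :> R)//; lra.
  apply: (@le_lt_trans _ _ (\sum_(k <oo) (2^-1 ^+ k)%:E)%E).
    by apply: lee_nneseries => // k _ _; apply: integral_ge0 => x _; rewrite lee_fin.
  have := @cvg_geometric_eseries_half R 2 0; rewrite expr0 divr1 => /cvg_lim.
  rewrite /eseries => H.
  rewrite (_ : (fun n => _) = (fun n => \sum_(0 <= k < n) (2 / (2 ^ (k + 1))%:R)%:E)%E).
    by rewrite H// ltry.
  apply/funext => n; apply: eq_bigr => k _; congr EFin.
  by rewrite addn1 expnS natrM invfM mulrA divff// mul1r natrX exprVn.
have mh : measurable_fun D h.
  apply: ge0_emeasurable_sum => [k x _ _|k _]; last exact: mw.
  by rewrite lee_fin.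
have h0 x : (0 <= h x)%E by apply: nneseries_ge0 => k _ _; rewrite lee_fin.
have Ih : mu.-integrable D h.
  apply/integrableP; split=> //; apply: le_lt_trans hI.
  by apply: le_of_eq; apply: eq_integral => x _; rewrite gee0_abs.
have := integrable_ae mD Ih; apply: filterS => x + Dx => /(_ Dx) hx.
apply: (@cvgn_geometric_incr _ (Num.sqrt (fine (h x)))) => k.
have : ((w k x)%:E <= h x)%E.
  apply: le_trans (nneseries_lim_ge k.+1 _); last by move=> *; rewrite lee_fin.
  rewrite big_nat_recr//= leeDr// sume_ge0// => *; by rewrite lee_fin.
rewrite -(fineK hx) lee_fin /w => H.
have : Num.sqrt (4 ^+ k * (g_ k.+1 x - g_ k x) ^+ 2) <= Num.sqrt (fine (h x)).
  by rewrite ler_sqrt ?fine_ge0.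
rewrite sqrtrM ?exprn_ge0// sqrtr_sqr (_ : 4 ^+ k = (2 ^+ k) ^+ 2 :> R); last first.
  by rewrite -exprM mulnC exprM; congr (_ ^+ _); ring.
rewrite sqrtr_sqr ger0_norm ?exprn_ge0// exprVn.
by rewrite mulrC ler_pdivlMr ?exprn_gt0.
Qed.

Lemma L2_complete (f_ : nat -> T -> R) : (forall n, L2r (f_ n)) -> cauchy2 f_ ->
  exists2 f, L2r f & cvg2 f_ f.
Proof.
move=> Lf_ Cf.
have /choice[N HN] k : exists N, forall m n, (N <= m)%N -> (N <= n)%N ->
    ip (f_ m \- f_ n) (f_ m \- f_ n) <= 8^-1 ^+ k by apply: Cf; rewrite exprn_gt0.
(* A sum of thresholds is at least each of them, so the index [M k] serves all levels j <= k at
   once. *)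
pose M k := (\sum_(j < k.+1) N j)%N.
have NM j k : (j <= k)%N -> (N j <= M k)%N.
  move=> jk; have jk' : (j < k.+1)%N by [].
  by rewrite /M (bigD1 (Ordinal jk'))//= leq_addr.
pose g_ k := f_ (M k).
have Lg k : L2r (g_ k) by exact: Lf_.
have cg : {ae mu, forall x, D x -> cvgn (fun k => g_ k x)}.
  by apply: ae_cvgn_of_fast => // k; apply: HN; apply: NM.
(* The upper limit is measurable and defined at every point, and it is the limit wherever the
   subsequence converges. *)
pose f x := fine (limn_esup (fun k => (g_ k x)%:E)).
have mf : measurable_fun D f.
  apply: (@measurableT_comp _ _ _ _ _ _ (@fine R)) => //.
  by apply: measurable_fun_limn_esup => k; apply/mEFinP; case: (Lg k).
have fc : {ae mu, forall x, D x -> (fun k => g_ k x) @ \oo --> f x}.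
  apply: filterS cg => x + Dx => /(_ Dx) /cvg_ex[l gl].
  have gl' : (fun k => (g_ k x)%:E) @ \oo --> l%:E by apply: cvg_EFin; [exact: nearW|exact: gl].
  by rewrite /f (cvg_limn_einf_sup gl').2.
(* Fatou's lemma along the subsequence: from the index j on, each [g_ k] is within 8^-j of [f_ n] in
   squared norm, and this passes to the limit. *)
have key j n : (N j <= n)%N ->
    (\int[mu]_(x in D) ((f_ n x - f x) ^+ 2)%:E <= (8^-1 ^+ j)%:E)%E.
  move=> Njn.
  have mq k : measurable_fun D (fun x => ((f_ n x - g_ k x) ^+ 2)%:E).
    apply/mEFinP; apply: measurable_funX.
    by apply: measurable_funB; [case: (Lf_ n)|case: (Lg k)].
  have q0 k x : D x -> (0 <= ((f_ n x - g_ k x) ^+ 2)%:E)%E by rewrite lee_fin sqr_ge0.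
  have := fatou mu mD mq q0.
  rewrite (_ : (\int[mu]_(x in D) _)%E = (\int[mu]_(x in D) ((f_ n x - f x) ^+ 2)%:E)%E).
    move=> /le_trans; apply; rewrite limn_einf_lim.
    apply: lime_le; first exact: is_cvg_einfs.
    apply: nearW => m; apply: ge_ereal_inf.
    exists (\int[mu]_(x in D) ((f_ n x - g_ (maxn m j) x) ^+ 2)%:E)%E.
      by exists (maxn m j) => //=; exact: leq_maxl.
    have LB := L2rB (Lf_ n) (Lg (maxn m j)).
    by rewrite -(ip_sqr LB) lee_fin; apply: HN => //; apply: NM; exact: leq_maxr.
  apply: ae_eq_integral => //.
  - rewrite /limn_einf; apply: measurableT_comp => //.
    by apply: measurable_fun_limn_esup => k; exact: measurableT_comp.
  - apply/mEFinP; apply: measurable_funX.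
    by apply: measurable_funB => //; case: (Lf_ n).
  - apply: filterS fc => x + Dx => /(_ Dx) fx /=.
    have : (fun k => ((f_ n x - g_ k x) ^+ 2)%:E) @ \oo --> ((f_ n x - f x) ^+ 2)%:E.
      apply: cvg_EFin; first exact: nearW.
      rewrite -[X in X @ _ --> _]/((fun y => y ^+ 2) \o (fun k => f_ n x - g_ k x)).
      apply: continuous_cvg; first exact: exprn_continuous.
      by apply: cvgB => //; exact: cvg_cst.
    by move=> /cvg_limn_einf_sup [].
have LBj j n : (N j <= n)%N -> L2r (f_ n \- f).
  move=> Njn; split; last by apply: le_lt_trans (key _ _ Njn) _; rewrite ltry.
  by apply: measurable_funB => //; case: (Lf_ n).
have Lf : L2r f.
  have := L2rB (Lf_ (N 0%N)) (LBj 0%N _ (leqnn _)).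
  by rewrite (_ : _ \- _ = f)//; apply/funext => x /=; rewrite opprB addrC subrK.
exists f => //; apply/cvgr0Pnorm_le => e e0.
have : geometric 1 8^-1 @ \oo --> (0 : R).
  by apply: cvg_geometric; rewrite ger0_norm ?invr_ge0// invf_lt1 ?ltr1n.
move=> /cvgr0Pnorm_le /(_ _ e0) [j _ Hj]; exists (N j) => // n /= Njn.
rewrite ger0_norm ?ip_ge0//.
have := Hj j (leqnn _); rewrite /= mul1r ger0_norm ?exprn_ge0//.
apply: le_trans; rewrite -lee_fin (ip_sqr (LBj _ _ Njn)); exact: key.
Qed.

End L2toolkit.

Section L2dominated.
Context (R : realType) d (T : measurableType d) (mu : {measure set T -> \bar R}).
Context (D : set T) (mD : measurable D).
Implicit Types f g h : T -> R.

Lemma cvg2_dominated (f_ : nat -> T -> R) f g :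
  (forall n, measurable_fun D (f_ n)) -> measurable_fun D f -> L2r mu D g ->
  (forall n x, D x -> `|f_ n x| <= `|g x|) ->
  (forall x, D x -> (fun n => f_ n x) @ \oo --> f x) -> cvg2 mu D f_ f.
Proof.
move=> mf_ mf Lg fg ff.
have fg' x : D x -> `|f x| <= `|g x|.
  move=> Dx; have H : (fun n => `|f_ n x|) @ \oo --> `|f x| by apply: cvg_norm; exact: ff.
  rewrite -(cvg_lim _ H)//.
  apply: limr_le; first by apply/cvg_ex; eexists; exact: H.
  by apply: nearW => n; exact: fg.
have IG : mu.-integrable D (EFin \o (fun x => 4 * g x ^+ 2)).
  by have := integrableZl mD 4 (L2r_int_sqr Lg).
have [|||||] := @dominated_convergence _ _ _ mu D mD
  (fun n x => ((f_ n x - f x) ^+ 2)%:E) (cst 0%E) (fun x => (4 * g x ^+ 2)%:E).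
- by move=> n; apply/mEFinP; apply: measurable_funX; exact: measurable_funB.
- exact: measurable_cst.
- apply/aeW => x Dx; apply: cvg_EFin; first exact: nearW.
  have E : (f x - f x) ^+ 2 = 0 by rewrite subrr expr0n.
  rewrite -[X in _ --> X]E.
  rewrite -[X in X @ _ --> _]/((fun y => y ^+ 2) \o (fun k => f_ k x - f x)).
  apply: continuous_cvg; first exact: exprn_continuous.
  by apply: cvgB; [exact: ff|exact: cvg_cst].
- exact: IG.
- apply/aeW => x n Dx; rewrite /= lee_fin ger0_norm ?sqr_ge0//.
  have := fg n x Dx; have := fg' x Dx; rewrite -[g x ^+ 2]real_normK ?num_real//.
  rewrite -[(_ - _) ^+ 2]real_normK ?num_real//.
  have := ler_normB (f_ n x) (f x); have := normr_ge0 (f_ n x - f x).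
  move: `|f_ n x - f x| `|f_ n x| `|f x| `|g x| => a b c' c h1 h2 h3 h4.
  rewrite (_ : 4 * c ^+ 2 = (2 * c) ^+ 2); last by ring.
  by rewrite lerXn2r ?nnegrE//; lra.
- move=> _ _; rewrite /= integral0 => H.
  have : fine (\int[mu]_(x in D) ((f_ n x - f x) ^+ 2)%:E)%E @[n --> \oo] --> (0 : R).
    by apply: fine_cvg.
  by [].
Qed.

Lemma Rintegral_lin (a b : R) f g :
  mu.-integrable D (EFin \o f) -> mu.-integrable D (EFin \o g) ->
  a * Rintegral mu D f + b * Rintegral mu D g = Rintegral mu D (fun x => a * f x + b * g x).
Proof.
move=> If Ig; rewrite -!RintegralZl// -RintegralD//.
- exact: (integrableZl mD a If).
- exact: (integrableZl mD b Ig).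
Qed.

Lemma integrable_lin (a b : R) f g :
  mu.-integrable D (EFin \o f) -> mu.-integrable D (EFin \o g) ->
  mu.-integrable D (EFin \o (fun x => a * f x + b * g x)).
Proof.
move=> If Ig.
exact: (integrableD mD (integrableZl mD a If) (integrableZl mD b Ig)).
Qed.

Lemma RintegralN f : mu.-integrable D (EFin \o f) ->
  Rintegral mu D (fun x => - f x) = - Rintegral mu D f.
Proof.
move=> If; rewrite -mulN1r -RintegralZl//.
by apply: eq_Rintegral => x _; rewrite mulN1r.
Qed.

End L2dominated.

Local Notation mT := measurableT.
Local Notation mR := (measurableTypeR _).
Local Notation mu := (@lebesgue_measure _).
Local Notation mu2 := (mu \x mu)%E.
Local Notation ip2 := (ip mu2 setT).
Local Notation L2p := (L2r mu2 setT).
Local Notation L1 u := (mu2.-integrable setT (EFin \o u)).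
Local Notation intg A u := (mu.-integrable A (EFin \o u)).
Local Notation measT := (measurable_fun setT).
Local Notation Rint := (Rintegral mu).
Local Notation Rint2 := (Rintegral mu2 setT).

(** * Smooth functions and test functions *)

Section smooth_closure.
Context (R : realType).
Implicit Types V W : normedModType R.

(** The proof principle for [smooth]: a class of differentiable functions that is stable under
    directional derivatives contains only smooth functions. Each smoothness proof below consists in
    finding such a class. *)
Lemma smooth_family V W (P : (V -> W) -> Prop) :
  (forall f, P f -> forall x, differentiable f x) ->
  (forall f v, P f -> P (fun y => 'D_v f y)) ->
  forall f, P f -> smooth f.
Proof.
move=> Pd PD f Pf s x; apply: Pd.
by elim: s => [//|v s IH] /=; exact: PD.
Qed.

Lemma smooth_differentiable V W (f : V -> W) x : smooth f -> differentiable f x.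
Proof. by move=> /(_ [::] x). Qed.

Lemma smooth_D V W (f : V -> W) v : smooth f -> smooth (fun y => 'D_v f y).
Proof. by move=> sf s x; have := sf (rcons s v) x; rewrite foldr_rcons. Qed.

Lemma smooth_continuous V W (f : V -> W) : smooth f -> continuous f.
Proof. by move=> sf x; apply/differentiable_continuous/smooth_differentiable. Qed.

Lemma smooth_derivable V W (f : V -> W) x v : smooth f -> derivable f x v.
Proof. by move=> sf; apply/diff_derivable/smooth_differentiable. Qed.

Lemma smooth_cst V W (a : W) : smooth (cst a : V -> W).
Proof.
apply: (@smooth_family _ _ (fun f => exists a : W, f = cst a)); last by exists a.
  by move=> f [b ->] x; exact: differentiable_cst.
move=> f v [b ->]; exists 0; apply/funext => x; exact: derive_cst.
Qed.

Lemma smooth_affine V W (a : W) (l : {linear V -> W}) : continuous l ->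
  smooth (fun x => a + l x).
Proof.
move=> cl.
have dl x : differentiable l x by exact: linear_differentiable.
apply: (@smooth_family _ _ (fun f => exists c b, f = fun x => c + b *: l x)).
- move=> f [c [b ->]] x; apply: differentiableD => //.
  by apply: differentiableZ.
- move=> f v [c [b ->]]; exists (b *: l v), 0; apply/funext => x.
  rewrite scale0r addr0 deriveD//; last first.
    by apply: derivableZ; exact: diff_derivable.
  rewrite derive_cst add0r deriveZ//; last exact: diff_derivable.
  by rewrite deriveE// diff_lin.
- by exists a, 1; apply/funext => x; rewrite scale1r.
Qed.

(** Products of smooth functions alone are not stable under derivation, because the Leibniz rule
    produces sums; closing under both operations gives a stable class. *)
Inductive sumprod V (f : V -> R) : Prop :=
| SumprodBase of smooth f
| SumprodAdd g h of sumprod g & sumprod h & f = g \+ h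
| SumprodMul g h of sumprod g & sumprod h & f = g \* h.

Lemma sumprod_diff V (f : V -> R) x : sumprod f -> differentiable f x.
Proof.
elim=> {f} [f sf|f g h _ dg _ dh ->|f g h _ dg _ dh ->].
- exact: smooth_differentiable.
- exact: differentiableD.
- exact: differentiableM.
Qed.

Lemma sumprod_smooth V (f : V -> R) : sumprod f -> smooth f.
Proof.
apply: smooth_family => {f} [f Pf x|f v]; first exact: sumprod_diff.
elim=> {f} [f sf|f g h Pg Dg Ph Dh ->|f g h Pg Dg Ph Dh ->].
- by apply: SumprodBase; exact: smooth_D.
- apply: (SumprodAdd Dg Dh); apply/funext => x.
  by rewrite deriveD//; exact/diff_derivable/sumprod_diff.
- apply: (SumprodAdd (SumprodMul Pg Dh erefl) (SumprodMul Ph Dg erefl)).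
  apply/funext => x.
  by rewrite deriveM//; exact/diff_derivable/sumprod_diff.
Qed.

Lemma smoothD V (f g : V -> R) : smooth f -> smooth g -> smooth (f \+ g).
Proof.
by move=> sf sg; apply/sumprod_smooth/(SumprodAdd _ _ erefl); exact: SumprodBase.
Qed.

Lemma smoothM V (f g : V -> R) : smooth f -> smooth g -> smooth (f \* g).
Proof.
by move=> sf sg; apply/sumprod_smooth/(SumprodMul _ _ erefl); exact: SumprodBase.
Qed.

Lemma smoothZ V (c : R) (f : V -> R) : smooth f -> smooth (fun x => c * f x).
Proof. by move=> sf; apply: smoothM => //; exact: smooth_cst. Qed.

Lemma smoothN V (f : V -> R) : smooth f -> smooth (\- f).
Proof.
move=> /(smoothZ (-1)); congr smooth.
by apply/funext => x; rewrite mulN1r.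
Qed.

Lemma smoothB V (f g : V -> R) : smooth f -> smooth g -> smooth (f \- g).
Proof. by move=> sf sg; apply: smoothD => //; exact: smoothN. Qed.

Lemma deriveR (f : R -> R) (x v : R) : differentiable f x ->
  'D_v f x = v * 'D_1 f x.
Proof.
move=> df; rewrite !deriveE//.
by rewrite -{1}(mulr1 v) -[v * 1]/(v *: (1 : R)) linearZ.
Qed.

Lemma smooth1_family (P : (R -> R) -> Prop) :
  (forall f, P f -> forall x, derivable f x 1) ->
  (forall f, P f -> P (fun y => 'D_1 f y)) ->
  forall f, P f -> smooth f.
Proof.
move=> Pd PD f Pf.
have Pd' g x : P g -> differentiable g x by move=> Pg; apply/derivable1_diffP/Pd.
apply: (@smooth_family _ _ (fun f => exists (c : R) g, P g /\ f = fun x => c * g x)).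
- move=> _ [c [g [Pg ->]]] x; apply: differentiableM => //; exact: Pd'.
- move=> _ v [c [g [Pg ->]]]; exists (v * c), (fun y => 'D_1 g y); split; first exact: PD.
  apply/funext => x; rewrite deriveMl; last by apply/diff_derivable/Pd'.
  by rewrite (deriveR v (Pd' _ _ Pg)) mulrA (mulrC c).
- by exists 1, f; split => //; apply/funext => x; rewrite mul1r.
Qed.

Lemma derive_comp1 V (f : R -> R) (l : V -> R) x v :
  differentiable f (l x) -> differentiable l x ->
  'D_v (f \o l) x = 'D_1 f (l x) * 'D_v l x.
Proof.
move=> df dl; rewrite deriveE; last exact: differentiable_comp.
rewrite diff_comp//= -deriveE// -deriveE// deriveR// mulrC.
by rewrite deriveE.
Qed.

(** As [l] has a constant derivative, the chain rule only produces a scalar factor, so the functions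
    c g(l x) with [g] smooth form a stable class. *)
Lemma smooth_comp_affine V (f : R -> R) (l : V -> R) (dl : V -> R) :
  (forall x, differentiable l x) -> (forall x v, 'D_v l x = dl v) ->
  smooth f -> smooth (f \o l).
Proof.
move=> ll Dl sf.
apply: (@smooth_family _ _ (fun F => exists (c : R) g, smooth g /\
    F = fun x => c * g (l x))).
- move=> _ [c [g [sg ->]]] x; apply: differentiableM => //.
  by apply: differentiable_comp => //; exact: smooth_differentiable.
- move=> _ v [c [g [sg ->]]]; exists (c * dl v), (fun y => 'D_1 g y).
  split; first exact: smooth_D.
  have dg y : differentiable g y by exact: smooth_differentiable.
  apply/funext => x; rewrite deriveMl; last first.
    by apply/diff_derivable/differentiable_comp.
  by rewrite -[fun x => g (l x)]/(g \o l) derive_comp1// Dl mulrAC mulrA.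
- by exists 1, f; split => //; apply/funext => x; rewrite mul1r.
Qed.

End smooth_closure.

(** * The flat function exp(-1/t) *)

Section eta.
Context (R : realType).

(** From (s / (n + 2))^(n + 2) <= exp s. The exponent exceeds n by two so that a factor s^-2
    remains; with s = 1/t it becomes the t^2 that yields differentiability at 0. *)
Lemma expRN_pow_le (n : nat) (s : R) : 0 < s ->
  s ^+ n * expR (- s) <= (n.+2)%:R ^+ n.+2 * (s^-1) ^+ 2.
Proof.
move=> s0; rewrite expRN.
have n0 : 0 < (n.+2)%:R :> R by rewrite ltr0n.
have H : (s / n.+2%:R) ^+ n.+2 <= expR s.
  rewrite -[in leRHS](divfK (lt0r_neq0 n0) s) expRM_natr lerXn2r ?nnegrE ?expR_ge0//.
    by rewrite divr_ge0// ltW.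
  by apply: le_trans (expR_ge1Dx _); rewrite lerDr.
rewrite ler_pdivrMr ?expR_gt0//.
apply: le_trans (ler_wpM2l _ H); last by rewrite mulr_ge0// exprn_ge0// invr_ge0 ltW.
apply: le_of_eq; rewrite expr_div_n.
have := expf_neq0 n.+2 (lt0r_neq0 n0); set A : R := _ ^+ n.+2 => A0; rewrite -/A.
rewrite -(addn2 n) exprD; move: A (s ^+ n) A0 => A B A0.
by field; rewrite A0 gt_eqF.
Qed.

Lemma horner_expRN_le (q : {poly R}) : exists C, forall s : R, 0 < s ->
  `|q.[s] * expR (- s)| <= C * (s^-1) ^+ 2.
Proof.
exists (\sum_(i < size q) `|q`_i| * (i.+2)%:R ^+ i.+2) => s s0.
rewrite horner_coef !mulr_suml (le_trans (ler_norm_sum _ _ _))// ler_sum// => i _.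
rewrite !normrM normrX (gtr0_norm s0) (gtr0_norm (expR_gt0 _)).
rewrite -[leLHS]mulrA -[leRHS]mulrA ler_wpM2l//.
exact: expRN_pow_le.
Qed.

Lemma is_derive_le_sqr (f : R -> R) C : (forall t, `|f t| <= C * t ^+ 2) ->
  is_derive (0 : R) (1 : R) f 0.
Proof.
move=> fC.
have f0 : f 0 = 0.
  by apply/eqP; rewrite -normr_le0 (le_trans (fC 0))// expr0n mulr0.
have c : h^-1 *: (f (h *: 1 + 0) - f 0) @[h --> 0^'] --> (0 : R).
  apply/cvgr0Pnorm_le => e e0.
  near=> h.
  have h0 : h != 0 by near: h; exact: nbhs_dnbhs_neq.
  rewrite f0 subr0 addr0 normrM normfV ler_pdivrMl ?normr_gt0//.
  rewrite -[h *: 1]/(h * 1) mulr1 (le_trans (fC h))//.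
  have C1 : 0 < `|C| + 1 by rewrite ltr_wpDl.
  have : `|h| <= e / (`|C| + 1) by near: h; apply: dnbhs0_le; rewrite divr_gt0.
  rewrite ler_pdivlMr// -[h ^+ 2]real_normK ?num_real//.
  have := ler_norm C; have := normr_ge0 h.
  move: `|h| `|C| => x y x0 Cy H; rewrite (le_trans (_ : _ <= y * x ^+ 2))//.
    by rewrite ler_wpM2r ?sqr_ge0.
  by rewrite mulrC expr2 -mulrA ler_wpM2l//; nra.
by apply: DeriveDef; [apply/cvg_ex; exists 0|exact/cvg_lim].
Unshelve. all: by end_near. Qed.

(** The class stable under derivation for exp(-1/t): differentiating q(1/t) exp(-1/t) replaces q by
    (q - q') X^2. *)
Definition eta_poly (q : {poly R}) (t : R) : R :=
  if 0 < t then q.[t^-1] * expR (- t^-1) else 0.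

Lemma is_derive_eta_poly q (t : R) :
  is_derive t (1 : R) (eta_poly q) (eta_poly ((q - q^`()) * 'X^2) t).
Proof.
have [t0|t0|->] := ltgtP t 0.
- rewrite /eta_poly (lt_gtF t0).
  apply: (@near_eq_is_derive _ _ _ (cst 0)); rewrite ?oner_eq0//.
  by near=> s; rewrite /= ltNge ltW//; near: s; exact: lt_nbhsl.
- rewrite [X in is_derive _ _ _ X]/eta_poly t0.
  apply: (@near_eq_is_derive _ _ _ (fun s : R => q.[s^-1] * expR (- s^-1))).
  + by near=> s; rewrite /eta_poly ifT//; near: s; exact: lt_nbhsr.
  + have tn : t != 0 by rewrite gt_eqF.
    have dV : is_derive t (1 : R) (fun s => s^-1) (- t ^- 2).
      have := is_deriveV tn (is_derive_id t (1 : R)).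
      by rewrite /GRing.scale/= mulr1.
    have d1 : is_derive t (1 : R) (fun s => q.[s^-1]) ((q^`()).[t^-1] * - t ^- 2).
      exact: (is_derive1_comp (is_derive_poly q _) dV).
    have d2 : is_derive t (1 : R) (fun s => expR (- s^-1)) (expR (- t^-1) * (t ^- 2)).
      have dN : is_derive t (1 : R) (fun s => - s^-1) (t ^- 2).
        by have := is_deriveN dV; rewrite opprK.
      exact: (is_derive1_comp (is_derive_expR _) dN).
    apply: (is_derive_eq (is_deriveM d1 d2)).
    have sc (a b : R) : a *: (b : R) = a * b by [].
    rewrite !sc hornerM hornerXn hornerD hornerN -!exprVn.
    have E (A B C D : R) : A * (C * D) + C * (B * - D) = (A - B) * D * C by ring.
    exact: E.
(* At the origin the function is O(t^2), so its derivative there is 0, which is also the value at 0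
   of every member of the family. *)
- have [C HC] := horner_expRN_le q.
  rewrite {2}/eta_poly ltxx.
  apply: (@is_derive_le_sqr _ C) => u.
  rewrite /eta_poly; case: ifPn => [t0|_].
    by rewrite -[u in leRHS]invrK; apply: HC; rewrite invr_gt0.
  rewrite normr0 mulr_ge0 ?sqr_ge0//.
  by have := HC 1 ltr01; rewrite invr1 expr1n mulr1; apply: le_trans.
Unshelve. all: by end_near. Qed.

Lemma smooth_eta_poly q : smooth (eta_poly q).
Proof.
apply: (@smooth1_family _ (fun f => exists q, f = eta_poly q)).
- by move=> _ [p ->] x; case: (is_derive_eta_poly p x).
- move=> _ [p ->]; exists ((p - p^`()) * 'X^2); apply/funext => x.
  by case: (is_derive_eta_poly p x).
- by exists q.
Qed.

Definition eta (t : R) : R := if 0 < t then expR (- t^-1) else 0.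

Lemma etaE : eta = eta_poly 1.
Proof. by apply/funext => t; rewrite /eta /eta_poly hornerC mul1r. Qed.

Lemma smooth_eta : smooth eta.
Proof. by rewrite etaE; exact: smooth_eta_poly. Qed.

Lemma eta_ge0 t : 0 <= eta t.
Proof. by rewrite /eta; case: ifP => // _; exact: expR_ge0. Qed.

Lemma eta_gt0 t : 0 < t -> 0 < eta t.
Proof. by rewrite /eta => ->; exact: expR_gt0. Qed.

Lemma eta_le0 t : t <= 0 -> eta t = 0.
Proof. by rewrite /eta leNgt => /negbTE ->. Qed.

End eta.

(** * Open sets of the plane and the product sigma-algebra *)

Section measurable2.
Context (R : realType).

(** An open set is the countable union of the squares with rational centre and radius 1/(n + 1) that
    it contains; a square that is not contained in it is replaced by the empty set. *)
Lemma open_measurable2 (U : set (R * R)) : open U ->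
  measurable (U : set (mR * mR)).
Proof.
move=> oU.
pose box (q : rat * rat * nat) : set (R * R) :=
  ball (ratr q.1.1 : R) q.2.+1%:R^-1 `*` ball (ratr q.1.2 : R) q.2.+1%:R^-1.
pose F (q : rat * rat * nat) : set (mR * mR) := if `[< box q `<=` U >] then box q else set0.
have -> : U = \bigcup_q F q.
  apply/seteqP; split => [x Ux|x [q _]]; last first.
    by rewrite /F; case: asboolP => // qU /qU.
  have /nbhs_ballP[e /= e0 eU] := open_nbhs_nbhs (conj oU Ux).
  have e2 : 0 < e / 2 by rewrite divr_gt0.
  have [n ne] : exists n : nat, n.+1%:R^-1 < e / 2.
    have [n _ Hn] := near_infty_natSinv_lt (PosNum e2).
    by exists n; exact: (Hn n (leqnn _)).
  have rx (y : R) : exists q : rat, ball (ratr q : R) n.+1%:R^-1 y.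
    have r0 : 0 < n.+1%:R^-1 :> R by rewrite invr_gt0.
    have [z [Hz [q _ qz]]] :=
      dense_rat (ex_intro _ y (ballxx y r0)) (ball_open y _).
    by exists q; rewrite qz; exact: ball_sym.
  have [q1 H1] := rx x.1; have [q2 H2] := rx x.2.
  exists (q1, q2, n) => //; rewrite /F asboolT//.
  move=> y [/= y1 y2]; apply: eU; split => /=.
  - apply: (@le_ball _ _ _ (n.+1%:R^-1 + n.+1%:R^-1)).
      by rewrite [leRHS](splitr e) lerD// ltW.
    by apply: ball_triangle y1; exact: ball_sym.
  - apply: (@le_ball _ _ _ (n.+1%:R^-1 + n.+1%:R^-1)).
      by rewrite [leRHS](splitr e) lerD// ltW.
    by apply: ball_triangle y2; exact: ball_sym.
apply: countable_bigcupT_measurable; first exact: countableP.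
move=> q; rewrite /F; case: ifP => // _.
by apply: measurableX; exact: measurable_ball.
Qed.

Lemma continuous_measurable2 (f : R * R -> R) : continuous f ->
  measT (f : mR * mR -> mR).
Proof.
move=> cf; apply: (measurability (RGenOpens.G (R := R)) (RGenOpens.measurableE R)).
move=> _ [_ [a [b ->]] <-]; rewrite setTI; apply: open_measurable2.
by apply: open_comp => // x _; exact: cf.
Qed.

End measurable2.

(** * Test functions and integration by parts *)

Section test_functions.
Context (R : realType).
Implicit Types phi psi : R * R -> R.

(** Compact support is traded for vanishing outside a ball of the max norm, a condition that passes
    easily through sums, products, derivatives and dilations. *)
Lemma test_funP phi : test_fun phi <->
  smooth phi /\ exists M : R, forall x, M < `|x| -> phi x = 0.
Proof.
split=> [[sp cp]|[sp [M HM]]]; split=> //.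
  have [M [_ HM]] := compact_bounded cp.
  exists (M + 1) => x Mx; apply: contrapT => px.
  have := HM (M + 1); rewrite ltrDl => /(_ ltr01 x).
  move=> H; suff: `|x| <= M + 1 by rewrite leNgt Mx.
  by apply: H; apply: subset_closure => /=; exact/eqP.
have cK : compact (`[- M, M]%classic `*` `[- M, M]%classic : set (R * R)).
  by apply: compact_setX; exact: segment_compact.
apply: subclosed_compact cK _; first exact: closed_closure.
rewrite [X in _ `<=` X](_ : _ = closure (`[- M, M]%classic `*` `[- M, M]%classic)).
  apply: closure_subset.
  move=> x /= /eqP px; have : `|x| <= M by rewrite leNgt; apply/negP => /HM.
  by rewrite prod_normE/= ge_max !ler_norml => /andP[? ?]; split; rewrite /= in_itv.
apply/closure_id; apply: closedI; apply: closed_comp; try exact: itv_closed.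
- by move=> x _; exact: cvg_fst.
- by move=> x _; exact: cvg_snd.
Qed.

Lemma test_continuous phi : test_fun phi -> continuous phi.
Proof. by case=> sp _; exact: smooth_continuous. Qed.

Lemma test_measurable phi : test_fun phi -> measT (phi : mR * mR -> mR).
Proof. by move=> /test_continuous; exact: continuous_measurable2. Qed.

Lemma test_bounded phi : test_fun phi -> exists C, forall x, `|phi x| <= C.
Proof.
move=> tp; have [_ cp] := tp.
have cc : {within closure [set x | phi x != 0], continuous phi}.
  exact/continuous_subspaceT/test_continuous.
have [M [_ HM]] := compact_bounded (continuous_compact cc cp).
exists (`|M| + 1) => x.
have [->|px] := eqVneq (phi x) 0; first by rewrite normr0 addr_ge0.
apply: HM; first by rewrite (le_lt_trans (ler_norm M))// ltrDl.
by exists x => //; exact: subset_closure.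
Qed.

Lemma derive_near0 (V : normedModType R) (f : V -> R) (x v : V) :
  (\forall y \near x, f y = 0) -> 'D_v f x = 0.
Proof.
move=> f0; rewrite (@near_eq_derive _ _ _ f (cst 0))//.
by rewrite derive_cst.
Qed.

Lemma test_D phi v : test_fun phi -> test_fun (fun y => 'D_v phi y).
Proof.
move=> /test_funP[sp [M HM]]; apply/test_funP; split; first exact: smooth_D.
exists M => x Mx; apply: derive_near0.
near=> y; apply: HM; near: y.
have : (fun y : R * R => `|y|) @ x --> `|x| by exact: norm_continuous.
by move=> /cvgr_gt; apply.
Unshelve. all: by end_near. Qed.

Lemma test_smoothM phi (f : R * R -> R) : test_fun phi -> smooth f ->
  test_fun (phi \* f).
Proof.
move=> /test_funP[sp [M HM]] sf; apply/test_funP; split; first exact: smoothM.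
by exists M => x Mx /=; rewrite HM// mul0r.
Qed.

Lemma testD phi psi : test_fun phi -> test_fun psi -> test_fun (phi \+ psi).
Proof.
move=> /test_funP[sp [M HM]] /test_funP[sq [N HN]]; apply/test_funP.
split; first exact: smoothD.
exists (Num.max M N) => x; rewrite gt_max => /andP[Mx Nx] /=.
by rewrite HM// HN// addr0.
Qed.

Lemma testZ phi c : test_fun phi -> test_fun (fun x => c * phi x).
Proof.
move=> tp; have := test_smoothM tp (@smooth_cst _ _ _ (c : R)).
by congr test_fun; apply/funext => x /=; rewrite mulrC.
Qed.

Lemma testB phi psi : test_fun phi -> test_fun psi -> test_fun (phi \- psi).
Proof.
move=> tp /(testZ (-1)) tq; have := testD tp tq.
by congr test_fun; apply/funext => x /=; rewrite mulN1r.
Qed.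

Lemma testM phi psi : test_fun phi -> test_fun psi -> test_fun (phi \* psi).
Proof. by move=> tp [sq _]; exact: test_smoothM. Qed.

Lemma is_diff_affine2 (a : R * R) (k : R) y :
  is_diff y (fun z : R * R => a + k *: z) (k \*: id).
Proof.
have := is_diffD (is_diff_cst a y) (is_diffZ k (is_diff_id y)).
by rewrite add0r.
Qed.

Lemma differentiable_affine2 (a : R * R) (k : R) y :
  differentiable (fun z : R * R => a + k *: z) y.
Proof. by case: (is_diff_affine2 a k y). Qed.

Lemma derive_comp_affine2 (f : R * R -> R) (a : R * R) (k : R) y v :
  differentiable f (a + k *: y) ->
  'D_v (fun z => f (a + k *: z)) y = k * 'D_v f (a + k *: y).
Proof.
move=> df; pose A (z : R * R) : R * R := a + k *: z.
have dA : is_diff y A (k \*: id) := is_diff_affine2 a k y.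
have dA' : differentiable A y by case: dA.
rewrite -[fun z => _]/(f \o A) deriveE; last exact: differentiable_comp.
rewrite diff_comp//= diff_val/=.
by rewrite linearZ/= -deriveE.
Qed.

Lemma smooth_comp_affine2 (f : R * R -> R) (a : R * R) (k : R) :
  smooth f -> smooth (fun z => f (a + k *: z)).
Proof.
move=> sf; pose A (z : R * R) : R * R := a + k *: z.
have dA x : differentiable A x by exact: differentiable_affine2.
have dgA (g : R * R -> R) x : smooth g -> differentiable (g \o A) x.
  move=> sg; apply: differentiable_comp; first exact: dA.
  exact: smooth_differentiable.
apply: (@smooth_family _ _ _ (fun F => exists (c : R) g, smooth g /\
    F = fun z => c * (g \o A) z)).
- move=> _ [c [g [sg ->]]] x.
  by apply: (@differentiableM _ _ (cst c) (g \o A)); [exact: differentiable_cst|exact: dgA].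
- move=> _ v [c [g [sg ->]]]; exists (c * k), (fun y => 'D_v g y).
  split; first exact: smooth_D.
  apply/funext => x; rewrite deriveMl; last exact/diff_derivable/dgA.
  by rewrite derive_comp_affine2 ?mulrA//; exact: smooth_differentiable.
- by exists 1, f; split => //; apply/funext => x; rewrite mul1r.
Qed.

Lemma test_comp_affine2 phi (a : R * R) (k : R) : k != 0 ->
  test_fun phi -> test_fun (fun z => phi (a + k *: z)).
Proof.
move=> k0 /test_funP[sp [M HM]]; apply/test_funP.
split; first exact: smooth_comp_affine2.
exists ((M + `|a|) / `|k|) => x; rewrite ltr_pdivrMr ?normr_gt0// => H; apply: HM.
have := ler_normB (a + k *: x) a.
by rewrite (addrC _ (- a)) addKr normrZ; lra.
Qed.

(* both sides of the product rule integrate a compactly supported partial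
   derivative, so it is enough to integrate along lines *)
Lemma test_norm_le phi : test_fun phi ->
  exists2 M : R, 0 < M & forall x, M <= `|x| -> phi x = 0.
Proof.
move=> /test_funP[_ [M HM]]; exists (`|M| + 1); first by rewrite ltr_wpDl.
by move=> x Mx; apply: HM; rewrite (le_lt_trans (ler_norm M))// (lt_le_trans _ Mx)// ltrDl.
Qed.

Lemma test_integrable phi : test_fun phi -> mu2.-integrable setT (EFin \o phi).
Proof.
move=> tp; have [C HC] := test_bounded tp; have [M M0 HM] := test_norm_le tp.
pose K : set (mR * mR) := `[- M, M]%classic `*` `[- M, M]%classic.
have mK : measurable K by apply: measurableX; exact: measurable_itv.
apply: (@int_le _ _ _ mu2 setT measurableT _ (fun x => C * \1_K x)).
- exact: test_measurable.
- move=> x _; rewrite indicE; case: (boolP (x \in K)) => xK; first by rewrite mulr1.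
  rewrite mulr0 HM ?normr0// leNgt; apply/negP => xM.
  move: xK => /negP; apply; rewrite inE; move: (ltW xM).
  by rewrite prod_normE/= ge_max !ler_norml => /andP[? ?]; split; rewrite /= in_itv.
- apply: (@integrableZl _ _ _ mu2 setT measurableT C (fun x => (\1_K x)%:E)).
  apply: int_indic => //.
  rewrite /= product_measure1E//=.
  rewrite lebesgue_measure_itv/= lte_fin.
  by case: ifP => _; rewrite -?EFinB -?EFinM ltry.
Qed.

Lemma test_L2r phi : test_fun phi -> L2r mu2 setT phi.
Proof.
move=> tp; apply: int_L2r => //; first exact: test_measurable.
exact: (test_integrable (testM tp tp)).
Qed.

Lemma is_derive_line (V : normedModType R) (f : V -> R) (a v : V) (x : R) :
  derivable f (a + x *: v) v ->
  is_derive x (1 : R) (fun s => f (a + s *: v)) ('D_v f (a + x *: v)).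
Proof.
move=> df.
have E : (fun h : R => h^-1 *: (f (a + (h *: 1 + x) *: v) - f (a + x *: v))) =
         (fun h : R => h^-1 *: (f (h *: v + (a + x *: v)) - f (a + x *: v))).
  by apply/funext => h; rewrite -[h *: 1]/(h * 1) mulr1 scalerDl addrCA.
by apply: DeriveDef; rewrite /derivable /derive/= E.
Qed.

Lemma integral_line0 psi (a v : R * R) (M : R) : test_fun psi -> 0 < M ->
  (forall s : R, M <= `|s| -> psi (a + s *: v) = 0) ->
  (forall s : R, M <= `|s| -> 'D_v psi (a + s *: v) = 0) ->
  (\int[mu]_s ('D_v psi (a + s *: v))%:E = 0)%E.
Proof.
move=> tp M0 pM DM.
have [sp _] := tp; have [sq _] := test_D v tp.
have dF s := is_derive_line (@smooth_derivable _ _ _ psi (a + s *: v) v sp).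
have dG s := is_derive_line (@smooth_derivable _ _ _ _ (a + s *: v) v sq).
have cd (F : R -> R) (G : R -> R) : (forall s, is_derive s (1 : R) F (G s)) -> continuous F.
  move=> FG s; apply/differentiable_continuous/derivable1_diffP.
  by have [] := FG s.
have cF := cd _ _ dF; have cG := cd _ _ dG.
rewrite (_ : (\int[mu]_s _)%E =
    (\int[mu]_(s in `[(- M)%R, M]) ('D_v psi (a + s *: v))%:E)%E); last first.
  rewrite [RHS]integral_mkcond; apply: eq_integral => s _.
  rewrite patchE; case: ifPn => // /negP sM; rewrite DM// leNgt; apply/negP => sM'.
  by apply: sM; rewrite inE/= in_itv/= -ler_norml ltW.
rewrite (@continuous_FTC2 _ _ (fun s => psi (a + s *: v))).
- by rewrite !pM ?subee// ?normrN ger0_norm// ltW.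
- by rewrite gtrN.
- exact: continuous_subspaceT.
- split.
  + by move=> s _; have [] := dF s.
  + exact/cvg_at_right_filter/cF.
  + exact/cvg_at_left_filter/cF.
- by move=> s _; rewrite derive1E; have [] := dF s.
Qed.

Lemma integral_test_D1 psi : test_fun psi ->
  Rint2 (fun x => 'D_(e1 R) psi x) = 0.
Proof.
move=> tp; have [M M0 HM] := test_norm_le tp; have [N N0 HN] := test_norm_le (test_D (e1 R) tp).
have I := test_integrable (test_D (e1 R) tp).
rewrite /Rintegral -(integral21_prod_meas1 I).
rewrite integral0_eq// => y _; rewrite /fubini_G.
have E (s : R) : ((0 : R), y) + s *: e1 R = (s, y).
  by rewrite -[LHS]/(0 + s * 1, y + s * 0) mulr1 mulr0 add0r addr0.
have := @integral_line0 psi (0, y) (e1 R) (Num.max M N) tp.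
rewrite lt_max M0 => /(_ isT) H.
have le_s (s : R) : `|s| <= `|(s, y)| by rewrite prod_normE/= le_max lexx.
rewrite -[RHS]H; first by apply: eq_integral => s _; rewrite E.
- by move=> s; rewrite ge_max E => /andP[Ms _]; apply: HM; exact: le_trans (le_s s).
- by move=> s; rewrite ge_max E => /andP[_ Ns]; apply: HN; exact: le_trans (le_s s).
Qed.

Lemma integral_test_D2 psi : test_fun psi ->
  Rint2 (fun x => 'D_(e2 R) psi x) = 0.
Proof.
move=> tp; have [M M0 HM] := test_norm_le tp; have [N N0 HN] := test_norm_le (test_D (e2 R) tp).
have I := test_integrable (test_D (e2 R) tp).
rewrite /Rintegral -(integral12_prod_meas1 I).
rewrite integral0_eq// => y _; rewrite /fubini_F.
have E (s : R) : (y, (0 : R)) + s *: e2 R = (y, s).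
  by rewrite -[LHS]/(y + s * 0, 0 + s * 1) mulr1 mulr0 add0r addr0.
have := @integral_line0 psi (y, 0) (e2 R) (Num.max M N) tp.
rewrite lt_max M0 => /(_ isT) H.
have le_s (s : R) : `|s| <= `|(y, s)| by rewrite prod_normE/= le_max lexx orbT.
rewrite -[RHS]H; first by apply: eq_integral => s _; rewrite E.
- by move=> s; rewrite ge_max E => /andP[Ms _]; apply: HM; exact: le_trans (le_s s).
- by move=> s; rewrite ge_max E => /andP[_ Ns]; apply: HN; exact: le_trans (le_s s).
Qed.

(** No decay is asked of [f], since only its product with [phi] has to be a test function. In this
    form it applies to the smooth time slices of the Green function. *)
Lemma ibp_test (v : R * R) (f phi : R * R -> R) : v = e1 R \/ v = e2 R ->
  smooth f -> test_fun phi ->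
  Rint2 (fun x => f x * 'D_v phi x) =
  - Rint2 (fun x => 'D_v f x * phi x).
Proof.
move=> ve sf tp; have [sp _] := tp.
have t1 : test_fun (fun x => f x * 'D_v phi x).
  have := test_smoothM (test_D v tp) sf.
  by congr test_fun; apply/funext => x /=; rewrite mulrC.
have t2 : test_fun (fun x => 'D_v f x * phi x).
  have := test_smoothM tp (smooth_D v sf).
  by congr test_fun; apply/funext => x /=; rewrite mulrC.
have t3 := test_smoothM tp sf.
apply/eqP; rewrite -addr_eq0 -RintegralD//; try exact: test_integrable.
apply/eqP; transitivity (Rint2 (fun x => 'D_v (phi \* f) x)).
  apply: eq_Rintegral => x _.
  rewrite deriveM; [|exact: smooth_derivable..].
  by rewrite -[_ *: _]/(_ * _) -[f x *: _]/(f x * _) addrC [phi x * _]mulrC.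
by case: ve => ->; [exact: integral_test_D1|exact: integral_test_D2].
Qed.

End test_functions.

Import HBNNSimple.

(** * Lipschitz functions of bounded support are dense in L2 of the plane *)

Section density.
Context (R : realType).

(** Half-open boxes are stable under intersection, as Dynkin induction requires, and their
    indicators can be approximated by explicit piecewise linear functions. *)
Lemma measurable2_boxes : @measurable _ (mR * mR)%type =
  <<s [set A `*` B | A in @ocitv R & B in @ocitv R] >>.
Proof.
rewrite measurable_prod_measurableType eqEsubset; split; last first.
  apply: smallest_sub; first exact: smallest_sigma_algebra.
  move=> _ [A oA [B oB <-]]; apply: sub_sigma_algebra; exists A.
    by apply: sub_sigma_algebra.
  by exists B => //; apply: sub_sigma_algebra.
apply: smallest_sub; first exact: smallest_sigma_algebra.
pose G : set (set (R * R)) := [set A `*` B | A in @ocitv R & B in @ocitv R].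
pose TG := g_sigma_algebraType G.
have big (z : R) : exists n : nat, - n%:R < z <= n%:R.
  have [n _ Hn] := nbhs_infty_gtr `|z|.
  exists n; have := Hn n (leqnn _); rewrite ltr_norml => /andP[-> /ltW ->//].
have mfst : measT (fst : TG -> mR).
  apply: (@measurability _ _ TG mR setT fst (@ocitv R)) => //.
  move=> _ [A oA <-]; rewrite setTI.
  rewrite (_ : _ @^-1` _ = \bigcup_n (A `*` `] (- n%:R : R), n%:R]%classic)).
    apply: bigcup_measurable => n _; apply: sub_sigma_algebra.
    by exists A => //; exists `] (- n%:R : R), n%:R]%classic => //; exact: is_ocitv.
  apply/seteqP; split => [[x y] /= Ax|[x y] [n _ []//]].
  by have [n Hn] := big y; exists n => //; split => //=; rewrite in_itv.
have msnd : measT (snd : TG -> mR).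
  apply: (@measurability _ _ TG mR setT snd (@ocitv R)) => //.
  move=> _ [A oA <-]; rewrite setTI.
  rewrite (_ : _ @^-1` _ = \bigcup_n (`] (- n%:R : R), n%:R]%classic `*` A)).
    apply: bigcup_measurable => n _; apply: sub_sigma_algebra.
    by exists `] (- n%:R : R), n%:R]%classic; [exact: is_ocitv|exists A].
  apply/seteqP; split => [[x y] /= Ax|[x y] [n _ []//]].
  by have [n Hn] := big x; exists n => //; split => //=; rewrite in_itv.
move=> _ [A mA [B mB <-]].
have -> : A `*` B = (fst @^-1` A) `&` (snd @^-1` B) by [].
have := @measurableI _ TG _ _ (mfst measurableT _ mA) (msnd measurableT _ mB).
by rewrite !setTI.
Qed.

(** The Lipschitz constant gives a uniform rate for mollification in [conv_lipC]; general functions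
    then follow by density. *)
Definition lipC (psi : R * R -> R) :=
  (exists K, forall x y, `|psi x - psi y| <= K * `|x - y|) /\
  (exists M, forall x, M < `|x| -> psi x = 0).

Lemma lipC_continuous psi : lipC psi -> continuous psi.
Proof.
move=> [[K HK] _] x; apply/cvgrPdist_le => e e0; near=> y.
apply: (le_trans (HK x y)).
have : `|x - y| <= e / (`|K| + 1).
  near: y; apply: (@cvgr_dist_le _ _ _ (nbhs x) _ (@id (R * R)%type)) => //.
  by rewrite divr_gt0.
rewrite ler_pdivlMr// => H; apply: le_trans H.
by rewrite mulrC ler_wpM2l// (le_trans (ler_norm _))// lerDl.
Unshelve. all: by end_near. Qed.

Lemma bsupp_integrable (f : R * R -> R) (C M : R) :
  measT (f : mR * mR -> mR) -> (forall x, `|f x| <= C) ->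
  (forall x, M < `|x| -> f x = 0) -> mu2.-integrable setT (EFin \o f).
Proof.
move=> mf fC HM.
pose K : set (mR * mR) := `[- M, M]%classic `*` `[- M, M]%classic.
have mK : measurable K by apply: measurableX; exact: measurable_itv.
apply: (@int_le _ _ _ mu2 setT measurableT _ (fun x => C * \1_K x)) => //.
- move=> x _; rewrite indicE; case: (boolP (x \in K)) => xK; first by rewrite mulr1.
  rewrite mulr0 HM ?normr0// ltNge; apply/negP => xM.
  move: xK => /negP; apply; rewrite inE; move: xM.
  by rewrite prod_normE/= ge_max !ler_norml => /andP[? ?]; split; rewrite /= in_itv.
- apply: (@integrableZl _ _ _ mu2 setT measurableT C (fun x => (\1_K x)%:E)).
  apply: int_indic => //.
  rewrite /= product_measure1E//=.
  rewrite lebesgue_measure_itv/= lte_fin.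
  by case: ifP => _; rewrite -?EFinB -?EFinM ltry.
Qed.

Lemma bsupp_L2r (f : R * R -> R) (C M : R) :
  measT (f : mR * mR -> mR) -> (forall x, `|f x| <= C) ->
  (forall x, M < `|x| -> f x = 0) -> L2p f.
Proof.
move=> mf fC HM; apply: int_L2r => //.
apply: (@bsupp_integrable _ (C ^+ 2) M).
- exact: measurable_funX.
- move=> x; rewrite normrX lerXn2r// nnegrE// (le_trans _ (fC x))//.
- by move=> x /HM ->; rewrite expr0n.
Qed.

Lemma lipC_bounded psi : lipC psi -> exists C, forall x, `|psi x| <= C.
Proof.
move=> [[K HK] [M HM]].
pose p : R * R := (`|M| + 1, 0).
have pM : M < `|p|.
  by rewrite prod_normE lt_max/= ger0_norm ?addr_ge0// (le_lt_trans (ler_norm M))// ltrDl.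
exists (`|K| * (`|M| + `|p|)) => x.
have [xM|/HM ->] := leP `|x| M; last by rewrite normr0 mulr_ge0// addr_ge0.
rewrite -[psi x]subr0 -(HM _ pM) (le_trans (HK x p))//.
rewrite (le_trans (ler_wpM2r _ (ler_norm K)))// ler_wpM2l// (le_trans (ler_normB _ _))//.
by rewrite lerD2r (le_trans xM)// ler_norm.
Qed.

Lemma lipC_L2r psi : lipC psi -> L2p psi.
Proof.
move=> lp; have [C HC] := lipC_bounded lp; have [_ [M HM]] := lp.
apply: (@bsupp_L2r _ C M) => //; apply: continuous_measurable2; exact: lipC_continuous.
Qed.

Lemma lipCD f g : lipC f -> lipC g -> lipC (f \+ g).
Proof.
move=> [[K HK] [M HM]] [[K' HK'] [M' HM']]; split.
  exists (K + K') => x y; rewrite /= opprD addrACA mulrDl.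
  by rewrite (le_trans (ler_normD _ _))// lerD.
by exists (Num.max M M') => x; rewrite gt_max => /andP[/HM h /HM' h'] /=; rewrite h h' addr0.
Qed.

Lemma lipCZ f c : lipC f -> lipC (fun x => c * f x).
Proof.
move=> [[K HK] [M HM]]; split.
  by exists (`|c| * K) => x y; rewrite -mulrBr normrM -mulrA ler_wpM2l.
by exists M => x /HM ->; rewrite mulr0.
Qed.

(** A class closed under sums, multiples and L2 limits; the task is to show that it exhausts L2,
    going from boxes to measurable sets, to simple functions, to all functions. *)
Definition apx (w : R * R -> R) := L2p w /\
  forall e, 0 < e -> exists2 psi, lipC psi & ip2 (w \- psi) (w \- psi) <= e.

Lemma lipC_apx psi : lipC psi -> apx psi.
Proof.
move=> lp; have Lp := lipC_L2r lp; split=> // e e0; exists psi => //.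
by rewrite (ip_sub measurableT Lp Lp); have := ip_ge0 mu2 setT psi; lra.
Qed.

Lemma apx_lim (w_ : nat -> R * R -> R) w : (forall n, apx (w_ n)) -> L2p w ->
  cvg2 mu2 setT w_ w -> apx w.
Proof.
move=> aw Lw /cvgr0Pnorm_le ww; split=> // e e0.
have e4 : 0 < e / 4 by rewrite divr_gt0.
have [n _ /(_ n (leqnn _))] := ww _ e4; rewrite /= ger0_norm ?ip_ge0// => H.
have [Ln /(_ _ e4)[psi lp Hp]] := aw n; exists psi => //.
have Lp := lipC_L2r lp.
apply: (le_trans (ip_sub_le2 measurableT Lw Ln Lp)).
by rewrite (ip_subC _ _ w); lra.
Qed.

Lemma apxD f g : apx f -> apx g -> apx (f \+ g).
Proof.
move=> [Lf af] [Lg ag]; split; first exact: L2rD.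
move=> e e0; have e4 : 0 < e / 4 by rewrite divr_gt0.
have [p lp Hp] := af _ e4; have [q lq Hq] := ag _ e4.
exists (p \+ q); first exact: lipCD.
have Lp := L2rB measurableT Lf (lipC_L2r lp); have Lq := L2rB measurableT Lg (lipC_L2r lq).
rewrite (_ : _ \- _ = (f \- p) \+ (g \- q)); last first.
  by apply/funext => x /=; rewrite opprD addrACA.
rewrite (ip_add measurableT Lp Lq).
have := ip_ge0 mu2 setT ((f \- p) \- (g \- q)).
rewrite (ip_sub measurableT Lp Lq); lra.
Qed.

Lemma apxZ f c : apx f -> apx (fun x => c * f x).
Proof.
move=> [Lf af]; split; first exact: L2rZ.
move=> e e0; have c1 : 0 < c ^+ 2 + 1 by rewrite ltr_wpDl// sqr_ge0.
have e4 : 0 < e / (c ^+ 2 + 1) by rewrite divr_gt0.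
have [p lp Hp] := af _ e4; exists (fun x => c * p x); first exact: lipCZ.
have Lp := L2rB measurableT Lf (lipC_L2r lp).
rewrite (_ : _ \- _ = (fun x => c * (f \- p) x)); last first.
  by apply/funext => x /=; rewrite mulrBr.
rewrite (ipZl measurableT _ Lp)//; last exact: L2rZ.
rewrite (ipZr measurableT _ Lp)//.
move: Hp; rewrite ler_pdivlMr// => Hp; apply: le_trans Hp.
by have := ip_ge0 mu2 setT (f \- p); nra.
Qed.

(** Vanishes for s <= 0 and equals 1 from 1/k on, so the pointwise limit is the indicator of the
    open half-line. Differences of two translates therefore tend to indicators of the half-open
    intervals of [ocitv]. *)
Definition ramp (k : nat) (s : R) : R := Num.min 1 (Num.max 0 (k%:R * s)).

Lemma ramp_lip k s t : `|ramp k s - ramp k t| <= k%:R * `|s - t|.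
Proof.
rewrite -(ger0_norm (ler0n R k)) -normrM mulrBr /ramp.
move: (k%:R * s) (k%:R * t) => a b.
rewrite /Num.min /Num.max ler_norml.
have := ler_norm (a - b); have := ler_norm (- (a - b)); rewrite normrN.
move: `|a - b| => z.
by do ![case: ifPn]; rewrite -?leNgt => *; apply/andP; split; lra.
Qed.

Lemma ramp_ge0 k s : 0 <= ramp k s.
Proof. by rewrite /ramp le_min ler01 le_max lexx. Qed.

Lemma ramp_le1 k s : ramp k s <= 1.
Proof. by rewrite /ramp ge_min lexx. Qed.

Lemma ramp_le0 k s : s <= 0 -> ramp k s = 0.
Proof.
move=> s0; rewrite /ramp max_l ?min_r//; last by rewrite mulr_ge0_le0.
Qed.

Lemma ramp_eq1 k s : 1 <= k%:R * s -> ramp k s = 1.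
Proof. by move=> s1; rewrite /ramp min_l// le_max s1 orbT. Qed.

Lemma ramp_cvg s : (fun k => ramp k s) @ \oo --> (\1_(`]0, +oo[%classic : set R) s : R).
Proof.
rewrite indicE; have [s0|s0] := leP s 0.
  rewrite memNset; last by rewrite /= in_itv/= andbT; apply/negP; rewrite -leNgt.
  by under eq_fun do rewrite ramp_le0//; exact: cvg_cst.
rewrite mem_set; last by rewrite /= in_itv/= s0.
apply: cvg_near_cst; near=> k; apply: ramp_eq1.
rewrite -ler_pdivrMr// ltW//; near: k; exact: nbhs_infty_gtr.
Unshelve. all: by end_near. Qed.

Definition tent (a b : R) (k : nat) (s : R) := ramp k (s - a) - ramp k (s - b).

Lemma tent_lip a b k s t : `|tent a b k s - tent a b k t| <= (k + k)%:R * `|s - t|.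
Proof.
rewrite /tent (_ : _ - _ = (ramp k (s - a) - ramp k (t - a)) -
  (ramp k (s - b) - ramp k (t - b))); last by ring.
rewrite natrD mulrDl (le_trans (ler_normB _ _))//.
have h (c : R) : `|ramp k (s - c) - ramp k (t - c)| <= k%:R * `|s - t|.
  by rewrite (le_trans (ramp_lip _ _ _))// opprB addrA subrK.
by rewrite lerD.
Qed.

Lemma tent_bound a b k s : `|tent a b k s| <= 1.
Proof.
rewrite /tent ler_norml; have := ramp_ge0 k (s - a); have := ramp_le1 k (s - a).
have := ramp_ge0 k (s - b); have := ramp_le1 k (s - b).
by move=> *; apply/andP; split; lra.
Qed.

Lemma tent_supp a b k s : `|a| + `|b| + 1 < `|s| -> (0 < k)%N -> tent a b k s = 0.
Proof.
move=> H k0; have k1 : 1 <= k%:R :> R by rewrite ler1n.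
have := ler_norm a; have := ler_norm (- a); have := ler_norm b; have := ler_norm (- b).
rewrite !normrN => h1 h2 h3 h4.
have {}H : `|a| + 1 < `|s| /\ `|b| + 1 < `|s|.
  by have := normr_ge0 a; have := normr_ge0 b; split; lra.
case: H => Ha Hb; rewrite /tent.
have [s0|s0] := leP 0 s.
  move: Ha Hb; rewrite (ger0_norm s0) => Ha Hb.
  rewrite !ramp_eq1 ?subrr//; nra.
move: Ha Hb; rewrite (ltr0_norm s0) => Ha Hb.
rewrite !ramp_le0 ?subrr//; lra.
Qed.

Lemma tent_cvg a b s : a <= b ->
  (fun k => tent a b k s) @ \oo --> (\1_(`]a, b]%classic : set R) s : R).
Proof.
move=> ab.
have -> : \1_(`]a, b]%classic : set R) s =
   \1_(`]0, +oo[%classic : set R) (s - a) - \1_(`]0, +oo[%classic : set R) (s - b) :> R.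
  rewrite !indicE /=.
  have E (u v : bool) (A B C : set R) x y z : (x \in A) = u -> (y \in B) = v ->
    (z \in C) = u && ~~ v -> (v -> u) -> (z \in C)%:R = (x \in A)%:R - (y \in B)%:R :> R.
    by move=> -> -> ->; case: u; case: v => //= h; rewrite ?subrr ?subr0//; have := h isT.
  apply: (E (a < s) (b < s)).
  - by rewrite mem_setE in_itv/= andbT subr_gt0.
  - by rewrite mem_setE in_itv/= andbT subr_gt0.
  - by rewrite mem_setE in_itv/= -leNgt.
  - exact: le_lt_trans.
by apply: cvgB; exact: ramp_cvg.
Qed.

Lemma apx_box (A B : set R) : ocitv A -> ocitv B -> apx (\1_(A `*` B) : R * R -> R).
Proof.
move=> [[a b] _ <-] [[c e] _ <-] /=.
have [ab|ba] := leP a b; last first.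
  rewrite set_itv_ge; last by rewrite -leNgt bnd_simp ltW.
  rewrite set0X indic0; apply: lipC_apx; split; last by exists 0.
  by exists 0 => x y; rewrite subrr normr0 mul0r.
have [ce|ec] := leP c e; last first.
  rewrite [X in _ `*` X]set_itv_ge; last by rewrite -leNgt bnd_simp ltW.
  rewrite setX0 indic0; apply: lipC_apx; split; last by exists 0.
  by exists 0 => x y; rewrite subrr normr0 mul0r.
pose M := Num.max (`|a| + `|b| + 1) (`|c| + `|e| + 1).
pose w k (x : R * R) := tent a b k.+1 x.1 * tent c e k.+1 x.2.
have wM k x : M < `|x| -> w k x = 0.
  rewrite prod_normE/= lt_max /w => /orP[H|H].
    by rewrite tent_supp ?mul0r// (le_lt_trans _ H)// /M le_max lexx.
  by rewrite (tent_supp (a := c)) ?mulr0// (le_lt_trans _ H)// /M le_max lexx orbT.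
have wlip k : lipC (w k).
  split; last by exists M => x; exact: wM.
  exists ((k.+1 + k.+1)%:R + (k.+1 + k.+1)%:R) => x y; rewrite /w.
  rewrite (_ : _ - _ = (tent a b k.+1 x.1 - tent a b k.+1 y.1) * tent c e k.+1 x.2 +
    tent a b k.+1 y.1 * (tent c e k.+1 x.2 - tent c e k.+1 y.2)); last by ring.
  rewrite (le_trans (ler_normD _ _))// !normrM mulrDl lerD//.
    rewrite -[leRHS]mulr1 ler_pM ?tent_bound// (le_trans (tent_lip _ _ _ _ _))//.
    by rewrite ler_wpM2l// prod_normE/= le_max lexx.
  rewrite -[leRHS]mul1r ler_pM ?tent_bound// (le_trans (tent_lip _ _ _ _ _))//.
  by rewrite ler_wpM2l// prod_normE/= le_max lexx orbT.
have mAB : measurable (`]a, b]%classic `*` `]c, e]%classic : set (mR * mR)).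
  by apply: measurableX; exact: measurable_itv.
have LM : L2p (\1_(`[- M, M]%classic `*` `[- M, M]%classic)).
  apply: (@bsupp_L2r _ 1 M).
  - by apply: measurable_indic; apply: measurableX; exact: measurable_itv.
  - by move=> x; rewrite indicE; case: (_ \in _); rewrite ?normr0 ?normr1.
  - move=> x xM; rewrite indicE memNset// => -[/=]; rewrite !in_itv/= -!ler_norml => h1 h2.
    by move: xM; rewrite prod_normE/= ltNge ge_max h1 h2.
apply: (apx_lim (w_ := w)).
- by move=> k; exact: lipC_apx.
- apply: (@bsupp_L2r _ 1 M).
  + exact: measurable_indic.
  + by move=> x; rewrite indicE; case: (_ \in _); rewrite ?normr0 ?normr1.
  + move=> x xM; rewrite indicE memNset// => -[/=]; rewrite !in_itv/=.
    move=> /andP[h1 h2] /andP[h3 h4].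
    move: xM; rewrite prod_normE/= ltNge ge_max => /negP; apply.
    rewrite !ler_norml.
    have iM p q u : `|p| + `|q| + 1 <= M -> p < u -> u <= q -> - M <= u <= M.
      move=> pq pu uq; have := ler_norm q; have := ler_norm (- p); have := normr_ge0 p.
      by have := normr_ge0 q; rewrite normrN => *; apply/andP; split; lra.
    by rewrite (iM a b)// ?(iM c e)// /M le_max lexx ?orbT.
- apply: (cvg2_dominated measurableT _ _ LM).
  + by move=> k; apply: continuous_measurable2; exact: lipC_continuous.
  + exact: measurable_indic.
  + move=> k x _; rewrite indicE; case: (boolP (x \in _)) => [_|xM].
      by rewrite normr1 normrM mulr_ile1 ?tent_bound.
    rewrite wM ?normr0// ltNge; apply/negP => h; move: xM => /negP; apply.
    move: h; rewrite prod_normE/= ge_max !ler_norml => /andP[? ?].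
    by rewrite inE; split; rewrite /= in_itv.
  + move=> x _; rewrite (_ : \1_(_ `*` _) x =
        \1_(`]a, b]%classic) x.1 * \1_(`]c, e]%classic) x.2); last first.
      by rewrite !indicE in_setX -natrM mulnb.
    apply: cvgM.
    + by have := @tent_cvg a b x.1 ab; rewrite -cvg_shiftS.
    + by have := @tent_cvg c e x.2 ce; rewrite -cvg_shiftS.
Qed.

Lemma indic_norm_le T (A B : set T) (x : T) : A `<=` B ->
  `|\1_A x : R| <= `|\1_B x : R|.
Proof.
move=> AB; rewrite !indicE; case: (boolP (x \in A)) => [|_]; last by rewrite normr0.
by rewrite inE => /AB xB; rewrite mem_set.
Qed.

Definition BX (n : nat) : set (mR * mR) :=
  `] (- n%:R : R), n%:R]%classic `*` `] (- n%:R : R), n%:R]%classic.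

Lemma measurable_BX n : measurable (BX n).
Proof. by apply: measurableX; exact: measurable_itv. Qed.

Lemma L2_indic_BX n (A : set (mR * mR)) : measurable A -> L2p (\1_(A `&` BX n)).
Proof.
move=> mA; apply: (@bsupp_L2r _ 1 n%:R).
- by apply: measurable_indic; apply: measurableI => //; exact: measurable_BX.
- by move=> x; rewrite indicE; case: (_ \in _); rewrite ?normr0 ?normr1.
- move=> x xM; rewrite indicE memNset// => -[_ [/=]]; rewrite !in_itv/=.
  move=> /andP[h1 h2] /andP[h3 h4]; move: xM.
  by rewrite prod_normE/= ltNge ge_max !ler_norml h2 h4 !ltW.
Qed.

(** Dynkin induction on [A], for all n at once. Cutting by the bounded box [BX n] keeps the
    indicators in L2 when complements are taken. *)
Lemma apx_indic (A : set (mR * mR)) n : measurable A -> apx (\1_(A `&` BX n)).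
Proof.
move=> mA; move: n.
have GI : setI_closed [set A `*` B | A in @ocitv R & B in @ocitv R].
  move=> _ _ [A1 oA1 [B1 oB1 <-]] [A2 oA2 [B2 oB2 <-]].
  exists (A1 `&` A2); first exact: ocitvI.
  by exists (B1 `&` B2); [exact: ocitvI|rewrite setXI].
have oBX n : [set A `*` B | A in @ocitv R & B in @ocitv R] (BX n).
  by exists `] (- n%:R : R), n%:R]%classic; [exact: is_ocitv|
     exists `] (- n%:R : R), n%:R]%classic => //; exact: is_ocitv].
have abox (S : set (mR * mR)) : [set A `*` B | A in @ocitv R & B in @ocitv R] S -> apx (\1_S).
  by move=> [A1 oA1 [B1 oB1 <-]]; exact: apx_box.
apply: (dynkin_induction (P := fun S => forall n, apx (\1_(S `&` BX n))) measurable2_boxes GI).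
- by move=> n; rewrite setTI; exact: abox.
- by move=> S GS n; apply: abox; apply: GI.
- move=> S mS PS n.
  have := apxD (abox _ (oBX n)) (apxZ (-1) (PS n)).
  congr apx; apply/funext => x /=; rewrite !indicE !in_setI in_setC.
  by case: (x \in S); case: (x \in BX n); rewrite /= ?mulN1r ?subrr ?subr0 ?oppr0 ?addr0.
- move=> F mF tF PF n.
  pose w m : R * R -> R := \1_(\big[setU/set0]_(k < m) F k `&` BX n).
  apply: (apx_lim (w_ := w)).
  + elim=> [|m IH]; rewrite /w.
      rewrite big_ord0 set0I indic0; apply: lipC_apx; split; last by exists 0.
      by exists 0 => x y; rewrite subrr normr0 mul0r.
    have := apxD IH (PF m n); congr apx; apply/funext => x /=.
    rewrite /w !indicE big_ord_recr/= !in_setI in_setU.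
    have : ~ ((x \in \big[setU/set0]_(k < m) F k) /\ (x \in F m)).
      rewrite !inE => -[]; rewrite -bigcup_mkord => -[k /= km Fk] Fm.
      have := tF k m I I; rewrite -[in _ = _]/(k = m).
      move=> /(_ (ex_intro _ x (conj Fk Fm))) kE.
      by move: km; rewrite kE ltnn.
    case: (x \in \big[setU/set0]_(k < m) F k); case: (x \in F m); case: (x \in BX n) => //=;
      rewrite ?addr0 ?add0r// => h; by have := h (conj isT isT).
  + by apply: L2_indic_BX; exact: bigcup_measurable.
  + have LB := L2_indic_BX n (@measurableT _ (mR * mR)%type).
    apply: (cvg2_dominated measurableT _ _ LB).
    * move=> m; apply: measurable_indic; apply: measurableI; last exact: measurable_BX.
      by apply: bigsetU_measurable => k _; exact: mF.
    * apply: measurable_indic; apply: measurableI; last exact: measurable_BX.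
      by apply: bigcup_measurable => k _; exact: mF.
    * by move=> m x _; apply: indic_norm_le => y [_ ?].
    * move=> x _; rewrite /w.
      have [[j _ Fj]|nF] := pselect ((\bigcup_k F k) x); last first.
        apply: cvg_near_cst; apply: nearW => m; rewrite !indicE !in_setI.
        rewrite (memNset nF)/= memNset//= -bigcup_mkord => -[k _ Fk].
        by apply: nF; exists k.
      apply: cvg_near_cst; near=> m; rewrite !indicE !in_setI.
      have -> : x \in \bigcup_k F k by rewrite inE; exists j.
      have -> // : x \in \big[setU/set0]_(k < m) F k.
      rewrite inE -bigcup_mkord; exists j => //=; near: m; exact: nbhs_infty_gt.
- by rewrite -measurable2_boxes.
Unshelve. all: by end_near. Qed.

Lemma apx_sum I (s : seq I) (f : I -> R * R -> R) :
  (forall i, apx (f i)) -> apx (fun x => \sum_(i <- s) f i x).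
Proof.
move=> af; elim: s => [|i s IH].
  rewrite (_ : (fun _ => _) = cst 0); last by apply/funext => x; rewrite big_nil.
  apply: lipC_apx; split; last by exists 0.
  by exists 0 => x y; rewrite subrr normr0 mul0r.
have := apxD (af i) IH; congr apx; apply/funext => x /=; by rewrite big_cons.
Qed.

Lemma BX_cvg (x : R * R) : \forall n \near \oo, BX n x.
Proof.
near=> n; have : `|x| < n%:R by near: n; exact: nbhs_infty_gtr.
rewrite prod_normE gt_max/= !ltr_norml => /andP[/andP[h1 h2] /andP[h3 h4]].
by split; rewrite /= in_itv/= ?h1 ?h3 ltW.
Unshelve. all: by end_near. Qed.

(** Simple functions increasing to [w], cut by the boxes [BX k] so that their level sets fall under
    [apx_indic]; [w] itself dominates. *)
Lemma apx_nonneg w : L2p w -> (forall x, 0 <= w x) -> apx w.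
Proof.
move=> Lw w0; have [mw _] := Lw.
have mw' : measT (EFin \o w : mR * mR -> \bar R) by exact/mEFinP.
pose g := nnsfun_approx measurableT mw'.
have gcvg x : (fun k => g k x) @ \oo --> w x.
  have := cvg_nnsfun_approx measurableT mw' (fun x _ => w0 x) (x:=x) I.
  by move=> /fine_cvg.
have gle k x : g k x <= w x.
  rewrite -(cvg_lim _ (gcvg x))//; apply: limr_ge; first by apply/cvg_ex; exists (w x).
  by near=> n; apply/lefP/nd_nnsfun_approx; near: n; exists k.
apply: (apx_lim (w_ := fun k x => g k x * \1_(BX k) x)) => //.
- move=> k.
  have fin : finite_set (range (g k)) by exact: fimfunP.
  rewrite (_ : (fun x => _) = (fun x => \sum_(r <- finmap.enum_fset (fset_set (range (g k))))
      (r * \1_(g k @^-1` [set r] `&` BX k) x))); last first.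
    apply/funext => x; rewrite {1}(fimfunE (g k) x) fsbig_finite//= mulr_suml.
    apply: eq_bigr => r _; rewrite -mulrA; congr (_ * _).
    by rewrite indicI.
  apply: apx_sum => r; apply: apxZ; exact: apx_indic.
- apply: (cvg2_dominated measurableT _ _ Lw) => //.
  + by move=> k; apply: measurable_funM => //; apply: measurable_indic; exact: measurable_BX.
  + move=> k x _; rewrite normrM indicE; case: (_ \in _); rewrite ?normr0 ?normr1 ?mulr0 ?mulr1//.
    by rewrite !ger0_norm.
  + move=> x _; have H := gcvg x.
    rewrite -[X in _ --> X]mulr1; apply: cvgM => //.
    apply: cvg_near_cst; near=> n; rewrite indicE mem_set//; near: n; exact: BX_cvg.
Unshelve. all: by end_near. Qed.

Lemma apx_L2 w : L2p w -> apx w.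
Proof.
move=> Lw; have [mw _] := Lw.
have mp : measT (w^\+%R : mR * mR -> mR) by exact: measurable_funrpos.
have mn : measT (w^\-%R : mR * mR -> mR) by exact: measurable_funrneg.
have Lp : L2p w^\+%R.
  apply: (L2r_le measurableT mp _ Lw) => x _; rewrite ger0_norm ?funrpos_ge0//.
  by rewrite /funrpos ge_max ler_norm normr_ge0.
have Ln : L2p w^\-%R.
  apply: (L2r_le measurableT mn _ Lw) => x _; rewrite ger0_norm ?funrneg_ge0//.
  by rewrite /funrneg ge_max -normrN ler_norm normr_ge0.
have := apxD (apx_nonneg Lp (funrpos_ge0 w)) (apxZ (-1) (apx_nonneg Ln (funrneg_ge0 w))).
congr apx; apply/funext => x /=; rewrite mulN1r.
by have := congr1 (fun f => f x) (funrposBneg w).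
Qed.

End density.

(** * Differentials read off quadratic remainders *)

Section lin2.
Context (R : realType).

(** The general linear form on the plane. Later it also serves as the Euclidean inner product with
    the vector (A, B). *)
Definition lin2 (A B : R) (h : R * R) : R := h.1 * A + h.2 * B.

Lemma lin2_linear A B : linear (lin2 A B).
Proof.
move=> k x y.
rewrite -[LHS]/((k * x.1 + y.1) * A + (k * x.2 + y.2) * B).
rewrite -[RHS]/(k * (x.1 * A + x.2 * B) + (y.1 * A + y.2 * B)); ring.
Qed.

HB.instance Definition _ A B :=
  GRing.isLinear.Build R (R * R)%type R _ (lin2 A B) (lin2_linear A B).

Lemma lin2_continuous A B : continuous (lin2 A B).
Proof.
move=> x; apply: cvgD; apply: cvgMr_tmp.
- exact: cvg_fst.
- exact: cvg_snd.
Qed.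

(** A quadratic remainder bound survives integration against an integrable function, so this
    criterion is how derivatives are taken under the integral sign; it identifies all directional
    derivatives at once. *)
Lemma diff_quad (f : R * R -> R) (x : R * R) (A B C : R) :
  (forall h, `|f (h + x) - f x - lin2 A B h| <= C * `|h| ^+ 2) ->
  differentiable f x /\ forall v, 'D_v f x = lin2 A B v.
Proof.
move=> fC.
have E : f \o shift x = cst (f x) + lin2 A B +o_ (0 : R * R) id.
  apply/eqaddoP => _/posnumP[e]; near=> h.
  rewrite /= [leLHS](_ : _ = `|f (h + x) - f x - lin2 A B h|); last first.
    by rewrite -[(f \o _ - _) h]/(f (h + x) - (f x + lin2 A B h)) opprD addrA.
  apply: le_trans (fC h) _; rewrite expr2 mulrA ler_wpM2r//.
  have : `|h| <= e%:num / (`|C| + 1).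
    near: h; apply: (@nbhs0_le _ (R * R)%type); by rewrite divr_gt0.
  rewrite ler_pdivlMr// => H; apply: le_trans H; rewrite mulrC ler_wpM2l//.
  by rewrite (le_trans (ler_norm _))// lerDl.
have dE := diff_unique (@lin2_continuous A B) E.
have df : differentiable f x.
  by apply/diff_locallyP; rewrite dE; split; [exact: lin2_continuous|exact: E].
by split=> // v; rewrite deriveE// dE.
Unshelve. all: by end_near. Qed.

Lemma derive_lin2 (f : R * R -> R) x v : differentiable f x ->
  'D_v f x = lin2 ('D_(e1 R) f x) ('D_(e2 R) f x) v.
Proof.
move=> df; rewrite !deriveE// /lin2.
have {1}-> : v = v.1 *: e1 R + v.2 *: e2 R.
  rewrite -[RHS]/(v.1 * 1 + v.2 * 0, v.1 * 0 + v.2 * 1) !mulr1 !mulr0 addr0 add0r.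
  by case: v.
by rewrite linearD !linearZ.
Qed.

Lemma norm1_le (v : R * R) : `|v.1| <= `|v|.
Proof. by rewrite prod_normE/= le_max lexx. Qed.

Lemma norm2_le (v : R * R) : `|v.2| <= `|v|.
Proof. by rewrite prod_normE/= le_max lexx orbT. Qed.

Lemma lin2_lin2_le (h : R * R) (a b c d A B C D : R) :
  `|a| <= A -> `|b| <= B -> `|c| <= C -> `|d| <= D ->
  `|lin2 (lin2 a c h) (lin2 b d h) h| <= (A + B + C + D) * `|h| ^+ 2.
Proof.
move=> Ha Hb Hc Hd.
have P (i j k K : R) : `|i| <= `|h| -> `|j| <= `|h| -> `|k| <= K ->
    `|i * (j * k)| <= K * `|h| ^+ 2.
  move=> hi hj hk; rewrite mulrA mulrC normrM ler_pM// normrM expr2.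
  by rewrite ler_pM.
have t1 := P h.1 h.1 a A (norm1_le h) (norm1_le h) Ha.
have t2 := P h.2 h.1 b B (norm2_le h) (norm1_le h) Hb.
have t3 := P h.1 h.2 c C (norm1_le h) (norm2_le h) Hc.
have t4 := P h.2 h.2 d D (norm2_le h) (norm2_le h) Hd.
rewrite /lin2 !mulrDr !mulrDl (le_trans (ler_normD _ _))// -!addrA.
rewrite (le_trans (lerD (ler_normD _ _) (ler_normD _ _)))//.
move: t1 t2 t3 t4; set x1 := `|_|; set x2 := `|_|; set x3 := `|_|; set x4 := `|_|.
move: (_ * _ ^+ 2) (B * _) (C * _) (D * _); clear => *; lra.
Qed.

(** The mean value theorem is applied twice along the segment from z to z + h; the second derivative
    in the direction h is a quadratic form in h whose coefficients are bounded second partials. *)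
Lemma test_taylor (psi : R * R -> R) : test_fun psi -> exists2 C, 0 <= C &
  forall z h, `|psi (h + z) - psi z - 'D_h psi z| <= C * `|h| ^+ 2.
Proof.
move=> tp; have [sp _] := tp.
pose D i j := fun y => 'D_i (fun y => 'D_j psi y) y.
have bD i j : exists2 C, 0 <= C & forall x, `|D i j x| <= C.
  have [C HC] := test_bounded (test_D i (test_D j tp)).
  by exists C => //; apply: le_trans (HC 0).
have [C11 p11 H11] := bD (e1 R) (e1 R); have [C12 p12 H12] := bD (e1 R) (e2 R).
have [C21 p21 H21] := bD (e2 R) (e1 R); have [C22 p22 H22] := bD (e2 R) (e2 R).
exists (C11 + C12 + C21 + C22); first by rewrite !addr_ge0.
move=> z h.
have sD1 := smooth_D (e1 R) sp; have sD2 := smooth_D (e2 R) sp.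
have DhE : (fun y => 'D_h psi y) = (fun y => h.1 * 'D_(e1 R) psi y + h.2 * 'D_(e2 R) psi y).
  by apply/funext => y; rewrite derive_lin2//; exact: smooth_differentiable.
have sDh := smooth_D h sp.
have dF s := is_derive_line (@smooth_derivable _ _ _ psi (z + s *: h) h sp).
have dG s := is_derive_line (@smooth_derivable _ _ _ _ (z + s *: h) h sDh).
have cd (F : R -> R) (G : R -> R) : (forall s, is_derive s (1 : R) F (G s)) -> continuous F.
  move=> FG s; apply/differentiable_continuous/derivable1_diffP.
  by have [] := FG s.
have [s s01 Hs] := MVT_segment ler01 (fun s _ => dF s) (continuous_subspaceT (cd _ _ dF)).
move: Hs; rewrite subr0 mulr1 scale1r scale0r addr0 (addrC z) => ->.
move: s01; rewrite in_itv/= => /andP[s0 s1].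
have [r r01 Hr] := MVT_segment s0 (fun s _ => dG s) (continuous_subspaceT (cd _ _ dG)).
move: Hr; rewrite subr0 scale0r addr0 => ->.
rewrite normrM (ger0_norm s0).
have b : `|'D_h ('D_h psi) (z + r *: h)| <= (C11 + C12 + C21 + C22) * `|h| ^+ 2.
  rewrite DhE; set w := z + r *: h.
  have d1 v := @smooth_derivable _ _ _ ('D_(e1 R) psi) w v sD1.
  have d2 v := @smooth_derivable _ _ _ ('D_(e2 R) psi) w v sD2.
  rewrite deriveD; [|exact: derivableM|exact: derivableM].
  rewrite !deriveMl//.
  have q1 := @derive_lin2 _ w h (@smooth_differentiable _ _ _ ('D_(e1 R) psi) w sD1).
  have q2 := @derive_lin2 _ w h (@smooth_differentiable _ _ _ ('D_(e2 R) psi) w sD2).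
  rewrite q1 q2.
  apply: lin2_lin2_le; [exact: H11|exact: H12|exact: H21|exact: H22].
by apply: le_trans b; rewrite ler_piMr.
Qed.

End lin2.

(** * Mollification *)

Section convolution.
Context (R : realType).
Implicit Types (u : R * R -> R) (psi : R * R -> R).

Definition conv u psi (x : R * R) : R := Rint2 (fun y => u y * psi (x - y)).

Lemma sub_affine (x y : R * R) : x - y = x + (-1) *: y.
Proof. by rewrite scaleN1r. Qed.

Lemma test_reflect psi x : test_fun psi -> test_fun (fun y => psi (x - y)).
Proof.
move=> tp; under eq_fun do rewrite sub_affine.
by apply: test_comp_affine2 => //; rewrite oppr_eq0 oner_eq0.
Qed.

Lemma derive_reflect psi x v y : smooth psi ->
  'D_v (fun y => psi (x - y)) y = - 'D_v psi (x - y).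
Proof.
move=> sp; rewrite (_ : (fun y => psi (x - y)) = (fun y => psi (x + (-1) *: y))); last first.
  by apply/funext => z; rewrite sub_affine.
by rewrite derive_comp_affine2 -?sub_affine ?mulN1r//; exact: smooth_differentiable.
Qed.

Lemma L1_mul_test u psi x : L1 u -> test_fun psi -> L1 (fun y => u y * psi (x - y)).
Proof.
move=> Lu tp; have [C HC] := test_bounded tp.
apply: (@int_le _ _ _ mu2 setT measurableT _ (fun y => C * `|u y|)).
- apply: measurable_funM; first by have /measurable_int/mEFinP := Lu.
  exact: test_measurable (test_reflect x tp).
- by move=> y _; rewrite normrM mulrC ler_wpM2r.
- by have := integrableZl measurableT C (integrable_norm Lu).
Qed.

Lemma L2_mul_test u psi x : L2p u -> test_fun psi -> L1 (fun y => u y * psi (x - y)).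
Proof.
by move=> Lu tp; apply: (L2r_mul measurableT Lu); exact: test_L2r (test_reflect x tp).
Qed.

(** The Taylor bound for [psi] is uniform in the base point, so it can be integrated against |u|. *)
Lemma conv_quad u psi x : L1 u -> test_fun psi -> exists C, forall h,
  `|conv u psi (h + x) - conv u psi x -
    lin2 (conv u (fun y => 'D_(e1 R) psi y) x) (conv u (fun y => 'D_(e2 R) psi y) x) h|
  <= C * `|h| ^+ 2.
Proof.
move=> Lu tp; have [C C0 HC] := test_taylor tp; have [sp _] := tp.
exists (C * Rint2 (fun y => `|u y|)) => h.
have I1 := L1_mul_test (h + x) Lu tp; have I0 := L1_mul_test x Lu tp.
have t1 := test_D (e1 R) tp; have t2 := test_D (e2 R) tp.
have J1 := L1_mul_test x Lu t1; have J2 := L1_mul_test x Lu t2.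
rewrite /lin2 /conv (Rintegral_lin measurableT h.1 h.2 J1 J2).
rewrite -(RintegralB measurableT I1 I0).
have I10 := integrableB measurableT I1 I0.
have J12 := integrable_lin measurableT h.1 h.2 J1 J2.
rewrite -(RintegralB measurableT I10 J12).
have K := integrableB measurableT I10 J12.
apply: (le_trans (le_normr_Rintegral measurableT K)).
rewrite -mulrA mulrC -mulrA -RintegralZr//; last exact: integrable_norm.
apply: le_Rintegral => //.
- exact: integrable_norm.
- exact: (integrableZr measurableT (`|h| ^+ 2 * C) (integrable_norm Lu)).
move=> y _ /=.
have -> : u y * psi (h + x - y) - u y * psi (x - y) -
     (h.1 * (u y * 'D_(e1 R) psi (x - y)) + h.2 * (u y * 'D_(e2 R) psi (x - y))) =
  u y * (psi (h + (x - y)) - psi (x - y) - 'D_h psi (x - y)).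
  rewrite (@derive_lin2 _ psi (x - y) h (smooth_differentiable _ sp)).
  rewrite /lin2 addrA; ring.
rewrite normrM ler_wpM2l// mulrC; exact: HC.
Qed.

Lemma conv_differentiable u psi x : L1 u -> test_fun psi ->
  differentiable (conv u psi) x.
Proof. by move=> Lu tp; have [C /diff_quad[]] := conv_quad x Lu tp. Qed.

Lemma conv_D u psi v x : L1 u -> test_fun psi ->
  'D_v (conv u psi) x = conv u (fun y => 'D_v psi y) x.
Proof.
move=> Lu tp; have [C /diff_quad[_ ->]] := conv_quad x Lu tp; have [sp _] := tp.
have J1 := L1_mul_test x Lu (test_D (e1 R) tp).
have J2 := L1_mul_test x Lu (test_D (e2 R) tp).
rewrite /lin2 /conv (Rintegral_lin measurableT v.1 v.2 J1 J2).
apply: eq_Rintegral => y _.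
rewrite (@derive_lin2 _ psi (x - y) v (smooth_differentiable _ sp)).
by rewrite /lin2; ring.
Qed.

Lemma conv_smooth u psi : L1 u -> test_fun psi -> smooth (conv u psi).
Proof.
move=> Lu tp.
apply: (@smooth_family _ _ _ (fun f => exists2 p, test_fun p & f = conv u p)).
- by move=> _ [p tp' ->] x; exact: conv_differentiable.
- move=> _ v [p tp' ->]; exists (fun y => 'D_v p y); first exact: test_D.
  by apply/funext => x; exact: conv_D.
- by exists psi.
Qed.

Lemma conv_supp u psi M N x : (forall y, M < `|y| -> u y = 0) ->
  (forall y, N < `|y| -> psi y = 0) -> M + N < `|x| -> conv u psi x = 0.
Proof.
move=> uM pN H; rewrite /conv /Rintegral integral0_eq// => y _.
have [/uM ->|yM] := ltP M `|y|; first by rewrite mul0r.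
rewrite pN ?mulr0//; have := ler_normB (x - y) (- y).
rewrite opprK subrK normrN; lra.
Qed.

Lemma conv_test u psi M : L1 u -> (forall y, M < `|y| -> u y = 0) -> test_fun psi ->
  test_fun (conv u psi).
Proof.
move=> Lu uM tp; have /test_funP[_ [N HN]] := tp; apply/test_funP; split.
  exact: conv_smooth.
by exists (M + N) => x; exact: conv_supp.
Qed.

Definition weak_deriv v u g :=
  forall phi, test_fun phi -> ip2 u (fun y => 'D_v phi y) = - ip2 g phi.

(** The weak derivative is tested with y |-> psi (x - y); the sign from the reflection cancels the
    one from integration by parts. *)
Lemma conv_weak_deriv u g v psi x : L2p u -> weak_deriv v u g -> test_fun psi ->
  conv u (fun y => 'D_v psi y) x = conv g psi x.
Proof.
move=> Lu wu tp; have [sp _] := tp.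
have w := wu _ (test_reflect x tp).
have -> : conv g psi x = ip2 g (fun y => psi (x - y)) by [].
apply/eqP; rewrite -eqr_opp -w -(RintegralN measurableT (L2_mul_test x Lu (test_D v tp))).
by apply/eqP/eq_Rintegral => y _; rewrite derive_reflect// mulrN.
Qed.

End convolution.

Section mollifier.
Context (R : realType).

Definition bump (t : R) : R := eta (1 + t) * eta (1 - t).

Lemma smooth_bump : smooth bump.
Proof.
apply: smoothM.
- apply: (@smooth_comp_affine _ _ (@eta R) (fun t : R => 1 + t) id) => //; last exact: smooth_eta.
  move=> x v; rewrite deriveD//; rewrite derive_cst add0r; exact: derive_id.
- apply: (@smooth_comp_affine _ _ (@eta R) (fun t : R => 1 - t) -%R) => //; last exact: smooth_eta.
  move=> x v; rewrite deriveB//; rewrite derive_cst add0r; congr (- _); exact: derive_id.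
Qed.

Lemma bump_ge0 t : 0 <= bump t. Proof. by rewrite mulr_ge0 ?eta_ge0. Qed.

Lemma bump_sym t : bump (- t) = bump t.
Proof. by rewrite /bump opprK mulrC. Qed.

Lemma bump_eq0 t : 1 <= `|t| -> bump t = 0.
Proof.
rewrite ler_normr /bump => /orP[t1|t1].
  by rewrite [X in _ * X]eta_le0 ?mulr0//; lra.
by rewrite eta_le0 ?mul0r//; lra.
Qed.

Lemma bump_gt0 t : `|t| < 1 -> 0 < bump t.
Proof.
by rewrite ltr_norml => /andP[t1 t2]; rewrite mulr_gt0// eta_gt0//; lra.
Qed.

Lemma bump_continuous : continuous bump.
Proof. exact: smooth_continuous smooth_bump. Qed.

Lemma bump_measurable : measT bump.
Proof. by apply: continuous_measurable_fun; exact: bump_continuous. Qed.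

Lemma bump_le1 t : bump t <= 1.
Proof.
have e1 s : eta s <= 1 :> R.
  rewrite /eta; case: ifP => // s0.
  by rewrite -expR0 ler_expR oppr_le0 invr_ge0 ltW.
by rewrite mulr_ile1 ?eta_ge0.
Qed.

Lemma bump_integrable : intg setT bump.
Proof.
apply: (@int_le _ _ _ mu setT measurableT _ (\1_(`[- 1, 1]%classic : set R))).
- exact: bump_measurable.
- move=> t _; rewrite ger0_norm ?bump_ge0// indicE.
  have [t1|t1] := leP `|t| 1.
    by rewrite mem_set/= ?bump_le1// in_itv/= -ler_norml.
  by rewrite bump_eq0; [exact: ler0n|exact: ltW].
- exact: integrable_indic_itv.
Qed.

Definition bump_mass : R := Rint setT bump.

Lemma bump_massE : (bump_mass%:E = \int[mu]_t (bump t)%:E)%E.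
Proof. by rewrite /bump_mass /Rintegral fineK//; exact: integrable_fin_num bump_integrable. Qed.

Lemma bump_mass_gt0 : 0 < bump_mass.
Proof.
rewrite lt_neqAle Rintegral_ge0 ?andbT; last by move=> t _; exact: bump_ge0.
apply/eqP => m0.
have : (\int[mu]_t `|(bump t)%:E| = 0)%E.
  rewrite -[RHS]/(0%:E) m0 bump_massE; apply: eq_integral => t _.
  by rewrite gee0_abs// lee_fin bump_ge0.
have mb : measT (EFin \o bump) by apply/mEFinP; exact: bump_measurable.
move=> /(ae_eq_integral_abs mu measurableT mb)[N [mN N0 HN]].
have : (mu (`](-1)%R, 1%R[%classic : set R) <= mu N)%E.
  apply: le_measure; rewrite ?inE//; apply: subset_trans HN => t /=.
  rewrite in_itv/= -ltr_norml => t1 /(_ I) [] b0.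
  by have := bump_gt0 t1; rewrite b0 ltxx.
rewrite N0 lebesgue_measure_itv/= lte_fin.
rewrite ifT; last by lra.
by rewrite -EFinB lee_fin; lra.
Qed.

Definition mol (N : nat) (t : R) : R := N.+1%:R / bump_mass * bump (N.+1%:R * t).

Lemma mol_ge0 N t : 0 <= mol N t.
Proof. by rewrite mulr_ge0 ?bump_ge0// divr_ge0// ltW// bump_mass_gt0. Qed.

Lemma mol_sym N t : mol N (- t) = mol N t.
Proof. by rewrite /mol mulrN bump_sym. Qed.

Lemma mol_eq0 N t : N.+1%:R^-1 <= `|t| -> mol N t = 0.
Proof.
move=> t1; rewrite /mol bump_eq0 ?mulr0// normrM ger0_norm//.
by rewrite mulrC -ler_pdivrMr// div1r.
Qed.

Lemma smooth_mol N : smooth (mol N).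
Proof.
apply: smoothZ.
apply: (@smooth_comp_affine _ _ bump (fun t : R => N.+1%:R * t) ( *%R N.+1%:R)); last exact: smooth_bump.
- by move=> x; apply: differentiableM => //; exact: differentiable_cst.
- by move=> x v; rewrite deriveMl// derive_id.
Qed.

Lemma integral_mol N (x : R) : (\int[mu]_t (mol N (t - x))%:E = 1)%E.
Proof.
have m0 := bump_mass_gt0.
pose F (t : R) : R := N.+1%:R * (t - x).
have dF (t : R) : is_derive t (1 : R) F N.+1%:R.
  have := is_deriveZ N.+1%:R (is_deriveB (is_derive_id t (1 : R)) (is_derive_cst x t 1)).
  by rewrite subr0 -[_ *: _]/(_ * 1) mulr1.
have F' : F^`()%classic = cst N.+1%:R.
  by apply/funext => t; rewrite derive1E; have [] := dF t.
have := @increasing_ge0_integration_by_substitutionT R F bump.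
have H1 : {homo F : s t / s < t} by move=> s t st; rewrite /F ltr_pM2l ?ltr0n// ltrD2r.
have H2 : continuous F^`()%classic by rewrite F' => t; exact: cvg_cst.
have H3 : cvg (F^`()%classic t @[t --> -oo]) by rewrite F'; apply: is_cvg_cst.
have H4 : cvg (F^`()%classic t @[t --> +oo]) by rewrite F'; apply: is_cvg_cst.
have H5 : forall t, derivable F t 1 by move=> t; have [] := dF t.
have H6 : F t @[t --> -oo] --> -oo.
  apply/cvgrNyPle => A; near=> t; rewrite /F mulrC -ler_pdivlMr// lerBlDr.
  near: t; apply: nbhs_ninfty_le; exact: num_real.
have H7 : F t @[t --> +oo] --> +oo.
  apply/cvgryPge => A; near=> t; rewrite /F mulrC -ler_pdivrMr// lerBrDr.
  near: t; apply: nbhs_pinfty_ge; exact: num_real.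
move=> /(_ H1 H2 H3 H4 H5 H6 H7 bump_continuous bump_ge0).
rewrite -bump_massE F' => E.
have mm : measT (fun t => (bump (F t) * N.+1%:R)%:E).
  apply/mEFinP; apply: measurable_funM => //.
  apply: measurableT_comp; first exact: bump_measurable.
  by apply: measurable_funM => //; exact: measurable_funB.
transitivity (bump_mass^-1%:E * \int[mu]_t (bump (F t) * N.+1%:R)%:E)%E.
  rewrite -ge0_integralZl//.
  - by apply: eq_integral => t _; rewrite -EFinM; congr EFin; rewrite /mol /F; ring.
  - by move=> t _; rewrite lee_fin mulr_ge0// bump_ge0.
  - by rewrite lee_fin invr_ge0 ltW.
rewrite [X in (_ * X)%E](_ : _ = bump_mass%:E)//.
by rewrite -EFinM mulVf// gt_eqF.
Unshelve. all: by end_near. Qed.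

Definition rho (N : nat) (x : R * R) : R := mol N x.1 * mol N x.2.

Lemma rho_ge0 N x : 0 <= rho N x.
Proof. by rewrite mulr_ge0 ?mol_ge0. Qed.

Lemma rho_sym N x : rho N (- x) = rho N x.
Proof. by rewrite /rho /= !mol_sym. Qed.

Lemma rho_eq0 N x : N.+1%:R^-1 <= `|x| -> rho N x = 0.
Proof.
rewrite prod_normE/= le_max /rho => /orP[H|H]; first by rewrite mol_eq0 ?mul0r.
by rewrite (mol_eq0 H) mulr0.
Qed.

Lemma smooth_fst (f : R -> R) : smooth f -> smooth (fun x : R * R => f x.1).
Proof.
move=> sf; apply: (@smooth_comp_affine _ _ f fst (lin2 1 0)) => //.
  by move=> x; have [] := @diff_quad _ fst x 1 0 0 _; move=> *;
    rewrite ?mul0r /lin2/= ?mulr1 ?mulr0 ?addr0 ?addrK ?subrr ?normr0.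
move=> x; have [] // := @diff_quad _ fst x 1 0 0 _ => h.
by rewrite mul0r /lin2/= mulr1 mulr0 addr0 addrK subrr normr0.
Qed.

Lemma smooth_snd (f : R -> R) : smooth f -> smooth (fun x : R * R => f x.2).
Proof.
move=> sf; apply: (@smooth_comp_affine _ _ f snd (lin2 0 1)) => //.
  by move=> x; have [] := @diff_quad _ snd x 0 1 0 _; move=> *;
    rewrite ?mul0r /lin2/= ?mulr1 ?mulr0 ?add0r ?addrK ?subrr ?normr0.
move=> x; have [] // := @diff_quad _ snd x 0 1 0 _ => h.
by rewrite mul0r /lin2/= mulr1 mulr0 add0r addrK subrr normr0.
Qed.

Lemma rho_test N : test_fun (rho N).
Proof.
apply/test_funP; split; last by exists N.+1%:R^-1 => x /ltW; exact: rho_eq0.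
by apply: smoothM; [apply: smooth_fst|apply: smooth_snd]; exact: smooth_mol.
Qed.

Lemma integral_rho N (y : R * R) : (\int[mu2]_x (rho N (x - y))%:E = 1)%E.
Proof.
have mr : measT (fun x : mR * mR => (rho N (x - y))%:E).
  apply/mEFinP.
  have := test_measurable (test_reflect y (rho_test N)).
  by congr measurable_fun; apply/funext => x; rewrite -rho_sym opprB.
rewrite fubini_tonelli1//; last by move=> x; rewrite lee_fin rho_ge0.
rewrite /fubini_F; under eq_integral.
  move=> s _.
  have E : (\int[mu]_t (rho N ((s, t) - y))%:E = (mol N (s - y.1))%:E)%E.
    rewrite /rho/=; under eq_integral do rewrite EFinM.
    rewrite ge0_integralZl ?integral_mol ?mule1//.
    - by apply/mEFinP; apply: measurableT_comp; [by apply: continuous_measurable_fun; exact: smooth_continuous (smooth_mol N)|exact: measurable_funB].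
    - by move=> t _; rewrite lee_fin mol_ge0.
    - by rewrite lee_fin mol_ge0.
  rewrite E; over.
exact: integral_mol.
Qed.

End mollifier.

(** * Tonelli's theorem for pairs of points of the plane *)

Section sigma_finite_product.
Context d1 d2 (T1 : measurableType d1) (T2 : measurableType d2) (R : realType)
  (m1 : {sigma_finite_measure set T1 -> \bar R}) (m2 : {sigma_finite_measure set T2 -> \bar R}).

Lemma product_sigma_finite : sigma_finite setT (m1 \x m2)%E.
Proof.
have /sigma_finiteP[F [TF ndF Foo]] := sigma_finiteT m1.
have /sigma_finiteP[G [TG ndG Goo]] := sigma_finiteT m2.
exists (fun n => F n `*` G n).
  rewrite -setXTT TF TG predeqE => -[x y]; split.
    move=> [/= [n _ Fnx] [k _ Gky]]; exists (maxn n k) => //; split.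
    - by move: x Fnx; exact/subsetPset/ndF/leq_maxl.
    - by move: y Gky; exact/subsetPset/ndG/leq_maxr.
  by move=> [n _ []/= ? ?]; split; exists n.
move=> k; have [? ?] := Foo k; have [? ?] := Goo k.
split; first exact: measurableX.
by rewrite product_measure1E// lte_mul_pinfty// ge0_fin_numE.
Qed.

Definition sigma_finite_prod : {sigma_finite_measure set (T1 * T2)%type -> \bar R} :=
  HB.pack (m1 \x m2)%E (Measure_isSigmaFinite.Build _ _ _ (m1 \x m2)%E product_sigma_finite).
End sigma_finite_product.

Section tonelli.
Context (R : realType).
Notation mR := (measurableTypeR R).
Notation mu := (@lebesgue_measure R).
Notation mu2 := (mu \x mu)%E.

Definition leb2S : {sigma_finite_measure set (mR * mR)%type -> \bar R} :=
  sigma_finite_prod mu mu.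

Lemma tonelli22 (K : (mR * mR) * (mR * mR) -> \bar R) :
  measT K -> (forall z, 0 <= K z)%E ->
  (\int[mu2]_x \int[mu2]_y K (x, y) = \int[mu2]_y \int[mu2]_x K (x, y))%E.
Proof.
move=> mK K0; have H := @fubini_tonelli _ _ _ _ _ leb2S leb2S K mK K0; exact: H.
Qed.

Lemma measurable_tonelli22 (K : (mR * mR) * (mR * mR) -> \bar R) :
  measT K -> (forall z, 0 <= K z)%E ->
  measT (fun x => \int[mu2]_y K (x, y))%E.
Proof.
move=> mK K0.
have H := @measurable_fun_fubini_tonelli_F _ _ _ _ _ leb2S K mK K0; exact: H.
Qed.
End tonelli.

Section mollification.
Context (R : realType).
Notation mR := (measurableTypeR R).
Notation mu := (@lebesgue_measure R).
Notation mu2 := (mu \x mu)%E.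
Notation L1 u := (mu2.-integrable setT (EFin \o u)).
Implicit Types (u : R * R -> R).

Lemma rho_integrable N x : L1 (fun y => rho N (x - y) : R).
Proof. exact/test_integrable/test_reflect/rho_test. Qed.

Lemma Rintegral_rho N x : Rint2 (fun y => rho N (x - y) : R) = 1.
Proof.
rewrite /Rintegral (_ : (\int[mu2]_y _)%E = 1%E)//.
rewrite -[RHS](integral_rho N x); apply: eq_integral => y _.
by rewrite -rho_sym opprB.
Qed.

Lemma Rintegral_rhoZ N x (c : R) :
  c = Rint2 (fun y => c * rho N (x - y) : R).
Proof.
by rewrite (RintegralZl c mT (rho_integrable N x)) Rintegral_rho mulr1.
Qed.

(* variance of u with respect to the density rho (x - .) *)
Lemma conv_rho_sqr_le N u x : L2p u ->
  (conv u (rho N) x) ^+ 2 <= Rint2 (fun y => u y ^+ 2 * rho N (x - y)).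
Proof.
move=> Lu; set m := conv u (rho N) x.
have tr := rho_test R N.
have I1 := L2_mul_test x Lu tr.
have I2 := L1_mul_test x (L2r_int_sqr Lu) tr.
have I0 := rho_integrable N x.
have : 0 <= Rint2 (fun y => 1 * (u y ^+ 2 * rho N (x - y)) +
     1 * ((- (2 * m)) * (u y * rho N (x - y)) + m ^+ 2 * rho N (x - y))).
  apply: Rintegral_ge0 => y _.
  rewrite (_ : _ + _ = (u y - m) ^+ 2 * rho N (x - y)); last by ring.
  by rewrite mulr_ge0 ?sqr_ge0 ?rho_ge0.
rewrite -(Rintegral_lin mT 1 1 I2 (integrable_lin mT (- (2 * m)) (m ^+ 2) I1 I0)).
rewrite -(Rintegral_lin mT _ _ I1 I0) Rintegral_rho -/(conv u (rho N) x) -/m; lra.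
Qed.

Lemma conv_measurable u psi : L1 u -> test_fun psi ->
  measT (conv u psi : mR * mR -> mR).
Proof.
by move=> Lu tp; apply: continuous_measurable2; exact: smooth_continuous (conv_smooth Lu tp).
Qed.

(** The pointwise variance inequality is integrated over x; after exchanging the integrals, [rho N]
    has mass 1 in x as well. *)
Lemma conv_rho_contract N u : L1 u -> L2p u ->
  L2p (conv u (rho N)) /\ ip2 (conv u (rho N)) (conv u (rho N)) <= ip2 u u.
Proof.
move=> L1u Lu; have [mu_ _] := Lu; have tr := rho_test R N.
have mc := conv_measurable L1u tr.
pose K (z : (mR * mR) * (mR * mR)) : \bar R := ((u z.2) ^+ 2 * rho N (z.1 - z.2))%:E.
have mK : measT K.
  apply/mEFinP; apply: measurable_funM.
    by apply: measurable_funX; apply: measurableT_comp.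
  apply: (@measurableT_comp _ _ _ _ _ _ (rho N : mR * mR -> mR)).
    exact: test_measurable.
  apply/measurable_fun_pairP; split.
  - apply: (@measurable_funB _ _ _ _ (fun z : (mR * mR) * (mR * mR) => z.1.1)
      (fun z => z.2.1)); by do !apply: measurableT_comp => //.
  - apply: (@measurable_funB _ _ _ _ (fun z : (mR * mR) * (mR * mR) => z.1.2)
      (fun z => z.2.2)); by do !apply: measurableT_comp => //.
have K0 z : (0 <= K z)%E by rewrite lee_fin mulr_ge0 ?sqr_ge0 ?rho_ge0.
have E : (\int[mu2]_x \int[mu2]_y K (x, y) = \int[mu2]_y ((u y) ^+ 2)%:E)%E.
  transitivity (\int[mu2]_y \int[mu2]_x K (x, y))%E; first exact: tonelli22.
  apply: eq_integral => y _.
  rewrite /K /=; under eq_integral do rewrite EFinM.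
  rewrite ge0_integralZl ?integral_rho ?mule1//.
  - apply/mEFinP.
    have := test_measurable (test_reflect y (rho_test R N)).
    by congr measurable_fun; apply/funext => x; rewrite -rho_sym opprB.
  - by move=> x _; rewrite lee_fin rho_ge0.
  - by rewrite lee_fin sqr_ge0.
have B : (\int[mu2]_x ((conv u (rho N) x) ^+ 2)%:E <= \int[mu2]_y ((u y) ^+ 2)%:E)%E.
  rewrite -E; apply: ge0_le_integral => //.
  - by move=> x _; rewrite lee_fin sqr_ge0.
  - by apply/mEFinP; exact: measurable_funX.
  - exact: measurable_tonelli22.
  - move=> x _; have := conv_rho_sqr_le N x Lu; rewrite -lee_fin => /le_trans; apply.
    have I2 := L1_mul_test x (L2r_int_sqr Lu) tr.
    by rewrite /Rintegral fineK//; exact: integrable_fin_num.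
have Lc : L2p (conv u (rho N)).
  by split=> //; apply: le_lt_trans B _; case: Lu.
by split=> //; rewrite -lee_fin !(ip_sqr mT).
Qed.

Lemma convB u w psi x : L1 u -> L1 w -> test_fun psi ->
  conv (u \- w) psi x = conv u psi x - conv w psi x.
Proof.
move=> Lu Lw tp; rewrite /conv -RintegralB//; last 2 first.
- exact: L1_mul_test.
- exact: L1_mul_test.
by apply: eq_Rintegral => y _ /=; rewrite mulrBl.
Qed.

Lemma lipC_L1 psi : lipC psi -> L1 psi.
Proof.
move=> lp; have [C HC] := lipC_bounded lp; have [_ [M HM]] := lp.
by apply: (@bsupp_integrable _ _ C M) => //; apply: continuous_measurable2; exact: lipC_continuous.
Qed.

(** The mollifier lives in a ball of radius 1/(N + 1), so the pointwise error is at most the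
    Lipschitz constant divided by N + 1. Everything vanishes outside the square [B], one unit larger
    than the support, which gives the dominating function. *)
Lemma conv_lipC psi : lipC psi -> cvg2 mu2 setT (fun N => conv psi (rho N)) psi.
Proof.
move=> lp; have [[K HK] [M HM]] := lp; have [C HC] := lipC_bounded lp.
have C0 : 0 <= C by apply: le_trans (HC 0).
have L1p := lipC_L1 lp.
pose B : set (mR * mR) := `[- (`|M| + 1), `|M| + 1]%classic `*` `[- (`|M| + 1), `|M| + 1]%classic.
have mB : measurable B by apply: measurableX; exact: measurable_itv.
have NB (x : R * R) : ~ B x -> `|M| + 1 < `|x|.
  move=> nB; rewrite ltNge; apply/negP => h; apply: nB; move: h.
  by rewrite prod_normE/= ge_max !ler_norml => /andP[? ?]; split; rewrite /= in_itv.
have LB : L2p (fun x => (C + C) * \1_B x).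
  apply: (@bsupp_L2r _ _ (C + C) (`|M| + 1)).
  - by apply: measurable_funM => //; exact: measurable_indic.
  - by move=> x; rewrite indicE normrM ger0_norm ?addr_ge0//; case: (_ \in _);
      rewrite ?normr0 ?normr1 ?mulr1 ?mulr0 ?addr_ge0.
  - move=> x xM; rewrite indicE memNset ?mulr0// => -[/=]; rewrite !in_itv/= -!ler_norml.
    by move: xM; rewrite prod_normE/= ltNge ge_max => /negP h h1 h2; apply: h; rewrite h1.
have bnd N x : `|conv psi (rho N) x - psi x| <= `|K| * N.+1%:R^-1.
  have I1 := L1_mul_test x L1p (rho_test R N).
  have I0 := rho_integrable N x.
  have -> : conv psi (rho N) x - psi x =
    1 * conv psi (rho N) x + (- psi x) * Rint2 (fun y => rho N (x - y) : R).
    by rewrite Rintegral_rho mul1r mulr1.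
  rewrite (Rintegral_lin mT _ _ I1 I0).
  apply: (le_trans (le_normr_Rintegral mT (integrable_lin mT _ _ I1 I0))).
  rewrite [leRHS](Rintegral_rhoZ N x).
  apply: le_Rintegral => //.
  - by apply: integrable_norm; exact: integrable_lin.
  - exact: (integrableZl mT (`|K| * N.+1%:R^-1) I0).
  move=> y _; rewrite (_ : _ + _ = (psi y - psi x) * rho N (x - y)); last by ring.
  rewrite normrM (ger0_norm (rho_ge0 _ _)).
  have [xy|xy] := leP N.+1%:R^-1 `|x - y|; first by rewrite rho_eq0 ?mulr0.
  rewrite ler_wpM2r ?rho_ge0// (le_trans (HK y x))// distrC.
  apply: (@le_trans _ _ (`|K| * `|x - y|)); first by rewrite ler_wpM2r ?ler_norm.
  by rewrite ler_wpM2l// ltW.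
apply: (cvg2_dominated mT _ _ LB).
- by move=> N; apply: conv_measurable => //; exact: rho_test.
- by case: (lipC_L2r lp).
- move=> N x _.
  have [Bx|nB] := pselect (B x); last first.
    rewrite (@conv_supp _ _ _ M 1)// ?normr0//.
    + by move=> y /ltW y1; apply: rho_eq0; apply: le_trans y1; rewrite invf_le1// ler1n.
    + by apply: le_lt_trans (NB _ nB); rewrite lerD2r ler_norm.
  rewrite indicE mem_set// mulr1 [leRHS]ger0_norm ?addr_ge0//.
  have I1 := L1_mul_test x L1p (rho_test R N).
  have I0 := rho_integrable N x.
  apply: (le_trans (le_normr_Rintegral mT I1)).
  apply: (@le_trans _ _ C); last by rewrite lerDl.
  rewrite [leRHS](Rintegral_rhoZ N x).
  apply: le_Rintegral => //.
  + exact: integrable_norm.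
  + exact: (integrableZl mT C I0).
  + by move=> y _; rewrite normrM (ger0_norm (rho_ge0 _ _)) ler_wpM2r ?rho_ge0.
- move=> x _; apply/cvgrPdist_le => e e0.
  have K1 : 0 < `|K| + 1 by rewrite ltr_wpDl.
  have eK : 0 < e / (`|K| + 1) by rewrite divr_gt0.
  near=> N; rewrite distrC (le_trans (bnd N x))//.
  have : N.+1%:R^-1 < e / (`|K| + 1).
    near: N; exact: (near_infty_natSinv_lt (PosNum eK)).
  rewrite ltr_pdivlMr// => /ltW H; apply: le_trans H.
  by rewrite mulrC ler_wpM2l ?invr_ge0// lerDl.
Unshelve. all: by end_near. Qed.

(** Approximation by a Lipschitz function: mollification is a contraction, hence preserves the
    error. Two uses of [ip_sub_le2] multiply errors by at most 10, so e / 16 is small enough. *)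
Lemma conv_cvg2 u : L1 u -> L2p u -> cvg2 mu2 setT (fun N => conv u (rho N)) u.
Proof.
move=> L1u Lu; apply/cvgr0Pnorm_le => e e0.
have e8 : 0 < e / 16 by rewrite divr_gt0.
have [_ /(_ _ e8)[psi lp Hp]] := apx_L2 Lu.
have Lp := lipC_L2r lp; have L1p := lipC_L1 lp.
have /cvgr0Pnorm_le/(_ _ e8) [N0 _ HN0] := conv_lipC lp.
exists N0 => // N /= NN; rewrite ger0_norm ?ip_ge0//.
have := HN0 N NN; rewrite /= ger0_norm ?ip_ge0// => H2.
have [Lc _] := conv_rho_contract N L1u Lu.
have [Lcp _] := conv_rho_contract N L1p Lp.
have L1d : L1 (u \- psi) := integrableB mT L1u L1p.
have [Lcd H1] := conv_rho_contract N L1d (L2rB mT Lu Lp).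
rewrite (_ : conv (u \- psi) (rho N) = conv u (rho N) \- conv psi (rho N)) in H1; last first.
  by apply/funext => x; apply: convB => //; exact: rho_test.
have T1 := ip_sub_le2 mT Lc Lcp Lu; have T2 := ip_sub_le2 mT Lcp Lp Lu.
apply: (le_trans T1); have T3 := ip_subC mu2 setT psi u; rewrite T3 in T2.
move: T2 H1 H2 Hp; rewrite !/(_ \- _); move: (ip _ _ _ _) => a.
move: (ip _ _ _ _) => b; move: (ip _ _ _ _) => c'; move: (ip _ _ _ _) => d'.
by clear -e0; lra.
Qed.

End mollification.

(** * Test functions are dense in H^1 *)

Section density.
Context (R : realType).
Implicit Types (u g phi : R * R -> R).

(** The mollifier at scale 1, dilated by k + 1 and normalised at the origin: bounded uniformly,
    tending to 1 pointwise, with derivatives O(1/(k + 1)). *)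
Definition cutoff (k : nat) (x : R * R) : R := rho 0 (0 + k.+1%:R^-1 *: x) / rho 0 0.

Lemma rho00_gt0 : 0 < rho 0 0 :> R.
Proof.
by rewrite /rho/= mulr_gt0// /mol !mulr0 mulr_gt0 ?divr_gt0 ?bump_mass_gt0//
  bump_gt0// normr0.
Qed.

Lemma cutoff_test k : test_fun (cutoff k).
Proof.
have k0 : k.+1%:R^-1 != 0 :> R by rewrite invr_neq0.
have := testZ (rho 0 0)^-1 (test_comp_affine2 0 k0 (rho_test R 0)).
by congr test_fun; apply/funext => x; rewrite mulrC.
Qed.

Lemma cutoff_bounded : exists C : R, forall k x, `|cutoff k x| <= C.
Proof.
have [C HC] := test_bounded (rho_test R 0).
by exists (C / rho 0 0) => k x; rewrite normrM normfV (gtr0_norm rho00_gt0) ler_pM2r ?invr_gt0 ?rho00_gt0.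
Qed.

Lemma cutoff_cvg x : (fun k => cutoff k x) @ \oo --> (1 : R).
Proof.
have E : rho 0 0 / rho 0 0 = 1 :> R by rewrite divff// gt_eqF// rho00_gt0.
rewrite -[X in _ --> X]E /cutoff; apply: cvgMr_tmp.
have H : (fun k : nat => 0 + k.+1%:R^-1 *: x) @ \oo --> (0 : R * R).
  rewrite -[X in _ --> X](addr0 0); apply: cvgD; first exact: cvg_cst.
  rewrite -[X in _ --> X](scale0r x); apply: cvgZr_tmp.
  exact: cvg_harmonic.
apply: (@cvg_comp _ _ _ _ (rho 0) _ _ _ H); exact: (test_continuous (rho_test R 0)).
Qed.

Lemma D_cutoff k v x :
  'D_v (cutoff k) x = k.+1%:R^-1 * ('D_v (rho 0) (0 + k.+1%:R^-1 *: x) / rho 0 0).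
Proof.
have [sr _] := rho_test R 0.
have dr : differentiable (rho 0) (0 + k.+1%:R^-1 *: x) by exact: smooth_differentiable.
have s2 := smooth_comp_affine2 0 k.+1%:R^-1 sr.
rewrite /cutoff (_ : (fun x => _) = (rho 0 0)^-1 *: (fun z : R * R => rho 0 (0 + k.+1%:R^-1 *: z))); last first.
  by apply/funext => z; rewrite mulrC.
rewrite deriveZ; last exact: smooth_derivable.
by rewrite derive_comp_affine2// /GRing.scale/= mulrC mulrA.
Qed.

Lemma cutoff_cvg2 u : L2p u -> cvg2 mu2 setT (fun k => u \* cutoff k) u.
Proof.
move=> Lu; have [mu_ _] := Lu; have [C HC] := cutoff_bounded.
have LC : L2p (fun x => C * u x) by exact: L2rZ.
apply: (cvg2_dominated mT _ mu_ LC).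
- by move=> k; apply: measurable_funM => //; exact: test_measurable (cutoff_test k).
- move=> k x _; rewrite /= normrM [leRHS]normrM mulrC ler_wpM2r// (le_trans (HC k x))// ler_norm//.
- move=> x _; rewrite -[X in _ --> X]mulr1; apply: cvgMl_tmp; exact: cutoff_cvg.
Qed.

Lemma D_cutoff_cvg2 u v : L2p u ->
  cvg2 mu2 setT (fun k => u \* (fun x => 'D_v (cutoff k) x)) (cst 0).
Proof.
move=> Lu; have [mu_ _] := Lu.
have [C HC] := test_bounded (test_D v (rho_test R 0)).
pose C' := C / rho 0 0.
have bnd k x : `|'D_v (cutoff k) x| <= k.+1%:R^-1 * C'.
  rewrite D_cutoff normrM ger0_norm ?invr_ge0// ler_wpM2l ?invr_ge0//.
  by rewrite normrM normfV (gtr0_norm rho00_gt0) ler_pM2r ?invr_gt0 ?rho00_gt0.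
have C0 : 0 <= C' by have := le_trans (normr_ge0 _) (bnd 0%N 0); rewrite invr1 mul1r.
have LC : L2p (fun x => C' * u x) by exact: L2rZ.
apply: (cvg2_dominated mT _ _ LC).
- move=> k; apply: measurable_funM => //.
  exact: test_measurable (test_D v (cutoff_test k)).
- exact: measurable_cst.
- move=> k x _; rewrite /= normrM [leRHS]normrM mulrC ler_wpM2r// (le_trans (bnd k x))//.
  rewrite (ger0_norm C0) ler_piMl// invf_le1 ?ler1n//.
- move=> x _; apply: (@squeeze_cvgr _ _ _ _ (fun k : nat => - (`|u x| * C' * k.+1%:R^-1))
    (fun k : nat => `|u x| * C' * k.+1%:R^-1)).
  + apply: nearW => k; rewrite -ler_norml normrM -mulrA ler_wpM2l//.
    by rewrite mulrC.
  + rewrite -oppr0; apply: cvgN; rewrite -[X in _ --> X](mulr0 (`|u x| * C')).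
    by apply: cvgMl_tmp; exact: cvg_harmonic.
  + rewrite -[X in _ --> X](mulr0 (`|u x| * C')).
    by apply: cvgMl_tmp; exact: cvg_harmonic.
Qed.

Lemma L2M_test u phi : L2p u -> test_fun phi -> L2p (u \* phi).
Proof.
move=> Lu tp; have [C HC] := test_bounded tp.
apply: (L2r_le mT _ _ (L2rZ mT C Lu)).
  by apply: measurable_funM; [case: Lu|exact: test_measurable].
by move=> x _; rewrite /= !normrM mulrC ler_wpM2r// (le_trans (HC x))// ler_norm.
Qed.

Lemma cutoff_weak_deriv k v u g : L2p u -> L2p g -> weak_deriv v u g ->
  weak_deriv v (u \* cutoff k) ((g \* cutoff k) \+ (u \* (fun x => 'D_v (cutoff k) x))).
Proof.
move=> Lu Lg wu phi tp; have tc := cutoff_test k.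
have [sc _] := tc; have [sp _] := tp.
have tD := test_D v tc; have tDp := test_D v tp.
have Lc : L2p (g \* cutoff k) by exact: L2M_test.
have Ld : L2p (u \* (fun x => 'D_v (cutoff k) x)) by exact: L2M_test.
rewrite (ipDl mT) //; last exact: test_L2r.
have := wu _ (testM tp tc).
have -> : (fun y => 'D_v (phi \* cutoff k) y) =
   (phi \* (fun y => 'D_v (cutoff k) y)) \+ (cutoff k \* (fun y => 'D_v phi y)).
  by apply/funext => y; rewrite (_ : phi \* cutoff k = phi * cutoff k)// deriveM//; exact: smooth_derivable.
rewrite (ipDr mT (test_L2r (testM tp tD)) (test_L2r (testM tc tDp)) Lu).
have -> : ip2 u (phi \* (fun y => 'D_v (cutoff k) y)) =
   ip2 (u \* (fun x => 'D_v (cutoff k) x)) phi.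
  by apply: eq_Rintegral => x _ /=; rewrite mulrA mulrAC.
have -> : ip2 u (cutoff k \* (fun y => 'D_v phi y)) =
   ip2 (u \* cutoff k) (fun y => 'D_v phi y).
  by apply: eq_Rintegral => x _ /=; rewrite mulrA.
have -> : ip2 g (phi \* cutoff k) = ip2 (g \* cutoff k) phi.
  by apply: eq_Rintegral => x _ /=; rewrite mulrA mulrAC.
rewrite opprD => H; apply/eqP; rewrite -subr_eq opprK addrC; exact/eqP.
Qed.

Lemma quarter_le (a b c e : R) : 0 < e ->
  a <= 2 * b + 2 * c -> b <= e / 16 -> c <= e / 16 -> a <= e.
Proof. lra. Qed.

(** Truncation comes before mollification because the convolution lemmas ask for an integrable
    function, and an L2 function times a test function is integrable. A single pair (k, N) is chosen
    for the function and both of its derivatives. *)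
Lemma H1_approx u (g1 g2 : R * R -> R) (e : R) : 0 < e -> L2p u -> L2p g1 -> L2p g2 ->
  weak_deriv (e1 R) u g1 -> weak_deriv (e2 R) u g2 ->
  exists phi, [/\ test_fun phi, ip2 (phi \- u) (phi \- u) <= e,
    ip2 ((fun x => 'D_(e1 R) phi x) \- g1) ((fun x => 'D_(e1 R) phi x) \- g1) <= e &
    ip2 ((fun x => 'D_(e2 R) phi x) \- g2) ((fun x => 'D_(e2 R) phi x) \- g2) <= e].
Proof.
move=> e_gt0 Lu L_1 L_2 w1 w2.
have e8 : 0 < e / 16 by rewrite divr_gt0.
pose G (g : R * R -> R) (v : R * R) k := (g \* cutoff k) \+ (u \* (fun x => 'D_v (cutoff k) x)).
have GL (g : R * R -> R) v k : L2p g -> L2p (G g v k).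
  by move=> Lg; apply: L2rD => //; apply: L2M_test => //; [exact: cutoff_test|apply: test_D; exact: cutoff_test].
have GL1 (g : R * R -> R) v k : L2p g -> L1 (G g v k).
  move=> Lg.
  have I1 := L2r_mul mT Lg (test_L2r (cutoff_test k)).
  have I2 := L2r_mul mT Lu (test_L2r (test_D v (cutoff_test k))).
  have := integrable_lin mT 1 1 I1 I2.
  by apply: eq_integrable => // x _; rewrite /= !mul1r.
have near1 (f_ : nat -> R * R -> R) f : cvg2 mu2 setT f_ f ->
    \forall n \near \oo, ip2 (f_ n \- f) (f_ n \- f) <= e / 16.
  move=> /cvgr0Pnorm_le/(_ _ e8); apply: filterS => n.
  by rewrite ger0_norm ?ip_ge0.
have close v g f k N : L2p g ->
   ip2 (g \* cutoff k \- g) (g \* cutoff k \- g) <= e / 16 ->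
   ip2 (u \* (fun x => 'D_v (cutoff k) x) \- cst 0) (u \* (fun x => 'D_v (cutoff k) x) \- cst 0) <= e / 16 ->
   ip2 (conv (G g v k) (rho N) \- G g v k) (conv (G g v k) (rho N) \- G g v k) <= e / 16 ->
   f = conv (G g v k) (rho N) ->
   ip2 (f \- g) (f \- g) <= e.
  move=> Lg H1 H2 H3 ->.
  have LG := GL g v k Lg.
  have Lck : L2p (g \* cutoff k) by apply: L2M_test => //; exact: cutoff_test.
  have [Lc _] := conv_rho_contract N (GL1 g v k Lg) LG.
  apply: (le_trans (ip_sub_le2 mT Lc LG Lg)).
  have T := ip_sub_le2 mT LG Lck Lg.
  have E : ip2 (G g v k \- g \* cutoff k) (G g v k \- g \* cutoff k) =
    ip2 (u \* (fun x => 'D_v (cutoff k) x) \- cst 0) (u \* (fun x => 'D_v (cutoff k) x) \- cst 0).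
    by apply: eq_Rintegral => x _ /=; rewrite subr0 /G/= addrAC subrr add0r.
  rewrite E in T.
  move: T H1 H2 H3; move: (ip2 _ _) => a1; move: (ip2 _ _) => a2; move: (ip2 _ _) => a3.
  move: (ip2 _ _) => a4 *; lra.
have A1 := near1 _ _ (cutoff_cvg2 Lu); have A2 := near1 _ _ (cutoff_cvg2 L_1).
have A3 := near1 _ _ (cutoff_cvg2 L_2); have A4 := near1 _ _ (D_cutoff_cvg2 (e1 R) Lu).
have A5 := near1 _ _ (D_cutoff_cvg2 (e2 R) Lu).
have [k _ /(_ k (leqnn k))[Hu [H1 [H2 [D1 D2]]]]] :=
  filterI A1 (filterI A2 (filterI A3 (filterI A4 A5))).
have tc := cutoff_test k.
have Luk : L2p (u \* cutoff k) by exact: L2M_test.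
have L1uk : L1 (u \* cutoff k) by apply: (L2r_mul mT Lu); exact/test_L2r.
have B1 := near1 _ _ (conv_cvg2 L1uk Luk).
have B2 := near1 _ _ (conv_cvg2 (GL1 _ (e1 R) k L_1) (GL _ (e1 R) k L_1)).
have B3 := near1 _ _ (conv_cvg2 (GL1 _ (e2 R) k L_2) (GL _ (e2 R) k L_2)).
have [N _ /(_ N (leqnn N))[Nu [N1 N2]]] := filterI B1 (filterI B2 B3).
have tr := rho_test R N.
exists (conv (u \* cutoff k) (rho N)); split.
- have /test_funP[_ [M HM]] := tc.
  by apply: (@conv_test _ _ _ M) => // y /HM H; rewrite /= H mulr0.
- have [Lc _] := conv_rho_contract N L1uk Luk.
  exact: quarter_le e_gt0 (ip_sub_le2 mT Lc Luk Lu) Nu Hu.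
- apply: (close (e1 R) g1 _ k N L_1 H1 D1 N1); apply/funext => x.
  rewrite (conv_D _ _ L1uk tr).
  exact: (conv_weak_deriv x Luk (cutoff_weak_deriv k Lu L_1 w1) tr).
- apply: (close (e2 R) g2 _ k N L_2 H2 D2 N2); apply/funext => x.
  rewrite (conv_D _ _ L1uk tr).
  exact: (conv_weak_deriv x Luk (cutoff_weak_deriv k Lu L_2 w2) tr).
Qed.

Lemma cvg2_harmonic (phi : nat -> R * R -> R) u :
  (forall n, ip2 (phi n \- u) (phi n \- u) <= n.+1%:R^-1) -> cvg2 mu2 setT phi u.
Proof.
move=> H; apply: (@squeeze_cvgr _ _ _ _ (cst 0) (fun n : nat => n.+1%:R^-1)).
- by apply: nearW => n; rewrite ip_ge0 H.
- exact: cvg_cst.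
- exact: cvg_harmonic.
Qed.

Lemma H1_density u (g1 g2 : R * R -> R) : L2p u -> L2p g1 -> L2p g2 ->
  weak_deriv (e1 R) u g1 -> weak_deriv (e2 R) u g2 ->
  exists phi : nat -> R * R -> R, [/\ forall n, test_fun (phi n), cvg2 mu2 setT phi u,
    cvg2 mu2 setT (fun n x => 'D_(e1 R) (phi n) x) g1 &
    cvg2 mu2 setT (fun n x => 'D_(e2 R) (phi n) x) g2].
Proof.
move=> Lu L_1 L_2 w1 w2.
have /choice[phi H] n := H1_approx (e := n.+1%:R^-1) ltac:(by rewrite invr_gt0) Lu L_1 L_2 w1 w2.
by exists phi; split; [move=> n; case: (H n)|apply: cvg2_harmonic => n; case: (H n)..].
Qed.

Lemma test_dense u : L2p u -> exists phi : nat -> R * R -> R,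
  (forall n, test_fun (phi n)) /\ cvg2 mu2 setT phi u.
Proof.
move=> Lu.
have {}H (e : R) : 0 < e -> exists phi, test_fun phi /\ ip2 (phi \- u) (phi \- u) <= e.
  move=> e_gt0; have e4 : 0 < e / 4 by rewrite divr_gt0.
  have /cvgr0Pnorm_le/(_ _ e4)[k _ /(_ k (leqnn k))] := cutoff_cvg2 Lu.
  have tc := cutoff_test k.
  have Luk : L2p (u \* cutoff k) by exact: L2M_test.
  have L1uk : L1 (u \* cutoff k) by apply: (L2r_mul mT Lu); exact/test_L2r.
  have /cvgr0Pnorm_le/(_ _ e4)[N _ /(_ N (leqnn N))] := conv_cvg2 L1uk Luk.
  rewrite !ger0_norm ?ip_ge0// => h1 h2.
  exists (conv (u \* cutoff k) (rho N)); split.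
    have /test_funP[_ [M HM]] := tc.
    apply: (@conv_test _ _ _ M) => //; last exact: rho_test.
    by move=> y /HM h; rewrite /= h mulr0.
  have [Lc _] := conv_rho_contract N L1uk Luk.
  have T := ip_sub_le2 mT Lc Luk Lu.
  move: T h1 h2; move: (ip2 _ _) => a1; move: (ip2 _ _) => a2; move: (ip2 _ _) => a3 *; lra.
have /choice[phi {}H] n := H n.+1%:R^-1 ltac:(by rewrite invr_gt0).
by exists phi; split; [move=> n; case: (H n)|apply: cvg2_harmonic => n; case: (H n)].
Qed.

(** Along test functions that tend to [u] in L2, the vanishing products tend to the squared norm of
    [u]. *)
Lemma test_orth_ae0 u : L2p u -> (forall phi, test_fun phi -> ip2 u phi = 0) ->
  ae_eq mu2 setT u (cst 0).
Proof.
move=> Lu H; apply: (ip_eq0_ae mT) => //.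
have [phi [tp cp]] := test_dense Lu.
have : (fun n => ip2 (phi n) u) @ \oo --> ip2 u u.
  by apply: (cvg2_ipr mT) => // n; exact: test_L2r.
under eq_fun do rewrite ipC H//.
by move/(cvg_unique _); apply => //; exact: cvg_cst.
Qed.

Lemma weak_deriv_unique v u g (g' : R * R -> R) : L2p u -> L2p g -> L2p g' ->
  weak_deriv v u g -> weak_deriv v u g' -> ae_eq mu2 setT g g'.
Proof.
move=> Lu Lg Lg' w w'.
have : ae_eq mu2 setT (g \- g') (cst 0).
  apply: test_orth_ae0; first exact: L2rB.
  move=> phi tp; rewrite (ipBl mT)//; last exact: test_L2r.
  by apply/eqP; rewrite subr_eq0; apply/eqP/oppr_inj; rewrite -w// w'.
by apply: filterS => x /= H /H/eqP; rewrite subr_eq0 => /eqP.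
Qed.

End density.

(** * Integrals of families of functions over a parameter *)

Section superposition.
Context (R : realType).
Variables (F : R -> R * R -> R) (a : R -> R).
Hypothesis mF : measT (fun z : mR * (mR * mR) => F z.1 z.2).
Hypothesis ia : intg setT a.
Hypothesis F_le : forall z x, `|F z x| <= a z.
Hypothesis F_int : forall z, (\int[mu2]_x `|F z x|%:E <= (a z)%:E)%E.

(** Each [F z] is bounded by [a z] both pointwise and in L1. The superposition is thus bounded and
    integrable, and square integrability follows from |s|^2 <= (sup |s|) |s|. The parameter is a
    time for Green functions and a point of the arc for potentials. *)
Definition superpose (x : R * R) : R := Rint setT (fun z => F z x).

Lemma measurable_slice z : measT (F z : mR * mR -> mR).
Proof.
exact: (measurableT_comp mF (pair1_measurable z)).
Qed.

Lemma slice_L1 z : L1 (F z).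
Proof.
apply/integrableP; split; first by apply/mEFinP; exact: measurable_slice.
by apply: le_lt_trans (F_int z) _; rewrite ltry.
Qed.

Lemma superpose_slice x : mu.-integrable setT (EFin \o F ^~ x).
Proof.
apply: (int_le mT _ _ ia) => [|z _]; last exact: F_le.
exact: (measurableT_comp mF (pair2_measurable x)).
Qed.

Lemma superpose_le x : `|superpose x| <= Rint setT a.
Proof.
apply: (le_trans (le_normr_Rintegral mT (superpose_slice x))).
by apply: le_Rintegral => //; exact: integrable_norm (superpose_slice x).
Qed.

Lemma superpose_prod (psi : R * R -> R) C : measT (psi : mR * mR -> mR) ->
  (forall x, `|psi x| <= C) ->
  (mu \x leb2S R)%E.-integrable setT
    (fun zx : mR * (mR * mR) => (F zx.1 zx.2 * psi zx.2)%:E).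
Proof.
move=> mpsi HC.
have C0 : 0 <= C := le_trans (normr_ge0 _) (HC 0).
have mFp : measT (fun zx : mR * (mR * mR) => (F zx.1 zx.2 * psi zx.2)%:E).
  by apply/mEFinP; apply: measurable_funM => //; exact: measurableT_comp.
apply/integrable12ltyP => //=.
apply: (@le_lt_trans _ _ (\int[mu]_z (C * a z)%:E)%E); last first.
  by have /integrable_lty := integrableZl mT C ia; apply.
apply: ge0_le_integral => //.
- by move=> z _; apply: integral_ge0.
- apply: (@measurable_fun_fubini_tonelli_F _ _ _ _ _ (leb2S R)
    (fun zx : mR * (mR * mR) => `|(F zx.1 zx.2 * psi zx.2)%:E|%E)) => //.
  exact: measurableT_comp.
- by have /measurable_int := integrableZl mT C ia.
move=> z _; rewrite [leRHS]EFinM.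
apply: (@le_trans _ _ (C%:E * \int[mu2]_x `|F z x|%:E)%E); last first.
  by apply: lee_wpmul2l => //; rewrite lee_fin.
rewrite -ge0_integralZl//; last first.
  by apply/mEFinP/measurableT_comp => //; exact: measurable_slice.
apply: ge0_le_integral => //.
- apply/mEFinP; apply: measurableT_comp => //; apply: measurable_funM => //.
  exact: measurable_slice.
- apply/mEFinP; apply: measurable_funM => //; apply: measurableT_comp => //.
  exact: measurable_slice.
- by move=> x _; rewrite lee_fin normrM mulrC ler_wpM2r.
Qed.

Lemma superposeE x : (\int[mu]_z (F z x * 1)%:E = (superpose x)%:E)%E.
Proof.
under eq_integral do rewrite mulr1.
by rewrite /superpose /Rintegral fineK//; exact: integrable_fin_num (superpose_slice x).
Qed.

Lemma superpose_G_prod : (mu \x leb2S R)%E.-integrable setT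
    (fun zx : mR * (mR * mR) => (F zx.1 zx.2 * 1)%:E).
Proof.
apply: (superpose_prod (psi := cst 1) (C := 1)) => //.
by move=> x; rewrite normr1.
Qed.

Lemma superpose_measurable : measT (superpose : mR * mR -> mR).
Proof.
have := measurable_fubini_G superpose_G_prod.
by move=> H; apply/mEFinP; apply: eq_measurable_fun H => x _; exact: superposeE.
Qed.

Lemma superpose_int_le : (\int[mu2]_x `|superpose x|%:E <= (Rint setT a)%:E)%E.
Proof.
have H := superpose_G_prod; have mH := measurable_int _ H.
have mA : measT (fun zx : mR * (mR * mR) => `|(F zx.1 zx.2 * 1)%:E|%E).
  exact: measurableT_comp.
apply: (@le_trans _ _ (\int[mu2]_x \int[mu]_z `|(F z x * 1)%:E|)%E).
  apply: ge0_le_integral => //.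
  - by apply/mEFinP; apply: measurableT_comp => //; exact: superpose_measurable.
  - by apply: (@measurable_fun_fubini_tonelli_G _ _ _ _ _ mu
      (fun zx : mR * (mR * mR) => `|(F zx.1 zx.2 * 1)%:E|%E)).
  move=> x _; rewrite -[`|superpose x|%:E]/(`|(superpose x)%:E|%E) -superposeE.
  apply: le_abse_integral => //.
  by apply/mEFinP; have /measurable_int/mEFinP := superpose_slice x;
    under [X in _ -> measurable_fun _ X]eq_fun do rewrite mulr1.
have T := @fubini_tonelli _ _ _ _ _ mu (leb2S R)
  (fun zx : mR * (mR * mR) => `|(F zx.1 zx.2 * 1)%:E|%E) mA (fun=> abse_ge0 _).
rewrite /= in T; rewrite -[leLHS]T.
have -> : ((Rint setT a)%:E = \int[mu]_z (a z)%:E)%E.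
  by rewrite /Rintegral fineK//; exact: integrable_fin_num ia.
apply: ge0_le_integral => //.
- by move=> z _; apply: integral_ge0.
- by apply: (@measurable_fun_fubini_tonelli_F _ _ _ _ _ (leb2S R)
      (fun zx : mR * (mR * mR) => `|(F zx.1 zx.2 * 1)%:E|%E)).
- exact: measurable_int ia.
- move=> z _; apply: le_trans (F_int z).
  by apply: le_of_eq; apply: eq_integral => x _; rewrite mulr1.
Qed.

Lemma superpose_L1 : L1 superpose.
Proof.
apply/integrableP; split; first by apply/mEFinP; exact: superpose_measurable.
by apply: le_lt_trans superpose_int_le _; rewrite ltry.
Qed.

Lemma superpose_L2 : L2p superpose.
Proof.
apply: int_L2r => //; first exact: superpose_measurable.
have := integrableZl mT (Rint setT a) (integrable_norm superpose_L1).
apply: (int_le mT) => [|x _].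
  by apply: measurable_funX; exact: superpose_measurable.
by rewrite normrX /= expr2 ler_wpM2r// superpose_le.
Qed.

Lemma superpose_fubini (psi : R * R -> R) C : measT (psi : mR * mR -> mR) ->
  (forall x, `|psi x| <= C) ->
  ip2 superpose psi = Rint setT (fun z => ip2 (F z) psi).
Proof.
move=> mpsi HC; have H := superpose_prod mpsi HC.
have E x : (\int[mu]_z (F z x * psi x)%:E = (superpose x * psi x)%:E)%E.
  under eq_integral do rewrite mulrC EFinM.
  rewrite integralZl//; last exact: superpose_slice.
  rewrite mulrC EFinM; congr (_ * _)%E.
  by rewrite /superpose /Rintegral fineK//; exact: integrable_fin_num (superpose_slice x).
have F0 := Fubini H; rewrite /= in F0.
rewrite {1}/ip {1}/Rintegral; under eq_integral do rewrite -E.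
rewrite -[X in fine X]F0; rewrite /ip /Rintegral; congr fine.
apply: eq_integral => z _; rewrite fineK//.
apply: integrable_fin_num => //.
apply: (int_le mT _ _ (integrableZl mT C (integrable_norm (slice_L1 z)))).
  by apply: measurable_funM => //; exact: measurable_slice.
by move=> x _; rewrite /= normrM mulrC ler_wpM2r.
Qed.

Lemma superpose_ip_int (psi : R * R -> R) C : measT (psi : mR * mR -> mR) ->
  (forall x, `|psi x| <= C) ->
  intg setT (fun z => ip2 (F z) psi).
Proof.
move=> mpsi HC; have H := superpose_prod mpsi HC.
have := integrable_fubini_F H; apply: eq_integrable => // z _.
rewrite /fubini_F/= /ip /Rintegral fineK//.
apply: integrable_fin_num => //.
apply: (int_le mT _ _ (integrableZl mT C (integrable_norm (slice_L1 z)))).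
  by apply: measurable_funM => //; exact: measurable_slice.
by move=> x _; rewrite /= normrM mulrC ler_wpM2r.
Qed.

End superposition.

Lemma derive_expRE (R : realType) (x : R) : 'D_1 (@expR R) x = expR x.
Proof. exact: (congr1 (fun f => f x) (derive_expR R)). Qed.

Section expR_smooth.
Context (R : realType) (V : normedModType R).

Lemma smooth_expR_comp (q : V -> R) : smooth q -> smooth (fun x => expR (q x)).
Proof.
move=> sq.
have de x : differentiable (@expR R) x by apply/derivable1_diffP; exact: derivable_expR.
have dq x : differentiable (fun x => expR (q x)) x.
  by apply: (@differentiable_comp _ _ _ _ q (@expR R)) => //; exact: smooth_differentiable.
apply: (@smooth_family _ _ _ (fun f => exists2 h : V -> R, smooth h & f = fun x => h x * expR (q x))).
- by move=> _ [h sh ->] x; apply: differentiableM => //; exact: smooth_differentiable.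
- move=> f v [h sh ->]; exists (fun x => 'D_v h x + h x * 'D_v q x).
    by apply: smoothD; [exact: smooth_D|apply: smoothM => //; exact: smooth_D].
  apply/funext => x.
  rewrite (_ : (fun y => h y * expR (q y)) = h * (@expR R \o q))// deriveM; last 2 first.
  - exact: smooth_derivable.
  - by apply: diff_derivable; exact: dq.
  rewrite derive_comp1//; last exact: smooth_differentiable.
  rewrite derive_expRE -[h x *: _]/(h x * _) -[_ *: 'D_v h x]/(expR (q x) * _); ring.
- by exists (cst 1); [exact: smooth_cst|apply/funext => x; rewrite mul1r].
Qed.

Lemma D_expR_comp (q : V -> R) v x : differentiable q x ->
  'D_v (fun x => expR (q x)) x = expR (q x) * 'D_v q x.
Proof.
move=> dq; rewrite -[fun x => _]/(@expR R \o q) derive_comp1//; last first.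
  by apply/derivable1_diffP; exact: derivable_expR.
by rewrite derive_expRE.
Qed.

End expR_smooth.

(** * Heat kernel and Green function *)

Section heat_kernel.
Context (R : realType).
Notation pi := (@pi R).
Implicit Types (s t : R) (y a b : R * R).

Definition sqn y : R := y.1 ^+ 2 + y.2 ^+ 2.

Definition heat t y : R := (4 * pi * t)^-1 * expR (- sqn y / (4 * t)).

Definition heat1 t (x : R) : R := (Num.sqrt (4 * pi * t))^-1 * expR (- x ^+ 2 / (4 * t)).

Lemma sqn_ge0 y : 0 <= sqn y. Proof. by rewrite addr_ge0 ?sqr_ge0. Qed.

Lemma sqnN y : sqn (- y) = sqn y.
Proof. by rewrite /sqn /= !sqrrN. Qed.

Lemma heatN t y : heat t (- y) = heat t y.
Proof. by rewrite /heat sqnN. Qed.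

Lemma pi4_gt0 t : 0 < t -> 0 < 4 * pi * t.
Proof. by move=> t0; rewrite !mulr_gt0// pi_gt0. Qed.

Lemma heat_ge0 t y : 0 < t -> 0 <= heat t y.
Proof. by move=> t0; rewrite mulr_ge0 ?expR_ge0// invr_ge0 ltW// pi4_gt0. Qed.

Lemma heat_le t y : 0 < t -> heat t y <= (4 * pi * t)^-1.
Proof.
move=> t0; rewrite ler_piMr ?invr_ge0 ?(ltW (pi4_gt0 t0))// -expR0 ler_expR.
by rewrite mulNr oppr_le0 divr_ge0 ?sqn_ge0// mulr_ge0// ltW.
Qed.

Lemma heatE t y : 0 < t -> heat t y = heat1 t y.1 * heat1 t y.2.
Proof.
move=> t0; rewrite /heat /heat1 mulrACA -expRD -invfM -expr2 sqr_sqrtr; last first.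
  by rewrite ltW// pi4_gt0.
by congr (_ * expR _); rewrite /sqn opprD mulrDl.
Qed.

Lemma heat1_ge0 t x : 0 <= heat1 t x.
Proof. by rewrite mulr_ge0 ?expR_ge0// invr_ge0. Qed.

(** The variance is 2t; measurability and total mass are inherited from the normal density. *)
Lemma heat1_normal t x (c : R) : 0 < t -> heat1 t (x - c) = normal_pdf c (Num.sqrt (2 * t)) x.
Proof.
move=> t0; have t2 : 0 < 2 * t by rewrite mulr_gt0.
rewrite normal_pdfE; last by rewrite gt_eqF// sqrtr_gt0.
rewrite /normal_peak /normal_fun /heat1 (sqr_sqrtr (ltW t2)).
have E1 : 2 * t * pi *+ 2 = 4 * pi * t by rewrite -mulr_natr; ring.
have E2 : 2 * t *+ 2 = 4 * t by rewrite -mulr_natr; ring.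
by rewrite E1 E2.
Qed.

Lemma heat1_measurable t (c : R) : 0 < t -> measT (fun x : mR => heat1 t (x - c)).
Proof.
move=> t0; have := measurable_normal_pdf c (Num.sqrt (2 * t)).
by apply: eq_measurable_fun => x _; rewrite heat1_normal.
Qed.

Lemma heat1_int t (c : R) : 0 < t -> (\int[mu]_x (heat1 t (x - c))%:E = 1)%E.
Proof.
move=> t0; rewrite -[RHS](integral_normal_pdf c (Num.sqrt (2 * t))).
by apply: eq_integral => x _; rewrite heat1_normal.
Qed.

Lemma tensor_integral (f g : R -> R) : measT (f : mR -> mR) ->
  measT (g : mR -> mR) -> (forall x, 0 <= f x) -> (forall x, 0 <= g x) ->
  (\int[mu2]_x (f x.1 * g x.2)%:E = (\int[mu]_x (f x)%:E) * \int[mu]_x (g x)%:E)%E.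
Proof.
move=> mf mg f0 g0.
have mfg : measT (fun x : mR * mR => (f x.1 * g x.2)%:E).
  by apply/mEFinP; apply: measurable_funM; apply: measurableT_comp.
rewrite fubini_tonelli1//; last by move=> x; rewrite lee_fin mulr_ge0.
transitivity (\int[mu]_x ((f x)%:E * \int[mu]_y (g y)%:E))%E.
  apply: eq_integral => x _; rewrite /fubini_F/=.
  under eq_integral do rewrite EFinM.
  by rewrite ge0_integralZl//; [exact/mEFinP|move=> y _; rewrite lee_fin|rewrite lee_fin].
rewrite ge0_integralZr//; last by apply: integral_ge0 => y _; rewrite lee_fin.
  exact/mEFinP.
by move=> y _; rewrite lee_fin.
Qed.

Lemma heat_int t a : 0 < t -> (\int[mu2]_x (heat t (x - a))%:E = 1)%E.
Proof.
move=> t0; under eq_integral do rewrite heatE//=.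
rewrite (@tensor_integral (fun x => heat1 t (x - a.1)) (fun x => heat1 t (x - a.2))).
- by rewrite !heat1_int// mule1.
- exact: heat1_measurable.
- exact: heat1_measurable.
- by move=> x; exact: heat1_ge0.
- by move=> x; exact: heat1_ge0.
Qed.

(** Completing the square: the second factor is a Gaussian in x centred at the weighted mean of the
    two centres, so integrating over x leaves the semigroup law. *)
Lemma heat1_mul s t (x a b : R) : 0 < s -> 0 < t ->
  heat1 s (x - a) * heat1 t (x - b) =
  heat1 (s + t) (a - b) * heat1 (s * t / (s + t)) (x - (t * a + s * b) / (s + t)).
Proof.
move=> s0 t0; have st0 : 0 < s + t by rewrite addr_gt0.
have [sn [tn stn]] : s != 0 /\ (t != 0 /\ s + t != 0) by rewrite !gt_eqF.
rewrite /heat1 mulrACA [RHS]mulrACA -!expRD -!invfM -!sqrtrM ?ltW ?pi4_gt0//.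
congr ((Num.sqrt _)^-1 * expR _).
  by field.
by field; rewrite sn tn stn.
Qed.

Lemma heat1_conv s t (a b : R) : 0 < s -> 0 < t ->
  (\int[mu]_x (heat1 s (x - a) * heat1 t (x - b))%:E = (heat1 (s + t) (a - b))%:E)%E.
Proof.
move=> s0 t0; have st0 : 0 < s * t / (s + t) by rewrite divr_gt0 ?mulr_gt0 ?addr_gt0.
under eq_integral do rewrite heat1_mul// EFinM.
rewrite ge0_integralZl//.
- by rewrite heat1_int// mule1.
- by apply/mEFinP; exact: heat1_measurable.
- by move=> x _; rewrite lee_fin heat1_ge0.
- by rewrite lee_fin heat1_ge0.
Qed.

Lemma heat_conv s t a b : 0 < s -> 0 < t ->
  (\int[mu2]_x (heat s (x - a) * heat t (x - b))%:E = (heat (s + t) (a - b))%:E)%E.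
Proof.
move=> s0 t0; have st0 : 0 < s + t by rewrite addr_gt0.
under eq_integral do rewrite !heatE//= mulrACA.
rewrite (@tensor_integral (fun x => heat1 s (x - a.1) * heat1 t (x - b.1))
  (fun x => heat1 s (x - a.2) * heat1 t (x - b.2))).
- by rewrite !heat1_conv// heatE.
- by apply: measurable_funM; exact: heat1_measurable.
- by apply: measurable_funM; exact: heat1_measurable.
- by move=> x; rewrite mulr_ge0 ?heat1_ge0.
- by move=> x; rewrite mulr_ge0 ?heat1_ge0.
Qed.

(** Doubling the time gives up half of the Gaussian exponent; the freed factor exp(-u) absorbs the
    powers of |y| that derivatives produce. This is why all dominations below involve the times t
    and 2t. *)
Lemma heat_half t y (u : R) : 0 < t -> u = sqn y / (8 * t) ->
  heat t y = 2 * heat (2 * t) y * expR (- u).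
Proof.
move=> t0 ->; have tn : t != 0 by rewrite gt_eqF.
have pin : pi != 0 by rewrite gt_eqF// pi_gt0.
have E : expR (- sqn y / (4 * t)) = expR (- sqn y / (4 * (2 * t))) * expR (- (sqn y / (8 * t))).
  by rewrite -expRD; congr expR; field.
rewrite /heat E; move: pin; move: (trigo.pi) => p pn.
by field; rewrite tn pn.
Qed.

Lemma sqn_heat_le t y : 0 < t -> sqn y * heat t y <= 16 * t * heat (2 * t) y.
Proof.
move=> t0; have tn : t != 0 by rewrite gt_eqF.
pose u := sqn y / (8 * t).
rewrite (heat_half t0 (erefl u)).
have -> : sqn y = 8 * t * u by rewrite /u; field.
have u0 : 0 <= u by rewrite divr_ge0 ?sqn_ge0// mulr_ge0// ltW.
have h0 : 0 <= heat (2 * t) y by rewrite heat_ge0// mulr_gt0.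
have ue : u * expR (- u) <= 1.
  rewrite expRN ler_pdivrMr ?expR_gt0// mul1r (le_trans _ (expR_ge1Dx u))//.
  by rewrite lerDr.
have -> : 8 * t * u * (2 * heat (2 * t) y * expR (- u)) =
  16 * t * heat (2 * t) y * (u * expR (- u)) by ring.
by rewrite ler_piMr// mulr_ge0// mulr_ge0// ltW.
Qed.

Lemma norm_heat_le t y (z : R) : 0 < t -> z ^+ 2 <= sqn y ->
  `|z| * heat t y <= 4 * Num.sqrt t * heat (2 * t) y.
Proof.
move=> t0 zy; have tn : t != 0 by rewrite gt_eqF.
pose u := sqn y / (8 * t).
have u0 : 0 <= u by rewrite divr_ge0 ?sqn_ge0// mulr_ge0// ltW.
have h0 : 0 <= heat (2 * t) y by rewrite heat_ge0// mulr_gt0.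
rewrite (heat_half t0 (erefl u)).
have K : `|z| * expR (- u) <= 2 * Num.sqrt t.
  rewrite -(@ler_pXn2r _ 2)// ?nnegrE ?mulr_ge0 ?expR_ge0 ?sqrtr_ge0//.
  rewrite !exprMn (sqr_sqrtr (ltW t0)) real_normK ?num_real//.
  apply: (@le_trans _ _ (8 * t * u * expR (- u) ^+ 2)).
    rewrite ler_wpM2r ?sqr_ge0// (le_trans zy)// /u le_eqVlt; apply/orP; left.
    by apply/eqP; field.
  have ue : 2 * u * expR (- u) ^+ 2 <= 1.
    rewrite -expRM_natl mulrN expRN ler_pdivrMr ?expR_gt0// mul1r.
    by rewrite (le_trans _ (expR_ge1Dx _))// mulr_natl lerDr.
  have -> : 8 * t * u * expR (- u) ^+ 2 = 2 ^+ 2 * t * (2 * u * expR (- u) ^+ 2) by ring.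
  by rewrite ler_piMr// mulr_ge0 ?exprn_ge0// ltW.
have -> : `|z| * (2 * heat (2 * t) y * expR (- u)) = 2 * heat (2 * t) y * (`|z| * expR (- u)) by ring.
have -> : 4 * Num.sqrt t * heat (2 * t) y = 2 * heat (2 * t) y * (2 * Num.sqrt t) by ring.
by rewrite ler_wpM2l// mulr_ge0.
Qed.

Definition heat_exponent t a (x : R * R) : R := - sqn (x - a) / (4 * t).

Lemma heat_exponent_diff t a x : 0 < t ->
  differentiable (heat_exponent t a) x /\ forall v, 'D_v (heat_exponent t a) x =
    lin2 (- (x.1 - a.1) / (2 * t)) (- (x.2 - a.2) / (2 * t)) v.
Proof.
move=> t0; have tn : t != 0 by rewrite gt_eqF.
apply: (@diff_quad _ _ _ _ _ ((2 * t)^-1)) => h.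
have -> : heat_exponent t a (h + x) - heat_exponent t a x -
  lin2 (- (x.1 - a.1) / (2 * t)) (- (x.2 - a.2) / (2 * t)) h = - (sqn h / (4 * t)).
  by rewrite /heat_exponent /lin2 /sqn /=; field.
rewrite normrN ger0_norm; last by rewrite divr_ge0 ?sqn_ge0// mulr_ge0// ltW.
rewrite ler_pdivrMr ?mulr_gt0//.
have -> : (2 * t)^-1 * `|h| ^+ 2 * (4 * t) = `|h| ^+ 2 + `|h| ^+ 2 by field.
by apply: lerD; rewrite -(real_normK (num_real _)) ler_pXn2r ?nnegrE//; [exact: norm1_le|exact: norm2_le].
Qed.

Lemma smooth_heat_exponent t a : 0 < t -> smooth (heat_exponent t a).
Proof.
move=> t0; rewrite (_ : heat_exponent t a = (fun x => - (4 * t)^-1 *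
  ((fun x : R * R => (fun s : R => - a.1 + s) x.1) \* (fun x : R * R => (fun s : R => - a.1 + s) x.1) \+
   (fun x : R * R => (fun s : R => - a.2 + s) x.2) \* (fun x : R * R => (fun s : R => - a.2 + s) x.2)) x)); last first.
  apply/funext => x; rewrite /heat_exponent /sqn /=.
  by rewrite !(addrC (- _)) -!expr2 mulNr mulNr mulrC.
have sa (c : R) : smooth (fun s : R => - c + s).
  by apply: (@smooth_affine _ _ _ (- c) (@idfun R)) => x; exact: cvg_id.
by apply: smoothZ; apply: smoothD; apply: smoothM; (apply: smooth_fst || apply: smooth_snd).
Qed.

Lemma heat_shiftE t a : (fun x => heat t (x - a)) =
  (fun x => (4 * pi * t)^-1 * expR (heat_exponent t a x)).
Proof. by []. Qed.

Lemma smooth_heat t a : 0 < t -> smooth (fun x => heat t (x - a)).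
Proof.
move=> t0; rewrite heat_shiftE; apply: smoothZ; apply: smooth_expR_comp.
exact: smooth_heat_exponent.
Qed.

Lemma D_heat t a v x : 0 < t -> 'D_v (fun x => heat t (x - a)) x =
  lin2 (- (x.1 - a.1) / (2 * t)) (- (x.2 - a.2) / (2 * t)) v * heat t (x - a).
Proof.
move=> t0; have [dq Dq] := heat_exponent_diff a x t0.
rewrite heat_shiftE (_ : (fun x => _) = (4 * pi * t)^-1 *: (fun x => expR (heat_exponent t a x)))//.
rewrite deriveZ; last by apply/smooth_derivable/smooth_expR_comp/smooth_heat_exponent.
by rewrite (D_expR_comp v dq) Dq /GRing.scale/= /heat -/(heat_exponent t a x); ring.
Qed.

End heat_kernel.

(** * Integrals over the positive half-line *)

Section half_line.
Context (R : realType).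
Notation mR := (measurableTypeR R).
Implicit Types (f g : R -> R).

(** Inversion is discontinuous at 0, where its value is 0 by convention, so it is expressed
    piecewise by exp and ln. *)
Lemma measurable_inv : measT (fun x : mR => x^-1 : mR).
Proof.
have E x : x^-1 = if 0 < x then expR (- ln x) else if x < 0 then - expR (- ln (- x)) else 0 :> R.
  case: ltrgtP => [x0|x0|<-]; last by rewrite invr0.
  - by rewrite expRN lnK.
  - by rewrite expRN lnK ?invrN ?opprK// posrE oppr_gt0.
rewrite (_ : (fun x => _) = (fun x : R => if 0 < x then expR (- ln x) else if x < 0 then - expR (- ln (- x)) else 0)); last first.
  by apply/funext => x; exact: E.
have mexp f : measT (f : mR -> mR) -> measT (fun x : mR => expR (f x)).
  by move=> mf; apply: (measurableT_comp (@measurable_expR R) mf).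
have mln f : measT (f : mR -> mR) -> measT (fun x : mR => ln (f x)).
  by move=> mf; apply: (measurableT_comp (@measurable_ln R) mf).
have mopp f : measT (f : mR -> mR) -> measT (fun x : mR => - f x).
  by move=> mf; apply: measurableT_comp.
apply: measurable_fun_ifT; first exact: measurable_fun_ltr.
  by apply: (mexp); apply: (mopp); exact: mln.
apply: measurable_fun_ifT; first exact: measurable_fun_ltr.
  by apply: (mopp); apply: (mexp); apply: (mopp); apply: (mln); exact: (mopp).
exact: measurable_cst.
Qed.

(** Extension by zero: the superposition and Fubini lemmas are stated for a parameter ranging over
    the whole line. *)
Definition hl f (x : R) : R := if 0 < x then f x else 0.

Lemma hlE f : hl f = f \_ `]0, +oo[.
Proof.
apply/funext => x; rewrite /hl patchE.
have [x0|x0] := boolP (0 < x); first by rewrite mem_set//= in_itv/= x0.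
by rewrite memNset//= in_itv/= andbT; apply/negP.
Qed.

Lemma hl_integrable f : mu.-integrable `]0, +oo[ (EFin \o f) <->
  mu.-integrable setT (EFin \o hl f).
Proof.
by rewrite hlE -restrict_EFin; exact: integrable_mkcond.
Qed.

Lemma Rintegral_hl f : Rint setT (hl f) = Rintegral mu `]0, +oo[ f.
Proof. by rewrite [RHS]Rintegral_mkcond hlE. Qed.

Lemma is_deriveCl (f : R -> R) (c x df : R) : is_derive x (1 : R) f df ->
  is_derive x (1 : R) (fun t => c * f t) (c * df).
Proof. exact: is_deriveZ. Qed.

Lemma is_derive_expRZ (c x : R) : is_derive x (1 : R) (fun t => expR (c * t)) (c * expR (c * x)).
Proof.
have d1 : is_derive x (1 : R) (fun t : R => c * t) c.
  by have := is_deriveCl c (is_derive_id x (1 : R)); rewrite mulr1.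
by have := is_derive1_comp (is_derive_expR (c * x)) d1; rewrite mulrC.
Qed.

Lemma cvg_expRZ (E : R) : 0 < E -> expR (- E * x) @[x --> +oo%R] --> (0 : R).
Proof.
move=> E0; rewrite (_ : (fun x => expR (- E * x)) = (fun z => expR (- z)) \o (fun z => E * z)); last first.
  by apply: eq_fun => x; rewrite mulNr.
apply: (@cvg_comp _ _ _ _ _ _ (pinfty_nbhs R)); last exact: cvgr_expR.
exact: gt0_cvgMry.
Qed.

Lemma derivable_within (f : R -> R) : (forall x : R, 0 <= x -> derivable f x 1) ->
  {within `[0, +oo[, continuous f}.
Proof.
move=> df; apply: derivable_within_continuous => x; rewrite in_itv/= andbT; exact: df.
Qed.

Lemma hl_FTC_ge0 (f F : R -> R) (l : R) : (forall x, 0 <= x -> 0 <= f x) ->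
  {within `[0, +oo[, continuous f} -> (forall x : R, 0 <= x -> is_derive x (1 : R) F (f x)) ->
  F x @[x --> +oo%R] --> l ->
  mu.-integrable setT (EFin \o hl f) /\ Rint setT (hl f) = l - F 0.
Proof.
move=> f0 cf dF Fl.
have I : (\int[mu]_(x in `[0%R, +oo[) (f x)%:E = l%:E - (F 0)%:E)%E.
  apply: ge0_continuous_FTC2y => //.
  - by move=> x x0; have [] := dF x (ltW x0).
  - apply: cvg_at_right_filter; have [d _] := dF 0 (lexx _).
    by apply: differentiable_continuous; apply/derivable1_diffP.
  - by move=> x; rewrite in_itv/= andbT => x0; rewrite derive1E; have [_ ->] := dF x (ltW x0).
have mf : measurable_fun (`[0, +oo[ : set mR) (EFin \o f).
  by apply/mEFinP; apply: subspace_continuous_measurable_fun => //; exact: measurable_itv.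
have mf' : measurable_fun (`]0, +oo[ : set mR) (EFin \o f).
  by apply: (measurable_funS _ _ mf) => // x; rewrite /= !in_itv/= !andbT; exact: ltW.
have I' : (\int[mu]_(x in `]0%R, +oo[) (f x)%:E = l%:E - (F 0)%:E)%E.
  by rewrite integral_itv_obnd_cbnd.
split.
  apply/hl_integrable/integrableP; split => //.
  under eq_integral.
    move=> x; rewrite inE/= in_itv/= andbT => x0.
    rewrite ger0_norm; last by rewrite f0// ltW.
    over.
  by rewrite I' -EFinB ltry.
by rewrite Rintegral_hl /Rintegral I'.
Qed.

Lemma hl_expR_int (E C : R) : 0 < E ->
  mu.-integrable setT (EFin \o hl (fun t => C * expR (- E * t))).
Proof.
move=> E0.
have H : mu.-integrable setT (EFin \o hl (fun t => expR (- E * t))).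
  have [] // := @hl_FTC_ge0 (fun t => expR (- E * t)) (fun t => (- E)^-1 * expR (- E * t)) ((- E)^-1 * 0).
  - by apply: derivable_within => x _; have [] := is_derive_expRZ (- E) x.
  - move=> x _; have := is_derive_expRZ (- E) x => d.
    have := is_deriveCl (- E)^-1 d.
    by rewrite mulrA mulVf ?mul1r// oppr_eq0 gt_eqF.
  - by apply: cvgMl_tmp; exact: cvg_expRZ.
have := integrableZl mT C H; apply: eq_integrable => // x _ /=.
by rewrite -EFinM /hl; case: ifP; rewrite ?mulr0.
Qed.

(** Adding K exp(-E x), whose integral is known, makes the integrand nonnegative and reduces to the
    previous case. *)
Lemma hl_FTC (f F : R -> R) (E K : R) : 0 < E -> (forall x, 0 <= x -> - (K * expR (- E * x)) <= f x) ->
  {within `[0, +oo[, continuous f} -> (forall x : R, 0 <= x -> is_derive x (1 : R) F (f x)) ->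
  F x @[x --> +oo%R] --> (0 : R) ->
  mu.-integrable setT (EFin \o hl f) /\ Rint setT (hl f) = - F 0.
Proof.
move=> E0 fK cf dF Fl.
pose k (t : R) := K * expR (- E * t).
have dk (x : R) : derivable k x 1.
  by apply: derivableM => //; have [] := is_derive_expRZ (- E) x.
pose Kp (t : R) := K * (- E)^-1 * expR (- E * t).
have dKp (x : R) : is_derive x (1 : R) Kp (k x).
  have := is_deriveCl (K * (- E)^-1) (is_derive_expRZ (- E) x).
  by rewrite mulrA -(mulrA K) mulVf ?mulr1// oppr_eq0 gt_eqF.
have Kl : Kp x @[x --> +oo%R] --> (0 : R).
  by rewrite -[X in _ --> X](mulr0 (K * (- E)^-1)); apply: cvgMl_tmp; exact: cvg_expRZ.
have iK : mu.-integrable setT (EFin \o hl k) by exact: hl_expR_int.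
have [iKn IKn] : mu.-integrable setT (EFin \o hl (f \+ k)) /\
    Rint setT (hl (f \+ k)) = (0 + 0) - (F \+ Kp) 0.
  apply: hl_FTC_ge0.
  - by move=> x x0; rewrite /= -lerBlDr sub0r; exact: fK.
  - move=> x; apply: continuousD; first exact: cf.
    by apply: derivable_within => // y _; exact: dk.
  - by move=> x x0; apply: is_deriveD; exact: dF.
  - exact: cvgD.
have lin := integrable_lin mT 1 (-1) iKn iK.
have hE : (fun x => 1 * hl (f \+ k) x + -1 * hl k x) = hl f.
  apply/funext => x; rewrite /hl; case: ifP => _; last by rewrite !mulr0 addr0.
  by rewrite mul1r mulN1r /= addrK.
split; first by rewrite -hE.
rewrite -hE -(Rintegral_lin mT 1 (-1) iKn iK) IKn mul1r addr0.
have [iKk ->] : mu.-integrable setT (EFin \o hl (fun x => k x)) /\ Rint setT (hl k) = - Kp 0.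
  split => //.
  have H (c : R) : 0 <= c -> Rint setT (hl (fun x => c * expR (- E * x))) = c / E.
    move=> c0; have [] // := @hl_FTC_ge0 (fun t => c * expR (- E * t)) (fun t => c * (- E)^-1 * expR (- E * t)) 0.
    - by move=> x _; rewrite mulr_ge0 ?expR_ge0.
    - by apply: derivable_within => x _; apply: derivableM => //; have [] := is_derive_expRZ (- E) x.
    - move=> x _; have := is_deriveCl (c * (- E)^-1) (is_derive_expRZ (- E) x).
      by rewrite mulrA -(mulrA c) mulVf ?mulr1// oppr_eq0 gt_eqF.
    - by rewrite -[X in _ --> X](mulr0 (c * (- E)^-1)); apply: cvgMl_tmp; exact: cvg_expRZ.
    - by move=> _ ->; rewrite sub0r mulr0 expR0 mulr1 invrN mulrN opprK.
  have i1 : mu.-integrable setT (EFin \o hl (fun x => 1 * expR (- E * x))) by exact: hl_expR_int.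
  have -> : hl k = (fun x => K * hl (fun x => 1 * expR (- E * x)) x).
    by apply/funext => x; rewrite /hl/=; case: ifP; rewrite ?mulr0// mul1r.
  by rewrite (RintegralZl K mT i1) H// /Kp mulr0 expR0 mulr1 invrN mulrN opprK mul1r.
by rewrite /= sub0r; ring.
Qed.

End half_line.

(** * Laplace transforms in time of kernels dominated by the heat kernel *)

Section green.
Context (R : realType).
Notation mR := (measurableTypeR R).
Notation pi := (@trigo.pi R).
Implicit Types (E eta tau t : R) (y a : R * R).

Lemma measurable_sqn d (T : measurableType d) (g : T -> mR * mR) :
  measT g -> measT (fun z => sqn (g z) : mR).
Proof.
move=> mg; apply: measurable_funD; apply: measurable_funX.
  exact: (measurableT_comp (@measurable_fst _ _ mR mR) mg).
exact: (measurableT_comp (@measurable_snd _ _ mR mR) mg).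
Qed.

Lemma measurable_expR_comp d (T : measurableType d) (f : T -> R) :
  measT (f : T -> mR) -> measT (fun z => expR (f z) : mR).
Proof. by move=> mf; exact: (measurableT_comp (@measurable_expR R) mf). Qed.

Lemma measurable_inv_comp d (T : measurableType d) (f : T -> R) :
  measT (f : T -> mR) -> measT (fun z => (f z)^-1 : mR).
Proof. by move=> mf; exact: (measurableT_comp (@measurable_inv R) mf). Qed.

Lemma measurable_heat d (T : measurableType d) (f : T -> R) (g : T -> R * R) :
  measT (f : T -> mR) -> measT (g : T -> mR * mR) ->
  measT (fun z => heat (f z) (g z) : mR).
Proof.
move=> mf mg; apply: measurable_funM.
  by apply: measurable_inv_comp; apply: measurable_funM.
apply: measurable_expR_comp; apply: measurable_funM.
  by apply: measurableT_comp => //; exact: measurable_sqn.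
by apply: measurable_inv_comp; apply: measurable_funM.
Qed.

Lemma measurable_sub2 d (T : measurableType d) (f g : T -> R * R) :
  measT (f : T -> mR * mR) -> measT (g : T -> mR * mR) ->
  measT (fun z => f z - g z : mR * mR).
Proof.
move=> mf mg; apply/measurable_fun_pairP; split; apply: (@measurable_funB _ _ _ _ (_ \o f) (_ \o g)).
- exact: (measurableT_comp (@measurable_fst _ _ mR mR) mf).
- exact: (measurableT_comp (@measurable_fst _ _ mR mR) mg).
- exact: (measurableT_comp (@measurable_snd _ _ mR mR) mf).
- exact: (measurableT_comp (@measurable_snd _ _ mR mR) mg).
Qed.

Section domination.
Variables (E eta A : R) (k : R -> R * R -> R).
Hypotheses (E_gt0 : 0 < E) (eta_gt0 : 0 < eta) (A_ge0 : 0 <= A).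
Hypothesis mk : measT (fun z : mR * (mR * mR) => k z.1 z.2 : mR).
Hypothesis k_le : forall t y, eta <= t -> `|k t y| <= A * (heat t y + heat (2 * t) y).

(** One construction for three kernels: the heat kernel, its partial derivatives and its residual
    under -Laplacian + E. Times t >= eta are written eta + tau, so the singularity at time 0 is
    avoided. *)
Definition lap_slice a tau (x : R * R) : R :=
  hl (fun tau => expR (- E * (eta + tau)) * k (eta + tau) (x - a)) tau.

(** It dominates a slice in both norms: 2 is the total mass of the two heat kernels, and each of
    them is at most (4 pi eta)^-1 pointwise. *)
Definition lap_dom (tau : R) : R := hl (fun t => (A * (2 + 2 * (4 * pi * eta)^-1)) * expR (- E * t)) tau.

Lemma lap_dom_int : intg setT lap_dom.
Proof. exact: hl_expR_int. Qed.

Lemma measurable_lap a : measT (fun z : mR * (mR * mR) => lap_slice a z.1 z.2).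
Proof.
apply: measurable_fun_ifT.
- by apply: measurable_fun_ltr => //; exact: measurable_fst.
- have ms : measT (fun z : mR * (mR * mR) => eta + z.1).
    by apply: measurable_funD => //; exact: measurable_fst.
  apply: measurable_funM.
    by apply: measurable_expR_comp; apply: measurable_funM.
  have mp : measT (fun z : mR * (mR * mR) => (eta + z.1, z.2 - a) : mR * (mR * mR)).
    by apply/measurable_fun_pairP; split => //; apply: measurable_sub2.
  exact: (measurableT_comp mk mp).
- exact: measurable_cst.
Qed.

Lemma expR_le_tau tau : 0 < tau -> expR (- E * (eta + tau)) <= expR (- E * tau).
Proof.
by move=> t0; rewrite ler_expR !mulNr lerN2 ler_wpM2l ?(ltW E_gt0)// lerDr ltW.
Qed.

Lemma kernel_bound t y : eta <= t -> `|k t y| <= A * (2 + 2 * (4 * pi * eta)^-1).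
Proof.
move=> et; have et0 : 0 < t by apply: lt_le_trans et.
have et2 : 0 < 2 * t by rewrite mulr_gt0.
apply: (le_trans (k_le _ et)); rewrite ler_wpM2l//.
have h1 : heat t y <= (4 * pi * eta)^-1.
  apply: (le_trans (heat_le _ et0)); rewrite lef_pV2 ?posrE ?pi4_gt0//.
  by rewrite ler_wpM2l// ltW// mulr_gt0 ?pi_gt0.
have h2 : heat (2 * t) y <= (4 * pi * eta)^-1.
  apply: (le_trans (heat_le _ et2)); rewrite lef_pV2 ?posrE ?pi4_gt0//.
  by rewrite ler_wpM2l ?(ltW (mulr_gt0 _ (pi_gt0 R)))//; lra.
by lra.
Qed.

Lemma lap_le a tau x : `|lap_slice a tau x| <= lap_dom tau.
Proof.
rewrite /lap_slice /lap_dom /hl; case: ifPn => t0; last by rewrite normr0.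
have et : eta <= eta + tau by rewrite lerDl ltW.
rewrite normrM ger0_norm ?expR_ge0// mulrC.
apply: ler_pM => //; last exact: expR_le_tau.
exact: kernel_bound.
Qed.

Lemma lap_int a tau : (\int[mu2]_x `|lap_slice a tau x|%:E <= (lap_dom tau)%:E)%E.
Proof.
rewrite /lap_slice /lap_dom /hl; case: ifPn => t0; last first.
  by rewrite integral0_eq// => x _; rewrite normr0.
have et : eta <= eta + tau by rewrite lerDl ltW.
have et0 : 0 < eta + tau by rewrite addr_gt0.
have et2 : 0 < 2 * (eta + tau) by rewrite mulr_gt0.
have mh s : measT (fun x : mR * mR => heat s (x - a)).
  by apply: measurable_heat => //; exact: measurable_sub2.
pose c := expR (- E * (eta + tau)) * A.
have c0 : 0 <= c by rewrite mulr_ge0 ?expR_ge0.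
apply: (@le_trans _ _ (\int[mu2]_x (c%:E * ((heat (eta + tau) (x - a))%:E + (heat (2 * (eta + tau)) (x - a))%:E)))%E).
  apply: ge0_le_integral => //.
  - apply/mEFinP; apply: measurableT_comp => //; apply: measurable_funM => //.
    have mp : measT (fun x : mR * mR => (eta + tau, x - a) : mR * (mR * mR)).
      have ms : measT (fun x : mR * mR => x - a : mR * mR) by exact: measurable_sub2.
      exact: (measurable_fun_pair (measurable_cst _) ms).
    exact: (measurableT_comp mk mp).
  - by apply: measurable_funeM; apply: emeasurable_funD; exact/mEFinP.
  move=> x _; rewrite -EFinD -EFinM lee_fin normrM ger0_norm ?expR_ge0// /c -mulrA.
  by rewrite ler_wpM2l ?expR_ge0// k_le.
rewrite ge0_integralZl//; last 2 first.
- by apply: emeasurable_funD; exact/mEFinP.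
- by move=> x _; rewrite -EFinD lee_fin addr_ge0// heat_ge0.
rewrite ge0_integralD//; last 4 first.
- by move=> x _; rewrite lee_fin heat_ge0.
- exact/mEFinP.
- by move=> x _; rewrite lee_fin heat_ge0.
- exact/mEFinP.
rewrite !heat_int// -EFinD -EFinM lee_fin /c.
have p0 : 0 <= (4 * pi * eta)^-1 by rewrite invr_ge0 ltW// pi4_gt0.
rewrite (_ : expR (- E * (eta + tau)) * A * (1 + 1) = A * 2 * expR (- E * (eta + tau))); last by ring.
apply: ler_pM; rewrite ?expR_ge0 ?mulr_ge0// ?expR_le_tau//.
by rewrite ler_wpM2l// lerDl mulr_ge0.
Qed.

Definition lap a : R * R -> R := superpose (lap_slice a).

Lemma lap_L1 a : L1 (lap a).
Proof. exact: superpose_L1 (measurable_lap a) lap_dom_int (lap_le a) (lap_int a). Qed.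
Lemma lap_int_le a : (\int[mu2]_x `|lap a x|%:E <= (Rint setT lap_dom)%:E)%E.
Proof. exact: superpose_int_le (measurable_lap a) lap_dom_int (lap_le a) (lap_int a). Qed.
Lemma lap_bounded a x : `|lap a x| <= Rint setT lap_dom.
Proof. exact: superpose_le (measurable_lap a) lap_dom_int (lap_le a) x. Qed.
Lemma lap_fubini a (psi : R * R -> R) C : measT (psi : mR * mR -> mR) ->
  (forall x, `|psi x| <= C) ->
  ip2 (lap a) psi = Rint setT (fun tau => ip2 (lap_slice a tau) psi).
Proof. exact: superpose_fubini (measurable_lap a) lap_dom_int (lap_le a) (lap_int a) _ _. Qed.

Lemma lap_ip_int a (psi : R * R -> R) C : measT (psi : mR * mR -> mR) ->
  (forall x, `|psi x| <= C) ->
  intg setT (fun tau => ip2 (lap_slice a tau) psi).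
Proof.
move=> mp HC.
exact: (superpose_ip_int (measurable_lap a) lap_dom_int (lap_int a) mp HC).
Qed.

End domination.
End green.

Section heat_time.
Context (R : realType).
Notation pi := (@trigo.pi R).
Implicit Types (E eta tau t : R) (y a : R * R).

Lemma heat_split t y : heat t y = (4 * pi)^-1 * (t^-1 * expR ((- sqn y / 4) * t^-1)).
Proof.
by rewrite /heat (_ : - sqn y / (4 * t) = - sqn y / 4 * t^-1) ?invfM ?mulrA.
Qed.

Lemma is_derive_heat t y : 0 < t ->
  is_derive t (1 : R) (fun t => heat t y) ((sqn y / (4 * t ^+ 2) - t^-1) * heat t y).
Proof.
move=> t0; have tn : t != 0 by rewrite gt_eqF.
pose c := - sqn y / 4.
have dV : is_derive t (1 : R) (fun t : R => t^-1) (- t ^- 2).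
  have := is_deriveV (f := id) tn (is_derive_id t (1 : R)).
  by move=> d; apply: is_derive_eq d _; rewrite /GRing.scale/= mulr1.
have dE := @is_derive1_comp _ (@expR R) (fun t => c * t^-1) t _ _
  (is_derive_expR (c * t^-1)) (is_deriveCl c dV).
have dM := is_deriveCl (4 * pi)^-1 (is_deriveM dV dE).
rewrite (_ : (fun t => heat t y) = (fun t => (4 * pi)^-1 * (t^-1 * expR (c * t^-1)))); last first.
  by apply/funext => s; exact: heat_split.
apply: is_derive_eq dM _; rewrite heat_split -/c /GRing.scale/=.
rewrite (_ : sqn y = - 4 * c); last by rewrite /c; field.
move: (expR _) => e; move: ((4 * pi)^-1) => p; field; exact: tn.
Qed.

Definition lap_F E eta y tau : R := - (expR (- E * (eta + tau)) * heat (eta + tau) y).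

(** This is E times the heat kernel minus its time derivative, hence also -Laplacian + E applied to
    it. The first reading makes exp(-E t) times it the derivative of -exp(-E t) heat t y, which is
    [lap_F]; the second is [slice_lap]. *)
Definition heat_res E t y : R := (E + t^-1 - sqn y / (4 * t ^+ 2)) * heat t y.

Lemma is_derive_lap_F E eta y tau : 0 < eta -> 0 <= tau ->
  is_derive tau (1 : R) (lap_F E eta y) (expR (- E * (eta + tau)) * heat_res E (eta + tau) y).
Proof.
move=> e0 t0; have et0 : 0 < eta + tau by rewrite ltr_wpDr.
have ds : is_derive tau (1 : R) (fun s : R => eta + s) 1.
  have := is_deriveD (is_derive_cst eta tau (1 : R)) (is_derive_id tau (1 : R)).
  by move=> d; apply: is_derive_eq d _; rewrite add0r.
have dM := is_deriveM (is_derive_expRZ (- E) (eta + tau)) (is_derive_heat y et0).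
have d1 := is_deriveCl (-1) (is_derive1_comp dM ds).
rewrite (_ : lap_F E eta y = (fun t => -1 * (((fun t => expR (- E * t)) * (fun t => heat t y)) (eta + t)))); last first.
  by apply/funext => s; rewrite mulN1r.
apply: is_derive_eq d1 _.
rewrite /heat_res /GRing.scale/=; ring.
Qed.

Lemma derivable_lap_f E eta y tau : 0 < eta -> 0 <= tau ->
  derivable (fun tau => expR (- E * (eta + tau)) * heat_res E (eta + tau) y) tau 1.
Proof.
move=> e0 t0; have et0 : 0 < eta + tau by rewrite ltr_wpDr.
have ds : is_derive tau (1 : R) (fun s : R => eta + s) 1.
  have := is_deriveD (is_derive_cst eta tau (1 : R)) (is_derive_id tau (1 : R)).
  by move=> d; apply: is_derive_eq d _; rewrite add0r.
have tn : eta + tau != 0 by rewrite gt_eqF.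
have dV := is_deriveV (f := id) tn (is_derive_id (eta + tau) (1 : R)).
have dp := is_deriveB (is_deriveD (is_derive_cst E (eta + tau) (1 : R)) dV)
     (is_deriveCl (sqn y / 4) (is_deriveM dV dV)).
have dh := is_deriveM dp (is_derive_heat y et0).
have dM := is_deriveM (is_derive_expRZ (- E) (eta + tau)) dh.
have [d1 _] := is_derive1_comp dM ds.
rewrite (_ : (fun tau => _) = (((fun t => expR (- E * t)) * ((fun t : R => E + t^-1 - sqn y / 4 * (t^-1 * t^-1)) * (fun t => heat t y))) \o (fun s => eta + s)))//.
apply/funext => s /=; congr (_ * (_ * _)).
by rewrite /heat_res invfM -expr2 exprVn mulrA.
Qed.

End heat_time.

Section Rintegral3.
Context d (T : measurableType d) (R : realType) (mu : {measure set T -> \bar R}) (D : set T).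
Hypothesis mD : measurable D.
Variables (f g h : T -> R) (c : R).
Hypotheses (If : mu.-integrable D (EFin \o f)) (Ig : mu.-integrable D (EFin \o g))
  (Ih : mu.-integrable D (EFin \o h)).

Lemma Rintegral_add3 : Rintegral mu D f + Rintegral mu D g + c * Rintegral mu D h =
  Rintegral mu D (fun x => f x + g x + c * h x).
Proof.
rewrite -[_ + Rintegral mu D g]mul1r -[Rintegral mu D f]mul1r -[Rintegral mu D g]mul1r.
rewrite (Rintegral_lin mD 1 1 If Ig) (Rintegral_lin mD 1 c (integrable_lin mD 1 1 If Ig) Ih).
by apply: eq_Rintegral => x _; rewrite !mul1r.
Qed.

Lemma Rintegral_sub3 : - Rintegral mu D f - Rintegral mu D g + c * Rintegral mu D h =
  Rintegral mu D (fun x => - f x - g x + c * h x).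
Proof.
rewrite -[_ - Rintegral mu D g]mul1r -[- Rintegral mu D f]mulN1r -[- Rintegral mu D g]mulN1r.
rewrite (Rintegral_lin mD (-1) (-1) If Ig) (Rintegral_lin mD 1 c (integrable_lin mD (-1) (-1) If Ig) Ih).
by apply: eq_Rintegral => x _; rewrite !mulN1r mul1r.
Qed.
End Rintegral3.

(** * The equation satisfied by the Green function with cutoff *)

Section green_identity.
Context (R : realType).
Notation mR := (measurableTypeR R).
Notation pi := (@trigo.pi R).
Variables (E eta : R).
Hypotheses (E_gt0 : 0 < E) (eta_gt0 : 0 < eta).
Implicit Types (tau t : R) (y a : R * R) (phi : R * R -> R).

(** The derivative of the heat kernel along v, in closed form so that joint measurability in time
    and space is evident. *)
Definition heatD (v : R * R) t y : R := lin2 (- y.1 / (2 * t)) (- y.2 / (2 * t)) v * heat t y.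

Lemma heat_dom t y : eta <= t -> `|heat t y| <= 1 * (heat t y + heat (2 * t) y).
Proof.
move=> et; have t0 : 0 < t by apply: lt_le_trans et.
by rewrite ger0_norm ?heat_ge0// mul1r lerDl heat_ge0// mulr_gt0.
Qed.

Lemma sqrt_ratio (s h : R) : 0 < s -> 4 * s * h / (2 * s ^+ 2) = 2 / s * h.
Proof. by move=> s0; field; rewrite gt_eqF. Qed.

Lemma heatD_dom v t y : v = e1 R \/ v = e2 R -> eta <= t ->
  `|heatD v t y| <= 2 / Num.sqrt eta * (heat t y + heat (2 * t) y).
Proof.
move=> vE et; have t0 : 0 < t by apply: lt_le_trans et.
have t20 : 0 < 2 * t by rewrite mulr_gt0.
have h1 : 0 <= heat t y by rewrite heat_ge0.
have h2 : 0 <= heat (2 * t) y by rewrite heat_ge0.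
have H z : z ^+ 2 <= sqn y -> `|- z / (2 * t) * heat t y| <= 2 / Num.sqrt eta * (heat t y + heat (2 * t) y).
  move=> zy; rewrite normrM (ger0_norm h1) normrM normrN normfV (ger0_norm (ltW t20)) mulrAC.
  have s0 : 0 < Num.sqrt t by rewrite sqrtr_gt0.
  have se : 0 < Num.sqrt eta by rewrite sqrtr_gt0.
  apply: (@le_trans _ _ (4 * Num.sqrt t * heat (2 * t) y / (2 * t))).
    by rewrite ler_pM2r ?invr_gt0// norm_heat_le.
  have -> : 4 * Num.sqrt t * heat (2 * t) y / (2 * t) = 2 / Num.sqrt t * heat (2 * t) y.
    by rewrite -(sqrt_ratio (heat (2 * t) y) s0) sqr_sqrtr// ltW.
  apply: ler_pM => //.
    by rewrite ler_wpM2l// lef_pV2 ?posrE// ler_wsqrtr.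
  by rewrite lerDr.
rewrite /heatD /lin2; case: vE => ->; rewrite /= ?mul1r ?mul0r ?addr0 ?add0r; apply: H.
- by rewrite /sqn lerDl sqr_ge0.
- by rewrite /sqn lerDr sqr_ge0.
Qed.

(** The constant 5 collects 1 from the term 1/t and 4 from the quadratic term, via [sqn_heat_le]. *)
Lemma heat_res_dom t y : eta <= t ->
  `|heat_res E t y| <= (E + 5 / eta) * (heat t y + heat (2 * t) y).
Proof.
move=> et; have t0 : 0 < t by apply: lt_le_trans et.
have h1 : 0 <= heat t y by rewrite heat_ge0.
have h2 : 0 <= heat (2 * t) y by rewrite heat_ge0// mulr_gt0.
have s1 := sqn_heat_le y t0.
have ti : t^-1 <= eta^-1 by rewrite lef_pV2 ?posrE.
have ti0 : 0 < t^-1 by rewrite invr_gt0.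
have ei0 : 0 < eta^-1 by rewrite invr_gt0.
have s2 : sqn y / (4 * t ^+ 2) * heat t y <= 4 / eta * heat (2 * t) y.
  rewrite mulrAC; apply: (@le_trans _ _ (16 * t * heat (2 * t) y / (4 * t ^+ 2))).
    by rewrite ler_pM2r ?invr_gt0 ?mulr_gt0 ?exprn_gt0.
  have -> : 16 * t * heat (2 * t) y / (4 * t ^+ 2) = 4 * t^-1 * heat (2 * t) y.
    by field; rewrite gt_eqF.
  by rewrite ler_wpM2r// ler_wpM2l.
have s0 : 0 <= sqn y / (4 * t ^+ 2) * heat t y.
  by rewrite mulr_ge0// divr_ge0 ?sqn_ge0// mulr_ge0// sqr_ge0.
have a1 : (E + t^-1) * heat t y <= (E + 5 / eta) * heat t y.
  by rewrite ler_wpM2r// lerD2l; lra.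
have a2 : 4 / eta * heat (2 * t) y <= (E + 5 / eta) * heat (2 * t) y.
  rewrite ler_wpM2r//; apply: (@le_trans _ _ (5 / eta)); last by rewrite lerDr ltW.
  by rewrite ler_pM2r// ler_nat.
have a0 : 0 <= (E + t^-1) * heat t y by rewrite mulr_ge0// addr_ge0// ltW.
rewrite /heat_res mulrBl ler_norml mulrDr; apply/andP; split; lra.
Qed.

Lemma measurable_heat_pair : measT (fun z : mR * (mR * mR) => heat z.1 z.2 : mR).
Proof. by apply: measurable_heat; [exact: measurable_fst|exact: measurable_snd]. Qed.

Lemma measurable_fst2 : measT (fun z : mR * (mR * mR) => z.2.1 : mR).
Proof. exact: (measurableT_comp (@measurable_fst _ _ mR mR) (@measurable_snd _ _ mR (mR * mR)%type)). Qed.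
Lemma measurable_snd2 : measT (fun z : mR * (mR * mR) => z.2.2 : mR).
Proof. exact: (measurableT_comp (@measurable_snd _ _ mR mR) (@measurable_snd _ _ mR (mR * mR)%type)). Qed.

Lemma measurable_heatD v : measT (fun z : mR * (mR * mR) => heatD v z.1 z.2 : mR).
Proof.
have m1 : measT (fun z : mR * (mR * mR) => (2 * z.1)^-1 : mR).
  by apply: measurable_inv_comp; apply: measurable_funM => //; exact: measurable_fst.
apply: measurable_funM; last exact: measurable_heat_pair.
by apply: measurable_funD; apply: measurable_funM => //; apply: measurable_funM => //;
  apply: measurableT_comp => //; [exact: measurable_fst2|exact: measurable_snd2].
Qed.

Lemma measurable_heat_res : measT (fun z : mR * (mR * mR) => heat_res E z.1 z.2 : mR).
Proof.
apply: measurable_funM; last exact: measurable_heat_pair.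
apply: measurable_funB.
  by apply: measurable_funD => //; exact: measurable_inv_comp.
apply: measurable_funM; first by apply: measurable_sqn; exact: measurable_snd.
by apply: measurable_inv_comp; apply: measurable_funM => //; exact: measurable_funX.
Qed.

Definition green a := lap E eta (@heat R) a.
Definition greenD v a := lap E eta (heatD v) a.

Let A0 : 0 <= 1 :> R. Proof. by []. Qed.
Let A1 : 0 <= 2 / Num.sqrt eta. Proof. by rewrite divr_ge0 ?sqrtr_ge0. Qed.
Let A2 : 0 <= E + 5 / eta. Proof. by rewrite addr_ge0 ?divr_ge0 ?ltW. Qed.

(** The time integrand is an exact derivative that vanishes at infinity, so only the initial time
    [eta] contributes. *)
Lemma lap_heat_res a x : lap E eta (heat_res E) a x = expR (- E * eta) * heat eta (x - a).
Proof.
have [] := @hl_FTC _ (fun tau => expR (- E * (eta + tau)) * heat_res E (eta + tau) (x - a))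
  (lap_F E eta (x - a)) E ((E + 5 / eta) * (2 + 2 * (4 * pi * eta)^-1)) E_gt0.
- move=> tau t0; set c := _ * (2 + _).
  have et : eta <= eta + tau by rewrite lerDl.
  have K := kernel_bound eta_gt0 A2 heat_res_dom (x - a) et.
  rewrite lerNl; apply: le_trans (ler_norm _) _; rewrite normrN normrM ger0_norm ?expR_ge0// mulrC.
  apply: ler_pM => //; rewrite ?expR_ge0//.
  by rewrite ler_expR !mulNr lerN2 ler_wpM2l ?(ltW E_gt0)// lerDr ltW.
- by apply: derivable_within => tau t0; exact: derivable_lap_f.
- by move=> tau t0; exact: is_derive_lap_F.
- have B tau : 0 <= tau -> `|lap_F E eta (x - a) tau| <= (4 * pi * eta)^-1 * expR (- E * tau).
    move=> t0; have et0 : 0 < eta + tau by rewrite ltr_wpDr.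
    rewrite normrN normrM ger0_norm ?expR_ge0// (ger0_norm (heat_ge0 _ et0)) mulrC.
    apply: ler_pM; rewrite ?expR_ge0 ?heat_ge0//.
      apply: (le_trans (heat_le _ et0)); rewrite lef_pV2 ?posrE ?pi4_gt0//.
      by rewrite ler_wpM2l ?lerDl// ltW// mulr_gt0 ?pi_gt0.
    by rewrite ler_expR !mulNr lerN2 ler_wpM2l ?(ltW E_gt0)// lerDr ltW.
  have Z : (4 * pi * eta)^-1 * expR (- E * tau) @[tau --> +oo%R] --> (0 : R).
    by rewrite -[X in _ --> X](mulr0 (4 * pi * eta)^-1); apply: cvgMl_tmp; exact: cvg_expRZ.
  apply: (@squeeze_cvgr _ _ _ _ (fun tau => - ((4 * pi * eta)^-1 * expR (- E * tau)))
     (fun tau => (4 * pi * eta)^-1 * expR (- E * tau))) => //.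
    near=> tau; rewrite -ler_norml; apply: B.
    by near: tau; exact: nbhs_pinfty_ge (num_real _).
  by rewrite -[X in _ --> X]oppr0; apply: cvgN.
move=> _; rewrite /lap /superpose => ->; by rewrite /lap_F addr0 opprK.
Unshelve. all: by end_near. Qed.

Lemma slice_smooth a tau : 0 < tau -> smooth (lap_slice E eta (@heat R) a tau).
Proof.
move=> t0; have et0 : 0 < eta + tau by rewrite addr_gt0.
rewrite (_ : lap_slice _ _ _ _ _ = (fun x => expR (- E * (eta + tau)) * heat (eta + tau) (x - a))).
  by apply: smoothZ; exact: smooth_heat.
by apply/funext => x; rewrite /lap_slice /hl t0.
Qed.

Lemma slice_D v a tau : 0 < tau ->
  lap_slice E eta (heatD v) a tau = (fun x => 'D_v (lap_slice E eta (@heat R) a tau) x).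
Proof.
move=> t0; have et0 : 0 < eta + tau by rewrite addr_gt0.
rewrite [in RHS](_ : lap_slice _ _ _ _ _ = expR (- E * (eta + tau)) *: (fun x => heat (eta + tau) (x - a))); last first.
  by apply/funext => x; rewrite /lap_slice /hl t0.
apply/funext => x; rewrite deriveZ; last exact: smooth_derivable (smooth_heat a et0).
by rewrite D_heat// /lap_slice /hl t0.
Qed.

Lemma D_heat_coef t a v x : 0 < t -> let F := fun x : R * R => lin2 (- (x - a).1 / (2 * t)) (- (x - a).2 / (2 * t)) v in
  differentiable F x /\ forall w, 'D_w F x = lin2 (- v.1 / (2 * t)) (- v.2 / (2 * t)) w.
Proof.
move=> t0; have tn : t != 0 by rewrite gt_eqF.
apply: (@diff_quad _ _ _ _ _ 0) => h.
rewrite mul0r (_ : _ - _ - _ = 0) ?normr0// /lin2/=.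
by field.
Qed.

Lemma slice_lap a tau x : 0 < tau ->
  - 'D_(e1 R) (lap_slice E eta (heatD (e1 R)) a tau) x
  - 'D_(e2 R) (lap_slice E eta (heatD (e2 R)) a tau) x +
  E * lap_slice E eta (@heat R) a tau x = lap_slice E eta (heat_res E) a tau x.
Proof.
move=> t0; have et0 : 0 < eta + tau by rewrite addr_gt0.
have tn : eta + tau != 0 by rewrite gt_eqF.
pose F (v : R * R) := fun x : R * R => lin2 (- (x - a).1 / (2 * (eta + tau))) (- (x - a).2 / (2 * (eta + tau))) v.
have sl v : lap_slice E eta (heatD v) a tau =
    expR (- E * (eta + tau)) *: (F v * (fun x => heat (eta + tau) (x - a))).
  by apply/funext => z; rewrite /lap_slice /hl t0.
have dl v : 'D_v (lap_slice E eta (heatD v) a tau) x = expR (- E * (eta + tau)) *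
    (F v x * (F v x * heat (eta + tau) (x - a)) +
     heat (eta + tau) (x - a) * lin2 (- v.1 / (2 * (eta + tau))) (- v.2 / (2 * (eta + tau))) v).
  have [dF DF] := D_heat_coef a v x et0.
  have dh : derivable (fun x => heat (eta + tau) (x - a)) x v.
    exact: smooth_derivable (smooth_heat a et0).
  rewrite sl deriveZ; last by apply: derivableM => //; exact: diff_derivable.
  rewrite deriveM//; last exact: diff_derivable.
  by rewrite D_heat// DF.
rewrite !dl /lap_slice /hl t0 /heat_res /F /lin2 /sqn /=.
move: (expR _) (heat _ _) => e h; field; exact: tn.
Qed.

Lemma green_weak_deriv v a : v = e1 R \/ v = e2 R -> weak_deriv v (green a) (greenD v a).
Proof.
move=> vE phi tp; have tD := test_D v tp.
have [C0 HC0] := test_bounded tp; have [C1 HC1] := test_bounded tD.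
rewrite (lap_fubini E_gt0 eta_gt0 A0 measurable_heat_pair heat_dom a (test_measurable tD) HC1).
rewrite (lap_fubini E_gt0 eta_gt0 A1 (measurable_heatD v) (fun t y => heatD_dom y vE) a (test_measurable tp) HC0).
rewrite -(RintegralN mT (lap_ip_int E_gt0 eta_gt0 A1 (measurable_heatD v) (fun t y => heatD_dom y vE) a (test_measurable tp) HC0)).
apply: eq_Rintegral => tau _.
have [t0|t0] := boolP (0 < tau); last first.
  have z k psi : ip2 (lap_slice E eta k a tau) psi = 0.
    rewrite /ip /Rintegral integral0_eq// => x _.
    by rewrite /lap_slice /hl (negbTE t0) mul0r.
  by rewrite !z oppr0.
by rewrite slice_D//; exact: (ibp_test vE (slice_smooth a t0) tp).
Qed.

Lemma smooth_test_int (f phi : R * R -> R) : smooth f -> test_fun phi -> L1 (fun x => f x * phi x).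
Proof.
move=> sf tp; have := test_integrable (test_smoothM tp sf).
by apply: eq_integrable => // x _ /=; rewrite mulrC.
Qed.

(** Weak form of (-Laplacian + E) G = exp(-E eta) heat eta, where the heat kernel stands for a
    smeared point mass at [a]. Integration by parts is done slice by slice in time and then summed
    by Fubini. *)
Lemma green_energy a phi : test_fun phi ->
  ip2 (greenD (e1 R) a) (fun x => 'D_(e1 R) phi x) + ip2 (greenD (e2 R) a) (fun x => 'D_(e2 R) phi x)
  + E * ip2 (green a) phi = expR (- E * eta) * ip2 (fun x => heat eta (x - a)) phi.
Proof.
move=> tp; have e1E : e1 R = e1 R \/ e1 R = e2 R by left.
have e2E : e2 R = e1 R \/ e2 R = e2 R by right.
have t1 := test_D (e1 R) tp; have t2 := test_D (e2 R) tp.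
have [C0 HC0] := test_bounded tp; have [C1 HC1] := test_bounded t1; have [C2 HC2] := test_bounded t2.
have i0 := lap_ip_int E_gt0 eta_gt0 A0 measurable_heat_pair heat_dom a (test_measurable tp) HC0.
have i1 := lap_ip_int E_gt0 eta_gt0 A1 (measurable_heatD (e1 R)) (fun t y => heatD_dom y e1E) a (test_measurable t1) HC1.
have i2 := lap_ip_int E_gt0 eta_gt0 A1 (measurable_heatD (e2 R)) (fun t y => heatD_dom y e2E) a (test_measurable t2) HC2.
rewrite (lap_fubini E_gt0 eta_gt0 A0 measurable_heat_pair heat_dom a (test_measurable tp) HC0).
rewrite (lap_fubini E_gt0 eta_gt0 A1 (measurable_heatD (e1 R)) (fun t y => heatD_dom y e1E) a (test_measurable t1) HC1).
rewrite (lap_fubini E_gt0 eta_gt0 A1 (measurable_heatD (e2 R)) (fun t y => heatD_dom y e2E) a (test_measurable t2) HC2).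
apply: (etrans (Rintegral_add3 mT E i1 i2 i0)).
have -> : expR (- E * eta) * ip2 (fun x => heat eta (x - a)) phi = ip2 (lap E eta (heat_res E) a) phi.
  have I : L1 (fun x => heat eta (x - a) * phi x) by apply: smooth_test_int => //; exact: smooth_heat.
  rewrite -(RintegralZl _ mT I); apply: eq_Rintegral => x _.
  by rewrite lap_heat_res mulrA.
rewrite (lap_fubini E_gt0 eta_gt0 A2 measurable_heat_res heat_res_dom a (test_measurable tp) HC0).
apply: eq_Rintegral => tau _.
have [t0|t0] := boolP (0 < tau); last first.
  have z k psi : ip2 (lap_slice E eta k a tau) psi = 0.
    rewrite /ip /Rintegral integral0_eq// => x _.
    by rewrite /lap_slice /hl (negbTE t0) mul0r.
  by rewrite !z !mulr0 !addr0.
have s0 := slice_smooth a t0.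
have s1 : smooth (lap_slice E eta (heatD (e1 R)) a tau) by rewrite slice_D//; exact: smooth_D.
have s2 : smooth (lap_slice E eta (heatD (e2 R)) a tau) by rewrite slice_D//; exact: smooth_D.
have ibp1 := ibp_test e1E s1 tp; have ibp2 := ibp_test e2E s2 tp.
have j0 := smooth_test_int s0 tp.
have j1 := smooth_test_int (smooth_D (e1 R) s1) tp.
have j2 := smooth_test_int (smooth_D (e2 R) s2) tp.
rewrite [in LHS]/ip /= ibp1 ibp2.
apply: (etrans (Rintegral_sub3 mT E j1 j2 j0)).
apply: eq_Rintegral => x _; rewrite -slice_lap//; ring.
Qed.

End green_identity.

Section green_function.
Context (R : realType).
Implicit Types (E eta t : R) (y a b : R * R).

(** The kernel as a function of the difference of two points. The case eta = 0 is the true Green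
    function; there the integral diverges at y = 0. *)
Definition greenf E eta y : R :=
  Rint setT (hl (fun tau => expR (- E * (eta + tau)) * heat (eta + tau) y)).

Definition greenDf E eta v y : R :=
  Rint setT (hl (fun tau => expR (- E * (eta + tau)) * heatD v (eta + tau) y)).

(** The sup bound and the L1 bound, uniform under translation, are the two dominations asked of a
    superposition over the points of an arc. *)
Definition bump_like (U : R * R -> R) (C : R) := [/\ measT (U : mR * mR -> mR),
  forall y, `|U y| <= C & forall a, (\int[mu2]_x `|U (x - a)|%:E <= C%:E)%E].

Lemma L1_translate_bound (U : R * R -> R) (C : R) a : measT (U : mR * mR -> mR) ->
  (\int[mu2]_x `|U (x - a)|%:E <= C%:E)%E -> mu2.-integrable setT (EFin \o (fun x => U (x - a))).
Proof.
move=> mU H; apply/integrableP; split.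
  apply/mEFinP; apply: (measurableT_comp mU).
  exact: measurable_sub2.
by apply: le_lt_trans H _; rewrite ltry.
Qed.

Lemma lap_bump_like E eta A (k : R -> R * R -> R) : 0 < E -> 0 < eta -> 0 <= A ->
  measT (fun z : mR * (mR * mR) => k z.1 z.2 : mR) ->
  (forall t y, eta <= t -> `|k t y| <= A * (heat t y + heat (2 * t) y)) ->
  exists C, bump_like (fun y => Rint setT (hl (fun tau => expR (- E * (eta + tau)) * k (eta + tau) y))) C.
Proof.
move=> E0 e0 A0 mk kA; set U := (fun y => _).
have UE a : (fun x => U (x - a)) = lap E eta k a by [].
have U0 : U = lap E eta k 0 by rewrite -UE; apply/funext => x; rewrite subr0.
have L1a a := lap_L1 E0 e0 A0 mk kA a.
have mU : measT (U : mR * mR -> mR).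
  by rewrite U0; have /measurable_int/mEFinP := L1a 0.
exists (Rint setT (lap_dom E eta A)); split => //.
- by move=> y; rewrite U0; exact: (lap_bounded E0 e0 A0 mk kA 0 y).
- by move=> a; exact: (lap_int_le E0 e0 A0 mk kA a).
Qed.

Lemma green_bump E eta : 0 < E -> 0 < eta -> exists C, bump_like (greenf E eta) C.
Proof.
move=> E0 e0; apply: (lap_bump_like E0 e0 _ (@measurable_heat_pair R) (heat_dom e0)) => //.
Qed.

Lemma greenD_bump E eta v : 0 < E -> 0 < eta -> v = e1 R \/ v = e2 R ->
  exists C, bump_like (greenDf E eta v) C.
Proof.
move=> E0 e0 vE; apply: (lap_bump_like E0 e0 _ (measurable_heatD v) (fun t y => heatD_dom e0 y vE)) => //.
Qed.

Lemma heat_bump eta : 0 < eta -> exists C, bump_like (@heat R eta) C.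
Proof.
move=> e0; exists (Num.max 1 (4 * trigo.pi * eta)^-1); split.
- by apply: measurable_heat => //; exact: measurable_id.
- by move=> y; rewrite ger0_norm ?heat_ge0// le_max heat_le ?orbT.
- move=> a; under eq_integral do rewrite ger0_norm ?heat_ge0//.
  by rewrite heat_int// lee_fin le_max lexx.
Qed.

Lemma green_shift E eta a : (fun x => greenf E eta (x - a)) = green E eta a.
Proof. by []. Qed.

(** By the semigroup law the heat kernel at time [eta] pushes every time of the Laplace integral
    forward by [eta], so cutoffs add up. *)
Lemma green_heat E eta delta a b : 0 < E -> 0 < eta -> 0 < delta ->
  expR (- E * eta) * ip2 (fun x => greenf E delta (x - a)) (fun x => heat eta (x - b)) =
  greenf E (delta + eta) (a - b).
Proof.
move=> E0 e0 d0.
have [C [mh hC _]] := heat_bump e0.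
have mhb : measT (fun x : mR * mR => heat eta (x - b)).
  by apply: (measurableT_comp mh); exact: measurable_sub2.
have hCb x : `|heat eta (x - b)| <= C by exact: hC.
have A0 : 0 <= 1 :> R by [].
rewrite green_shift (lap_fubini E0 d0 A0 (@measurable_heat_pair R) (heat_dom d0) a mhb hCb).
rewrite -(RintegralZl _ mT (lap_ip_int E0 d0 A0 (@measurable_heat_pair R) (heat_dom d0) a mhb hCb)).
apply: eq_Rintegral => tau _.
rewrite /hl; have [t0|t0] := boolP (0 < tau); last first.
  rewrite /ip /Rintegral integral0_eq ?mulr0// => x _.
  by rewrite /lap_slice /hl (negbTE t0) mul0r.
have dt0 : 0 < delta + tau by rewrite addr_gt0.
have H := heat_conv a b dt0 e0.
have I : mu2.-integrable setT (EFin \o (fun x => heat (delta + tau) (x - a) * heat eta (x - b))).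
  apply/integrableP; split.
    apply/mEFinP; apply: measurable_funM => //.
    by apply: measurable_heat => //; exact: measurable_sub2.
  apply: (@le_lt_trans _ _ (heat (delta + tau + eta) (a - b))%:E); last by rewrite ltry.
  rewrite -H; apply: le_of_eq; apply: eq_integral => x _.
  by rewrite /= ger0_norm// mulr_ge0 ?heat_ge0.
have -> : ip2 (lap_slice E delta (@heat R) a tau) (fun x => heat eta (x - b)) =
   expR (- E * (delta + tau)) * heat (delta + tau + eta) (a - b).
  rewrite [X in _ * X](_ : _ = Rint2 (fun x => heat (delta + tau) (x - a) * heat eta (x - b))); last first.
    by rewrite /Rintegral H.
  rewrite -(RintegralZl _ mT I); apply: eq_Rintegral => x _.
  by rewrite /lap_slice /hl t0 mulrA.
rewrite mulrA -expRD; congr (expR _ * heat _ _); ring.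
Qed.

End green_function.

(** * Regularised potentials of densities on an arc *)

Section arc_potential.
Context (R : realType).
Variables (sigma : R -> R * R) (L : R).
Hypothesis msigma : measT (sigma : mR -> mR * mR).
Implicit Types (g h : R -> R) (U : R * R -> R) (E eta delta : R).

(** Densities are bounded, supported in [0, L] and defined on the whole line. These suffice as test
    densities: [weight_orth] recovers L2 functions from them. *)
Definition weight g := measT (g : mR -> mR) /\
  exists M, forall s, `|g s| <= M * \1_(`[0, L]%classic : set R) s.

Definition pot g U (x : R * R) : R := Rint setT (fun s => g s * U (x - sigma s)).

Lemma indic_itv_int (c : R) : intg setT (fun s => c * \1_(`[0, L]%classic : set R) s).
Proof.
have I : intg setT (\1_(`[0, L]%classic : set mR) : mR -> R); last exact: (integrableZl mT c I).
apply: int_indic; first exact: measurable_itv.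
apply: (eq_ind_r (fun x => (x < +oo)%E) _ (@lebesgue_measure_itv R `[0, L])).
by case: ifP; rewrite ?ltry// -EFinB ltry.
Qed.

Lemma weight_bound g : weight g -> exists2 M, 0 <= M & forall s, `|g s| <= M * \1_(`[0, L]%classic : set R) s.
Proof.
move=> [mg [M HM]]; exists `|M|; first exact: normr_ge0.
by move=> s; apply: (le_trans (HM s)); rewrite ler_wpM2r// ?ler_norm// indicE.
Qed.

Local Opaque greenf greenDf heat.

Section superposed.
Variables (g : R -> R) (U : R * R -> R) (C : R).
Hypotheses (wg : weight g) (bU : bump_like U C).
Let F s x := g s * U (x - sigma s).

Lemma pot_meas : measT (fun z : mR * (mR * mR) => F z.1 z.2).
Proof.
have [mg _] := wg; have [mU _ _] := bU.
apply: measurable_funM; first by apply: (measurableT_comp mg); exact: measurable_fst.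
apply: (measurableT_comp mU); apply: measurable_sub2; first exact: measurable_snd.
by apply: (measurableT_comp msigma); exact: measurable_fst.
Qed.

Lemma pot_dom : exists2 a : R -> R, intg setT a &
  (forall s x, `|F s x| <= a s) /\ (forall s, (\int[mu2]_x `|F s x|%:E <= (a s)%:E)%E).
Proof.
have [M M0 HM] := weight_bound wg; have [mU UC UI] := bU.
exists (fun s => M * C * \1_(`[0, L]%classic : set R) s); first exact: indic_itv_int.
split=> [s x|s].
  by rewrite normrM mulrAC; apply: ler_pM.
under eq_integral do rewrite normrM EFinM.
rewrite ge0_integralZl//; last first.
  apply/mEFinP; apply: measurableT_comp => //; apply: (measurableT_comp mU).
  exact: measurable_sub2.
rewrite mulrAC EFinM; apply: lee_pmul => //; rewrite ?lee_fin//.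
by apply: integral_ge0 => x _; rewrite lee_fin.
Qed.

Lemma pot_L1 : L1 (pot g U).
Proof. have [a ia [a1 a2]] := pot_dom; exact: superpose_L1 pot_meas ia a1 a2. Qed.

Lemma pot_L2 : L2p (pot g U).
Proof. have [a ia [a1 a2]] := pot_dom; exact: superpose_L2 pot_meas ia a1 a2. Qed.

Lemma pot_measurable : measT (pot g U : mR * mR -> mR).
Proof. by have /measurable_int/mEFinP := pot_L1. Qed.

Lemma pot_bounded : exists K, forall x, `|pot g U x| <= K.
Proof.
have [a ia [a1 a2]] := pot_dom; exists (Rint setT a) => x.
exact: superpose_le pot_meas ia a1 x.
Qed.

Lemma pot_ip (psi : R * R -> R) K : measT (psi : mR * mR -> mR) ->
  (forall x, `|psi x| <= K) ->
  ip2 (pot g U) psi = Rint setT (fun s => g s * ip2 (fun x => U (x - sigma s)) psi) /\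
  intg setT (fun s => g s * ip2 (fun x => U (x - sigma s)) psi).
Proof.
move=> mpsi HK; have [a ia [a1 a2]] := pot_dom; have [mU UC UI] := bU.
have E s : ip2 (F s) psi = g s * ip2 (fun x => U (x - sigma s)) psi.
  have I : L1 (fun x => U (x - sigma s) * psi x).
    have I0 := L1_translate_bound mU (UI (sigma s)).
    apply: (int_le mT _ _ (integrableZl mT K (integrable_norm I0))).
      by apply: measurable_funM => //; have /measurable_int/mEFinP := I0.
    by move=> x _; rewrite /= normrM mulrC ler_wpM2r.
  by rewrite -(RintegralZl _ mT I); apply: eq_Rintegral => x _; rewrite /F mulrA.
split; first rewrite (superpose_fubini pot_meas ia a1 a2 mpsi HK).
  by apply: eq_Rintegral => s _; exact: E.
have := superpose_ip_int pot_meas ia a2 mpsi HK.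
by apply: eq_integrable => // s _ /=; rewrite E.
Qed.

End superposed.

Variable (E : R).
Hypothesis E_gt0 : 0 < E.

Lemma pot_weak_deriv g eta v : weight g -> 0 < eta -> v = e1 R \/ v = e2 R ->
  weak_deriv v (pot g (greenf E eta)) (pot g (greenDf E eta v)).
Proof.
move=> wg e0 vE phi tp; have tD := test_D v tp.
have [C0 HC0] := test_bounded tp; have [C1 HC1] := test_bounded tD.
have [Cg bg] := green_bump E_gt0 e0; have [Cd bd] := greenD_bump E_gt0 e0 vE.
have [Q0 _] := pot_ip wg bg (test_measurable tD) HC1.
have [Q1 I] := pot_ip wg bd (test_measurable tp) HC0.
apply: (etrans Q0); apply: (etrans _ (congr1 -%R (esym Q1))).
rewrite -(RintegralN mT I); apply: eq_Rintegral => s _.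
have W := green_weak_deriv E_gt0 e0 (sigma s) vE tp.
by rewrite -mulrN; congr (_ * _); exact: W.
Qed.

(** The H^1 product with weight E on the L2 part. Weak derivatives are passed as separate arguments
    since they are determined only almost everywhere. *)
Definition energy u (u1 u2 : R * R -> R) (w w1 w2 : R * R -> R) : R :=
  ip2 u1 w1 + ip2 u2 w2 + E * ip2 u w.

Definition gpot g eta := pot g (greenf E eta).
Definition gpot1 g eta := pot g (greenDf E eta (e1 R)).
Definition gpot2 g eta := pot g (greenDf E eta (e2 R)).

Lemma pot_energy_test g eta (phi : R * R -> R) : weight g -> 0 < eta -> test_fun phi ->
  energy (gpot g eta) (gpot1 g eta) (gpot2 g eta)
    phi (fun x => 'D_(e1 R) phi x) (fun x => 'D_(e2 R) phi x) =
  expR (- E * eta) * ip2 (pot g (@heat R eta)) phi.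
Proof.
move=> wg e0 tp.
have e1E : e1 R = e1 R \/ e1 R = e2 R by left.
have e2E : e2 R = e1 R \/ e2 R = e2 R by right.
have t1 := test_D (e1 R) tp; have t2 := test_D (e2 R) tp.
have [C0 HC0] := test_bounded tp; have [C1 HC1] := test_bounded t1; have [C2 HC2] := test_bounded t2.
have [Cg bg] := green_bump E_gt0 e0; have [Cd1 bd1] := greenD_bump E_gt0 e0 e1E.
have [Cd2 bd2] := greenD_bump E_gt0 e0 e2E; have [Ch bh] := heat_bump e0.
have [Q0 I0] := pot_ip wg bg (test_measurable tp) HC0.
have [Q1 I1] := pot_ip wg bd1 (test_measurable t1) HC1.
have [Q2 I2] := pot_ip wg bd2 (test_measurable t2) HC2.
have [Qh Ih] := pot_ip wg bh (test_measurable tp) HC0.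
apply: (etrans (congr2 +%R (congr2 +%R Q1 Q2) (congr1 ( *%R E) Q0))).
apply: (etrans _ (congr1 ( *%R (expR (- E * eta))) (esym Qh))).
apply: (etrans (Rintegral_add3 mT E I1 I2 I0)).
rewrite -(RintegralZl _ mT Ih); apply: eq_Rintegral => s _.
have G := green_energy E_gt0 e0 (sigma s) tp.
have alg (x a b c r q : R) : a + b + E * c = q * r -> x * a + x * b + E * (x * c) = q * (x * r).
  by move=> H; rewrite [RHS]mulrCA -H; ring.
exact: alg G.
Qed.

Lemma cvg2_energy u (u1 u2 : R * R -> R) (w_ w1_ w2_ : nat -> R * R -> R) w (w1 w2 : R * R -> R) :
  L2p u -> L2p u1 -> L2p u2 -> (forall n, L2p (w_ n)) -> (forall n, L2p (w1_ n)) -> (forall n, L2p (w2_ n)) ->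
  L2p w -> L2p w1 -> L2p w2 -> cvg2 mu2 setT w_ w -> cvg2 mu2 setT w1_ w1 -> cvg2 mu2 setT w2_ w2 ->
  (fun n => energy u u1 u2 (w_ n) (w1_ n) (w2_ n)) @ \oo --> energy u u1 u2 w w1 w2.
Proof.
move=> Lu Lu1 Lu2 Lw_ Lw1_ Lw2_ Lw Lw1 Lw2 c0 c1 c2; rewrite /energy.
have H (f : R * R -> R) (f_ : nat -> R * R -> R) (h : R * R -> R) : (forall n, L2p (f_ n)) -> L2p f -> L2p h -> cvg2 mu2 setT f_ f ->
    (fun n => ip2 h (f_ n)) @ \oo --> ip2 h f.
  move=> Lf_ Lf Lh c; under eq_fun do rewrite ipC; rewrite ipC.
  exact: (cvg2_ipr mT Lf_ Lf Lh c).
apply: cvgD; first by apply: cvgD; exact: H.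
by apply: cvgMl_tmp; exact: H.
Qed.

(** Density of test functions in H^1 carries the identity over to every w, in particular to another
    potential. *)
Lemma pot_energy g eta w (w1 w2 : R * R -> R) : weight g -> 0 < eta ->
  L2p w -> L2p w1 -> L2p w2 -> weak_deriv (e1 R) w w1 -> weak_deriv (e2 R) w w2 ->
  energy (gpot g eta) (gpot1 g eta) (gpot2 g eta) w w1 w2 =
  expR (- E * eta) * ip2 (pot g (@heat R eta)) w.
Proof.
move=> wg e0 Lw Lw1 Lw2 d1 d2.
have e1E : e1 R = e1 R \/ e1 R = e2 R by left.
have e2E : e2 R = e1 R \/ e2 R = e2 R by right.
have [phi [tp c0 c1 c2]] := H1_density Lw Lw1 Lw2 d1 d2.
have [Cg bg] := green_bump E_gt0 e0; have [Cd1 bd1] := greenD_bump E_gt0 e0 e1E.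
have [Cd2 bd2] := greenD_bump E_gt0 e0 e2E; have [Ch bh] := heat_bump e0.
have Lp n : L2p (phi n) by exact: test_L2r.
have Lp1 n : L2p (fun x => 'D_(e1 R) (phi n) x) by apply: test_L2r; exact: test_D.
have Lp2 n : L2p (fun x => 'D_(e2 R) (phi n) x) by apply: test_L2r; exact: test_D.
have A := cvg2_energy (pot_L2 wg bg) (pot_L2 wg bd1) (pot_L2 wg bd2) Lp Lp1 Lp2 Lw Lw1 Lw2 c0 c1 c2.
have B : (fun n => expR (- E * eta) * ip2 (pot g (@heat R eta)) (phi n)) @ \oo -->
   expR (- E * eta) * ip2 (pot g (@heat R eta)) w.
  apply: cvgMl_tmp; under eq_fun do rewrite ipC; rewrite ipC.
  exact: (cvg2_ipr mT Lp Lw (pot_L2 wg bh) c0).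
apply: (cvg_unique _ A); first exact: Rhausdorff.
have Eq n := pot_energy_test wg e0 (tp n).
by rewrite (_ : (fun n => _) = (fun n => expR (- E * eta) * ip2 (pot g (@heat R eta)) (phi n)))//; apply/funext => n; exact: Eq.
Qed.

Definition Nform g h eta : R :=
  Rint setT (fun s => g s * Rint setT (fun s' => h s' * greenf E eta (sigma s' - sigma s))).

Lemma pot_heat_gpot g h eta delta : weight g -> weight h -> 0 < eta -> 0 < delta ->
  expR (- E * eta) * ip2 (pot g (@heat R eta)) (gpot h delta) = Nform g h (delta + eta).
Proof.
move=> wg wh e0 d0.
have [Cg bg] := green_bump E_gt0 d0; have [Ch bh] := heat_bump e0.
have [K HK] := pot_bounded wh bg; have mg := pot_measurable wh bg.
have [Q I] := pot_ip wg bh mg HK.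
apply: (etrans (congr1 ( *%R (expR (- E * eta))) Q)).
rewrite -(RintegralZl _ mT I); apply: eq_Rintegral => s _; rewrite mulrCA; congr (_ * _).
have [mh hC _] := bh.
have mhs : measT (fun x : mR * mR => heat eta (x - sigma s)).
  by apply: (measurableT_comp mh); exact: measurable_sub2.
have hCs x : `|heat eta (x - sigma s)| <= Ch by exact: hC.
have [Q' I'] := pot_ip wh bg mhs hCs.
rewrite ipC; apply: (etrans (congr1 ( *%R (expR (- E * eta))) Q')).
rewrite -(RintegralZl _ mT I'); apply: eq_Rintegral => s' _; rewrite mulrCA; congr (_ * _).
exact: green_heat.
Qed.

(** The right side sees the cutoffs only through their sum. This exact formula is what makes the
    regularised potentials a Cauchy family in H^1. *)
Lemma gpot_energy g h eta delta : weight g -> weight h -> 0 < eta -> 0 < delta ->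
  energy (gpot g eta) (gpot1 g eta) (gpot2 g eta) (gpot h delta) (gpot1 h delta) (gpot2 h delta) =
  Nform g h (delta + eta).
Proof.
move=> wg wh e0 d0.
have e1E : e1 R = e1 R \/ e1 R = e2 R by left.
have e2E : e2 R = e1 R \/ e2 R = e2 R by right.
have [Cg bg] := green_bump E_gt0 d0; have [Cd1 bd1] := greenD_bump E_gt0 d0 e1E.
have [Cd2 bd2] := greenD_bump E_gt0 d0 e2E.
rewrite (pot_energy wg e0 (pot_L2 wh bg) (pot_L2 wh bd1) (pot_L2 wh bd2)
  (pot_weak_deriv wh d0 e1E) (pot_weak_deriv wh d0 e2E)).
exact: pot_heat_gpot.
Qed.

End arc_potential.

(** * Integrals with an integrable power singularity *)

Section singular_integrals.
Context (R : realType).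
Notation mR := (measurableTypeR R).

(** The integrand may blow up at the endpoints, so the fundamental theorem is applied on compact
    subintervals and monotone convergence concludes; a bounded antiderivative suffices for the upper
    bound 2M. *)
Lemma sing_FTC (a b : R) (f F : R -> R) (M : R) : a < b ->
  (forall x, a < x < b -> 0 <= f x) -> (forall x, a < x < b -> {for x, continuous f}) ->
  (forall x : R, a < x < b -> is_derive x (1 : R) F (f x)) -> (forall x, a < x < b -> `|F x| <= M) ->
  (\int[mu]_(x in `]a, b[) (f x)%:E <= (2 * M)%:E)%E.
Proof.
move=> ab f0 cf dF FM.
(* With n + 3 the margin satisfies 2 d < b - a already for n = 0, so every subinterval is
   nondegenerate. *)
pose d (n : nat) := (b - a) / (n.+3)%:R.
have d0 n : 0 < d n by rewrite divr_gt0 ?subr_gt0.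
have d2 n : 2 * d n < b - a.
  rewrite /d mulrA ltr_pdivrMr// mulrC ltr_pM2l ?subr_gt0//.
  by rewrite ltr_nat.
have dle n m : (n <= m)%N -> d m <= d n.
  by move=> nm; rewrite ler_pM2l ?subr_gt0// lef_pV2 ?posrE// ler_nat.
pose S (n : nat) : set mR := `[a + d n, b - d n]%classic.
have Sin n x : S n x -> a < x < b.
  rewrite /S/= in_itv/= => /andP[h1 h2]; have := d0 n => dn; apply/andP; split.
    by apply: lt_le_trans h1; rewrite ltrDl.
  by apply: le_lt_trans h2 _; rewrite gtrBl.
have US : `]a, b[%classic = \bigcup_n S n.
  apply/seteqP; split => [x|x [n _ /Sin]]; last by rewrite /= in_itv.
  rewrite /= in_itv/= => /andP[ax xb].
  pose e := Num.min (x - a) (b - x) / (b - a).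
  have e0 : 0 < e by rewrite divr_gt0 ?subr_gt0// lt_min !subr_gt0 ax xb.
  have [N _ HN] := near_infty_natSinv_lt (PosNum e0).
  exists N => //; rewrite /S/= in_itv/=.
  have : d N <= Num.min (x - a) (b - x).
    have := HN N (leqnn N); rewrite /= /e ltr_pdivlMr ?subr_gt0// => /ltW H.
    apply: le_trans H; rewrite /d mulrC ler_pM2r ?subr_gt0// lef_pV2 ?posrE// ler_nat.
    by rewrite (leq_trans (leqnSn _) (leqnSn _)).
  by rewrite le_min => /andP[h1 h2]; rewrite addrC -lerBrDr h1 lerBrDr addrC -lerBrDr.
have mS n : measurable (S n) by exact: measurable_itv.
have cS n : {within S n, continuous f}.
  by apply: continuous_in_subspaceT => x; rewrite inE => xS; apply: cf; apply: (Sin n).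
have IS n : (\int[mu]_(x in S n) (f x)%:E <= (2 * M)%:E)%E.
  have lt : a + d n < b - d n.
    have := d2 n; rewrite mulr2n mulrDl mul1r => h.
    by rewrite -subr_gt0; move: h; rewrite -subr_gt0; congr (_ < _); ring.
  have inl : a < a + d n < b.
    by apply: (Sin n); rewrite /S/= in_itv/= lexx ltW.
  have inr : a < b - d n < b.
    by apply: (Sin n); rewrite /S/= in_itv/= lexx andbT ltW.
  have cF x : a < x < b -> {for x, continuous F}.
    by move=> /dF[h _]; apply: differentiable_continuous; apply/derivable1_diffP.
  rewrite (@continuous_FTC2 _ f F _ _ lt).
  - rewrite -EFinB lee_fin; have := FM _ inl; have := FM _ inr.
    rewrite !ler_norml => /andP[h1 h2] /andP[h3 h4]; lra.
  - exact: cS.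
  - split.
    + move=> x; rewrite in_itv/= => /andP[h1 h2].
      have /dF[] // : a < x < b.
      by apply: (Sin n); rewrite /S/= in_itv/= (ltW h1) (ltW h2).
    + by apply: cvg_at_right_filter; exact: cF.
    + by apply: cvg_at_left_filter; exact: cF.
  - move=> x; rewrite in_itv/= => /andP[h1 h2].
    have /dF[_ h] : a < x < b.
      by apply: (Sin n); rewrite /S/= in_itv/= (ltW h1) (ltW h2).
    by rewrite derive1E.
have nS : nondecreasing_seq S.
  move=> n m nm; apply/subsetPset => x; rewrite /S/= !in_itv/= => /andP[h1 h2].
  have := dle n m nm => h; apply/andP; split.
    by apply: le_trans h1; rewrite lerD2l.
  by apply: (le_trans h2); rewrite lerB.
rewrite US.
have H := @ge0_nondecreasing_set_cvg_integral _ _ _ S (EFin \o f) mu nS mS.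
have {}H := H _ _.
rewrite -(cvg_lim _ (H _ _))//; last 2 first.
- by move=> n; apply/mEFinP; apply: subspace_continuous_measurable_fun; [exact: mS|exact: cS].
- by move=> n x /Sin xS; rewrite lee_fin f0.
apply: lime_le; last by apply: nearW => n; exact: IS.
apply/cvg_ex; eexists; apply: H.
- by move=> n; apply/mEFinP; apply: subspace_continuous_measurable_fun; [exact: mS|exact: cS].
- by move=> n x /Sin xS; rewrite lee_fin f0.
Qed.

Lemma is_derive_powR (r x : R) : 0 < x ->
  is_derive x (1 : R) (fun t => t `^ r) (r * x `^ (r - 1)).
Proof.
move=> x0; have xi : x \in `]0, +oo[ by rewrite in_itv/= x0.
have d := @derivable_powR R 1 r x xi.
apply: DeriveDef; first exact: d.
by rewrite -derive1E (powR_derive1 r xi).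
Qed.

Lemma powR_continuous (r x : R) : 0 < x -> {for x, continuous (fun t : R => t `^ r)}.
Proof.
move=> /(is_derive_powR r)[h _].
by apply: differentiable_continuous; apply/derivable1_diffP.
Qed.

Lemma sing_powR (r b : R) : 0 < r -> 0 < b ->
  (\int[mu]_(x in `]0%R, b[) (x `^ (r - 1))%:E <= (2 * (r^-1 * b `^ r))%:E)%E.
Proof.
move=> r0 b0; apply: (@sing_FTC 0 b (fun x => x `^ (r - 1)) (fun x => r^-1 * x `^ r)); first exact: b0.
- by move=> x _; exact: powR_ge0.
- by move=> x /andP[x0 _]; exact: powR_continuous.
- move=> x /andP[x0 _]; have := is_deriveCl r^-1 (is_derive_powR r x0).
  by rewrite mulrA mulVf ?mul1r// gt_eqF.
- move=> x /andP[x0 xb]; rewrite ger0_norm; last first.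
    by rewrite mulr_ge0 ?powR_ge0// invr_ge0 ltW.
  by rewrite ler_pM2l ?invr_gt0// ge0_ler_powR ?nnegrE ?ltW.
Qed.

(** A power that dominates the logarithm of the Green function along an arc; the exponent -1/4 keeps
    both [sing] and its square integrable. *)
Definition sing (s u : R) : R := `|s - u| `^ (- 4^-1).

Lemma sing_ge0 s u : 0 <= sing s u. Proof. exact: powR_ge0. Qed.

Lemma singC s u : sing s u = sing u s. Proof. by rewrite /sing distrC. Qed.

Lemma measurable_sing d (T : measurableType d) (f g : T -> R) :
  measT (f : T -> mR) -> measT (g : T -> mR) ->
  measT (fun z => sing (f z) (g z) : mR).
Proof.
move=> mf mg; apply: (measurableT_comp (measurable_powR _)).
by apply: measurableT_comp => //; exact: measurable_funB.
Qed.

(** The sign [e] tells on which side of [s] the interval lies, so one computation covers both sides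
    of the singularity. *)
Lemma abs_powR_side (a b e r s L : R) : 0 < r -> 0 < L -> e ^+ 2 = 1 ->
  (forall x, a < x < b -> 0 < e * (x - s) <= L) ->
  (\int[mu]_(u in `]a, b[) (`|s - u| `^ (r - 1))%:E <= (2 * (r^-1 * L `^ r))%:E)%E.
Proof.
move=> r0 L0 e2 he.
have [ab|ab] := ltP a b; last first.
  rewrite set_itv_ge; last by rewrite bnd_simp -leNgt.
  by rewrite integral_set0 lee_fin mulr_ge0// mulr_ge0 ?powR_ge0// invr_ge0 ltW.
have nE x : a < x < b -> `|s - x| = e * (x - s).
  move=> /he/andP[h _]; rewrite -(gtr0_norm h) normrM distrC.
  by have /eqP := e2; rewrite sqrf_eq1 => /orP[]/eqP->; rewrite ?normrN normr1 mul1r.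
apply: (@sing_FTC a b (fun u => `|s - u| `^ (r - 1)) (fun u => e * r^-1 * (e * (u - s)) `^ r)) => // x abx;
  have /andP[x0 xL] := he x abx.
- apply: (@continuous_comp _ _ _ (fun u : R => `|s - u|) (fun t : R => t `^ (r - 1))).
    by apply: continuous_comp; [apply: continuousB => //; exact: cst_continuous|exact: norm_continuous].
  by apply: powR_continuous; rewrite nE.
- have ds : is_derive x (1 : R) (fun u : R => e * (u - s)) e.
    have dd := is_deriveCl e (is_deriveB (is_derive_id x (1 : R)) (is_derive_cst s x (1 : R))).
    by apply: is_derive_eq dd _; rewrite subr0 mulr1.
  have dd := is_deriveCl (e * r^-1) (@is_derive1_comp _ (fun t => t `^ r) (fun u => e * (u - s)) x _ _ (is_derive_powR r x0) ds).
  apply: is_derive_eq dd _; rewrite nE//; transitivity (e ^+ 2 * (r^-1 * r) * (e * (x - s)) `^ (r - 1)); first by ring.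
  by rewrite e2 mulVf ?mul1r// gt_eqF.
have n1 : `|e| = 1 by have /eqP := e2; rewrite sqrf_eq1 => /orP[]/eqP->; rewrite ?normrN normr1.
rewrite !normrM n1 mul1r (gtr0_norm (_ : 0 < r^-1)) ?invr_gt0// (ger0_norm (powR_ge0 _ _)).
by rewrite ler_pM2l ?invr_gt0// ge0_ler_powR ?nnegrE ?(ltW r0) ?(ltW x0) ?(ltW L0).
Qed.

Lemma abs_powR_int (r s L : R) : 0 < r -> 0 <= s <= L -> 0 < L ->
  (\int[mu]_(u in `[0%R, L]) (`|s - u| `^ (r - 1))%:E <= (4 * (r^-1 * L `^ r))%:E)%E.
Proof.
move=> r0 /andP[s0 sL] L0.
have mf (D : set mR) : measurable D -> measurable_fun D (fun u : mR => (`|s - u| `^ (r - 1))%:E).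
  move=> mD; apply: measurable_funTS; apply/mEFinP.
  apply: (measurableT_comp (measurable_powR _)).
  by apply: measurableT_comp => //; exact: measurable_funB.
have half1 : (\int[mu]_(u in `]0%R, s[) (`|s - u| `^ (r - 1))%:E <= (2 * (r^-1 * L `^ r))%:E)%E.
  apply: (@abs_powR_side 0 s (-1)) => // [|x /andP[x0 xs]]; first by rewrite sqrrN expr1n.
  by rewrite mulN1r opprB subr_gt0 xs (le_trans _ sL)// gerBl ltW.
have half2 : (\int[mu]_(u in `]s, L[) (`|s - u| `^ (r - 1))%:E <= (2 * (r^-1 * L `^ r))%:E)%E.
  apply: (@abs_powR_side s L 1) => // [|x /andP[sx xL]]; first by rewrite expr1n.
  by rewrite mul1r subr_gt0 sx (le_trans _ (ltW xL))// gerBl.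
rewrite (@itv_bndbnd_setU _ _ (BLeft 0) (BRight s) (BRight L)) ?bnd_simp//.
have mU : measurable_fun (`[0, s] `|` `]s, L] : set mR) (fun u : mR => (`|s - u| `^ (r - 1))%:E).
  by apply: (mf); apply: measurableU; exact: measurable_itv.
have nn (u : mR) : (0 <= (`|s - u| `^ (r - 1))%:E)%E by rewrite lee_fin powR_ge0.
have dj : [disjoint `[0, s]%classic & `]s, L]%classic].
  rewrite disj_set2E; apply/eqP; rewrite -subset0 => u [] /=.
  rewrite !in_itv/= => /andP[_ us] /andP[su _].
  by move: (lt_le_trans su us); rewrite ltxx.
rewrite ge0_integral_setU//.
rewrite -integral_itv_bndo_bndc; last by apply: mf; exact: measurable_itv.
rewrite -integral_itv_obnd_cbnd; last by apply: mf; exact: measurable_itv.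
rewrite -[X in (_ + X)%E]integral_itv_bndo_bndc; last by apply: mf; exact: measurable_itv.
apply: (le_trans (leeD half1 half2)); rewrite -EFinD lee_fin.
by rewrite -mulrDl -natrD.
Qed.

Lemma measurable_abs_powR (r s : R) (D : set mR) : measurable D ->
  measurable_fun D (fun u : mR => (`|s - u| `^ r)).
Proof.
move=> mD; apply: measurable_funTS.
apply: (measurableT_comp (measurable_powR _)).
by apply: measurableT_comp => //; exact: measurable_funB.
Qed.

Lemma abs_powR_integrable (r s L : R) : 0 < r -> 0 <= s <= L -> 0 < L ->
  intg `[0, L] (fun u => `|s - u| `^ (r - 1)) /\
  Rint `[0, L] (fun u => `|s - u| `^ (r - 1)) <= 4 * (r^-1 * L `^ r).
Proof.
move=> r0 sL L0; have H := abs_powR_int r0 sL L0.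
have I : intg `[0, L] (fun u => `|s - u| `^ (r - 1)).
  apply/integrableP; split.
    by apply/mEFinP; apply: measurable_abs_powR; exact: measurable_itv.
  apply: (@le_lt_trans _ _ (4 * (r^-1 * L `^ r))%:E); last by rewrite ltry.
  apply: le_trans H; apply: le_of_eq.
  by apply: eq_integral => u _ /=; rewrite ger0_norm ?powR_ge0.
by split => //; rewrite -lee_fin /Rintegral fineK//; exact: integrable_fin_num.
Qed.

Lemma sing_integrable (s L : R) : 0 <= s <= L -> 0 < L ->
  mu.-integrable `[0, L] (EFin \o sing s) /\
  Rint `[0, L] (sing s) <= 4 * ((3 / 4)^-1 * L `^ (3 / 4)).
Proof.
move=> sL L0; have := @abs_powR_integrable (3 / 4) s L ltac:(lra) sL L0.
by rewrite (_ : 3 / 4 - 1 = - 4^-1 :> R)//; lra.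
Qed.

Lemma sing_sqr_integrable (s L : R) : 0 <= s <= L -> 0 < L ->
  intg `[0, L] (fun u => sing s u ^+ 2) /\
  Rint `[0, L] (fun u => sing s u ^+ 2) <= 4 * (2^-1^-1 * L `^ (2^-1)).
Proof.
move=> sL L0; have := @abs_powR_integrable 2^-1 s L ltac:(lra) sL L0.
rewrite (_ : (fun u => `|s - u| `^ (2^-1 - 1)) = (fun u => sing s u ^+ 2))//.
apply/funext => u; rewrite /sing -powR_mulrn ?powR_ge0// -powRrM.
by congr (_ `^ _); lra.
Qed.

End singular_integrals.

(** * Size of the Green function near its singularity *)

Section green_bounds.
Context (R : realType).
Notation mR := (measurableTypeR R).
Implicit Types (E eta t : R) (y : R * R).

(** This is |y|^(-1/4) in the Euclidean norm, since [sqn y] is the squared length. *)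
Definition rad y : R := (sqn y `^ 8^-1)^-1.

Lemma rad_ge0 y : 0 <= rad y. Proof. by rewrite invr_ge0 powR_ge0. Qed.

Definition hc : R := (4 * pi)^-1 * 4 `^ 8^-1.

Lemma hc_gt0 : 0 < hc.
Proof. by rewrite mulr_gt0 ?powR_gt0// invr_gt0 mulr_gt0 ?pi_gt0. Qed.

(** From x^(1/8) <= exp x at x = |y|^2 / (4 t): a small power of |y|^2 is traded for a time factor
    t^(1/8 - 1) that is integrable at 0, and [hc] collects the constants. *)
Lemma heat_rad t y : 0 < t -> 0 < sqn y -> heat t y <= hc * t `^ (8^-1 - 1) * rad y.
Proof.
move=> t0 y0; have t4 : 0 < 4 * t by rewrite mulr_gt0.
pose x := sqn y / (4 * t); have x0 : 0 < x by rewrite divr_gt0.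
have K : x `^ 8^-1 <= expR x.
  apply: (@le_trans _ _ (1 + x)); last exact: expR_ge1Dx.
  have [x1|x1] := leP x 1.
    apply: (@le_trans _ _ 1); last by rewrite lerDl ltW.
    apply: (@le_trans _ _ (1 `^ 8^-1)); last by rewrite powR1.
    by apply: ge0_ler_powR; rewrite ?nnegrE// ltW.
  apply: (@le_trans _ _ x); last by rewrite lerDr.
  by apply: ler1_powR; [exact: ltW|rewrite invf_le1 ?ler1n].
have xE : x `^ 8^-1 = sqn y `^ 8^-1 / (4 * t) `^ 8^-1.
  rewrite /x powRM ?ltW ?invr_gt0//; congr (_ * _).
  by rewrite -powR_inv1 ?ltW// powRAC powR_inv1 ?powR_ge0.
rewrite /heat mulNr -/x expRN.
have -> : hc * t `^ (8^-1 - 1) * rad y = (4 * pi * t)^-1 * (x `^ 8^-1)^-1.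
  have alg (p A B q S : R) : p^-1 * A * (B / q) * S^-1 = (p * q)^-1 * (A * B / S).
    by rewrite invfM; ring.
  rewrite xE invf_div (powRM _ (ler0n _ 4) (ltW t0)) powRB ?(gt_eqF t0) ?implybT//.
  by rewrite powRr1 ?(ltW t0)// /rad /hc alg.
rewrite ler_pM2l ?invr_gt0 ?pi4_gt0// lef_pV2 ?posrE ?expR_gt0//.
by rewrite powR_gt0.
Qed.

Lemma c78_ge0 : 0 <= 1 - 8^-1 :> R.
Proof. by rewrite subr_ge0 invf_le1 ?ler1n. Qed.

(** The time weight left by [heat_rad]: integrable at 0 because its exponent exceeds -1, and at
    infinity because of the exponential. *)
Definition lapw E t : R := expR (- E * t) * t `^ (8^-1 - 1).

Lemma hl_split (f : R -> R) (g : R -> R) (M : R) : measT (f : mR -> mR) ->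
  (forall t, 0 <= f t) ->
  (\int[mu]_(t in `]0%R, 1%R[) (f t)%:E <= M%:E)%E -> mu.-integrable setT (EFin \o hl g) ->
  (forall t, 1 <= t -> f t <= g t) -> mu.-integrable setT (EFin \o hl f).
Proof.
move=> mf f0 fM ig fg.
have I1 : mu.-integrable `]0, 1[ (EFin \o f).
  apply/integrableP; split; first by apply/mEFinP; exact: measurable_funTS.
  under eq_integral do rewrite /= ger0_norm//.
  by apply: le_lt_trans fM _; rewrite ltry.
have I1' : intg setT (f \_ `]0, 1[).
  have m1 : measurable (`]0, 1[ : set mR) by exact: measurable_itv.
  by rewrite -restrict_EFin; exact: (iffLR (integrable_mkcond _ m1) I1).
have I2 := integrable_lin mT 1 1 I1' (integrable_norm ig).
apply: (int_le mT _ _ I2) => [|t _].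
  by apply: measurable_fun_ifT => //; apply: measurable_fun_ltr => //; exact: measurable_cst.
rewrite !mul1r /= /hl patchE; case: ifPn => t0; last first.
  by rewrite normr0 addr_ge0//; case: ifP.
rewrite ger0_norm//; have [t1|t1] := ltP t 1.
  by rewrite mem_set/= ?in_itv/= ?t0// lerDl.
apply: (@le_trans _ _ `|g t|); first by apply: le_trans (ler_norm _); exact: fg.
by rewrite lerDr; case: ifP.
Qed.

Lemma measurable_lapw E : measT (lapw E : mR -> mR).
Proof.
apply: measurable_funM; last exact: measurable_powR.
by apply: measurable_expR_comp; apply: measurable_funM => //; exact: measurable_cst.
Qed.

Lemma lapw_ge0 E t : 0 <= lapw E t.
Proof. by rewrite mulr_ge0 ?expR_ge0 ?powR_ge0. Qed.

Lemma lapw_integrable E : 0 < E -> mu.-integrable setT (EFin \o hl (lapw E)).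
Proof.
move=> E0; have ig := hl_expR_int 1 E0.
apply: (@hl_split _ _ (2 * (8^-1^-1 * 1 `^ 8^-1)) (measurable_lapw E) (lapw_ge0 E) _ ig).
- have H := @sing_powR R 8^-1 1 ltac:(by rewrite invr_gt0) ltr01.
  apply: le_trans H; apply: ge0_le_integral => //.
  + by move=> t _; rewrite lee_fin lapw_ge0.
  + by apply/mEFinP; apply: measurable_funTS; exact: measurable_lapw.
  + by apply/mEFinP; apply: measurable_funTS; exact: measurable_powR.
  + move=> t; rewrite /= in_itv/= => /andP[t0 _]; rewrite lee_fin ler_piMl ?powR_ge0//.
    by rewrite -expR0 ler_expR mulNr oppr_le0 mulr_ge0 ?ltW.
- move=> t t1; rewrite mul1r /lapw ler_piMr ?expR_ge0//.
  have t0 : 0 < t by apply: lt_le_trans t1.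
  rewrite (_ : 8^-1 - 1 = - (1 - 8^-1) :> R); last by rewrite opprB.
  rewrite powRN invf_le1 ?powR_gt0//.
  apply: (@le_trans _ _ (1 `^ (1 - 8^-1))); first by rewrite powR1.
  by apply: (ge0_ler_powR c78_ge0); rewrite ?nnegrE// ltW.
Qed.

Definition lapc E : R := hc * Rint setT (hl (lapw E)).

Lemma greenf_integrable E eta y : 0 < E -> 0 <= eta -> 0 < sqn y ->
  mu.-integrable setT (EFin \o hl (fun tau => expR (- E * (eta + tau)) * heat (eta + tau) y)).
Proof.
move=> E0 e0 y0.
have I := integrableZl mT (hc * rad y) (lapw_integrable E0).
apply: (int_le mT _ _ I) => [|t _].
  apply: measurable_fun_ifT => //.
    by apply: measurable_fun_ltr => //; exact: measurable_cst.
  have ms : measT (fun t : mR => eta + t) by apply: measurable_funD => //; exact: measurable_cst.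
  apply: measurable_funM.
    by apply: measurable_expR_comp; apply: measurable_funM => //; exact: measurable_cst.
  by apply: measurable_heat => //; exact: measurable_cst.
rewrite /hl; case: ifPn => t0; last by rewrite normr0 mulr0.
have et0 : 0 < eta + t by rewrite ltr_wpDl.
rewrite (ger0_norm (mulr_ge0 (expR_ge0 _) (heat_ge0 _ et0))).
apply: (le_trans (ler_wpM2l (expR_ge0 _) (heat_rad et0 y0))).
rewrite /lapw (_ : hc * rad y * (_ * _) = expR (- E * t) * (hc * t `^ (8^-1 - 1) * rad y)); last by ring.
have hr : 0 <= hc * rad y by rewrite mulr_ge0 ?rad_ge0 ?ltW ?hc_gt0.
have hp : 0 <= hc * (eta + t) `^ (8^-1 - 1) * rad y.
  by rewrite mulr_ge0 ?rad_ge0// mulr_ge0 ?powR_ge0// ltW ?hc_gt0.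
apply: ler_pM; rewrite ?expR_ge0//.
  by rewrite ler_expR !mulNr lerN2 ler_wpM2l ?(ltW E0)// lerDr.
rewrite ler_wpM2r ?rad_ge0// ler_wpM2l ?(ltW hc_gt0)//.
rewrite (_ : 8^-1 - 1 = - (1 - 8^-1) :> R); last by rewrite opprB.
rewrite !powRN lef_pV2 ?posrE ?powR_gt0//.
by apply: (ge0_ler_powR c78_ge0); rewrite ?nnegrE ?(ltW t0) ?(ltW et0)// lerDr.
Qed.

Lemma greenf_ge0 E eta y : 0 <= eta -> 0 <= greenf E eta y.
Proof.
move=> e0; apply: Rintegral_ge0 => t _; rewrite /hl; case: ifPn => // t0.
by rewrite mulr_ge0 ?expR_ge0 ?heat_ge0// ltr_wpDl.
Qed.

Lemma greenf0_le E y : 0 < E -> 0 < sqn y -> greenf E 0 y <= lapc E * rad y.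
Proof.
move=> E0 y0; have I := lapw_integrable E0.
have -> : lapc E * rad y = Rint setT (fun t => hc * rad y * hl (lapw E) t).
  by rewrite (RintegralZl _ mT I) /lapc mulrAC.
apply: le_Rintegral => //.
- exact: greenf_integrable.
- exact: (integrableZl mT (hc * rad y) I).
- move=> t _; rewrite /hl; case: ifPn => t0; last by rewrite mulr0.
  rewrite add0r; apply: (le_trans (ler_wpM2l (expR_ge0 _) (heat_rad t0 y0))).
  by apply: le_of_eq; rewrite /lapw; ring.
Qed.

(* shifting the time variable by [eta] removes the contribution of times below [eta] *)
Lemma greenf_shift_le E eta y : 0 < E -> 0 < eta -> 0 < sqn y ->
  0 <= greenf E 0 y - greenf E eta y <= 2 * (8 * eta `^ 8^-1) * hc * rad y.
Proof.
move=> E0 e0 y0.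
pose phi (t : R) := expR (- E * t) * heat t y.
have phi0 t : 0 < t -> 0 <= phi t by move=> t0; rewrite mulr_ge0 ?expR_ge0 ?heat_ge0.
have dphi t : 0 < t -> derivable phi t 1.
  move=> t0; have [h _] := is_deriveM (is_derive_expRZ (- E) t) (is_derive_heat y t0).
  exact: h.
have cphi t : 0 < t -> {for t, continuous phi}.
  by move=> /dphi h; apply: differentiable_continuous; apply/derivable1_diffP.
have mphi (D : set mR) : measurable D -> measurable_fun D (EFin \o phi).
  move=> mD; apply: measurable_funTS; apply/mEFinP; apply: measurable_funM.
    by apply: measurable_expR_comp; apply: measurable_funM => //; exact: measurable_cst.
  by apply: measurable_heat => //; exact: measurable_cst.
have G0 : ((greenf E 0 y)%:E = \int[mu]_(t in `]0%R, +oo[) (phi t)%:E)%E.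
  rewrite /greenf Rintegral_hl /Rintegral fineK; last first.
    apply: integrable_fin_num; first exact: measurable_itv.
    exact/hl_integrable/greenf_integrable.
  by apply: eq_integral => t _; rewrite /phi !add0r.
have Ge : ((greenf E eta y)%:E = \int[mu]_(t in `[eta, +oo[) (phi t)%:E)%E.
  rewrite /greenf Rintegral_hl /Rintegral fineK; last first.
    apply: integrable_fin_num; first exact: measurable_itv.
    by apply/hl_integrable/greenf_integrable => //; exact: ltW.
  have ds (t : R) : is_derive t (1 : R) (fun s : R => eta + s) 1.
    have := is_deriveD (is_derive_cst eta t (1 : R)) (is_derive_id t (1 : R)).
    by move=> d; apply: is_derive_eq d _; rewrite add0r.
  rewrite integral_itv_obnd_cbnd; last first.
    apply: measurable_funTS; apply/mEFinP; apply: measurable_funM.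
      by apply: measurable_expR_comp; do !apply: measurable_funM => //; apply: measurable_funD.
    by apply: measurable_heat; [apply: measurable_funD|exact: measurable_cst].
  have dF : derive1 (fun s : R => eta + s) = cst 1.
    by apply/funext => t; rewrite derive1E; have [_ ->] := ds t.
  have H := @increasing_ge0_integration_by_substitutiony R (fun s => eta + s) phi 0.
  rewrite addr0 in H; rewrite H.
  - by apply: eq_integral => t _; rewrite /= dF mulr1.
  - by move=> a b _ _ ab; rewrite ltrD2l.
  - by rewrite dF => x _; exact: cst_continuous.
  - by rewrite dF; apply/cvg_ex; exists 1; exact: cvg_cst.
  - by rewrite dF; apply/cvg_ex; exists 1; exact: cvg_cst.
  - split; first by move=> t _; have [] := ds t.
    apply: cvg_at_right_filter; have [h _] := ds 0.
    by apply: differentiable_continuous; apply/derivable1_diffP.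
  - apply/cvgryPge => A; near=> t; rewrite -lerBlDl.
    by near: t; exact: nbhs_pinfty_ge (num_real _).
  - apply: continuous_in_subspaceT => t; rewrite inE/= in_itv/= andbT => et.
    by apply: cphi; apply: lt_le_trans et.
  - by move=> t; rewrite in_itv/= andbT => et; apply: phi0; apply: lt_trans et.
have S : (\int[mu]_(t in `]0%R, +oo[) (phi t)%:E =
    \int[mu]_(t in `]0%R, eta[) (phi t)%:E + \int[mu]_(t in `[eta, +oo[) (phi t)%:E)%E.
  rewrite (@itv_bndbnd_setU _ _ (BRight 0) (BLeft eta) +oo%O) ?bnd_simp//.
  have U : (`]0, eta[ `|` `[eta, +oo[ : set mR) = `]0, +oo[%classic.
    by rewrite -(@itv_bndbnd_setU _ _ (BRight 0) (BLeft eta) +oo%O) ?bnd_simp//.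
  rewrite ge0_integral_setU//.
  - by apply: mphi; apply: measurableU; exact: measurable_itv.
  - by move=> t; rewrite U /= in_itv/= andbT => t0; rewrite lee_fin phi0.
  - rewrite disj_set2E; apply/eqP; rewrite -subset0 => u [] /=.
    rewrite !in_itv/= andbT => /andP[_ us] su.
    by move: (le_lt_trans su us); rewrite ltxx.
have I0 : (0 <= \int[mu]_(t in `]0%R, eta[) (phi t)%:E)%E.
  by apply: integral_ge0 => t /=; rewrite in_itv/= => /andP[t0 _]; rewrite lee_fin phi0.
have hr : 0 <= hc * rad y by rewrite mulr_ge0 ?rad_ge0 ?(ltW hc_gt0).
have B : (\int[mu]_(t in `]0%R, eta[) (phi t)%:E <= (2 * (8 * eta `^ 8^-1) * hc * rad y)%:E)%E.
  apply: (@le_trans _ _ (\int[mu]_(t in `]0%R, eta[) ((hc * rad y)%:E * (t `^ (8^-1 - 1))%:E))%E).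
    apply: ge0_le_integral => //.
    - by move=> t /=; rewrite in_itv/= => /andP[t0 _]; rewrite lee_fin phi0.
    - by apply: mphi; exact: measurable_itv.
    - apply: measurable_funeM; apply/mEFinP; apply: measurable_funTS.
      exact: measurable_powR.
    - move=> t /=; rewrite in_itv/= => /andP[t0 _]; rewrite -EFinM lee_fin /phi.
      apply: (@le_trans _ _ (heat t y)).
        by rewrite ler_piMl ?heat_ge0// -expR0 ler_expR mulNr oppr_le0 mulr_ge0 ?ltW.
      by rewrite mulrAC; exact: heat_rad.
  rewrite ge0_integralZl//.
  - have H := @sing_powR R 8^-1 eta ltac:(by rewrite invr_gt0) e0.
    rewrite invrK in H.
    apply: (le_trans (lee_wpmul2l _ H)); first by rewrite lee_fin.
    by rewrite -EFinM lee_fin; apply: le_of_eq; ring.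
  - by apply/mEFinP; apply: measurable_funTS; exact: measurable_powR.
  - by move=> t _; rewrite lee_fin powR_ge0.
have key : (((greenf E 0 y - greenf E eta y)%:E = \int[mu]_(t in `]0%R, eta[) (phi t)%:E)%E).
  by rewrite EFinB G0 S -Ge addeK.
by rewrite -!lee_fin key I0 B.
Unshelve. all: by end_near. Qed.

End green_bounds.

(** * Weakly singular kernels on an interval *)

Section singular_kernel.
Context (R : realType).
Variables (L : R).
Hypothesis L_gt0 : 0 < L.
Notation D := (`[0, L]%classic : set mR).
Notation L2D := (L2r mu D).
Notation ipD := (ip mu D).
Implicit Types (f h : R -> R) (s u : R) (K : R -> R -> R).

Let mD : measurable D. Proof. exact: measurable_itv. Qed.

(** A bound for the integral of [sing s] uniform in s, as in Schur's test; [hs_c] is the bound for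
    its square, which controls images pointwise by Cauchy-Schwarz. *)
Definition schur_c : R := 4 * ((3 / 4)^-1 * L `^ (3 / 4)).
Definition hs_c : R := 4 * (2^-1^-1 * L `^ (2^-1)).

Definition sing_kernel K (B : R) :=
  [/\ measT (fun z : mR * mR => K z.1 z.2 : mR),
      forall s u, K s u = K u s
    & forall s u, D s -> D u -> `|K s u| <= B * sing s u].

Definition Qop K f s : R := Rint D (fun u => f u * K s u).

Lemma D_bound s : D s -> 0 <= s <= L. Proof. by rewrite /= in_itv. Qed.

Lemma sing_L2 s : D s -> L2D (sing s).
Proof.
move=> Ds; have [I _] := sing_sqr_integrable (D_bound Ds) L_gt0.
apply: int_L2r => //; apply: measurable_funTS; exact: measurable_sing.
Qed.

Lemma ip_sing s : D s -> ipD (sing s) (sing s) <= hs_c.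
Proof. by move=> Ds; have [_] := sing_sqr_integrable (D_bound Ds) L_gt0. Qed.

Lemma kernel_slice K B s : sing_kernel K B -> measT (K s : mR -> mR).
Proof. by move=> [mK _ _]; exact: (measurableT_comp mK (pair1_measurable s)). Qed.

Lemma kernel_L2 K B s : sing_kernel K B -> D s -> L2D (K s).
Proof.
move=> sK Ds; have mK := kernel_slice s sK; have [_ _ KB] := sK.
apply: (L2r_le mD _ _ (L2rZ mD B (sing_L2 Ds))); first exact: measurable_funTS.
by move=> u Du; apply: (le_trans (KB s u Ds Du)); exact: ler_norm.
Qed.

Lemma kernel_ip_le K B s : sing_kernel K B -> D s -> ipD (K s) (K s) <= B ^+ 2 * hs_c.
Proof.
move=> sK Ds; have [_ _ KB] := sK.
have LK := kernel_L2 sK Ds; have Ls := L2rZ mD B (sing_L2 Ds).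
have I : intg D (fun u => B ^+ 2 * (sing s u * sing s u)).
  exact: (integrableZl mD (B ^+ 2) (L2r_mul mD (sing_L2 Ds) (sing_L2 Ds))).
apply: (@le_trans _ _ (Rint D (fun u => B ^+ 2 * (sing s u * sing s u)))).
  apply: le_Rintegral => //; first exact: (L2r_mul mD LK LK).
  move=> u Du; have H := KB s u Ds Du.
  rewrite -expr2 -(real_normK (num_real (K s u))).
  rewrite (_ : B ^+ 2 * _ = (B * sing s u) ^+ 2); last by rewrite exprMn expr2.
  by rewrite ler_pXn2r ?nnegrE// (le_trans _ H).
rewrite (RintegralZl _ mD (L2r_mul mD (sing_L2 Ds) (sing_L2 Ds))).
by rewrite ler_wpM2l ?sqr_ge0//; exact: ip_sing.
Qed.

Lemma Qop_integrable K B f s : sing_kernel K B -> L2D f -> D s ->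
  intg D (fun u => f u * K s u).
Proof. by move=> sK Lf Ds; exact: L2r_mul Lf (kernel_L2 sK Ds). Qed.

Lemma Qop_sqr_le K B f s : sing_kernel K B -> L2D f -> D s ->
  Qop K f s ^+ 2 <= B ^+ 2 * hs_c * ipD f f.
Proof.
move=> sK Lf Ds; apply: (le_trans (ip_CS mD Lf (kernel_L2 sK Ds))).
by rewrite mulrC ler_wpM2r ?ip_ge0// kernel_ip_le.
Qed.

(** Extension by zero, so that iterated integrals over the square [0, L]^2 become integrals over the
    whole plane, where Tonelli and Fubini apply. *)
Definition restr f : R -> R := f \_ D.

Lemma restr_meas f : measurable_fun D (f : mR -> mR) -> measT (restr f : mR -> mR).
Proof. by move=> mf; apply/(measurable_restrictT _ _).1. Qed.

Lemma restr_int f : intg D f <-> mu.-integrable setT (EFin \o restr f).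
Proof. by rewrite /restr -restrict_EFin; exact: integrable_mkcond. Qed.

Lemma Rintegral_restr f : Rint D f = Rint setT (restr f).
Proof. exact: Rintegral_mkcond. Qed.

Lemma restrE f s : restr f s = if (0 <= s <= L) then f s else 0.
Proof.
rewrite /restr patchE; case: ifPn => [|].
  by rewrite inE/= in_itv/= => ->.
by rewrite notin_setE/= in_itv/= => /negP/negbTE ->.
Qed.

(** One half of Schur's test: after 2 |f(s) h(u)| <= f(s)^2 + h(u)^2 the free variable of each term
    is integrated against [sing] alone. *)
Lemma sing_half f : L2D f ->
  (\int[mu]_s \int[mu]_u (restr f s ^+ 2 * restr (cst 1) u * sing s u)%:E <= (schur_c * ipD f f)%:E)%E.
Proof.
move=> Lf; have [mf _] := Lf.
have mrf := restr_meas mf.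
have If := L2r_int_sqr Lf.
have m1 : measT (restr (cst 1) : mR -> mR) by apply: restr_meas; exact: measurable_cst.
have r1 u : 0 <= restr (cst 1) u by rewrite restrE; case: ifP.
have nn s u : 0 <= restr f s ^+ 2 * restr (cst 1) u * sing s u.
  by rewrite mulr_ge0 ?sing_ge0// mulr_ge0 ?sqr_ge0.
have C0 : 0 <= schur_c.
  by rewrite mulr_ge0// mulr_ge0 ?powR_ge0// invr_ge0 divr_ge0.
apply: (@le_trans _ _ (\int[mu]_s (schur_c%:E * (restr f s ^+ 2)%:E))%E).
  apply: ge0_le_integral => //.
  - by move=> s _; apply: integral_ge0 => u _; rewrite lee_fin nn.
  - apply: (@measurable_fun_fubini_tonelli_F _ _ _ _ _ mu
      (fun z : mR * mR => (restr f z.1 ^+ 2 * restr (cst 1) z.2 * sing z.1 z.2)%:E)).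
    apply/mEFinP; apply: measurable_funM; last exact: measurable_sing.
    apply: measurable_funM; last exact: (measurableT_comp m1 (@measurable_snd _ _ mR mR)).
      by apply: measurable_funX; exact: (measurableT_comp mrf (@measurable_fst _ _ mR mR)).
    by move=> z; rewrite lee_fin nn.
  - by apply: measurable_funeM; apply/mEFinP; exact: measurable_funX.
  move=> s _; rewrite [leRHS]muleC.
  have [Ds|nDs] := boolP (0 <= s <= L); last first.
    rewrite integral0_eq ?restrE ?(negbTE nDs) ?expr0n ?mul0e// => u _.
    by rewrite mul0r mul0r.
  have [Is Bs] := sing_integrable Ds L_gt0.
  under eq_integral do rewrite -mulrA EFinM.
  rewrite ge0_integralZl//; last 3 first.
  - apply/mEFinP; apply: measurable_funM => //.
    by apply: measurable_sing => //; exact: measurable_cst.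
  - by move=> u _; rewrite lee_fin mulr_ge0 ?sing_ge0.
  - by rewrite lee_fin sqr_ge0.
  apply: lee_wpmul2l; first by rewrite lee_fin sqr_ge0.
  apply: le_trans (_ : (Rint D (sing s))%:E <= _)%E; last by rewrite lee_fin.
  rewrite /Rintegral fineK; last exact: integrable_fin_num.
  rewrite [leRHS]integral_mkcond; apply: le_of_eq; apply: eq_integral => u _.
  rewrite restrE patchE; case: ifPn => Du; first by rewrite mem_set /= ?in_itv// mul1r.
  by rewrite memNset /= ?in_itv ?mul0r//; exact/negP.
rewrite ge0_integralZl//; last 2 first.
- by apply/mEFinP; exact: measurable_funX.
- by move=> s _; rewrite lee_fin sqr_ge0.
rewrite [leRHS]EFinM; apply: lee_wpmul2l; first by rewrite lee_fin.
rewrite (ip_sqr mD Lf) [leRHS]integral_mkcond; apply: le_of_eq; apply: eq_integral => u _.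
rewrite restrE patchE; case: ifPn => Du; first by rewrite mem_set /= ?in_itv.
by rewrite memNset /= ?in_itv ?expr0n//; exact/negP.
Qed.

Lemma sing_half_meas f : L2D f ->
  measT (fun z : mR * mR => (restr f z.1 ^+ 2 * restr (cst 1) z.2 * sing z.1 z.2)%:E).
Proof.
move=> [mf _]; have mrf := restr_meas mf.
have m1 : measT (restr (cst 1) : mR -> mR) by apply: restr_meas; exact: measurable_cst.
apply/mEFinP; apply: measurable_funM; last exact: measurable_sing.
apply: measurable_funM; last exact: (measurableT_comp m1 (@measurable_snd _ _ mR mR)).
by apply: measurable_funX; exact: (measurableT_comp mrf (@measurable_fst _ _ mR mR)).
Qed.

Lemma sing_half_ge0 f s u : 0 <= restr f s ^+ 2 * restr (cst 1) u * sing s u.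
Proof.
by rewrite mulr_ge0 ?sing_ge0// mulr_ge0 ?sqr_ge0// restrE; case: ifP.
Qed.

Lemma sing_half2 f : L2D f ->
  (\int[mu]_s \int[mu]_u (restr f u ^+ 2 * restr (cst 1) s * sing s u)%:E <= (schur_c * ipD f f)%:E)%E.
Proof.
move=> Lf; apply: le_trans (sing_half Lf).
have T := @fubini_tonelli _ _ _ _ _ mu mu
  (fun z : mR * mR => (restr f z.1 ^+ 2 * restr (cst 1) z.2 * sing z.1 z.2)%:E)
  (sing_half_meas Lf) (fun z => sing_half_ge0 f z.1 z.2).
rewrite /= in T; rewrite [leRHS]T; apply: le_of_eq.
by apply: eq_integral => s _; apply: eq_integral => u _; rewrite singC.
Qed.

Definition dform K f h (z : R * R) : R := restr f z.1 * restr h z.2 * K z.1 z.2.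

Lemma dform_meas K B f h : sing_kernel K B -> L2D f -> L2D h ->
  measT (dform K f h : mR * mR -> mR).
Proof.
move=> [mK _ _] [mf _] [mh _]; have mrf := restr_meas mf; have mrh := restr_meas mh.
apply: measurable_funM => //; apply: measurable_funM.
- exact: (measurableT_comp mrf (@measurable_fst _ _ mR mR)).
- exact: (measurableT_comp mrh (@measurable_snd _ _ mR mR)).
Qed.

Lemma dform_le K B f h s u : sing_kernel K B -> 0 <= B ->
  `|dform K f h (s, u)| <= B / 2 * (restr f s ^+ 2 * restr (cst 1) u * sing s u +
    restr h u ^+ 2 * restr (cst 1) s * sing s u).
Proof.
move=> [_ _ KB] B0; rewrite /dform/= !restrE.
case: ifPn => [Ds|_]; last by rewrite !(mul0r, normr0, mulr0, expr0n, addr0).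
case: ifPn => [Du|_]; last by rewrite !(mul0r, normr0, mulr0, expr0n, addr0).
rewrite !mulr1 normrM normrM.
have H : `|K s u| <= B * sing s u by apply: KB; rewrite /= in_itv.
have s0 := sing_ge0 s u.
apply: (@le_trans _ _ (`|f s| * `|h u| * (B * sing s u))).
  by rewrite ler_wpM2l// mulr_ge0.
rewrite (_ : B / 2 * _ = (f s ^+ 2 + h u ^+ 2) / 2 * (B * sing s u)); last by ring.
rewrite ler_wpM2r ?mulr_ge0// ler_pdivlMr// -[X in X + _](real_normK (num_real _)).
rewrite -[X in _ + X](real_normK (num_real _)) -subr_ge0.
by rewrite (_ : _ - _ = (`|f s| - `|h u|) ^+ 2) ?sqr_ge0//; ring.
Qed.

Lemma dform_abs_int K B f h : sing_kernel K B -> 0 <= B -> L2D f -> L2D h ->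
  (\int[mu]_s \int[mu]_u `|dform K f h (s, u)|%:E <= (B * schur_c * (ipD f f + ipD h h) / 2)%:E)%E.
Proof.
move=> sK B0 Lf Lh.
have mH1 := sing_half_meas Lf.
have mH2 : measT (fun z : mR * mR => (restr h z.2 ^+ 2 * restr (cst 1) z.1 * sing z.1 z.2)%:E).
  have [mh _] := Lh; have mrh := restr_meas mh.
  have m1 : measT (restr (cst 1) : mR -> mR) by apply: restr_meas; exact: measurable_cst.
  apply/mEFinP; apply: measurable_funM; last exact: measurable_sing.
  apply: measurable_funM; last exact: (measurableT_comp m1 (@measurable_fst _ _ mR mR)).
  by apply: measurable_funX; exact: (measurableT_comp mrh (@measurable_snd _ _ mR mR)).
have n1 := sing_half_ge0 f.
have n2 s u : 0 <= restr h u ^+ 2 * restr (cst 1) s * sing s u by rewrite singC sing_half_ge0.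
pose A z : \bar R := (restr f z.1 ^+ 2 * restr (cst 1) z.2 * sing z.1 z.2)%:E.
pose A' z : \bar R := (restr h z.2 ^+ 2 * restr (cst 1) z.1 * sing z.1 z.2)%:E.
have sl (G : mR * mR -> \bar R) s : measT G -> measT (fun u => G (s, u)).
  by move=> mG; exact: (measurableT_comp mG (pair1_measurable s)).
have mF (G : mR * mR -> \bar R) : measT G -> (forall z, 0 <= G z)%E ->
    measT (fun s => \int[mu]_u G (s, u))%E.
  by move=> mG G0; apply: (@measurable_fun_fubini_tonelli_F _ _ _ _ _ mu G).
have pA z : (0 <= A z)%E by rewrite lee_fin n1.
have pA' z : (0 <= A' z)%E by rewrite lee_fin n2.
have B2 : (0 <= (B / 2)%:E)%E by rewrite lee_fin divr_ge0.
apply: (@le_trans _ _ (\int[mu]_s ((B / 2)%:E * (\int[mu]_u A (s, u) + \int[mu]_u A' (s, u))))%E).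
  apply: ge0_le_integral => //.
  - by move=> s _; apply: integral_ge0.
  - apply: (mF (fun z => `|dform K f h z|%:E)) => //.
    by apply/mEFinP; apply: measurableT_comp => //; exact: dform_meas sK Lf Lh.
  - by apply: measurable_funeM; apply: emeasurable_funD; apply: mF.
  move=> s _; rewrite -ge0_integralD//; [|exact: sl|exact: sl].
  rewrite -ge0_integralZl//; last 2 first.
  - by apply: emeasurable_funD; exact: sl.
  - by move=> u _; exact: adde_ge0.
  apply: ge0_le_integral => //.
  - apply: (sl (fun z => `|dform K f h z|%:E)).
    by apply/mEFinP; apply: measurableT_comp => //; exact: dform_meas sK Lf Lh.
  - by apply: measurable_funeM; apply: emeasurable_funD; exact: sl.
  - by move=> u _; rewrite -EFinD -EFinM lee_fin; exact: dform_le.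
rewrite ge0_integralZl//; last 2 first.
- by apply: emeasurable_funD; apply: mF.
- by move=> s _; apply: adde_ge0; apply: integral_ge0.
rewrite ge0_integralD//; last 4 first.
- by move=> s _; apply: integral_ge0.
- exact: mF.
- by move=> s _; apply: integral_ge0.
- exact: mF.
apply: (le_trans (lee_wpmul2l B2 (leeD (sing_half Lf) (sing_half2 Lh)))).
by rewrite -EFinD -EFinM lee_fin; apply: le_of_eq; ring.
Qed.

Lemma dform_integrable K B f h : sing_kernel K B -> 0 <= B -> L2D f -> L2D h ->
  (mu \x mu)%E.-integrable setT (EFin \o dform K f h).
Proof.
move=> sK B0 Lf Lh; apply/integrable12ltyP.
  by apply/mEFinP; exact: dform_meas sK Lf Lh.
apply: (@le_lt_trans _ _ (B * schur_c * (ipD f f + ipD h h) / 2)%:E); last by rewrite ltry.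
exact: dform_abs_int.
Qed.

Lemma dform_slice K B f h s : sing_kernel K B -> L2D h ->
  (\int[mu]_u (dform K f h (s, u))%:E = (restr (fun s => f s * Qop K h s) s)%:E)%E.
Proof.
move=> sK Lh; rewrite restrE; case: ifPn => [Ds|nDs]; last first.
  by rewrite integral0_eq// => u _; rewrite /dform restrE/= (negbTE nDs) !mul0r.
have DDs : D s by rewrite /= in_itv.
have I := Qop_integrable sK Lh DDs.
rewrite EFinM -[Qop K h s]/(fine _) fineK; last exact: integrable_fin_num.
rewrite [in RHS]integral_mkcond -integralZl//; last first.
  by rewrite restrict_EFin; apply/restr_int.
apply: eq_integral => u _; rewrite restrict_EFin -/(restr _) -EFinM /dform !restrE/= Ds.
by case: ifP; rewrite ?mulrA// !(mulr0, mul0r).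
Qed.

Lemma Qop_mul_integrable K B f h : sing_kernel K B -> 0 <= B -> L2D f -> L2D h ->
  intg D (fun s => f s * Qop K h s).
Proof.
move=> sK B0 Lf Lh; apply/restr_int.
have I := integrable_fubini_F (dform_integrable sK B0 Lf Lh).
by apply: eq_integrable I => // s _; exact: (dform_slice f s sK Lh).
Qed.

Lemma int_cstD (c : R) : intg D (cst c : R -> R).
Proof.
apply/restr_int; have := indic_itv_int L c; apply: eq_integrable => // s _ /=.
rewrite restrE indicE; case: ifPn => h.
  by rewrite mem_set/= ?in_itv//= mulr1.
by rewrite memNset/= ?mulr0// in_itv/=; apply/negP.
Qed.

Lemma L2D_bounded f (M : R) : measurable_fun D (f : mR -> mR) -> (forall s, D s -> `|f s| <= M) ->
  L2D f.
Proof.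
move=> mf fM; apply: int_L2r => //.
apply: (int_le mD _ _ (int_cstD (M ^+ 2))); first exact: measurable_funX.
move=> s Ds; rewrite normrX ler_pXn2r ?nnegrE ?fM//.
by apply: le_trans (fM s Ds).
Qed.

Lemma L2D_cst (c : R) : L2D (cst c).
Proof. by apply: (@L2D_bounded _ `|c|); [exact: measurable_cst|]. Qed.

Lemma Qop_measurable K B h : sing_kernel K B -> 0 <= B -> L2D h ->
  measurable_fun D (Qop K h : mR -> mR).
Proof.
move=> sK B0 Lh; have /measurable_int/mEFinP := Qop_mul_integrable sK B0 (L2D_cst 1) Lh.
by apply: eq_measurable_fun => s _; rewrite mul1r.
Qed.

Lemma Qop_L2 K B h : sing_kernel K B -> 0 <= B -> L2D h -> L2D (Qop K h).
Proof.
move=> sK B0 Lh; apply: (@L2D_bounded _ (Num.sqrt (B ^+ 2 * hs_c * ipD h h))).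
  exact: (Qop_measurable sK B0 Lh).
move=> s Ds; rewrite -sqrtr_sqr ler_wsqrtr//; exact: Qop_sqr_le.
Qed.

Lemma ip_QopE K B f h : sing_kernel K B -> 0 <= B -> L2D f -> L2D h ->
  ((ipD f (Qop K h))%:E = \int[mu]_s \int[mu]_u (dform K f h (s, u))%:E)%E.
Proof.
move=> sK B0 Lf Lh; have I := Qop_mul_integrable sK B0 Lf Lh.
rewrite /ip /Rintegral fineK; last exact: integrable_fin_num.
rewrite integral_mkcond; apply: eq_integral => s _.
by rewrite restrict_EFin -/(restr _) (dform_slice f s sK Lh).
Qed.

Lemma Qop_sym K B f h : sing_kernel K B -> 0 <= B -> L2D f -> L2D h ->
  ipD f (Qop K h) = ipD h (Qop K f).
Proof.
move=> sK B0 Lf Lh; have [_ Ks _] := sK.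
suff : ((ipD f (Qop K h))%:E = (ipD h (Qop K f))%:E)%E by move=> [].
rewrite (ip_QopE sK B0 Lf Lh) (ip_QopE sK B0 Lh Lf).
have T := Fubini (dform_integrable sK B0 Lf Lh); rewrite /= in T; rewrite T.
apply: eq_integral => s _; apply: eq_integral => u _.
by rewrite /dform/= Ks (mulrC (restr f u)).
Qed.

Lemma schur_c_ge0 : 0 <= schur_c.
Proof. by rewrite mulr_ge0// mulr_ge0 ?powR_ge0// invr_ge0 divr_ge0. Qed.

Lemma hs_c_ge0 : 0 <= hs_c.
Proof. by rewrite mulr_ge0// mulr_ge0 ?powR_ge0// invrK. Qed.

Lemma Qop_bound K B f h : sing_kernel K B -> 0 <= B -> L2D f -> L2D h ->
  `|ipD f (Qop K h)| <= B * schur_c * (ipD f f + ipD h h) / 2.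
Proof.
move=> sK B0 Lf Lh; rewrite -lee_fin -[(`|_|)%:E]/(`|(ipD f (Qop K h))%:E|)%E (ip_QopE sK B0 Lf Lh).
have mG := dform_meas sK Lf Lh.
have mF (G : mR * mR -> \bar R) : measT G -> (forall z, 0 <= G z)%E ->
    measT (fun s => \int[mu]_u G (s, u))%E.
  by move=> mG0 G0; apply: (@measurable_fun_fubini_tonelli_F _ _ _ _ _ mu G).
have I := dform_integrable sK B0 Lf Lh.
apply: (@le_trans _ _ (\int[mu]_s \int[mu]_u `|dform K f h (s, u)|%:E)%E); last first.
  exact: dform_abs_int.
apply: (@le_trans _ _ (\int[mu]_s `|\int[mu]_u (dform K f h (s, u))%:E|)%E).
  by apply: le_abse_integral => //; exact: (measurable_int _ (integrable_fubini_F I)).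
apply: ge0_le_integral => //.
- by apply: measurableT_comp => //; exact: (measurable_int _ (integrable_fubini_F I)).
- by apply: (mF (fun z => `|dform K f h z|%:E)) => //; apply/mEFinP; exact: measurableT_comp.
- move=> s _; apply: le_abse_integral => //.
  by apply/mEFinP; exact: (measurableT_comp mG (pair1_measurable s)).
Qed.

Lemma Qop_schur K B f : sing_kernel K B -> 0 <= B -> L2D f ->
  `|ipD f (Qop K f)| <= B * schur_c * ipD f f.
Proof.
move=> sK B0 Lf; apply: (le_trans (Qop_bound sK B0 Lf Lf)).
by apply: le_of_eq; field.
Qed.

Lemma Qop_linear K B f h (a b : R) s : sing_kernel K B -> L2D f -> L2D h -> D s ->
  Qop K (fun u => a * f u + b * h u) s = a * Qop K f s + b * Qop K h s.
Proof.
move=> sK Lf Lh Ds; rewrite /Qop.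
rewrite (Rintegral_lin mD a b (Qop_integrable sK Lf Ds) (Qop_integrable sK Lh Ds)).
by apply: eq_Rintegral => u _; rewrite mulrDl !mulrA.
Qed.

Lemma Qop_ae K B f h s : measurable_fun D (f : mR -> mR) -> measurable_fun D (h : mR -> mR) ->
  sing_kernel K B -> ae_eq mu D f h -> D s -> Qop K f s = Qop K h s.
Proof.
move=> mf mh sK fh Ds; rewrite /Qop /Rintegral; congr fine.
have mK : measurable_fun D (K s : mR -> mR) by apply: measurable_funTS; exact: kernel_slice sK.
apply: ae_eq_integral => //.
- by apply/mEFinP; exact: measurable_funM.
- by apply/mEFinP; exact: measurable_funM.
- by apply: filterS fh => u H Du; rewrite /= (H Du).
Qed.

End singular_kernel.

Section test_lipschitz.
Context (R : realType).

Lemma test_lip (psi : R * R -> R) : test_fun psi -> exists2 K : R, 0 <= K &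
  forall z h : R * R, `|psi (h + z) - psi z| <= K * `|h|.
Proof.
move=> tp; have [sp _] := tp.
have [C1 H1] := test_bounded (test_D (e1 R) tp); have [C2 H2] := test_bounded (test_D (e2 R) tp).
have p1 : 0 <= C1 := le_trans (normr_ge0 _) (H1 0).
have p2 : 0 <= C2 := le_trans (normr_ge0 _) (H2 0).
exists (C1 + C2) => [|z h]; first exact: addr_ge0.
have dF s := is_derive_line (@smooth_derivable _ _ _ psi (z + s *: h) h sp).
have cF : continuous (fun s : R => psi (z + s *: h)).
  by move=> s; apply/differentiable_continuous/derivable1_diffP; have [] := dF s.
have [s s01 Hs] := MVT_segment ler01 (fun s _ => dF s) (continuous_subspaceT cF).
move: Hs; rewrite subr0 mulr1 scale1r scale0r addr0 (addrC z) => ->.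
rewrite derive_lin2; last exact: smooth_differentiable.
rewrite /lin2 (le_trans (ler_normD _ _))// mulrDl !normrM.
by apply: lerD; rewrite mulrC; apply: ler_pM; rewrite ?norm1_le ?norm2_le.
Qed.

End test_lipschitz.

(** * The Green kernel restricted to an arc *)

Section arc_kernel.
Context (R : realType).
Notation mR := (measurableTypeR R).
Variables (sigma : R -> R * R) (L c : R).
Notation D := (`[0, L]%classic : set mR).
Notation L2D := (L2r mu D).
Notation ipD := (ip mu D).

Hypotheses (L_gt0 : 0 < L) (c_gt0 : 0 < c).
Hypothesis msigma : measT (sigma : mR -> mR * mR).
Hypothesis chord_ge : forall s u, D s -> D u -> (c * (s - u)) ^+ 2 <= sqn (sigma s - sigma u).

Let mD : measurable D. Proof. exact: measurable_itv. Qed.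

Lemma chord_gt0 s u : D s -> D u -> s != u -> 0 < sqn (sigma s - sigma u).
Proof.
move=> Ds Du su; apply: lt_le_trans (chord_ge Ds Du).
by rewrite exprn_even_gt0//= mulf_neq0 ?subr_eq0// gt_eqF.
Qed.

Definition chord_c : R := (c `^ 4^-1)^-1.

Lemma chord_c_ge0 : 0 <= chord_c. Proof. by rewrite invr_ge0 powR_ge0. Qed.

Lemma rad_arc s u : D s -> D u -> s != u -> rad (sigma s - sigma u) <= chord_c * sing s u.
Proof.
move=> Ds Du su; have ch := chord_ge Ds Du; have ch0 := chord_gt0 Ds Du su.
have -> : chord_c * sing s u = (((c * (s - u)) ^+ 2) `^ 8^-1)^-1.
  rewrite -(real_normK (num_real (c * _))) normrM (gtr0_norm c_gt0).
  rewrite -powR_mulrn ?mulr_ge0 ?(ltW c_gt0)// -powRrM.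
  rewrite (_ : 2%:R * 8^-1 = 4^-1 :> R); last by field.
  by rewrite powRM ?(ltW c_gt0)// invfM /chord_c /sing powRN.
rewrite /rad lef_pV2 ?posrE ?powR_gt0//; last first.
  by rewrite exprn_even_gt0//= mulf_neq0 ?subr_eq0// gt_eqF.
by apply: ge0_ler_powR => //; rewrite nnegrE ?sqr_ge0// sqn_ge0.
Qed.

Variable (E : R).
Hypothesis E_gt0 : 0 < E.

Local Opaque lapc hc chord_c greenf heat.

(** On the diagonal [sing s s] is 0, since [powR] sends 0 to 0 for a nonzero exponent, so the bound
    required by [sing_kernel] forces the value 0 there. The diagonal is negligible in every
    integral. *)
Definition ker eta s u : R := if s == u then 0 else greenf E eta (sigma s - sigma u).

Lemma greenfN eta y : greenf E eta (- y) = greenf E eta y.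
Proof. by apply: eq_Rintegral => t _; rewrite /hl heatN. Qed.

Lemma measurable_greenf eta : 0 <= eta -> measT (greenf E eta : mR * mR -> mR).
Proof.
move=> e0.
pose G (z : mR * (mR * mR)) : \bar R := (hl (fun tau => expR (- E * (eta + tau)) * heat (eta + tau) z.2) z.1)%:E.
have mG : measT G.
  apply/mEFinP; apply: measurable_fun_ifT.
  - by apply: measurable_fun_ltr => //; exact: measurable_fst.
  - have ms : measT (fun z : mR * (mR * mR) => eta + z.1).
      by apply: measurable_funD => //; exact: measurable_fst.
    apply: measurable_funM; first by apply: measurable_expR_comp; apply: measurable_funM.
    by apply: measurable_heat => //; exact: measurable_snd.
  - exact: measurable_cst.
have G0 z : (0 <= G z)%E.
  rewrite lee_fin /hl; case: ifPn => // t0.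
  by rewrite mulr_ge0 ?expR_ge0 ?heat_ge0// ltr_wpDl.
have := @measurable_fun_fubini_tonelli_G _ _ _ _ _ mu G mG G0.
by move=> H; apply: (measurableT_comp _ H).
Qed.

Lemma ker_meas eta : 0 <= eta -> measT (fun z : mR * mR => ker eta z.1 z.2 : mR).
Proof.
move=> e0; apply: measurable_fun_ifT.
- by apply: measurable_fun_eqr.
- exact: measurable_cst.
- apply: (measurableT_comp (measurable_greenf e0)); apply: measurable_sub2.
    exact: (measurableT_comp msigma (@measurable_fst _ _ mR mR)).
  exact: (measurableT_comp msigma (@measurable_snd _ _ mR mR)).
Qed.

Lemma ker_ge0 eta s u : 0 <= eta -> 0 <= ker eta s u.
Proof. by move=> e0; rewrite /ker; case: eqP => // _; exact: greenf_ge0. Qed.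

Lemma kerC eta s u : ker eta s u = ker eta u s.
Proof. by rewrite /ker eq_sym -greenfN opprB. Qed.

Lemma lapc_ge0 : 0 <= lapc E.
Proof.
rewrite mulr_ge0 ?(ltW (hc_gt0 R))//; apply: Rintegral_ge0 => t _.
by rewrite /hl; case: ifP => // _; exact: lapw_ge0.
Qed.

Lemma ker_c_ge0 : 0 <= lapc E * chord_c.
Proof. exact: mulr_ge0 lapc_ge0 chord_c_ge0. Qed.

Lemma ker_sing : sing_kernel L (ker 0) (lapc E * chord_c).
Proof.
split; [exact: ker_meas|by move=> s u; exact: kerC|move=> s u Ds Du].
rewrite ger0_norm ?ker_ge0// /ker; case: eqVneq => [<-|su].
  by apply: mulr_ge0; [exact: ker_c_ge0|exact: sing_ge0].
apply: (le_trans (greenf0_le E_gt0 (chord_gt0 Ds Du su))).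
by rewrite -mulrA ler_wpM2l ?lapc_ge0// rad_arc.
Qed.

Definition shift_c eta : R := 2 * (8 * eta `^ 8^-1) * hc R * chord_c.

Lemma shift_d_ge0 eta : 0 <= 2 * (8 * eta `^ 8^-1) * hc R.
Proof. by apply: mulr_ge0; [rewrite !mulr_ge0// powR_ge0|exact: (ltW (hc_gt0 R))]. Qed.

Lemma shift_c_ge0 eta : 0 <= shift_c eta.
Proof. by apply: mulr_ge0 (shift_d_ge0 eta) chord_c_ge0. Qed.

(** The constant [shift_c eta] is O(eta^(1/8)): the part of the kernel due to times below [eta] is a
    small operator, both in the Schur sense and pointwise. *)
Lemma ker_diff_sing eta : 0 < eta ->
  sing_kernel L (fun s u => ker 0 s u - ker eta s u) (shift_c eta).
Proof.
move=> e0; split.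
- by apply: measurable_funB; apply: ker_meas => //; exact: ltW.
- by move=> s u; rewrite (kerC 0 s u) (kerC eta s u).
move=> s u Ds Du; rewrite /ker; case: eqVneq => [<-|su].
  by rewrite subrr normr0 mulr_ge0 ?sing_ge0 ?shift_c_ge0.
have /andP[h1 h2] := greenf_shift_le E_gt0 e0 (chord_gt0 Ds Du su).
rewrite ger0_norm//; apply: (le_trans h2); rewrite /shift_c -[leRHS]mulrA ler_wpM2l ?rad_arc//.
exact: shift_d_ge0.
Qed.

Lemma ker_eta_sing eta : 0 < eta -> sing_kernel L (ker eta) (lapc E * chord_c).
Proof.
move=> e0; have e0' := ltW e0; split; [exact: ker_meas|by move=> s u; exact: kerC|move=> s u Ds Du].
have [_ _ /(_ s u Ds Du)] := ker_sing.
rewrite (ger0_norm (ker_ge0 s u (lexx 0))) (ger0_norm (ker_ge0 s u e0')); apply: le_trans.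
rewrite /ker; case: eqVneq => // su.
have /andP[h1 _] := greenf_shift_le E_gt0 e0 (chord_gt0 Ds Du su).
by rewrite -subr_ge0.
Qed.

Lemma weight_out g s : weight L g -> ~ D s -> g s = 0.
Proof.
move=> [_ [M HM]] nD; apply/normr0_eq0/le_anti; rewrite normr_ge0 andbT.
by apply: (le_trans (HM s)); rewrite indicE memNset// mulr0.
Qed.

Lemma weight_restr g (f : R -> R) : weight L g ->
  Rint setT (fun s => g s * f s) = Rint D (fun s => g s * f s).
Proof.
move=> wg; rewrite (Rintegral_restr L); apply: eq_Rintegral => s _.
case: ifPn => // /negP nD.
by rewrite (weight_out wg) ?mul0r// => Ds; apply: nD; rewrite mem_set.
Qed.

Lemma weight_L2 g : weight L g -> L2D g.
Proof.
move=> wg; have [M M0 HM] := weight_bound wg; have [mg _] := wg.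
apply: (@L2D_bounded _ L g M); first exact: measurable_funTS.
by move=> s Ds; apply: (le_trans (HM s)); rewrite indicE mem_set// mulr1.
Qed.

Lemma NformE g h eta : weight L g -> weight L h -> 0 < eta ->
  Nform sigma E g h eta = ipD g (Qop L (ker eta) h).
Proof.
move=> wg wh e0; rewrite /Nform (weight_restr _ wg); apply: eq_Rintegral => s Ds; congr (_ * _).
rewrite (weight_restr _ wh) /Qop /Rintegral; congr fine.
have [mh _] := wh.
have mgr : measurable_fun D (fun u : mR => h u * greenf E eta (sigma u - sigma s)).
  apply: measurable_funTS; apply: measurable_funM => //.
  apply: (measurableT_comp (measurable_greenf (ltW e0))); exact: measurable_sub2.
apply: ae_eq_integral => //.
- exact/mEFinP.
- apply/mEFinP; apply: measurable_funM; first exact: measurable_funTS.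
  by apply: measurable_funTS; exact: kernel_slice (ker_eta_sing e0).
exists [set s]; split; [exact: measurable_set1|exact: lebesgue_measure_set1|].
move=> u /= H; apply: contrapT => us; apply: H => _.
rewrite /ker; case: eqVneq => [su|_]; first by case: us.
by rewrite -greenfN opprB.
Qed.

Lemma Qop_ker_diff h eta s : 0 < eta -> L2D h -> D s ->
  Qop L (fun s u => ker 0 s u - ker eta s u) h s = Qop L (ker 0) h s - Qop L (ker eta) h s.
Proof.
move=> eta0 Lh Ds.
have I1 := Qop_integrable L_gt0 (ker_eta_sing eta0) Lh Ds.
have I2 := Qop_integrable L_gt0 ker_sing Lh Ds.
have := Rintegral_lin mD 1 (-1) I2 I1; rewrite mul1r mulN1r /Qop => ->.
by apply: eq_Rintegral => u _; rewrite mul1r mulN1r mulrBr.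
Qed.

Lemma ip_ker_diff g h eta : 0 < eta -> L2D g -> L2D h ->
  ipD g (Qop L (fun s u => ker 0 s u - ker eta s u) h) =
  ipD g (Qop L (ker 0) h) - ipD g (Qop L (ker eta) h).
Proof.
move=> eta0 Lg Lh.
have L0 := Qop_L2 L_gt0 ker_sing ker_c_ge0 Lh.
have L1 := Qop_L2 L_gt0 (ker_eta_sing eta0) ker_c_ge0 Lh.
apply: etrans (ipBr mD L0 L1 Lg); apply: eq_Rintegral => s /set_mem Ds.
by congr (_ * _); exact: Qop_ker_diff.
Qed.

Lemma dist_le_of_sub (a b x e : R) : x = a - b -> `|x| <= e -> `|b - a| <= e.
Proof. by move=> ->; rewrite distrC. Qed.

Lemma Nform_cvg g h : weight L g -> weight L h -> forall e, 0 < e ->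
  exists2 d, 0 < d & forall eta, 0 < eta -> eta < d ->
    `|Nform sigma E g h eta - ipD g (Qop L (ker 0) h)| <= e.
Proof.
move=> wg wh e e0; have Lg := weight_L2 wg; have Lh := weight_L2 wh.
pose K := 2 * 8 * hc R * chord_c * schur_c L * (ipD g g + ipD h h) / 2.
have K0 : 0 <= K.
  rewrite /K divr_ge0// mulr_ge0 ?addr_ge0 ?ip_ge0// mulr_ge0 ?schur_c_ge0//.
  by rewrite mulr_ge0 ?chord_c_ge0// mulr_ge0 ?(ltW (hc_gt0 R)).
have : (fun t : R => t `^ 8^-1) @ 0^'+ --> (0 : R) by apply: powR_cvg0; rewrite invr_gt0.
move=> /cvgr0Pnorm_le/(_ (e / (K + 1))); rewrite divr_gt0 ?ltr_wpDl// => /(_ isT).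
move=> [d /= d0 Hd]; exists d => // eta eta0 etad.
have H : eta `^ 8^-1 <= e / (K + 1).
  have := Hd eta; rewrite /ball_ /= sub0r normrN gtr0_norm// => /(_ etad eta0).
  by rewrite ger0_norm ?powR_ge0.
rewrite (NformE wg wh eta0).
have sK := ker_diff_sing eta0.
have Ed := ip_ker_diff eta0 Lg Lh.
apply: (dist_le_of_sub Ed); apply: (le_trans (Qop_bound L_gt0 sK (shift_c_ge0 eta) Lg Lh)).
rewrite (_ : _ / 2 = K * eta `^ 8^-1); last by rewrite /K /shift_c; ring.
apply: (@le_trans _ _ ((K + 1) * eta `^ 8^-1)); first by rewrite ler_wpM2r ?powR_ge0// lerDl.
by rewrite mulrC -ler_pdivlMr// ltr_wpDl.
Qed.

End arc_kernel.

(** * Potentials of densities carried by an arc *)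

Section energy_space.
Context (R : realType).
Implicit Types (u w : R * R -> R).

Lemma energy_sub (E : R) u u1 u2 w w1 w2 : L2p u -> L2p u1 -> L2p u2 -> L2p w -> L2p w1 -> L2p w2 ->
  energy E (u \- w) (u1 \- w1) (u2 \- w2) (u \- w) (u1 \- w1) (u2 \- w2) =
  energy E u u1 u2 u u1 u2 - 2 * energy E u u1 u2 w w1 w2 + energy E w w1 w2 w w1 w2.
Proof.
move=> Lu Lu1 Lu2 Lw Lw1 Lw2; have S := ip_sub mT Lu Lw; have S1 := ip_sub mT Lu1 Lw1.
have S2 := ip_sub mT Lu2 Lw2.
apply: (etrans (congr2 +%R (congr2 +%R S1 S2) (congr1 ( *%R E) S))); rewrite /energy; ring.
Qed.

Lemma energy_comp (E : R) u u1 u2 : 0 < E -> [/\ ip2 u1 u1 <= energy E u u1 u2 u u1 u2,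
  ip2 u2 u2 <= energy E u u1 u2 u u1 u2 & E * ip2 u u <= energy E u u1 u2 u u1 u2].
Proof.
move=> E0; have h1 := ip_ge0 mu2 setT u1; have h2 := ip_ge0 mu2 setT u2.
have h0 : 0 <= E * ip2 u u by rewrite mulr_ge0 ?ip_ge0// ltW.
rewrite /energy; split.
- by rewrite -addrA lerDl addr_ge0.
- by rewrite addrAC lerDr addr_ge0.
- by rewrite lerDr addr_ge0.
Qed.

Lemma energy_ge0 (E : R) u u1 u2 : 0 < E -> 0 <= energy E u u1 u2 u u1 u2.
Proof.
by move=> E0; have [h _ _] := energy_comp u u1 u2 E0; apply: le_trans h; exact: ip_ge0.
Qed.

Lemma energy_cauchy (E : R) (u_ u1_ u2_ : nat -> R * R -> R) : 0 < E ->
  (forall e : R, 0 < e -> exists N, forall m n, (N <= m)%N -> (N <= n)%N ->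
    energy E (u_ m \- u_ n) (u1_ m \- u1_ n) (u2_ m \- u2_ n)
             (u_ m \- u_ n) (u1_ m \- u1_ n) (u2_ m \- u2_ n) <= e) ->
  [/\ cauchy2 mu2 setT u_, cauchy2 mu2 setT u1_ & cauchy2 mu2 setT u2_].
Proof.
move=> E0 H; split=> e e0.
- have [N HN] := H (E * e) (mulr_gt0 E0 e0); exists N => m n Nm Nn.
  rewrite -(ler_pM2l E0); apply: le_trans (HN m n Nm Nn).
  by have [_ _] := energy_comp (u_ m \- u_ n) (u1_ m \- u1_ n) (u2_ m \- u2_ n) E0.
- have [N HN] := H e e0; exists N => m n Nm Nn; apply: le_trans (HN m n Nm Nn).
  by have [] := energy_comp (u_ m \- u_ n) (u1_ m \- u1_ n) (u2_ m \- u2_ n) E0.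
- have [N HN] := H e e0; exists N => m n Nm Nn; apply: le_trans (HN m n Nm Nn).
  by have [] := energy_comp (u_ m \- u_ n) (u1_ m \- u1_ n) (u2_ m \- u2_ n) E0.
Qed.

Lemma energy_cvg (E : R) (u_ u1_ u2_ w_ w1_ w2_ : nat -> R * R -> R) u u1 u2 w w1 w2 :
  (forall n, L2p (u_ n)) -> (forall n, L2p (u1_ n)) -> (forall n, L2p (u2_ n)) ->
  (forall n, L2p (w_ n)) -> (forall n, L2p (w1_ n)) -> (forall n, L2p (w2_ n)) ->
  L2p u -> L2p u1 -> L2p u2 -> L2p w -> L2p w1 -> L2p w2 ->
  cvg2 mu2 setT u_ u -> cvg2 mu2 setT u1_ u1 -> cvg2 mu2 setT u2_ u2 ->
  cvg2 mu2 setT w_ w -> cvg2 mu2 setT w1_ w1 -> cvg2 mu2 setT w2_ w2 ->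
  (fun n => energy E (u_ n) (u1_ n) (u2_ n) (w_ n) (w1_ n) (w2_ n)) @ \oo -->
  energy E u u1 u2 w w1 w2.
Proof.
move=> Lu_ Lu1_ Lu2_ Lw_ Lw1_ Lw2_ Lu Lu1 Lu2 Lw Lw1 Lw2 cu cu1 cu2 cw cw1 cw2.
have C := cvg2_ip mT Lu_ Lu Lw_ Lw cu cw.
have C1 := cvg2_ip mT Lu1_ Lu1 Lw1_ Lw1 cu1 cw1.
have C2 := cvg2_ip mT Lu2_ Lu2 Lw2_ Lw2 cu2 cw2.
apply: cvgD; first exact: cvgD C1 C2.
by apply: cvgMl_tmp C.
Qed.

Lemma cvg2_weak_deriv v (u_ g_ : nat -> R * R -> R) u g :
  (forall n, L2p (u_ n)) -> (forall n, L2p (g_ n)) -> L2p u -> L2p g ->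
  cvg2 mu2 setT u_ u -> cvg2 mu2 setT g_ g ->
  (forall n, weak_deriv v (u_ n) (g_ n)) -> weak_deriv v u g.
Proof.
move=> Lu_ Lg_ Lu Lg cu cg wd phi tp.
have C := cvg2_ipr mT Lu_ Lu (test_L2r (test_D v tp)) cu.
have C' := cvgN (cvg2_ipr mT Lg_ Lg (test_L2r tp) cg).
apply: (cvg_unique _ C); first exact: Rhausdorff.
have EE : (fun n => ip2 (u_ n) (fun y => 'D_v phi y)) = - (fun n => ip2 (g_ n) phi).
  by apply/funext => n; exact: wd.
by rewrite /= EE; exact: C'.
Qed.

End energy_space.

Section heat_mollify.
Context (R : realType).

Lemma norm_sqn (z : R * R) : `|z| ^+ 2 <= sqn z.
Proof.
rewrite prod_normE /sqn /Num.max; case: ifP => _.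
  by rewrite real_normK ?num_real// lerDr sqr_ge0.
by rewrite real_normK ?num_real// lerDl sqr_ge0.
Qed.

Lemma heat_integrable (t : R) a : 0 < t -> mu2.-integrable setT (EFin \o (fun x => heat t (x - a))).
Proof.
move=> t0; have [C [mU _ HC]] := heat_bump t0; exact: L1_translate_bound mU (HC a).
Qed.

Lemma heat_Rint (t : R) a : 0 < t -> Rint2 (fun x => heat t (x - a)) = 1.
Proof. by move=> t0; rewrite /Rintegral heat_int. Qed.

Lemma heat_test (psi : R * R -> R) : test_fun psi -> exists2 K : R, 0 <= K &
  forall t a, 0 < t -> `|ip2 (fun x => heat t (x - a)) psi - psi a| <= K * Num.sqrt t.
Proof.
move=> tp; have [K K0 HK] := test_lip tp; have [M HM] := test_bounded tp.
exists (K * 4) => [|t a t0]; first by rewrite mulr_ge0.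
have t20 : 0 < 2 * t by rewrite mulr_gt0.
have I1 := heat_integrable a t0; have I2 := heat_integrable a t20.
have mh : measT (fun x : mR * mR => heat t (x - a) : mR).
  by apply/mEFinP; exact: (measurable_int _ I1).
have Ih : mu2.-integrable setT (EFin \o (fun x => heat t (x - a) * psi x)).
  apply: (int_le mT _ _ (integrableZl mT M I1)).
    by apply: measurable_funM => //; exact: test_measurable.
  move=> x _ /=; rewrite normrM mulrC (ger0_norm (heat_ge0 _ t0)).
  by apply: ler_wpM2r => //; exact: heat_ge0.
have Id := integrable_lin mT 1 (- psi a) Ih I1.
have Ed := Rintegral_lin mT 1 (- psi a) Ih I1.
have -> : ip2 (fun x => heat t (x - a)) psi - psi a =
    Rint2 (fun x => 1 * (heat t (x - a) * psi x) + - psi a * heat t (x - a)).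
  by rewrite -Ed heat_Rint// mulr1 mul1r.
apply: (le_trans (le_normr_Rintegral mT Id)).
have -> : K * 4 * Num.sqrt t = Rint2 (fun x => (K * 4 * Num.sqrt t) * heat (2 * t) (x - a)).
  by rewrite (RintegralZl _ mT I2) heat_Rint// mulr1.
apply: (le_Rintegral mT).
- exact: integrable_norm Id.
- exact: (integrableZl mT _ I2).
move=> x _; rewrite mul1r mulrC -mulrDl normrM (ger0_norm (heat_ge0 _ t0)).
have L := HK a (x - a); rewrite subrK in L.
apply: (le_trans (ler_wpM2r (heat_ge0 _ t0) L)).
have N := norm_heat_le t0 (norm_sqn (x - a)); rewrite normr_id in N.
by rewrite -!mulrA ler_wpM2l// mulrA.
Qed.

End heat_mollify.

(** * Potentials as limits when the cutoff tends to zero *)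

Section arc_potential.
Context (R : realType).
Variables (sigma : R -> R * R) (L c E : R).
Notation D := (`[0, L]%classic : set mR).
Notation ipD := (ip mu D).
Hypotheses (L_gt0 : 0 < L) (c_gt0 : 0 < c) (E_gt0 : 0 < E).
Hypothesis msigma : measT (sigma : mR -> mR * mR).
Hypothesis chord_ge : forall s u, D s -> D u -> (c * (s - u)) ^+ 2 <= sqn (sigma s - sigma u).
Implicit Types (g h : R -> R).
Local Opaque greenf greenDf heat.

(** The potential and its gradient are characterised as L2 limits along the cutoffs 1/(n + 1), so
    that every identity below passes to the limit from the regularised one. *)
Definition is_pot g p p1 p2 :=
  [/\ L2p p, L2p p1 & L2p p2] /\
  [/\ cvg2 mu2 setT (fun n => gpot sigma E g n.+1%:R^-1) p,
      cvg2 mu2 setT (fun n => gpot1 sigma E g n.+1%:R^-1) p1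
    & cvg2 mu2 setT (fun n => gpot2 sigma E g n.+1%:R^-1) p2].

Let eps n : 0 < n.+1%:R^-1 :> R. Proof. by rewrite invr_gt0. Qed.

Lemma gpot_L2 g eta : weight L g -> 0 < eta -> L2p (gpot sigma E g eta).
Proof. by move=> wg e0; have [C b] := green_bump E_gt0 e0; exact: (pot_L2 msigma wg b). Qed.

Lemma gpot1_L2 g eta : weight L g -> 0 < eta -> L2p (gpot1 sigma E g eta).
Proof.
move=> wg e0; have [C b] := greenD_bump E_gt0 e0 (or_introl (erefl (e1 R))).
exact: (pot_L2 msigma wg b).
Qed.

Lemma gpot2_L2 g eta : weight L g -> 0 < eta -> L2p (gpot2 sigma E g eta).
Proof.
move=> wg e0; have [C b] := greenD_bump E_gt0 e0 (or_intror (erefl (e2 R))).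
exact: (pot_L2 msigma wg b).
Qed.

Local Opaque gpot gpot1 gpot2 Nform Qop energy.

Lemma Nform_close g h e : weight L g -> weight L h -> 0 < e -> exists N, forall m n, (N <= m)%N -> (N <= n)%N ->
  `|Nform sigma E g h (n.+1%:R^-1 + m.+1%:R^-1) - ipD g (Qop L (ker sigma E 0) h)| <= e.
Proof.
move=> wg wh e0; have [d d0 Hd] := Nform_cvg L_gt0 c_gt0 msigma chord_ge E_gt0 wg wh e0.
have d20 : 0 < d / 2 by rewrite divr_gt0.
have /cvgr0Pnorm_lt/(_ _ d20) := @cvg_harmonic R.
move=> [N _ HN]; exists N => m n Nm Nn; apply: Hd; first exact: addr_gt0.
rewrite [ltRHS]splitr.
have := HN _ Nm; have := HN _ Nn; rewrite /= !ger0_norm//; exact: ltrD.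
Qed.

(** By [gpot_energy] the energy of a difference is x - 2 z + y, where x, y, z are values of [Nform]
    that are all close to the same limit; errors of e / 4 add up to e. *)
Lemma pot_exists g : weight L g -> exists p p1 p2, is_pot g p p1 p2.
Proof.
move=> wg.
have L0 n := gpot_L2 wg (eps n).
have L1 n := gpot1_L2 wg (eps n).
have L2' n := gpot2_L2 wg (eps n).
have [] := @energy_cauchy R E (fun n => gpot sigma E g n.+1%:R^-1) (fun n => gpot1 sigma E g n.+1%:R^-1)
  (fun n => gpot2 sigma E g n.+1%:R^-1) E_gt0.
  move=> e e0; have e40 : 0 < e / 4 by rewrite divr_gt0.
  have [N HN] := Nform_close wg wg e40; exists N => m n Nm Nn.
  have G a b := gpot_energy msigma E_gt0 wg wg (eps a) (eps b).
  have Es := energy_sub E (L0 m) (L1 m) (L2' m) (L0 n) (L1 n) (L2' n).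
  apply: (le_trans (_ : _ <= Nform sigma E g g (m.+1%:R^-1 + m.+1%:R^-1)
     - 2 * Nform sigma E g g (n.+1%:R^-1 + m.+1%:R^-1) + Nform sigma E g g (n.+1%:R^-1 + n.+1%:R^-1))).
    apply: le_of_eq; apply: (etrans Es).
    by apply: (congr2 +%R (congr2 +%R (G m m) (congr1 (fun z => - (2 * z)) (G m n))) (G n n)).
  have := HN m m Nm Nm; have := HN m n Nm Nn; have := HN n n Nn Nn.
  move: (Nform _ _ _ _ _) (Nform _ _ _ _ _) (Nform _ _ _ _ _) (ipD _ _) => x y z w.
  by rewrite !ler_norml => /andP[a1 a2] /andP[b1 b2] /andP[c1 c2]; clear -a1 a2 b1 b2 c1 c2; lra.
move=> C0 C1 C2.
have [p Lp cp] := L2_complete mT L0 C0.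
have [p1 Lp1 cp1] := L2_complete mT L1 C1.
have [p2 Lp2 cp2] := L2_complete mT L2' C2.
by exists p, p1, p2.
Qed.

Lemma is_pot_weak_deriv g p p1 p2 : weight L g -> is_pot g p p1 p2 ->
  weak_deriv (e1 R) p p1 /\ weak_deriv (e2 R) p p2.
Proof.
move=> wg [[Lp Lp1 Lp2] [cp cp1 cp2]].
have L0 n := gpot_L2 wg (eps n).
have L1 n := gpot1_L2 wg (eps n).
have L2' n := gpot2_L2 wg (eps n).
split.
- apply: (cvg2_weak_deriv L0 L1 Lp Lp1 cp cp1) => n.
  exact: (pot_weak_deriv msigma E_gt0 wg (eps n) (or_introl erefl)).
- apply: (cvg2_weak_deriv L0 L2' Lp Lp2 cp cp2) => n.
  exact: (pot_weak_deriv msigma E_gt0 wg (eps n) (or_intror erefl)).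
Qed.

Lemma is_pot_energy g p p1 p2 h q q1 q2 : weight L g -> weight L h ->
  is_pot g p p1 p2 -> is_pot h q q1 q2 ->
  energy E p p1 p2 q q1 q2 = ipD g (Qop L (ker sigma E 0) h).
Proof.
move=> wg wh [[Lp Lp1 Lp2] [cp cp1 cp2]] [[Lq Lq1 Lq2] [cq cq1 cq2]].
have L0 n := gpot_L2 wg (eps n).
have L1 n := gpot1_L2 wg (eps n).
have L2' n := gpot2_L2 wg (eps n).
have M0 n := gpot_L2 wh (eps n).
have M1 n := gpot1_L2 wh (eps n).
have M2 n := gpot2_L2 wh (eps n).
have C := @energy_cvg R E _ _ _ _ _ _ _ _ _ _ _ _ L0 L1 L2' M0 M1 M2 Lp Lp1 Lp2 Lq Lq1 Lq2 cp cp1 cp2 cq cq1 cq2.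
apply: (cvg_unique _ C); first exact: Rhausdorff.
apply/cvgrPdist_le => e e0; have [N HN] := Nform_close wg wh e0.
exists N => // n /= Nn; rewrite distrC.
have G := gpot_energy msigma E_gt0 wg wh (eps n) (eps n).
apply: le_trans (HN n n Nn Nn).
by apply: (eq_ind_r (fun z => `|z - _| <= _) _ G).
Qed.

Lemma cvg_of_le (F : R -> R) (l C : R) : (forall e, 0 < e -> `|F e - l| <= C * Num.sqrt e) ->
  (fun n => F n.+1%:R^-1) @ \oo --> l.
Proof.
move=> H; apply/subr_cvg0/norm_cvg0P.
have CS : (fun n : nat => C * Num.sqrt n.+1%:R^-1) @ \oo --> C * Num.sqrt 0.
  apply: cvgMl_tmp; exact: (continuous_cvg _ (@sqrt_continuous R 0) (@cvg_harmonic R)).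
rewrite sqrtr0 mulr0 in CS.
apply: (@squeeze_cvgr _ _ _ _ (cst 0) _ _ _ _ _ CS); last exact: cvg_cst.
by apply: nearW => n; rewrite normr_ge0 H.
Qed.

Local Transparent energy.

(** The potential solves (-Laplacian + E) p = g times arc length on the arc. In the regularised
    identity the heat kernel tends to a point mass at rate sqrt eta. *)
Lemma is_pot_test g p p1 p2 phi : weight L g -> is_pot g p p1 p2 -> test_fun phi ->
  energy E p p1 p2 phi (fun x => 'D_(e1 R) phi x) (fun x => 'D_(e2 R) phi x) =
  ipD g (phi \o sigma).
Proof.
move=> wg [[Lp Lp1 Lp2] [cp cp1 cp2]] tp.
have L0 n := gpot_L2 wg (eps n).
have L1 n := gpot1_L2 wg (eps n).
have L2' n := gpot2_L2 wg (eps n).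
have T0 := test_L2r tp; have T1 := test_L2r (test_D (e1 R) tp); have T2 := test_L2r (test_D (e2 R) tp).
have C0 := cvg2_ipr mT L0 Lp T0 cp; have C1 := cvg2_ipr mT L1 Lp1 T1 cp1.
have C2 := cvg2_ipr mT L2' Lp2 T2 cp2.
have CE : (fun n => E * ip2 (gpot sigma E g n.+1%:R^-1) phi) @ \oo --> E * ip2 p phi.
  by apply: cvgMl_tmp C0.
have C : (fun n => energy E (gpot sigma E g n.+1%:R^-1) (gpot1 sigma E g n.+1%:R^-1)
    (gpot2 sigma E g n.+1%:R^-1) phi (fun x => 'D_(e1 R) phi x) (fun x => 'D_(e2 R) phi x)) @ \oo -->
    energy E p p1 p2 phi (fun x => 'D_(e1 R) phi x) (fun x => 'D_(e2 R) phi x).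
  exact: (cvgD (cvgD C1 C2) CE).
apply: (cvg_unique _ C); first exact: Rhausdorff.
have [K K0 HK] := heat_test tp; have [M M0 HM] := weight_bound wg; have [mg _] := wg.
have [B HB] := test_bounded tp; have mphi := test_measurable tp.
have Iphi : intg setT (fun s => g s * phi (sigma s)).
  apply: (int_le mT _ _ (indic_itv_int L (M * B))).
    by apply: measurable_funM => //; exact: measurableT_comp mphi msigma.
  move=> s _; rewrite normrM -mulrA [B * _]mulrC mulrA.
  by apply: ler_pM.
pose F eta := ip2 (pot sigma g (@heat R eta)) phi.
have HF eta : 0 < eta -> `|F eta - ipD g (phi \o sigma)| <= M * L * K * Num.sqrt eta.
  move=> e0; have [Ch bh] := heat_bump e0.
  have [Qh Ih] := pot_ip msigma wg bh mphi HB.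
  have -> : ipD g (phi \o sigma) = Rint setT (fun s => g s * phi (sigma s)).
    by rewrite (weight_restr (phi \o sigma) wg).
  have Ed := Rintegral_lin mT 1 (-1) Ih Iphi; have Id := integrable_lin mT 1 (-1) Ih Iphi.
  rewrite /F Qh; rewrite mul1r mulN1r in Ed; rewrite Ed.
  apply: (le_trans (le_normr_Rintegral mT Id)).
  have -> : M * L * K * Num.sqrt eta =
      Rint setT (fun s => (M * K * Num.sqrt eta) * \1_(`[0, L]%classic : set R) s).
    have I1 : intg setT (\1_(`[0, L]%classic : set mR) : mR -> R).
      by have := indic_itv_int L 1; under eq_fun do rewrite mul1r.
    rewrite (RintegralZl _ mT I1) /Rintegral integral_indic// setIT.
    rewrite (_ : fine _ = L); first by ring.
    apply: (eq_ind_r (fun x => fine x = L) _ (@lebesgue_measure_itv R `[0, L])).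
    by rewrite /= lte_fin L_gt0 oppr0 adde0.
  apply: (le_Rintegral mT); [exact: integrable_norm Id|exact: indic_itv_int|move=> s _].
  rewrite mul1r mulN1r -mulrBr normrM.
  have ac (x y z w : R) : x * y * (z * w) <= x * z * w * y by apply: le_of_eq; ring.
  by apply: (le_trans (ler_pM _ _ (HM s) (HK eta (sigma s) e0)) (ac _ _ _ _)).
have CF : (fun n => F n.+1%:R^-1) @ \oo --> ipD g (phi \o sigma).
  apply: (cvg_of_le HF).
have Ce : (fun n : nat => expR (- E * n.+1%:R^-1)) @ \oo --> (1 : R).
  have CN : (fun n : nat => - E * n.+1%:R^-1) @ \oo --> - E * 0 by apply: cvgMl_tmp (@cvg_harmonic R).
  have C1' : (fun n : nat => expR (- E * n.+1%:R^-1)) @ \oo --> expR (- E * 0).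
    by apply: (continuous_cvg _ (@continuous_expR R (- E * 0)) CN).
  by move: C1'; rewrite mulr0 expR0.
have CC : (fun n => expR (- E * n.+1%:R^-1) * F n.+1%:R^-1) @ \oo --> 1 * ipD g (phi \o sigma).
  exact: (cvgM Ce CF).
have EE : (fun n => energy E (gpot sigma E g n.+1%:R^-1) (gpot1 sigma E g n.+1%:R^-1)
    (gpot2 sigma E g n.+1%:R^-1) phi (fun x => 'D_(e1 R) phi x) (fun x => 'D_(e2 R) phi x)) =
    (fun n => expR (- E * n.+1%:R^-1) * F n.+1%:R^-1).
  by apply/funext => n; exact: (pot_energy_test msigma E_gt0 wg (eps n) tp).
by rewrite mul1r in CC; rewrite /= EE.
Qed.

End arc_potential.

(** * Limits along an ultrafilter *)

Section ultra.
Context (R : realType).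

(** Compactness of a closed bounded interval. A single ultrafilter yields limits of all sequences n
    |-> Q f_n(s) simultaneously, for every point s, so no diagonal extraction is made. *)
Lemma ultra_bounded (U : set_system nat) (u : nat -> R) (M : R) : UltraFilter U -> (forall n, `|u n| <= M) ->
  exists l : R, forall e, 0 < e -> U [set n | `|u n - l| <= e].
Proof.
move=> UU uM.
have cpt := @segment_compact R (- M) M.
have FM : (u @ U) `[- M, M]%classic.
  rewrite /fmap/= (_ : _ @^-1` _ = setT); first exact: filterT.
  by apply/seteqP; split=> // n _; rewrite /= in_itv/= -ler_norml.
have [l [_ cl]] := cpt (u @ U) _ FM.
exists l => e e0; have [//|UC] := in_ultra_setVsetC [set n | `|u n - l| <= e] UU.
have [y [yb ye]] := cl [set y | ~ (`|y - l| <= e)] (ball l e) UC (nbhsx_ballx l e e0).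
by exfalso; apply: yb; rewrite distrC ltW.
Qed.

End ultra.

Section perron_arith.
Context (R : realType).
Implicit Types (L e S a b x : R).

(** For e <= 1 the terms in e^2 are absorbed in terms in e, which is the linear form that
    [le_of_lin] lets tend to zero. *)
Lemma perron_aux L e S a b : 0 <= L -> 0 <= e -> e <= 1 -> 0 <= S ->
  a <= S ^+ 2 * (2 * (e ^+ 2 * L) + 2 * (2 * S * e)) -> b <= S ^+ 2 * (e ^+ 2 * L) ->
  2 * a + 2 * b <= 0 + (4 * S ^+ 2 * (2 * L + 4 * S) + 2 * S ^+ 2 * L) * e.
Proof.
move=> L0 e0 e1 S0 ha hb.
have eL : e ^+ 2 * L <= e * L by rewrite ler_wpM2r// expr2 ler_piMr.
have S2 : 0 <= S ^+ 2 := sqr_ge0 S.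
have h1 := ler_wpM2l S2 eL.
have h2 : 0 <= S ^+ 2 * (e * L) by rewrite !mulr_ge0.
have h3 : 0 <= S ^+ 2 * (S * e) by rewrite !mulr_ge0.
nra.
Qed.

Lemma perron_aux2 L e S x : 0 <= L -> 0 <= e -> e <= 1 -> 0 <= S ->
  S - x <= e -> x ^+ 2 <= 2 * (e ^+ 2 * L) -> S ^+ 2 <= 0 + (2 * S + 2 * L) * e.
Proof.
move=> L0 e0 e1 S0 hx hq.
have eL : e ^+ 2 * L <= e * L by rewrite ler_wpM2r// expr2 ler_piMr.
have h1 := sqr_ge0 x.
have [xS|xS] := leP e S; last by nra.
have h2 : (S - e) ^+ 2 <= x ^+ 2 by rewrite lerXn2r ?nnegrE; lra.
have : 0 <= e * e by rewrite mulr_ge0.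
nra.
Qed.

End perron_arith.

(** * Perron maximizers *)

Section perron.
Context (R : realType).
Variables (L : R).
Hypothesis L_gt0 : 0 < L.
Notation D := (`[0, L]%classic : set mR).
Notation L2D := (L2r mu D).
Notation ipD := (ip mu D).
Implicit Types (f h : R -> R) (s u : R).

Let mD : measurable D. Proof. exact: measurable_itv. Qed.

Lemma Rint_cstD (c : R) : Rint D (cst c) = c * L.
Proof.
rewrite /Rintegral (_ : (fun x => _) = cst c%:E)// integral_cst//.
apply: (eq_ind_r (fun x => fine (c%:E * x)%E = c * L) _ (@lebesgue_measure_itv R `[0, L])).
by rewrite /= lte_fin L_gt0 oppr0 adde0.
Qed.

Variables (K : R -> R -> R) (B : R).
Hypotheses (sK : sing_kernel L K B) (B_ge0 : 0 <= B).
Notation Q := (Qop L K).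
Notation q f h := (ipD f (Q h)).

Lemma Q_L2 f : L2D f -> L2D (Q f). Proof. exact: Qop_L2 sK B_ge0. Qed.

Lemma q_sym f h : L2D f -> L2D h -> q f h = q h f. Proof. exact: (Qop_sym L_gt0 sK B_ge0). Qed.

Lemma q_lin f h h' (a b : R) : L2D f -> L2D h -> L2D h' ->
  q f (fun u => a * h u + b * h' u) = a * q f h + b * q f h'.
Proof.
move=> Lf Lh Lh'; have I1 := L2r_mul mD Lf (Q_L2 Lh); have I2 := L2r_mul mD Lf (Q_L2 Lh').
rewrite /ip (Rintegral_lin mD a b I1 I2); apply: eq_Rintegral => s /set_mem Ds.
by rewrite (Qop_linear L_gt0 a b sK Lh Lh' Ds) /=; ring.
Qed.

Lemma L2D_lin (a b : R) f h : L2D f -> L2D h -> L2D (fun u => a * f u + b * h u).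
Proof. move=> Lf Lh; exact: (L2rD mD (L2rZ mD a Lf) (L2rZ mD b Lh)). Qed.

Lemma q_lin2 f h (a b : R) : L2D f -> L2D h ->
  q (fun u => a * f u + b * h u) (fun u => a * f u + b * h u) =
  a ^+ 2 * q f f + 2 * a * b * q f h + b ^+ 2 * q h h.
Proof.
move=> Lf Lh; have L1 := L2D_lin a b Lf Lh.
rewrite (q_lin a b L1 Lf Lh) (q_sym L1 Lf) (q_sym L1 Lh) (q_lin a b Lf Lf Lh) (q_lin a b Lh Lf Lh).
rewrite (q_sym Lh Lf).
by move: (q f f) (q f h) (q h h) => x y z; ring.
Qed.

Lemma ip_lin2 f h (a b : R) : L2D f -> L2D h ->
  ipD (fun u => a * f u + b * h u) (fun u => a * f u + b * h u) =
  a ^+ 2 * ipD f f + 2 * a * b * ipD f h + b ^+ 2 * ipD h h.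
Proof.
move=> Lf Lh; have La := L2rZ mD a Lf; have Lb := L2rZ mD b Lh.
rewrite (ip_add mD La Lb) (ipZl mD a Lf La) (ipZr mD a Lf Lf) (ipZl mD a Lf Lb) (ipZr mD b Lh Lf).
by rewrite (ipZl mD b Lh Lb) (ipZr mD b Lh Lh); ring.
Qed.

Definition qsup : R := sup [set x | exists f, [/\ L2D f, ipD f f <= 1 & x = q f f]].

Lemma qsup_has : has_sup [set x | exists f, [/\ L2D f, ipD f f <= 1 & x = q f f]].
Proof.
split.
  exists (q (cst 0) (cst 0)), (cst 0); split => //; first exact: L2D_cst.
  by rewrite /ip; under eq_Rintegral do rewrite mul0r; rewrite Rint_cstD mul0r.
exists (B * schur_c L) => _ [f [Lf f1 ->]]; apply: (le_trans (ler_norm _)).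
apply: (le_trans (Qop_schur L_gt0 sK B_ge0 Lf)); rewrite -[leRHS]mulr1.
by apply: ler_wpM2l => //; rewrite mulr_ge0// schur_c_ge0.
Qed.

Lemma qsup_ge f : L2D f -> ipD f f <= 1 -> q f f <= qsup.
Proof. by move=> Lf f1; apply: ub_le_sup; [exact: qsup_has.2|exists f]. Qed.

Lemma q_le f : L2D f -> q f f <= qsup * ipD f f.
Proof.
move=> Lf; have [f0|f0] := eqVneq (ipD f f) 0.
  rewrite f0 mulr0; apply: (le_trans (ler_norm _)).
  by apply: (le_trans (Qop_schur L_gt0 sK B_ge0 Lf)); rewrite f0 mulr0.
have fp : 0 < ipD f f by rewrite lt_neqAle eq_sym f0 ip_ge0.
have sp : 0 < Num.sqrt (ipD f f) by rewrite sqrtr_gt0.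
pose c := (Num.sqrt (ipD f f))^-1.
have cc : c ^+ 2 = (ipD f f)^-1 by rewrite exprVn sqr_sqrtr// ltW.
have L1 := L2D_lin c 0 Lf Lf.
have H : q (fun u => c * f u + 0 * f u) (fun u => c * f u + 0 * f u) <= qsup.
  apply: qsup_ge => //; rewrite (ip_lin2 c 0 Lf Lf) cc mulr0 expr0n/= !mul0r !addr0 mulVf//.
move: H; rewrite (q_lin2 c 0 Lf Lf) cc mulr0 expr0n/= !mul0r !addr0.
by rewrite ler_pdivrMl// mulrC.
Qed.

Hypothesis K_ge0 : forall s u, 0 <= K s u.

(** Replacing f by |f| keeps the norm and can only increase the form, because the kernel is
    nonnegative; so the supremum also controls negative values of the form. *)
Lemma q_norm_le f : L2D f -> `|q f f| <= qsup * ipD f f.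
Proof.
move=> Lf; have Ln := L2r_norm mD Lf.
have -> : ipD f f = ipD (fun x => `|f x|) (fun x => `|f x|).
  by apply: eq_Rintegral => s _; rewrite -normrM ger0_norm// -expr2 sqr_ge0.
apply: le_trans (q_le Ln); have I1 := L2r_mul mD Lf (Q_L2 Lf).
apply: (le_trans (le_normr_Rintegral mD I1)); apply: (le_Rintegral mD).
- exact: integrable_norm I1.
- exact: (L2r_mul mD Ln (Q_L2 Ln)).
move=> s Ds; rewrite normrM; apply: ler_wpM2l => //.
have I2 := Qop_integrable L_gt0 sK Lf Ds.
apply: (le_trans (le_normr_Rintegral mD I2)); apply: (le_Rintegral mD).
- exact: integrable_norm I2.
- exact: (Qop_integrable L_gt0 sK Ln Ds).
by move=> u _; rewrite normrM (ger0_norm (K_ge0 _ _)).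
Qed.

(** Polarisation with S f + Q f and S f - Q f, where S = [qsup]: their forms differ by 4 S |Q f|^2
    and are bounded by S times their squared norms. The bound on the form becomes a bound on the
    operator norm. *)
Lemma Q_norm_le f : 0 < qsup -> L2D f -> ipD (Q f) (Q f) <= qsup ^+ 2 * ipD f f.
Proof.
move=> S0 Lf; set S := qsup in S0 *; have LQ := Q_L2 Lf.
have Lp := L2D_lin S 1 Lf LQ; have Lm := L2D_lin S (-1) Lf LQ.
have h1 := q_norm_le Lp; have h2 := q_norm_le Lm.
have {h1} := le_trans (ler_norm _) h1; have {h2} := le_trans (lerNnormlW h2) (lexx _).
rewrite (q_lin2 S 1 Lf LQ) (q_lin2 S (-1) Lf LQ) (ip_lin2 S 1 Lf LQ) (ip_lin2 S (-1) Lf LQ).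
rewrite (q_sym Lf LQ) -/S; clear -S0.
move: (ipD f f) (q f f) (ipD f (Q f)) (ipD (Q f) (Q f)) (q (Q f) (Q f)) => a b c d e h1 h2.
have : 4 * S * d <= 2 * S * (S ^+ 2 * a + d) by nra.
by rewrite -(ler_pM2l S0); nra.
Qed.

Lemma res_aux (S a b d : R) : a <= S * S * d -> S * S * d <= S * S ->
  a - 2 * (S * b) + S * (S * d) <= 2 * S * (S - b).
Proof. by move=> H1 H2; lra. Qed.

(** Near-maximisers are approximate eigenfunctions: expand |Q f - S f|^2 and use that the operator
    norm is at most S. *)
Lemma Q_res_le f : 0 < qsup -> L2D f -> ipD f f <= 1 ->
  ipD (Q f \- (fun x => qsup * f x)) (Q f \- (fun x => qsup * f x)) <= 2 * qsup * (qsup - q f f).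
Proof.
move=> S0 Lf f1; have LQ := Q_L2 Lf; have LS := L2rZ mD qsup Lf.
rewrite (ip_sub mD LQ LS) (ipZr mD qsup Lf LQ) (ipZl mD qsup Lf LS) (ipZr mD qsup Lf Lf).
rewrite (ipC mu D (Q f) f); have := Q_norm_le S0 Lf.
move: (ipD (Q f) (Q f)) (q f f) (ipD f f) f1 => a b d f1 H.
have H2 : qsup ^+ 2 * d <= qsup ^+ 2 by rewrite ler_piMr// sqr_ge0.
rewrite expr2 in H H2; move: (qsup) H H2 => S H H2; exact: res_aux H H2.
Qed.

(** Equicontinuity of the image of the unit ball carries the compactness of the operator; for the
    Green kernel it is [ker_equi]. *)
Hypothesis equi : forall e, 0 < e -> exists2 d, 0 < d & forall f s s', L2D f -> ipD f f <= 1 ->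
  D s -> D s' -> `|s - s'| < d -> `|Q f s - Q f s'| <= e.
Variable (delta : R).
Hypotheses (delta_gt0 : 0 < delta) (K_ge : forall s u, D s -> D u -> s != u -> delta <= K s u).

Lemma L2D_int f : L2D f -> intg D f.
Proof.
move=> Lf; have := L2r_mul mD Lf (L2D_cst L 1); apply: eq_integrable => // s _ /=.
by rewrite mulr1.
Qed.

Lemma Q_lower f s : L2D f -> (forall u, D u -> 0 <= f u) -> D s -> delta * Rint D f <= Q f s.
Proof.
move=> Lf f0 Ds; have If := L2D_int Lf; have I1 := Qop_integrable L_gt0 sK Lf Ds.
rewrite -(RintegralZl _ mD If) /Q.
(* The lower bound is known only off the diagonal; altering one value makes it hold everywhere
   without changing the integral. *)
pose K' u := if u == s then delta else K s u.
have EK : Rint D (fun u => f u * K s u) = Rint D (fun u => f u * K' u).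
  rewrite /Rintegral; congr fine; have [mf _] := Lf; have mKs := kernel_slice s sK.
  apply: ae_eq_integral => //.
  - by have /measurable_int := I1.
  - apply/mEFinP; apply: measurable_funM => //; apply: measurable_funTS.
    apply: measurable_fun_ifT => //; apply: measurable_fun_eqr => //.
  exists [set s]; split; [exact: measurable_set1|exact: lebesgue_measure_set1|].
  by move=> u /= H; apply: contrapT => us; apply: H => _; rewrite /K'; case: eqVneq => // us'; case: us.
have I2 : intg D (fun u => f u * K' u).
  have I3 : intg D (fun u => f u * K s u + delta * f u).
    by have := integrable_lin mD 1 delta I1 If; apply: eq_integrable => // u _ /=; rewrite mul1r.
  apply: (int_le mD _ _ I3).
    have [mf _] := Lf; have mKs := kernel_slice s sK.
    apply: measurable_funM => //; apply: measurable_funTS.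
    by apply: measurable_fun_ifT => //; apply: measurable_fun_eqr.
  move=> u Du; rewrite normrM (ger0_norm (f0 u Du)) /K'; case: eqVneq => [->|_].
    by rewrite ger0_norm ?(ltW delta_gt0)// mulrC lerDr mulr_ge0// f0.
  by rewrite ger0_norm// lerDl mulr_ge0 ?f0// ltW.
rewrite EK; apply: (le_Rintegral mD) => //.
- exact: (integrableZl mD delta If).
move=> u Du; rewrite mulrC; apply: ler_wpM2l; first exact: f0.
by rewrite /K'; case: eqVneq => // us; apply: K_ge => //; rewrite eq_sym.
Qed.

Lemma q_lower f : L2D f -> (forall u, D u -> 0 <= f u) -> delta * Rint D f ^+ 2 <= q f f.
Proof.
move=> Lf f0; have If := L2D_int Lf.
rewrite expr2 mulrA -(RintegralZl _ mD If); apply: (le_Rintegral mD).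
- exact: (integrableZl mD _ If).
- exact: (L2r_mul mD Lf (Q_L2 Lf)).
by move=> s Ds; rewrite mulrC; apply: ler_wpM2l; [exact: f0|exact: Q_lower].
Qed.

Lemma qsup_ge_lower : delta * L <= qsup.
Proof.
have L1 := L2D_cst L 1; have := q_le L1.
have -> : ipD (cst 1) (cst 1) = L.
  by rewrite /ip; under eq_Rintegral do rewrite mulr1; rewrite Rint_cstD mul1r.
have := q_lower L1 (fun _ _ => ler01); rewrite Rint_cstD mul1r expr2 mulrA => h1 h2.
by have := le_trans h1 h2; rewrite ler_pM2r.
Qed.

Lemma qsup_gt0 : 0 < qsup.
Proof. by apply: lt_le_trans qsup_ge_lower; rewrite mulr_gt0. Qed.

Lemma maximizing_seq n : exists f, [/\ L2D f, ipD f f <= 1, forall s, 0 <= f s & qsup - q f f <= n.+1%:R^-1].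
Proof.
have e0 : 0 < n.+1%:R^-1 :> R by rewrite invr_gt0.
have [_ [f [Lf f1 ->]] Hf] := sup_adherent e0 qsup_has.
have Ln := L2r_norm mD Lf; exists (fun x => `|f x|); split => //.
  rewrite (_ : ipD _ _ = ipD f f)//.
  by apply: eq_Rintegral => s _; rewrite -normrM ger0_norm// -expr2 sqr_ge0.
rewrite lerBlDr -lerBlDl; apply: le_trans (ltW Hf) _.
have I1 := L2r_mul mD Lf (Q_L2 Lf); apply: (le_Rintegral mD) => //.
  exact: (L2r_mul mD Ln (Q_L2 Ln)).
move=> s Ds; apply: (le_trans (ler_norm _)); rewrite normrM; apply: ler_wpM2l => //.
have I2 := Qop_integrable L_gt0 sK Lf Ds.
apply: (le_trans (le_normr_Rintegral mD I2)); apply: (le_Rintegral mD).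
- exact: integrable_norm I2.
- exact: (Qop_integrable L_gt0 sK Ln Ds).
by move=> u _; rewrite normrM (ger0_norm (K_ge0 _ _)).
Qed.

Lemma sqr1D_ge (x : R) : 0 <= x -> x <= (1 + x) ^+ 2.
Proof. by move=> x0; nra. Qed.

Lemma le_of_lin (x y C : R) : (forall e, 0 < e -> e <= 1 -> x <= y + C * e) -> x <= y.
Proof.
move=> H; apply/ler_addgt0Pl => k k0.
have e0 : 0 < Num.min 1 (k / (`|C| + 1)) by rewrite lt_min ltr01 divr_gt0.
apply: (le_trans (H _ e0 _)); first by rewrite ge_min lexx.
rewrite addrC lerD2r; apply: (@le_trans _ _ ((`|C| + 1) * Num.min 1 (k / (`|C| + 1)))).
  by rewrite ler_wpM2r ?(ltW e0)// (le_trans (ler_norm _))// lerDl.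
by rewrite mulrC -ler_pdivlMr// ge_min lexx orbT.
Qed.

(** The argument of Arzela and Ascoli: pointwise limits along an ultrafilter inherit the modulus of
    continuity, and closeness on a finite net spreads to the whole interval. *)
Lemma Q_unif_limit (f_ : nat -> R -> R) : (forall n, L2D (f_ n)) -> (forall n, ipD (f_ n) (f_ n) <= 1) ->
  exists h : R -> R, forall e N, 0 < e -> exists2 n, (N <= n)%N & forall s, D s -> `|Q (f_ n) s - h s| <= e.
Proof.
move=> Lf f1.
have [U [UU UF]] := @ultraFilterLemma nat \oo _; have PU : ProperFilter U by exact: ultra_proper.
pose C := 1 + B ^+ 2 * hs_c L.
have bnd n s : D s -> `|Q (f_ n) s| <= C.
  move=> Ds; have H := Qop_sqr_le L_gt0 sK (Lf n) Ds.
  have b0 : 0 <= B ^+ 2 * hs_c L by rewrite mulr_ge0 ?sqr_ge0 ?hs_c_ge0.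
  have H2 : Q (f_ n) s ^+ 2 <= B ^+ 2 * hs_c L.
    by apply: (le_trans H); rewrite ler_piMr.
  rewrite -(@ler_pXn2r _ 2)// ?nnegrE ?addr_ge0// real_normK ?num_real//.
  by apply: (le_trans H2); exact: sqr1D_ge.
have C0 : 0 <= C by rewrite addr_ge0// mulr_ge0 ?sqr_ge0 ?hs_c_ge0.
have /choice[h hP] : forall s, exists l : R, D s -> forall e, 0 < e -> U [set n | `|Q (f_ n) s - l| <= e].
  move=> s; have [Ds|nD] := pselect (D s); last by exists 0.
  have [l Hl] := @ultra_bounded R U (fun n => Q (f_ n) s) C UU (fun n => bnd n s Ds).
  by exists l => _.
exists h => e N e0; have e30 : 0 < e / 3 by rewrite divr_gt0.
have [d d0 Hd] := equi e30.
have heq s s' : D s -> D s' -> `|s - s'| < d -> `|h s - h s'| <= e / 3.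
  move=> Ds Ds' ss'; apply/ler_addgt0Pl => k k0; have k20 : 0 < k / 2 by rewrite divr_gt0.
  have [n [/= H1 H2]] := filter_ex (filterI (hP s Ds _ k20) (hP s' Ds' _ k20)).
  have H3 := Hd (f_ n) s s' (Lf n) (f1 n) Ds Ds' ss'.
  move: H1 H2 H3; move: (Q _ _) (Q _ _) (h s) (h s') => a b x y; clear.
  rewrite !ler_norml => /andP[? ?] /andP[? ?] /andP[? ?]; apply/andP; split; lra.
(* The net consists of the multiples of [d]; taking the minimum with L keeps its points in the
   interval. *)
pose m := Num.truncn (L / d).
have net s : D s -> exists2 i : 'I_m.+1, D (Num.min L (i%:R * d)) & `|s - Num.min L (i%:R * d)| < d.
  move=> /=; rewrite in_itv/= => /andP[s0 sL].
  have sd0 : 0 <= s / d by rewrite divr_ge0// ltW.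
  have /andP[t1 t2] := truncn_itv sd0.
  have ti : (Num.truncn (s / d) < m.+1)%N by rewrite ltnS /m le_truncn// ler_pM2r ?invr_gt0.
  have h1 : (Num.truncn (s / d))%:R * d <= s by rewrite -ler_pdivlMr.
  have h2 : s < (Num.truncn (s / d))%:R * d + d by move: t2; rewrite ltr_pdivrMr// -natr1 mulrDl mul1r.
  exists (Ordinal ti) => /=; rewrite (min_idPr (le_trans h1 sL)).
    by rewrite in_itv/= (le_trans h1 sL) mulr_ge0// ltW.
  by rewrite ger0_norm ?subr_ge0// ltrBlDl.
have UN : U [set n | (N <= n)%N] by apply: UF; exists N.
have UA : \forall n \near U, forall i : 'I_m.+1, D (Num.min L (i%:R * d)) ->
    `|Q (f_ n) (Num.min L (i%:R * d)) - h (Num.min L (i%:R * d))| <= e / 3.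
  apply: filter_forall => i; have [Di|nD] := pselect (D (Num.min L (i%:R * d))).
    by apply: filterS (hP _ Di _ e30).
  by apply: filterS UN => n _ /nD.
have [n [/= Nn Hn]] := filter_ex (filterI UN UA).
exists n => // s Ds; have [i Di si] := net s Ds.
have H1 := Hn i Di; have H2 := Hd (f_ n) _ _ (Lf n) (f1 n) Ds Di si; have H3 := heq _ _ Ds Di si.
move: H1 H2 H3; move: (Q _ _) (Q _ _) (h _) (h _) => a b x y; clear.
rewrite !ler_norml => /andP[? ?] /andP[? ?] /andP[? ?]; apply/andP; split; lra.
Qed.

Lemma sup_ip_le f (e : R) : L2D f -> (forall s, D s -> `|f s| <= e) -> ipD f f <= e ^+ 2 * L.
Proof.
move=> Lf fe; rewrite -Rint_cstD; apply: (le_Rintegral mD).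
- exact: (L2r_mul mD Lf Lf).
- exact: (int_cstD L (e ^+ 2)).
move=> s Ds; rewrite -expr2 -(real_normK (num_real (f s))) /cst.
have := fe s Ds => h; by rewrite lerXn2r ?nnegrE ?(le_trans _ h).
Qed.

(** A maximising sequence of nonnegative functions has images that converge uniformly, along
    suitable indices, to some h; since the sequence nearly satisfies Q f = S f, the limit satisfies
    Q h = S h in L2. Uniform bounds from below come from the positivity of the kernel. *)
Lemma perron : exists g m M, [/\ 0 < m, L2D g, forall s, D s -> m <= g s <= M
  & forall s, D s -> Q g s = qsup * g s].
Proof.
have S0 := qsup_gt0; have [f_ Hf] := choice maximizing_seq.
have Lf n : L2D (f_ n) by have [] := Hf n.
have f1 n : ipD (f_ n) (f_ n) <= 1 by have [] := Hf n.
have f0 n s : 0 <= f_ n s by have [] := Hf n.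
have fq n : qsup - q (f_ n) (f_ n) <= n.+1%:R^-1 by have [] := Hf n.
have [h Hh] := Q_unif_limit Lf f1.
have LQ n := Q_L2 (Lf n).
(* For each n some index has error at most 1/(n + 1) uniformly, so h is a pointwise limit of
   measurable functions. *)
have mh : measurable_fun D (h : mR -> mR).
  have /choice[k Hk] : forall n : nat, exists k, forall s, D s -> `|Q (f_ k) s - h s| <= n.+1%:R^-1.
    by move=> n; have [|k _ Hk] := Hh n.+1%:R^-1 0%N; [rewrite invr_gt0|exists k].
  apply: (@measurable_fun_cvg _ _ _ D (fun n => Q (f_ (k n)))) => //.
    by move=> n; have [] := LQ (k n).
  move=> s Ds; apply/subr_cvg0/norm_cvg0P.
  apply: (@squeeze_cvgr _ _ _ _ (cst 0) _ _ _ _ _ (@cvg_harmonic R)); last exact: cvg_cst.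
  by apply: nearW => n /=; rewrite normr_ge0 Hk.
have [M M0 hM] : exists2 M, 0 < M & forall s, D s -> `|h s| <= M.
  have [//|n _ Hn] := Hh 1 0%N.
  have b0 : 0 <= B ^+ 2 * hs_c L by rewrite mulr_ge0 ?sqr_ge0 ?hs_c_ge0.
  exists (2 + B ^+ 2 * hs_c L) => [|s Ds]; first by rewrite ltr_wpDr.
  have H2 : Q (f_ n) s ^+ 2 <= B ^+ 2 * hs_c L.
    by apply: (le_trans (Qop_sqr_le L_gt0 sK (Lf n) Ds)); rewrite ler_piMr.
  have H3 : `|Q (f_ n) s| <= 1 + B ^+ 2 * hs_c L.
    rewrite -(@ler_pXn2r _ 2)// ?nnegrE ?addr_ge0// real_normK ?num_real//.
    exact: (le_trans H2 (sqr1D_ge b0)).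
  have := Hn s Ds; rewrite distrC => H4.
  rewrite -(subrK (Q (f_ n) s) (h s)); apply: (le_trans (ler_normD _ _)).
  by rewrite -[2]/(1 + 1) -addrA lerD.
have Lh : L2D h by apply: (L2D_bounded mh hM).
have h0 s : D s -> 0 <= h s.
  move=> Ds; apply: (@le_of_lin _ _ 1) => e e0 _; rewrite mul1r.
  have [n _ Hn] := Hh e 0%N e0; have := Hn s Ds; rewrite ler_norml => /andP[_ H].
  have q0 : 0 <= Q (f_ n) s by apply: Rintegral_ge0 => u _; rewrite mulr_ge0.
  by rewrite lerBlDr addrC in H; exact: le_trans q0 H.
have near_h e : 0 < e -> exists n, [/\ n.+1%:R^-1 <= e & ipD (Q (f_ n) \- h) (Q (f_ n) \- h) <= e ^+ 2 * L].
  move=> e0; have /cvgr0Pnorm_le/(_ _ e0)[N _ HN] := @cvg_harmonic R.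
  have [n Nn Hn] := Hh e N e0; exists n; split.
    by have := HN n Nn; rewrite /= ger0_norm.
  by apply: sup_ip_le => //; exact: (L2rB mD (LQ n) Lh).
have Qh : ipD (Q h \- (fun x => qsup * h x)) (Q h \- (fun x => qsup * h x)) = 0.
  apply/le_anti; rewrite ip_ge0 andbT.
  apply: (@le_of_lin _ _ (4 * qsup ^+ 2 * (2 * L + 4 * qsup) + 2 * qsup ^+ 2 * L)) => e e0 e1.
  have [n [n1 n2]] := near_h e e0.
  have LS := L2rZ mD qsup (Lf n); have LSh := L2rZ mD qsup Lh; have LQh := Q_L2 Lh.
  have A1 : ipD (h \- (fun x => qsup * f_ n x)) (h \- (fun x => qsup * f_ n x)) <=
      2 * (e ^+ 2 * L) + 2 * (2 * qsup * e).
    apply: (le_trans (ip_sub_le2 mD Lh (LQ n) LS)).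
    apply: lerD; (apply: ler_wpM2l; first by []).
      by rewrite ip_subC.
    apply: (le_trans (Q_res_le S0 (Lf n) (f1 n))); apply: ler_wpM2l; first by rewrite mulr_ge0// ltW.
    exact: (le_trans (fq n) n1).
  have Ld := L2rB mD Lh LS.
  have LSQ := L2rZ mD qsup (LQ n).
  apply: (le_trans (ip_sub_le2 mD LQh LSQ LSh)).
  have A2 : ipD (Q h \- (fun x => qsup * Q (f_ n) x)) (Q h \- (fun x => qsup * Q (f_ n) x)) <=
      qsup ^+ 2 * (2 * (e ^+ 2 * L) + 2 * (2 * qsup * e)).
    apply: (le_trans _ (ler_wpM2l (sqr_ge0 _) A1)); apply: (le_trans _ (Q_norm_le S0 Ld)).
    apply: le_of_eq; apply: eq_Rintegral => s /set_mem Ds /=.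
    have := Qop_linear L_gt0 1 (- qsup) sK Lh (Lf n) Ds; rewrite mul1r mulNr => <-.
    by congr (_ * _); apply: eq_Rintegral => u _ /=; rewrite mul1r mulNr.
  have A3 : ipD ((fun x => qsup * Q (f_ n) x) \- (fun x => qsup * h x))
      ((fun x => qsup * Q (f_ n) x) \- (fun x => qsup * h x)) <= qsup ^+ 2 * (e ^+ 2 * L).
    apply: (le_trans _ (ler_wpM2l (sqr_ge0 _) n2)).
    have Ldd := L2rB mD (LQ n) Lh; have LSd := L2rZ mD qsup Ldd.
    apply: le_of_eq; rewrite expr2 -mulrA.
    apply: (etrans _ (congr1 ( *%R qsup) (ipZl mD qsup Ldd Ldd))).
    apply: (etrans _ (ipZr mD qsup Ldd LSd)).
    by apply: eq_Rintegral => s _ /=; rewrite -!mulrBr.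
  move: A2 A3; move: (ipD _ _) (ipD _ _) => a b A2 A3.
  exact: (perron_aux (ltW L_gt0) (ltW e0) e1 (ltW S0) A2 A3).
(* If h were zero, the images would tend to zero in norm, while by Cauchy-Schwarz their norms
   dominate values of the form that tend to S > 0. *)
have hh : 0 < ipD h h.
  rewrite lt_neqAle ip_ge0 andbT; apply/eqP => hh0.
  have : qsup ^+ 2 <= 0.
    apply: (@le_of_lin _ _ (2 * qsup + 2 * L)) => e e0 e1; have [n [n1 n2]] := near_h e e0.
    have C1 := ip_CS mD (Lf n) (LQ n).
    have C2 : q (f_ n) (f_ n) ^+ 2 <= ipD (Q (f_ n)) (Q (f_ n)).
      by apply: (le_trans C1); rewrite ler_piMl ?ip_ge0.
    have L0 : L2D (cst 0) := L2D_cst L 0.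
    have C3 : ipD (Q (f_ n)) (Q (f_ n)) <= 2 * (e ^+ 2 * L).
      have := ip_sub_le2 mD (LQ n) Lh L0.
      have E1 (w : R -> R) : ipD (w \- cst 0) (w \- cst 0) = ipD w w.
        by apply: eq_Rintegral => s _ /=; rewrite subr0.
      rewrite !E1 -hh0 mulr0 addr0 => C3; apply: (le_trans C3).
      by apply: ler_wpM2l.
    have := fq n => h1; have h2 := le_trans h1 n1.
    move: (q _ _) C2 h2 => x C2 h2; have C4 := le_trans C2 C3.
    exact: (perron_aux2 (ltW L_gt0) (ltW e0) e1 (ltW S0) h2 C4).
  by rewrite leNgt exprn_gt0.
have Ih := L2D_int Lh.
have ih : 0 < Rint D h.
  have : ipD h h <= M * Rint D h.
    rewrite -(RintegralZl _ mD Ih); apply: (le_Rintegral mD).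
    - exact: (L2r_mul mD Lh Lh).
    - exact: (integrableZl mD M Ih).
    by move=> s Ds; apply: ler_wpM2r; [exact: h0|exact: le_trans (ler_norm _) (hM s Ds)].
  by move=> H; have := lt_le_trans hh H; rewrite pmulr_rgt0.
have LQh := Q_L2 Lh; have LSh := L2rZ mD qsup Lh.
(* The relation Q h = S h holds only almost everywhere; applying Q once more gives an eigenfunction
   at every point, with pointwise bounds on both sides. *)
exists (Q h), (delta * Rint D h), (1 + B ^+ 2 * hs_c L * ipD h h); split => //.
- exact: mulr_gt0.
- move=> s Ds; rewrite Q_lower//=; apply: (le_trans (ler_norm _)).
  have b0 : 0 <= B ^+ 2 * hs_c L * ipD h h by rewrite mulr_ge0 ?ip_ge0// mulr_ge0 ?sqr_ge0 ?hs_c_ge0.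
  rewrite -(@ler_pXn2r _ 2)// ?nnegrE ?addr_ge0// real_normK ?num_real//.
  exact: (le_trans (Qop_sqr_le L_gt0 sK Lh Ds) (sqr1D_ge b0)).
move=> s Ds.
have AE : ae_eq mu D (Q h) (fun x => qsup * h x).
  have := ip_eq0_ae mD (L2rB mD LQh LSh) Qh.
  by apply: filterS => x /= H Dx; apply/eqP; rewrite -subr_eq0; apply/eqP; exact: H.
rewrite (Qop_ae _ _ sK AE Ds); [|by have [] := LQh|by have [] := LSh].
have := Qop_linear L_gt0 qsup 0 sK Lh Lh Ds; rewrite mul0r addr0 => <-.
by apply: eq_Rintegral => u _; rewrite mul0r addr0.
Qed.

End perron.

(** * Comparison of the suprema of two kernels *)

Section compare.
Context (R : realType).
Variables (L : R).
Hypothesis L_gt0 : 0 < L.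
Notation D := (`[0, L]%classic : set mR).
Notation L2D := (L2r mu D).
Notation ipD := (ip mu D).
Implicit Types (f h : R -> R) (s u : R) (K : R -> R -> R).

Let mD : measurable D. Proof. exact: measurable_itv. Qed.

Lemma Rint_indic_itv (a b c : R) : 0 <= a -> a <= b -> b <= L ->
  Rint D (fun s => c * \1_(`[a, b]%classic : set R) s) = c * (b - a) /\
  intg D (fun s => c * \1_(`[a, b]%classic : set R) s).
Proof.
move=> a0 ab bL.
have I1 : intg D (\1_(`[a, b]%classic : set mR) : mR -> R).
  apply: (integrableS mT mD) => //; apply: int_indic; first exact: measurable_itv.
  apply: (eq_ind_r (fun x => (x < +oo)%E) _ (@lebesgue_measure_itv R `[a, b])).
  by case: ifP; rewrite ?ltry// -EFinB ltry.
split; last exact: (integrableZl mD c I1).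
rewrite (RintegralZl _ mD I1) /Rintegral integral_indic//.
rewrite (_ : _ `&` _ = `[a, b]%classic); last first.
  apply/seteqP; split=> [x [] //|x /= H]; split => //; move: H; rewrite /= !in_itv/= => /andP[h1 h2].
  by rewrite (le_trans a0 h1) (le_trans h2 bL).
congr (_ * _); apply: (eq_ind_r (fun x => fine x = b - a) _ (@lebesgue_measure_itv R `[a, b])) => /=.
rewrite lte_fin; case: ltP => [_|ba]; first by rewrite -EFinB.
by rewrite (@le_anti _ _ a b) ?subrr// ab.
Qed.

Lemma sub_sing K1 K2 B1 B2 : sing_kernel L K1 B1 -> sing_kernel L K2 B2 ->
  sing_kernel L (fun s u => K2 s u - K1 s u) (B2 + B1).
Proof.
move=> [m1 s1 b1] [m2 s2 b2]; split.
- exact: measurable_funB.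
- by move=> s u; rewrite s1 s2.
- move=> s u Ds Du; apply: (le_trans (ler_normB _ _)); rewrite mulrDl.
  by apply: lerD; [exact: b2|exact: b1].
Qed.

Section two.
Variables (K1 K2 : R -> R -> R) (B1 B2 : R).
Hypotheses (sK1 : sing_kernel L K1 B1) (sK2 : sing_kernel L K2 B2) (B10 : 0 <= B1) (B20 : 0 <= B2).
Notation K3 := (fun s u => K2 s u - K1 s u).
Let sK3 := sub_sing sK1 sK2.
Let B30 : 0 <= B2 + B1. Proof. exact: addr_ge0. Qed.

Lemma q_sub f h : L2D f -> L2D h ->
  ipD f (Qop L K3 h) = ipD f (Qop L K2 h) - ipD f (Qop L K1 h).
Proof.
move=> Lf Lh; apply: etrans (ipBr mD (Qop_L2 L_gt0 sK2 B20 Lh) (Qop_L2 L_gt0 sK1 B10 Lh) Lf).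
apply: eq_Rintegral => s /set_mem Ds; congr (_ * _).
have := Rintegral_lin mD 1 (-1) (Qop_integrable L_gt0 sK2 Lh Ds) (Qop_integrable L_gt0 sK1 Lh Ds).
rewrite mul1r mulN1r /Qop /= => ->.
by apply: eq_Rintegral => u _; rewrite mul1r mulN1r mulrBr.
Qed.

Lemma ip_abs f : ipD (fun x => `|f x|) (fun x => `|f x|) = ipD f f.
Proof. by apply: eq_Rintegral => s _; rewrite -normrM ger0_norm// -expr2 sqr_ge0. Qed.

Lemma q_sub_norm (C : R) f : 0 <= C -> (forall s u, D s -> D u -> `|K3 s u| <= C) ->
  L2D f -> `|ipD f (Qop L K3 f)| <= C * L * ipD f f.
Proof.
move=> C0 KC Lf; have Ln := L2r_norm mD Lf; have If := L2D_int Ln.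
have LQ := Qop_L2 L_gt0 sK3 B30 Lf; have I1 := L2r_mul mD Lf LQ.
set I := Rint D (fun x => `|f x|).
have QI s : D s -> `|Qop L K3 f s| <= C * I.
  move=> Ds; have I2 := Qop_integrable L_gt0 sK3 Lf Ds.
  apply: (le_trans (le_normr_Rintegral mD I2)); rewrite -(RintegralZl _ mD If).
  apply: (le_Rintegral mD); [exact: integrable_norm I2|exact: (integrableZl mD C If)|].
  by move=> u Du; rewrite normrM mulrC; apply: ler_wpM2r => //; exact: KC.
apply: (@le_trans _ _ (C * I * I)).
  apply: (le_trans (le_normr_Rintegral mD I1)); rewrite -(RintegralZl _ mD If).
  apply: (le_Rintegral mD); [exact: integrable_norm I1|exact: (integrableZl mD _ If)|].
  by move=> s Ds; rewrite /= normrM mulrC; apply: ler_wpM2r => //; exact: QI.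
rewrite -!mulrA; apply: ler_wpM2l => //.
have := ip_CS mD (L2D_cst L 1) Ln; rewrite ip_abs.
rewrite (_ : ipD (cst 1) _ = I); last by apply: eq_Rintegral => s _; rewrite mul1r.
rewrite (_ : ipD (cst 1) (cst 1) = L); first by rewrite expr2.
by rewrite /ip; under eq_Rintegral do rewrite mulr1; rewrite Rint_cstD// mul1r.
Qed.

Hypotheses (K1_ge0 : forall s u, 0 <= K1 s u) (K2_ge0 : forall s u, 0 <= K2 s u).

Lemma q_abs_le f : L2D f -> ipD f (Qop L K1 f) <= ipD (fun x => `|f x|) (Qop L K1 (fun x => `|f x|)).
Proof.
move=> Lf; have Ln := L2r_norm mD Lf.
apply: (le_Rintegral mD).
- exact: (L2r_mul mD Lf (Qop_L2 L_gt0 sK1 B10 Lf)).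
- exact: (L2r_mul mD Ln (Qop_L2 L_gt0 sK1 B10 Ln)).
move=> s Ds; apply: (le_trans (ler_norm _)); rewrite normrM; apply: ler_wpM2l => //.
have I2 := Qop_integrable L_gt0 sK1 Lf Ds.
apply: (le_trans (le_normr_Rintegral mD I2)); apply: (le_Rintegral mD).
- exact: integrable_norm I2.
- exact: (Qop_integrable L_gt0 sK1 Ln Ds).
by move=> u _; rewrite normrM (ger0_norm (K1_ge0 _ _)).
Qed.

Lemma qsup_mono : (forall s u, D s -> D u -> K1 s u <= K2 s u) -> qsup L K1 <= qsup L K2.
Proof.
move=> K12; apply: ge_sup; first exact: (qsup_has L_gt0 sK1 B10).1.
move=> _ [f [Lf f1 ->]]; have Ln := L2r_norm mD Lf; apply: (le_trans (q_abs_le Lf)).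
apply: (le_trans _ (qsup_ge L_gt0 sK2 B20 Ln _)); last by rewrite ip_abs.
apply: (le_Rintegral mD).
- exact: (L2r_mul mD Ln (Qop_L2 L_gt0 sK1 B10 Ln)).
- exact: (L2r_mul mD Ln (Qop_L2 L_gt0 sK2 B20 Ln)).
move=> s Ds; apply: ler_wpM2l => //; apply: (le_Rintegral mD).
- exact: (Qop_integrable L_gt0 sK1 Ln Ds).
- exact: (Qop_integrable L_gt0 sK2 Ln Ds).
by move=> u Du; apply: ler_wpM2l => //; exact: K12.
Qed.

Lemma qsup_dist_le (C : R) : 0 <= C -> (forall s u, D s -> D u -> `|K3 s u| <= C) ->
  qsup L K1 <= qsup L K2 + C * L.
Proof.
move=> C0 KC; apply: ge_sup; first exact: (qsup_has L_gt0 sK1 B10).1.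
move=> _ [f [Lf f1 ->]]; have := q_sub_norm C0 KC Lf; rewrite (q_sub Lf Lf) => H.
have H2 := qsup_ge L_gt0 sK2 B20 Lf f1.
have H3 : C * L * ipD f f <= C * L by rewrite ler_piMr// mulr_ge0// ltW.
move: H H2 H3; rewrite ler_norml => /andP[h _] h2 h3.
have h4 : ipD f (Qop L K1 f) <= ipD f (Qop L K2 f) + C * L * ipD f f by rewrite -lerBlDl -opprB lerNl.
by apply: (le_trans h4); apply: lerD.
Qed.

(** The larger kernel is tested on the Perron function of the smaller one. As this function is at
    least [m], an excess [delta] on the corner [0, r] x [L - r, L] raises the form by at least m^2
    delta r^2. *)
Lemma qsup_strict g (m M r delta : R) : 0 < m -> L2D g -> (forall s, D s -> m <= g s <= M) ->
  (forall s, D s -> Qop L K1 g s = qsup L K1 * g s) ->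
  0 < delta -> 0 < r -> r <= L -> (forall s u, D s -> D u -> K1 s u <= K2 s u) ->
  (forall s u, 0 <= s <= r -> L - r <= u <= L -> delta <= K3 s u) ->
  qsup L K1 < qsup L K2.
Proof.
move=> m0 Lg gm Qg d0 r0 rL K12 Kd.
have LQ := Qop_L2 L_gt0 sK3 B30 Lg.
have K30 s u : D s -> D u -> 0 <= K3 s u by move=> Ds Du; rewrite subr_ge0 K12.
have g0 s : D s -> 0 <= g s by move=> Ds; have /andP[h _] := gm s Ds; exact: le_trans (ltW m0) h.
have Lr0 : 0 <= L - r by rewrite subr_ge0.
have LrL : L - r <= L by rewrite lerBlDr lerDl ltW.
have [R1 J1] := Rint_indic_itv (m * delta) Lr0 LrL (lexx L).
have Q1 s : 0 <= s <= r -> m * delta * r <= Qop L K3 g s.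
  move=> /andP[s0 sr]; have Ds : D s by rewrite /= in_itv/= s0 (le_trans sr).
  apply: (@le_trans _ _ (m * delta * (L - (L - r)))); first by rewrite opprB addrC subrK.
  rewrite -R1; apply: (le_Rintegral mD) => //; first exact: (Qop_integrable L_gt0 sK3 Lg Ds).
  move=> u Du; have /andP[gu _] := gm u Du; rewrite indicE; case: (boolP (u \in _)) => [|_] /=; last first.
    by rewrite mulr0 mulr_ge0// ?g0// K30.
  rewrite inE /= in_itv/= => ur; rewrite mulr1; apply: ler_pM => //; rewrite ?(ltW m0) ?(ltW d0)//.
  by apply: Kd => //; rewrite s0.
have [R2 J2] := Rint_indic_itv (m * (m * delta * r)) (lexx 0) (ltW r0) rL.
have q3 : m * (m * delta * r) * (r - 0) <= ipD g (Qop L K3 g).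
  rewrite -R2; apply: (le_Rintegral mD) => //; first exact: (L2r_mul mD Lg LQ).
  move=> s Ds; have /andP[gs _] := gm s Ds; rewrite indicE; case: (boolP (s \in _)) => [|_] /=; last first.
    rewrite mulr0 mulr_ge0 ?g0//; apply: Rintegral_ge0 => u Du.
    by rewrite mulr_ge0 ?g0// K30.
  rewrite inE /= in_itv/= => sr; rewrite mulr1; apply: ler_pM => //; rewrite ?(ltW m0) ?Q1//.
  by rewrite !mulr_ge0// ltW.
have gg : 0 < ipD g g.
  have L1 := L2D_cst L m; apply: (@lt_le_trans _ _ (m * m * L)); first by rewrite !mulr_gt0.
  rewrite -(Rint_cstD L_gt0); apply: (le_Rintegral mD); first exact: (int_cstD L _).
    exact: (L2r_mul mD Lg Lg).
  by move=> s Ds; have /andP[gs _] := gm s Ds; apply: ler_pM => //; exact: ltW.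
have q1 : ipD g (Qop L K1 g) = qsup L K1 * ipD g g.
  rewrite -(ipZr mD (qsup L K1) Lg Lg); apply: eq_Rintegral => s /set_mem Ds.
  by rewrite Qg.
have := q_le L_gt0 sK2 B20 Lg; move: q3; rewrite (q_sub Lg Lg) q1 subr0 => q3 q2.
rewrite -(ltr_pM2r gg); apply: lt_le_trans q2; rewrite -subr_gt0.
by apply: lt_le_trans q3; rewrite !mulr_gt0.
Qed.

End two.
End compare.

(** * Dependence of the spectral supremum on the energy *)

Section green_energy_param.
Context (R : realType).
Notation pi := (@trigo.pi R).
Implicit Types (E t : R) (y z : R * R).

Lemma Rint_hl_gt0 (f : R -> R) : mu.-integrable setT (EFin \o hl f) -> (forall t, 0 < t -> 0 < f t) ->
  0 < Rint setT (hl f).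
Proof.
move=> If f0; have h0 t : 0 <= hl f t by rewrite /hl; case: ifP => // t0; exact: ltW (f0 t t0).
have m1 : 0 <= Rint setT (hl f) by apply: Rintegral_ge0 => t _; exact: h0.
rewrite lt_neqAle m1 andbT; apply/eqP => m0.
have : (\int[mu]_t `|(hl f t)%:E| = 0)%E.
  rewrite -[RHS]/(0%:E) m0 /Rintegral fineK; last exact: integrable_fin_num If.
  by apply: eq_integral => t _; rewrite gee0_abs// lee_fin.
move=> /(ae_eq_integral_abs mu mT (measurable_int _ If))[N [mN N0 sN]].
have : (mu (`]0%R, 1%R[%classic : set mR) <= mu N)%E.
  apply: le_measure; rewrite ?inE//.
  move=> t /=; rewrite in_itv/= => /andP[t0 t1]; apply: sN => /= H.
  have := H I; rewrite /hl t0 => -[ft]; by have := f0 t t0; rewrite ft ltxx.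
rewrite N0; apply/negP; rewrite -ltNge.
apply: (eq_ind_r (fun x => 0 < x)%E _ (@lebesgue_measure_itv R `]0%R, 1%R[)).
by rewrite /= lte_fin ltr01 -EFinB subr0 lte_fin.
Qed.

Lemma hl_expR_Rint E : 0 < E -> Rint setT (hl (fun t => 1 * expR (- E * t))) = E^-1.
Proof.
move=> E0.
have [] // := @hl_FTC_ge0 R (fun t => 1 * expR (- E * t)) (fun t => (- E)^-1 * expR (- E * t)) ((- E)^-1 * 0).
- apply: derivable_within => x _; have := is_deriveCl 1 (is_derive_expRZ (- E) x).
  by case.
- move=> x _; have := is_derive_expRZ (- E) x => d.
  have := is_deriveCl (- E)^-1 d.
  by rewrite mulrA mulVf ?mul1r// oppr_eq0 gt_eqF.
- by apply: cvgMl_tmp; exact: cvg_expRZ.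
move=> _ ->; rewrite !mulr0 expR0 mulr1 sub0r invrN opprK//.
Qed.

Lemma heat_sqn_le t y z : 0 < t -> sqn y <= sqn z -> heat t z <= heat t y.
Proof.
move=> t0 yz; rewrite /heat; apply: ler_wpM2l; first by rewrite invr_ge0 ltW// pi4_gt0.
by rewrite ler_expR ler_pM2r ?invr_gt0 ?mulr_gt0// lerN2.
Qed.

Lemma heat_sqn_lt t y z : 0 < t -> sqn y < sqn z -> heat t z < heat t y.
Proof.
move=> t0 yz; rewrite /heat ltr_pM2l ?invr_gt0 ?pi4_gt0//.
by rewrite ltr_expR ltr_pM2r ?invr_gt0 ?mulr_gt0// ltrN2.
Qed.

Definition greeni E eta y (tau : R) : R := expR (- E * (eta + tau)) * heat (eta + tau) y.

Lemma greeni_int E eta y : 0 < E -> 0 <= eta -> 0 < sqn y -> mu.-integrable setT (EFin \o hl (greeni E eta y)).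
Proof. exact: greenf_integrable. Qed.

Lemma hl_sub (f g : R -> R) : mu.-integrable setT (EFin \o hl f) -> mu.-integrable setT (EFin \o hl g) ->
  mu.-integrable setT (EFin \o hl (fun t => f t - g t)) /\
  Rint setT (hl f) - Rint setT (hl g) = Rint setT (hl (fun t => f t - g t)).
Proof.
move=> If Ig; have I := integrable_lin mT 1 (-1) If Ig; have E1 := Rintegral_lin mT 1 (-1) If Ig.
have H t : 1 * hl f t + -1 * hl g t = hl (fun t => f t - g t) t.
  by rewrite /hl; case: ifP => _; rewrite mul1r mulN1r ?subr0.
split; first by move: I; apply: eq_integrable => // t _ /=; rewrite H.
by rewrite mul1r mulN1r in E1; rewrite E1; apply: eq_Rintegral => t _; rewrite H.
Qed.

Lemma hl_le (f g : R -> R) : mu.-integrable setT (EFin \o hl f) -> mu.-integrable setT (EFin \o hl g) ->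
  (forall t, 0 < t -> f t <= g t) -> Rint setT (hl f) <= Rint setT (hl g).
Proof.
by move=> If Ig fg; apply: (le_Rintegral mT If Ig) => t _; rewrite /hl; case: ifP => // t0; exact: fg.
Qed.

Lemma hl_lt (f g : R -> R) : mu.-integrable setT (EFin \o hl f) -> mu.-integrable setT (EFin \o hl g) ->
  (forall t, 0 < t -> f t < g t) -> Rint setT (hl f) < Rint setT (hl g).
Proof.
move=> If Ig fg; rewrite -subr_gt0; have [I ->] := hl_sub Ig If; apply: Rint_hl_gt0 => // t t0.
by rewrite subr_gt0 fg.
Qed.

Lemma greenf_sqn_le E y z : 0 < E -> 0 < sqn y -> sqn y <= sqn z -> greenf E 0 z <= greenf E 0 y.
Proof.
move=> E0 y0 yz; apply: hl_le.
- by apply: greeni_int => //; exact: lt_le_trans yz.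
- exact: greeni_int.
- by move=> t t0; rewrite add0r; apply: ler_wpM2l; [exact: expR_ge0|exact: heat_sqn_le].
Qed.

Lemma greenf_sqn_lt E y z : 0 < E -> 0 < sqn y -> sqn y < sqn z -> greenf E 0 z < greenf E 0 y.
Proof.
move=> E0 y0 yz; apply: hl_lt.
- by apply: greeni_int => //; exact: lt_trans yz.
- exact: greeni_int.
- by move=> t t0; rewrite add0r ltr_pM2l ?expR_gt0//; exact: heat_sqn_lt.
Qed.

Lemma greenf_gt0 E y : 0 < E -> 0 < sqn y -> 0 < greenf E 0 y.
Proof.
move=> E0 y0; apply: Rint_hl_gt0; first exact: greeni_int.
move=> t t0; rewrite add0r mulr_gt0 ?expR_gt0// /heat mulr_gt0 ?expR_gt0//.
by rewrite invr_gt0 pi4_gt0.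
Qed.

Lemma greenf_lt_E E E' y : 0 < E -> E < E' -> 0 < sqn y -> greenf E' 0 y < greenf E 0 y.
Proof.
move=> E0 EE y0; have E'0 := lt_trans E0 EE; apply: hl_lt; [exact: greeni_int|exact: greeni_int|].
move=> t t0; rewrite add0r ltr_pM2r.
  by rewrite ltr_expR ltr_pM2r// ltrN2.
by rewrite /heat mulr_gt0 ?expR_gt0// invr_gt0 pi4_gt0.
Qed.

(** The factor exp(-E t) - exp(-E' t) is nonnegative and the heat kernel decreases with the
    distance. Hence the gain from lowering E along an arc is smallest at the largest distance. *)
Lemma greenf_diff_sqn E E' y z : 0 < E -> E <= E' -> 0 < sqn y -> sqn y <= sqn z ->
  greenf E 0 z - greenf E' 0 z <= greenf E 0 y - greenf E' 0 y.
Proof.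
move=> E0 EE y0 yz; have E'0 := lt_le_trans E0 EE; have z0 := lt_le_trans y0 yz.
have [I1 e1] := hl_sub (greeni_int E0 (lexx 0) z0) (greeni_int E'0 (lexx 0) z0).
have [I2 e2] := hl_sub (greeni_int E0 (lexx 0) y0) (greeni_int E'0 (lexx 0) y0).
rewrite /greenf e1 e2; apply: hl_le => // t t0; rewrite /greeni add0r -!mulrBl.
apply: ler_wpM2l; last exact: heat_sqn_le.
by rewrite subr_ge0 ler_expR ler_pM2r// lerN2.
Qed.

Lemma expR_sub_le (a b : R) : a <= b -> expR (- a) - expR (- b) <= (b - a) * expR (- a).
Proof.
move=> ab; have -> : expR (- b) = expR (- a) * expR (a - b).
  by rewrite -expRD; congr expR; rewrite addrA addNr add0r.
rewrite -{1}(mulr1 (expR (- a))) -mulrBr mulrC ler_pM2r ?expR_gt0//.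
have := expR_ge1Dx (a - b); rewrite lerBlDr => h.
by rewrite -lerBlDl; apply: le_trans h; apply: le_of_eq; ring.
Qed.

(** The difference of exponentials supplies a factor t that cancels the 1/t of the heat bound, so
    the difference stays bounded uniformly in y although both terms are singular. *)
Lemma greenf_E_lip E E' y : 0 < E -> E <= E' -> 0 < sqn y ->
  greenf E 0 y - greenf E' 0 y <= (E' - E) * ((4 * pi)^-1 * E^-1).
Proof.
move=> E0 EE y0; have E'0 := lt_le_trans E0 EE.
have [I1 e1] := hl_sub (greeni_int E0 (lexx 0) y0) (greeni_int E'0 (lexx 0) y0).
have Ie := hl_expR_int 1 E0.
rewrite /greenf e1 -(hl_expR_Rint E0) mulrA -(RintegralZl _ mT Ie).
apply: (le_Rintegral mT I1 (integrableZl mT _ Ie)) => t _; rewrite /hl.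
case: ifPn => t0; last by rewrite mulr0.
rewrite /greeni add0r -mulrBl mul1r !mulNr.
have h1 := @expR_sub_le (E * t) (E' * t) ltac:(by rewrite ler_pM2r).
have p0 : 0 < 4 * pi :> R by rewrite mulr_gt0// trigo.pi_gt0.
apply: (le_trans (ler_pM _ _ h1 (heat_le y t0))).
- by rewrite subr_ge0 ler_expR lerN2 ler_pM2r.
- exact: heat_ge0.
rewrite -mulrBl; apply: le_of_eq; move: (4 * pi) p0 => p p0.
by field; rewrite (gt_eqF p0) (gt_eqF t0).
Qed.

Lemma int_inv (b : R) : 1 < b -> (\int[mu]_(x in `[1%R, b]) (x^-1)%:E = (ln b)%:E)%E.
Proof.
move=> b1.
have d (x : R) : 0 < x -> derivable (@ln R) x 1 by move=> x0; have [] := is_derive1_ln x0.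
have c (x : R) : 0 < x -> {for x, continuous (@ln R)}.
  by move=> /d dx; apply/differentiable_continuous/derivable1_diffP.
rewrite (@continuous_FTC2 _ _ (@ln R))//.
- by rewrite ln1 sube0.
- apply: continuous_in_subspaceT => x; rewrite inE /= in_itv/= => /andP[x1 _].
  by apply: inv_continuous; rewrite gt_eqF// (lt_le_trans _ x1).
- split.
  + by move=> x; rewrite in_itv/= => /andP[x1 _]; apply: d; apply: lt_trans x1.
  + by apply: cvg_at_right_filter; apply: c.
  + by apply: cvg_at_left_filter; apply: c; apply: lt_trans b1.
- move=> x; rewrite in_itv/= => /andP[x1 _]; rewrite derive1E.
  by have [_ ->] := is_derive1_ln (lt_trans ltr01 x1).
Qed.

(** Only times between 1 and 1/E are kept: there E t <= 1, the Gaussian factor is at least its value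
    at t = 1, and the integral of 1/t is -ln E. This logarithmic divergence at E = 0, special to
    dimension two, gives a bound state for every coupling. *)
Lemma greenf_ln_ge E y : 0 < E -> E < 1 -> 0 < sqn y ->
  (4 * pi)^-1 * expR (- 1 - sqn y / 4) * - ln E <= greenf E 0 y.
Proof.
move=> E0 E1 y0; have b1 : 1 < E^-1 by rewrite invf_gt1.
have p0 : 0 < 4 * pi :> R by rewrite mulr_gt0// trigo.pi_gt0.
set C := (4 * pi)^-1 * _; have C0 : 0 <= C by rewrite mulr_ge0 ?expR_ge0// invr_ge0 ltW.
have I := greeni_int E0 (lexx 0) y0; have mI := measurable_itv `[1%R, E^-1].
have h0 t : 0 <= hl (greeni E 0 y) t.
  rewrite /hl; case: ifP => // t0.
  by rewrite /greeni add0r mulr_ge0 ?expR_ge0 ?heat_ge0.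
rewrite -lnV ?posrE// -lee_fin /greenf /Rintegral fineK; last exact: integrable_fin_num I.
have S : (\int[mu]_(t in `[1%R, (E^-1)%R]) (hl (greeni E 0 y) t)%:E <= \int[mu]_t (hl (greeni E 0 y) t)%:E)%E.
  apply: ge0_subset_integral => //; [exact: measurable_int I|by move=> t _; rewrite lee_fin].
have H : ((C * ln E^-1)%:E <= \int[mu]_(t in `[1%R, (E^-1)%R]) (hl (greeni E 0 y) t)%:E)%E; last exact: (le_trans H S).
rewrite EFinM -(int_inv b1) -ge0_integralZl//; last 2 first.
- apply/mEFinP; apply: measurable_funTS; exact: measurable_inv.
- by move=> t; rewrite /= in_itv/= => /andP[t1 _]; rewrite lee_fin invr_ge0 (le_trans _ t1).
apply: ge0_le_integral => //.
- by move=> t; rewrite /= in_itv/= => /andP[t1 _]; rewrite -EFinM lee_fin mulr_ge0// invr_ge0 (le_trans _ t1).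
- by apply: measurable_funeM; apply/mEFinP; apply: measurable_funTS; exact: measurable_inv.
- by apply: measurable_funTS; exact: measurable_int I.
move=> t; rewrite /= in_itv/= => /andP[t1 tE]; rewrite -EFinM lee_fin.
have t0 : 0 < t := lt_le_trans ltr01 t1.
rewrite /hl t0 /greeni add0r /C /heat.
have -> : (4 * pi)^-1 * expR (- 1 - sqn y / 4) / t =
    expR (-1) * ((4 * pi * t)^-1 * expR (- (sqn y / 4))).
  by rewrite expRD [(4 * pi * t)^-1]invfM; move: ((4 * pi)^-1) (expR _) (expR _) (t^-1) => a b c d; ring.
apply: ler_pM; rewrite ?expR_ge0//.
- by rewrite mulr_ge0 ?expR_ge0// invr_ge0 ltW// pi4_gt0.
- by rewrite ler_expR mulNr lerN2 -(@mulfV _ E) ?gt_eqF// ler_pM2l.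
apply: ler_wpM2l; first by rewrite invr_ge0 ltW// pi4_gt0.
rewrite ler_expR mulNr lerN2 ler_wpM2l ?sqn_ge0// lef_pV2 ?posrE ?mulr_gt0//.
by rewrite ler_peMr.
Qed.

Lemma heat_dist_aux t y z : 0 < t -> sqn y <= sqn z ->
  heat t y - heat t z <= (4 * pi * t)^-1 * ((4 * t)^-1 * (sqn z - sqn y)).
Proof.
move=> t0 yz; have t40 : 0 < (4 * t)^-1 by rewrite invr_gt0 mulr_gt0.
rewrite /heat -mulrBr; apply: ler_wpM2l; first by rewrite invr_ge0 ltW// pi4_gt0.
rewrite !mulNr; apply: (le_trans (expR_sub_le _)); first by rewrite ler_pM2r.
rewrite -mulrBl [(_ - _) / _]mulrC ler_piMr//.
  by rewrite mulr_ge0 ?subr_ge0// ltW.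
by rewrite -expR0 ler_expR oppr_le0 divr_ge0 ?sqn_ge0// mulr_ge0// ltW.
Qed.

Lemma heat_dist t y z : 0 < t -> `|heat t y - heat t z| <= (4 * pi * t)^-1 * ((4 * t)^-1 * `|sqn y - sqn z|).
Proof.
move=> t0; have [yz|/ltW zy] := leP (sqn y) (sqn z).
  rewrite ger0_norm ?subr_ge0 ?heat_sqn_le// distrC (ger0_norm (_ : 0 <= sqn z - _)) ?subr_ge0//.
  exact: heat_dist_aux.
rewrite distrC ger0_norm ?subr_ge0 ?heat_sqn_le// (ger0_norm (_ : 0 <= sqn y - _)) ?subr_ge0//.
exact: heat_dist_aux.
Qed.

Lemma expR_shift_le E eta t : 0 < E -> 0 < eta -> expR (- E * (eta + t)) <= expR (- E * t).
Proof. by move=> E0 e0; rewrite ler_expR !mulNr lerN2 ler_pM2l// lerDr ltW. Qed.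

Lemma greenf_dist E eta y z : 0 < E -> 0 < eta -> 0 < sqn y -> 0 < sqn z ->
  `|greenf E eta y - greenf E eta z| <= (4 * pi * eta)^-1 * ((4 * eta)^-1 * `|sqn y - sqn z|) * E^-1.
Proof.
move=> E0 e0 y0 z0; have e0' := ltW e0.
have [I1 e1] := hl_sub (greeni_int E0 e0' y0) (greeni_int E0 e0' z0).
have Ie := hl_expR_int 1 E0.
rewrite /greenf e1 -(hl_expR_Rint E0) -(RintegralZl _ mT Ie).
apply: (le_trans (le_normr_Rintegral mT I1)).
apply: (le_Rintegral mT (integrable_norm I1) (integrableZl mT _ Ie)) => t _; rewrite /hl /=.
case: ifPn => t0; last by rewrite mulr0 normr0.
have et : 0 < eta + t by rewrite addr_gt0.
rewrite /greeni -mulrBr normrM (ger0_norm (expR_ge0 _)) mul1r mulrC.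
apply: ler_pM; rewrite ?expR_ge0//; last exact: expR_shift_le.
apply: (le_trans (heat_dist y z et)).
have p40 : 0 < 4 * pi :> R by rewrite mulr_gt0// trigo.pi_gt0.
apply: ler_pM.
- by rewrite invr_ge0 ltW// mulr_gt0.
- by rewrite mulr_ge0// invr_ge0 ltW// mulr_gt0.
- by rewrite lef_pV2 ?posrE ?mulr_gt0 ?trigo.pi_gt0// ler_pM2l// lerDl ltW.
- by apply: ler_wpM2r => //; rewrite lef_pV2 ?posrE ?mulr_gt0// ler_pM2l// lerDl ltW.
Qed.

Lemma greenf_eta_le E eta y : 0 < E -> 0 < eta -> 0 < sqn y -> greenf E eta y <= (4 * pi * eta)^-1 * E^-1.
Proof.
move=> E0 e0 y0; have Ie := hl_expR_int 1 E0.
have p40 : 0 < 4 * pi :> R by rewrite mulr_gt0// trigo.pi_gt0.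
rewrite -(hl_expR_Rint E0) -(RintegralZl _ mT Ie).
apply: (le_Rintegral mT (greeni_int E0 (ltW e0) y0) (integrableZl mT _ Ie)) => t _; rewrite /hl.
case: ifPn => t0; last by rewrite mulr0.
have et : 0 < eta + t by rewrite addr_gt0.
rewrite mul1r [leRHS]mulrC /greeni; apply: ler_pM; rewrite ?expR_ge0 ?heat_ge0//; first exact: expR_shift_le.
apply: (le_trans (heat_le y et)).
by rewrite lef_pV2 ?posrE ?mulr_gt0 ?trigo.pi_gt0// ler_pM2l// lerDl ltW.
Qed.

End green_energy_param.

(** * The spectral supremum as a function of E *)

Section spectral_sup.
Context (R : realType).
Notation pi := (@trigo.pi R).
Variables (sigma : R -> R * R) (L c : R).
Notation D := (`[0, L]%classic : set mR).
Notation L2D := (L2r mu D).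
Notation ipD := (ip mu D).
Hypotheses (L_gt0 : 0 < L) (c_gt0 : 0 < c).
Hypothesis msigma : measT (sigma : mR -> mR * mR).
Hypothesis chord_ge : forall s u, D s -> D u -> (c * (s - u)) ^+ 2 <= sqn (sigma s - sigma u).
Hypothesis chord_le : forall s u, D s -> D u -> sqn (sigma s - sigma u) <= (s - u) ^+ 2.
Implicit Types (E s u : R) (f : R -> R).
Local Opaque greenf heat lapc.

Let mD : measurable D. Proof. exact: measurable_itv. Qed.

Lemma sum_le_aux (x y z a b : R) : x = y - z -> x <= a -> z <= b -> y <= a + b.
Proof. by move=> -> b1 b2; apply: le_trans (lerD b1 b2); rewrite subrK. Qed.

Lemma third_aux (x e : R) : x <= e / 3 -> 0 < e -> x + e / 3 < e.
Proof. by move=> h1 h2; lra. Qed.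

Lemma scale_aux (q e3 : R) : 0 < q -> 0 < e3 -> q * (q * L / e3)^-1 * L = e3.
Proof. by move=> q0 e0; field; rewrite (gt_eqF q0) (gt_eqF e0) (gt_eqF L_gt0). Qed.

Lemma minmax_aux (x y v : R) : x <= v -> v <= y -> Num.min y x <= v <= Num.max y x.
Proof. by move=> h1 h2; rewrite ge_min le_max h1 h2 orbT. Qed.

Lemma sqr_norm_le (a b : R) : 0 <= b -> a ^+ 2 <= b ^+ 2 -> `|a| <= b.
Proof. by move=> b0 h; rewrite -(@ler_pXn2r _ 2)// ?nnegrE// real_normK ?num_real. Qed.

Lemma dist3_aux (x y z w e : R) : `|x - y| <= e / 3 -> `|y - z| <= e / 3 -> `|w - z| <= e / 3 -> `|x - w| <= e.
Proof. rewrite !ler_norml => /andP[? ?] /andP[? ?] /andP[? ?]; apply/andP; split; lra. Qed.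

(** A reference vector of length l for l >= 0: the Green function is radial, so its value at
    distance l is taken there. *)
Definition seg (l : R) : R * R := (l, 0).

Lemma sqn_seg l : sqn (seg l) = l ^+ 2. Proof. by rewrite /sqn /= expr0n addr0. Qed.

Lemma dist_le s u : D s -> D u -> `|s - u| <= L.
Proof.
rewrite /= !in_itv/= => /andP[s0 sL] /andP[u0 uL]; rewrite ler_norml; apply/andP; split.
  by rewrite -[- L]add0r lerB.
by rewrite -[L]subr0 lerB.
Qed.

Lemma chord_leL s u : D s -> D u -> sqn (sigma s - sigma u) <= sqn (seg L).
Proof.
move=> Ds Du; apply: (le_trans (chord_le Ds Du)); rewrite sqn_seg -(real_normK (num_real (s - u))).
by rewrite lerXn2r ?nnegrE ?(ltW L_gt0) ?dist_le.
Qed.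

Lemma segL_gt0 : 0 < sqn (seg L). Proof. by rewrite sqn_seg exprn_gt0. Qed.

Lemma ker_lower E s u : 0 < E -> D s -> D u -> s != u -> greenf E 0 (seg L) <= ker sigma E 0 s u.
Proof.
move=> E0 Ds Du su; rewrite /ker (negbTE su).
by apply: greenf_sqn_le => //; [exact: (chord_gt0 c_gt0 chord_ge)|exact: chord_leL].
Qed.

Lemma Rint_off2 (f g : R -> R) (a b : R) : measurable_fun D (f : mR -> mR) -> measurable_fun D (g : mR -> mR) ->
  (forall u, D u -> u != a -> u != b -> f u = g u) -> Rint D f = Rint D g.
Proof.
move=> mf mg fg; rewrite /Rintegral; congr fine; apply: ae_eq_integral => //.
- exact/mEFinP.
- exact/mEFinP.
exists ([set a] `|` [set b]); split.
- by apply: measurableU; exact: measurable_set1.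
- by apply: countable_lebesgue_measure0; apply: finite_set_countable; exact: finite_set2.
move=> u /= H; have [ua|ua] := eqVneq u a; [by left|right].
by apply/eqP; apply: contra_notT H => ub Du; rewrite fg.
Qed.

Lemma coord_le (y : R * R) (l : R) : 0 <= l -> sqn y <= l ^+ 2 -> `|y.1| <= l /\ `|y.2| <= l.
Proof.
move=> l0 yl; split; rewrite -(@ler_pXn2r _ 2) ?nnegrE// real_normK ?num_real//.
  by apply: le_trans yl; rewrite lerDl sqr_ge0.
by apply: le_trans yl; rewrite lerDr sqr_ge0.
Qed.

Lemma sqn_dist s s' u : D s -> D s' -> D u ->
  `|sqn (sigma s - sigma u) - sqn (sigma s' - sigma u)| <= 4 * L * `|s - s'|.
Proof.
move=> Ds Ds' Du; have L0 := ltW L_gt0.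
have [a1 a2] : `|(sigma s - sigma u).1| <= L /\ `|(sigma s - sigma u).2| <= L.
  by apply: coord_le => //; rewrite -sqn_seg; exact: chord_leL.
have [b1 b2] : `|(sigma s' - sigma u).1| <= L /\ `|(sigma s' - sigma u).2| <= L.
  by apply: coord_le => //; rewrite -sqn_seg; exact: chord_leL.
have [d1 d2] : `|(sigma s - sigma s').1| <= `|s - s'| /\ `|(sigma s - sigma s').2| <= `|s - s'|.
  by apply: coord_le => //; rewrite real_normK ?num_real//; exact: chord_le.
have -> : sqn (sigma s - sigma u) - sqn (sigma s' - sigma u) =
   (sigma s - sigma s').1 * ((sigma s - sigma u).1 + (sigma s' - sigma u).1) +
   (sigma s - sigma s').2 * ((sigma s - sigma u).2 + (sigma s' - sigma u).2).
  by rewrite /sqn /=; ring.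
have -> : 4 * L * `|s - s'| = `|s - s'| * (L + L) + `|s - s'| * (L + L) by ring.
apply: (le_trans (ler_normD _ _)); rewrite !normrM; apply: lerD; apply: ler_pM => //.
  by apply: (le_trans (ler_normD _ _)); exact: lerD.
by apply: (le_trans (ler_normD _ _)); exact: lerD.
Qed.

Section fixed_E.
Variable E : R.
Hypothesis E_gt0 : 0 < E.
Notation K := (ker sigma E 0).
Notation B := (lapc E * chord_c c).

Let sK : sing_kernel L K B. Proof. exact: (ker_sing c_gt0 msigma chord_ge E_gt0). Qed.
Let B0 : 0 <= B. Proof. exact: ker_c_ge0. Qed.

Definition lip_eta (eta : R) : R := (4 * pi * eta)^-1 * ((4 * eta)^-1 * (4 * L)) * E^-1.

Lemma lip_eta_ge0 eta : 0 < eta -> 0 <= lip_eta eta.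
Proof.
move=> e0; have p : 0 < pi by exact: trigo.pi_gt0.
by rewrite /lip_eta !mulr_ge0 ?invr_ge0 ?mulr_ge0 ?(ltW p) ?(ltW e0) ?(ltW L_gt0) ?(ltW E_gt0).
Qed.

Lemma Qop_eta_lip eta f s s' : 0 < eta -> L2D f -> ipD f f <= 1 -> D s -> D s' ->
  `|Qop L (ker sigma E eta) f s - Qop L (ker sigma E eta) f s'| <= lip_eta eta * (1 + L) * `|s - s'|.
Proof.
move=> e0 Lf f1 Ds Ds'; have Ke := ker_eta_sing c_gt0 msigma chord_ge E_gt0 e0.
have I1 := Qop_integrable L_gt0 Ke Lf Ds; have I2 := Qop_integrable L_gt0 Ke Lf Ds'.
have Id := integrable_lin mD 1 (-1) I1 I2; have Ed := Rintegral_lin mD 1 (-1) I1 I2.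
rewrite mul1r mulN1r in Ed; rewrite /Qop /= Ed.
have Ln := L2r_norm mD Lf; have If := L2D_int Ln.
set C := lip_eta eta * `|s - s'|; have C0 : 0 <= C by rewrite mulr_ge0// lip_eta_ge0.
apply: (@le_trans _ _ (C * (1 + L))); last by rewrite /C mulrAC.
(* The two parameters where one of the kernels is set to 0 by convention are removed; elsewhere the
   Lipschitz bound [greenf_dist] applies. *)
pose g u := \1_(~` ([set s] `|` [set s']) : set mR) u *
  (1 * (f u * ker sigma E eta s u) + -1 * (f u * ker sigma E eta s' u)).
have mg : measurable_fun D (g : mR -> mR).
  apply: measurable_funM; last by have /measurable_int/mEFinP := Id.
  apply: measurable_funTS; apply: measurable_indic; apply: measurableC.
  by apply: measurableU; exact: measurable_set1.
have gle u : D u -> `|g u| <= C * `|f u|.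
  move=> Du; rewrite /g indicE; case: (boolP (u \in _)) => /= [|_]; last first.
    by rewrite mul0r normr0 mulr_ge0.
  rewrite inE /= => /not_orP[/eqP us /eqP us']; rewrite mul1r.
  rewrite mul1r mulN1r -mulrBr normrM mulrC; apply: ler_wpM2r => //.
  rewrite /ker ![_ == u]eq_sym (negbTE us) (negbTE us').
  have p1 := chord_gt0 c_gt0 chord_ge Ds Du; have p2 := chord_gt0 c_gt0 chord_ge Ds' Du.
  rewrite eq_sym in us; rewrite eq_sym in us'.
  apply: (le_trans (greenf_dist E_gt0 e0 (p1 us) (p2 us'))).
  have H := sqn_dist Ds Ds' Du.
  have p : 0 < 4 * pi :> R by rewrite mulr_gt0// trigo.pi_gt0.
  rewrite /C /lip_eta [leRHS]mulrAC; apply: ler_wpM2r; first by rewrite invr_ge0 ltW.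
  rewrite -[leRHS]mulrA -[(_ * (4 * L)) * _]mulrA.
  apply: ler_wpM2l; first by rewrite invr_ge0 ltW// mulr_gt0.
  by apply: ler_wpM2l => //; rewrite invr_ge0 ltW// mulr_gt0.
rewrite (@Rint_off2 _ g s s'); [|by have /measurable_int/mEFinP := Id|exact: mg|]; last first.
  by move=> u Du /eqP us /eqP us'; rewrite /g indicE mem_set ?mul1r//= => -[].
have Ig := int_le mD mg gle (integrableZl mD C If).
apply: (le_trans (le_normr_Rintegral mD Ig)).
apply: (@le_trans _ _ (C * Rint D (fun x => `|f x|))).
  rewrite -(RintegralZl _ mD If); apply: (le_Rintegral mD (integrable_norm Ig) (integrableZl mD C If)).
  by move=> u Du; exact: gle.
apply: ler_wpM2l => //.
have L1 := L2D_cst L 1; have := ip_young mD Ln L1; rewrite ip_abs.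
rewrite (_ : ipD _ (cst 1) = Rint D (fun x => `|f x|)); last first.
  by apply: eq_Rintegral => u _; rewrite /cst mulr1.
rewrite (_ : ipD (cst 1) (cst 1) = L); last first.
  by rewrite /ip; under eq_Rintegral do rewrite mulr1; rewrite Rint_cstD// mul1r.
by move=> H; apply: (le_trans (ler_norm _)); apply: (le_trans H); rewrite lerD2r.
Qed.

(** First [eta] is chosen so that the part of short times is uniformly within e / 3; the remaining
    kernel is Lipschitz with a constant depending on [eta], which then fixes [d]. *)
Lemma ker_equi e : 0 < e -> exists2 d, 0 < d & forall f s s', L2D f -> ipD f f <= 1 ->
  D s -> D s' -> `|s - s'| < d -> `|Qop L K f s - Qop L K f s'| <= e.
Proof.
move=> e0; have e30 : 0 < e / 3 by rewrite divr_gt0.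
pose A := 2 * 8 * hc R * chord_c c; pose H := Num.sqrt (hs_c L).
have A0 : 0 <= A by rewrite /A mulr_ge0 ?chord_c_ge0// mulr_ge0// ltW// hc_gt0.
have AH : 0 < A * H + 1 by rewrite ltr_wpDl// mulr_ge0// sqrtr_ge0.
have : (fun t : R => t `^ 8^-1) @ 0^'+ --> (0 : R) by apply: powR_cvg0; rewrite invr_gt0.
move=> /cvgr0Pnorm_le/(_ (e / 3 / (A * H + 1))); rewrite divr_gt0// => /(_ isT).
move=> [d1 /= d10 Hd1]; pose eta := d1 / 2.
have eta0 : 0 < eta by rewrite divr_gt0.
have etad : eta < d1 by rewrite ltr_pdivrMr// mulr_natr mulr2n ltrDl.
have Heta : eta `^ 8^-1 <= e / 3 / (A * H + 1).
  have := Hd1 eta; rewrite /ball_ /= sub0r normrN gtr0_norm// => /(_ etad eta0).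
  by rewrite ger0_norm ?powR_ge0.
have l0 : 0 < lip_eta eta * (1 + L) + 1.
  by rewrite ltr_wpDl// mulr_ge0 ?lip_eta_ge0// addr_ge0// ltW.
exists (e / 3 / (lip_eta eta * (1 + L) + 1)) => [|f s s' Lf f1 Ds Ds' ss']; first exact: divr_gt0.
have sd := ker_diff_sing c_gt0 msigma chord_ge E_gt0 eta0.
have close s0 : D s0 -> `|Qop L K f s0 - Qop L (ker sigma E eta) f s0| <= e / 3.
  move=> Ds0; rewrite -(Qop_ker_diff L_gt0 c_gt0 msigma chord_ge E_gt0 eta0 Lf Ds0).
  have Hq := Qop_sqr_le L_gt0 sd Lf Ds0.
  have hs0 := hs_c_ge0 L.
  have H2 : `|Qop L (fun s u => ker sigma E 0 s u - ker sigma E eta s u) f s0| <= shift_c c eta * H.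
    apply: sqr_norm_le; first by rewrite mulr_ge0 ?shift_c_ge0 ?sqrtr_ge0.
    by rewrite exprMn sqr_sqrtr//; apply: (le_trans Hq); rewrite ler_piMr// mulr_ge0 ?sqr_ge0.
  apply: (le_trans H2).
  have -> : shift_c c eta * H = A * H * eta `^ 8^-1 by rewrite /shift_c /A; ring.
  apply: (@le_trans _ _ ((A * H + 1) * eta `^ 8^-1)); first by rewrite ler_wpM2r ?powR_ge0// lerDl.
  by rewrite mulrC -ler_pdivlMr.
have H1 := close s Ds; have H2 := close s' Ds'.
have H3 : `|Qop L (ker sigma E eta) f s - Qop L (ker sigma E eta) f s'| <= e / 3.
  apply: (le_trans (Qop_eta_lip eta0 Lf f1 Ds Ds')).
  apply: (@le_trans _ _ ((lip_eta eta * (1 + L) + 1) * `|s - s'|)); first by rewrite ler_wpM2r// lerDl.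
  by rewrite mulrC -ler_pdivlMr// ltW.
exact: dist3_aux H1 H3 H2.
Qed.

Lemma perron_ker : exists g m M, [/\ 0 < m, L2D g, forall s, D s -> m <= g s <= M
  & forall s, D s -> Qop L K g s = qsup L K * g s].
Proof.
apply: (@perron R L L_gt0 K B sK B0 _ ker_equi (greenf E 0 (seg L))).
- by move=> s u; exact: ker_ge0.
- exact: greenf_gt0 E_gt0 segL_gt0.
- by move=> s u Ds Du; exact: ker_lower.
Qed.

Lemma qsup_ker_ge : greenf E 0 (seg L) * L <= qsup L K.
Proof.
apply: (@qsup_ge_lower R L L_gt0 K B sK B0).
- by move=> s u; exact: ker_ge0.
- exact: greenf_gt0 E_gt0 segL_gt0.
- by move=> s u Ds Du; exact: ker_lower.
Qed.

(** The first term is the Schur bound for times below [eta] and does not involve E; the second is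
    the sup bound for later times and decays like 1/E. *)
Lemma qsup_ker_le eta : 0 < eta ->
  qsup L K <= shift_c c eta * schur_c L + (4 * pi * eta)^-1 * E^-1 * L.
Proof.
move=> e0; have sd := ker_diff_sing c_gt0 msigma chord_ge E_gt0 e0.
have se := ker_eta_sing c_gt0 msigma chord_ge E_gt0 e0.
(* The bound on a difference of kernels, taken with the zero kernel, bounds the part with cutoff
   alone. *)
have s0 : sing_kernel L (fun _ _ => 0 : R) 0.
  by split=> // s u _ _; rewrite normr0 mul0r.
apply: ge_sup; first exact: (qsup_has L_gt0 sK B0).1.
move=> _ [f [Lf f1 ->]].
have H1 := Qop_schur L_gt0 sd (shift_c_ge0 c eta) Lf.
have C0 : 0 <= (4 * pi * eta)^-1 * E^-1.
  by rewrite mulr_ge0 ?invr_ge0 ?(ltW E_gt0)// mulr_ge0 ?(ltW e0)// mulr_ge0// ltW// trigo.pi_gt0.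
have H2 := q_sub_norm L_gt0 s0 se (lexx 0) B0 C0 _ Lf.
have {}H2 : `|ipD f (Qop L (ker sigma E eta) f)| <= (4 * pi * eta)^-1 * E^-1 * L * ipD f f.
  move: H2; rewrite (_ : (fun s u => ker sigma E eta s u - 0) = ker sigma E eta); last first.
    by apply/funext => s; apply/funext => u; rewrite subr0.
  apply => s u Ds Du; rewrite subr0 ger0_norm ?ker_ge0 ?(ltW e0)// /ker.
  by case: eqVneq => // su; apply: greenf_eta_le => //; exact: (chord_gt0 c_gt0 chord_ge).
have H3 := ip_ker_diff L_gt0 c_gt0 msigma chord_ge E_gt0 e0 Lf Lf.
have a1 : shift_c c eta * schur_c L * ipD f f <= shift_c c eta * schur_c L.
  by rewrite ler_piMr// mulr_ge0 ?shift_c_ge0 ?schur_c_ge0.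
have a2 : (4 * pi * eta)^-1 * E^-1 * L * ipD f f <= (4 * pi * eta)^-1 * E^-1 * L.
  by rewrite ler_piMr// mulr_ge0// ltW.
have b1 := le_trans (ler_norm _) (le_trans H1 a1); have b2 := le_trans (ler_norm _) (le_trans H2 a2).
exact: sum_le_aux H3 b1 b2.
Qed.

End fixed_E.

Definition SE E : R := qsup L (ker sigma E 0).

(** On the corner with r = L / 3 the kernels differ by at least their difference at distance L, by
    [greenf_diff_sqn], so [qsup_strict] applies. *)
Lemma SE_anti E E' : 0 < E -> E < E' -> SE E' < SE E.
Proof.
move=> E0 EE; have E'0 := lt_trans E0 EE.
have [g [m [M [m0 Lg gm Qg]]]] := perron_ker E'0.
have s1 := ker_sing c_gt0 msigma chord_ge E'0; have s2 := ker_sing c_gt0 msigma chord_ge E0.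
have r0 : 0 < L / 3 by rewrite divr_gt0.
have d0 : 0 < greenf E 0 (seg L) - greenf E' 0 (seg L).
  by rewrite subr_gt0; apply: greenf_lt_E => //; exact: segL_gt0.
apply: (@qsup_strict R L L_gt0 _ _ _ _ s1 s2 (ker_c_ge0 _ _) (ker_c_ge0 _ _) g m M (L / 3) _
  m0 Lg gm Qg d0 r0).
- by rewrite ler_pdivrMr// ler_peMr ?(ltW L_gt0)// ler1n.
- move=> s u Ds Du; rewrite /ker; case: eqVneq => // su.
  by apply: ltW; apply: greenf_lt_E => //; exact: (chord_gt0 c_gt0 chord_ge).
move=> s u /andP[h1 h2] /andP[h3 h4].
have Ds : D s by rewrite /= in_itv/= h1 (le_trans h2)// ler_pdivrMr// ler_peMr ?(ltW L_gt0)// ler1n.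
have Du : D u.
  rewrite /= in_itv/= h4 andbT (le_trans _ h3)// subr_ge0 ler_pdivrMr// ler_peMr ?(ltW L_gt0)//.
  by rewrite ler1n.
have su : s != u by rewrite lt_eqF//; apply: (le_lt_trans h2); apply: lt_le_trans h3; lra.
rewrite /ker (negbTE su); apply: greenf_diff_sqn => //; first exact: ltW.
  exact: (chord_gt0 c_gt0 chord_ge).
exact: chord_leL.
Qed.

Lemma SE_lip E E' : 0 < E -> E <= E' -> SE E <= SE E' + (E' - E) * ((4 * pi)^-1 * E^-1) * L.
Proof.
move=> E0 EE; have E'0 := lt_le_trans E0 EE.
have s1 := ker_sing c_gt0 msigma chord_ge E0; have s2 := ker_sing c_gt0 msigma chord_ge E'0.
have p : 0 < 4 * pi :> R by rewrite mulr_gt0// trigo.pi_gt0.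
apply: (@qsup_dist_le R L L_gt0 _ _ _ _ s1 s2 (ker_c_ge0 _ _) (ker_c_ge0 _ _)).
  by rewrite mulr_ge0 ?subr_ge0// mulr_ge0// invr_ge0 ltW.
have C0 : 0 <= (E' - E) * ((4 * pi)^-1 * E^-1).
  by rewrite mulr_ge0 ?subr_ge0// mulr_ge0// invr_ge0 ltW.
move=> s u Ds Du; rewrite /ker; case: eqVneq => su; first by rewrite subr0 normr0.
have ch := chord_gt0 c_gt0 chord_ge Ds Du su.
rewrite distrC ger0_norm; first exact: greenf_E_lip.
rewrite subr_ge0; move: EE; rewrite le_eqVlt => /predU1P[->//|EE].
by apply: ltW; exact: greenf_lt_E.
Qed.

(** In [qsup_ker_le] the cutoff is chosen first, making the first term at most e / 3; then E is
    chosen so that the second equals e / 3. *)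
Lemma SE_small e : 0 < e -> exists2 E, 0 < E & SE E < e.
Proof.
move=> e0; have e30 : 0 < e / 3 by rewrite divr_gt0.
pose A := 2 * 8 * hc R * chord_c c * schur_c L.
have A0 : 0 <= A.
  by rewrite /A mulr_ge0 ?schur_c_ge0// mulr_ge0 ?chord_c_ge0// mulr_ge0// ltW// hc_gt0.
have A1 : 0 < A + 1 by rewrite ltr_wpDl.
have : (fun t : R => t `^ 8^-1) @ 0^'+ --> (0 : R) by apply: powR_cvg0; rewrite invr_gt0.
move=> /cvgr0Pnorm_le/(_ (e / 3 / (A + 1))); rewrite divr_gt0// => /(_ isT).
move=> [d1 /= d10 Hd1]; pose eta := d1 / 2.
have eta0 : 0 < eta by rewrite divr_gt0.
have etad : eta < d1 by rewrite ltr_pdivrMr// mulr_natr mulr2n ltrDl.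
have Heta : eta `^ 8^-1 <= e / 3 / (A + 1).
  have := Hd1 eta; rewrite /ball_ /= sub0r normrN gtr0_norm// => /(_ etad eta0).
  by rewrite ger0_norm ?powR_ge0.
have p : 0 < 4 * pi * eta :> R by rewrite mulr_gt0// mulr_gt0// trigo.pi_gt0.
pose E := (4 * pi * eta)^-1 * L / (e / 3).
have E0 : 0 < E by rewrite divr_gt0// mulr_gt0// invr_gt0.
exists E => //; apply: (le_lt_trans (qsup_ker_le E0 eta0)).
have -> : (4 * pi * eta)^-1 * E^-1 * L = e / 3.
  by apply: scale_aux => //; rewrite invr_gt0.
have H : shift_c c eta * schur_c L <= e / 3.
  have -> : shift_c c eta * schur_c L = A * eta `^ 8^-1 by rewrite /shift_c /A; ring.
  apply: (@le_trans _ _ ((A + 1) * eta `^ 8^-1)); first by rewrite ler_wpM2r ?powR_ge0// lerDl.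
  by rewrite mulrC -ler_pdivlMr.
exact: third_aux.
Qed.

Lemma SE_big M : exists2 E, 0 < E & M < SE E.
Proof.
pose C := (4 * pi)^-1 * expR (- 1 - sqn (seg L) / 4) * L.
have C0 : 0 < C by rewrite mulr_gt0// mulr_gt0 ?expR_gt0// invr_gt0 mulr_gt0// trigo.pi_gt0.
(* With E = exp(-x) the logarithmic lower bound, times L, is C x = |M| + 1. *)
pose x := (`|M| + 1) / C; have x0 : 0 < x by rewrite divr_gt0// ltr_wpDl.
exists (expR (- x)); first exact: expR_gt0.
have h := qsup_ker_ge (expR_gt0 (- x)).
have h2 := greenf_ln_ge (expR_gt0 (- x)) _ segL_gt0; rewrite expRK opprK in h2.
have {}h2 := h2 ltac:(by rewrite -expR0 ltr_expR oppr_lt0).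
apply: lt_le_trans h; apply: (@lt_le_trans _ _ (C * x)).
  by rewrite /x mulrC divfK ?gt_eqF//; apply: (le_lt_trans (ler_norm _)); rewrite ltrDl.
by rewrite /C mulrAC; apply: ler_wpM2r => //; exact: ltW.
Qed.

Lemma SE_anti_le E E' : 0 < E -> E <= E' -> SE E' <= SE E.
Proof. by move=> E0; rewrite le_eqVlt => /predU1P[->//|h]; exact: ltW (SE_anti E0 h). Qed.

Lemma SE_continuous E : 0 < E -> {for E, continuous SE}.
Proof.
move=> E0; apply/cvgrPdist_le => e e0.
have p : 0 < 4 * pi :> R by rewrite mulr_gt0// trigo.pi_gt0.
have E20 : 0 < E / 2 by rewrite divr_gt0.
pose C := (4 * pi)^-1 * (E / 2)^-1 * L.
have C0 : 0 < C by rewrite mulr_gt0// mulr_gt0 ?invr_gt0.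
have key x y : E / 2 < x -> x <= y -> `|SE x - SE y| <= C * (y - x).
  move=> Ex xy; have x0 := lt_trans E20 Ex.
  rewrite ger0_norm ?subr_ge0 ?SE_anti_le// lerBlDl; apply: (le_trans (SE_lip x0 xy)).
  rewrite lerD2l /C [leRHS]mulrC [leRHS]mulrA; apply: ler_wpM2r; first exact: ltW.
  apply: ler_wpM2l; first by rewrite subr_ge0.
  by apply: ler_wpM2l; [rewrite invr_ge0 ltW|rewrite lef_pV2 ?posrE// ltW].
have d0 : 0 < Num.min (E / 2) (e / C) by rewrite lt_min E20 divr_gt0.
near=> y.
have yd : `|E - y| < Num.min (E / 2) (e / C).
  near: y; apply/nbhs_ballP; exists (Num.min (E / 2) (e / C)) => //=; exact: d0.
move: yd; rewrite lt_min => /andP[y1 y2].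
have Ey : E / 2 < y by move: y1; rewrite ltr_norml => /andP[_ h]; lra.
have y3 : C * `|E - y| <= e by rewrite mulrC -ler_pdivlMr// ltW.
have [Eley|/ltW yleE] := leP E y.
  apply: le_trans y3; rewrite [in leRHS]distrC (ger0_norm (_ : 0 <= y - E)) ?subr_ge0//.
  by apply: key => //; lra.
apply: le_trans y3; rewrite [in leRHS]ger0_norm ?subr_ge0// distrC.
exact: key.
Unshelve. all: by end_near.
Qed.

Lemma SE_root a : 0 < a -> exists2 E, 0 < E & SE E = a.
Proof.
move=> a0; have [E1 E10 S1] := SE_small a0; have [E2 E20 S2] := SE_big a.
have E21 : E2 <= E1.
  by rewrite leNgt; apply/negP => h; have := SE_anti E10 h; have := lt_trans S1 S2 => h1 h2; have := lt_trans h1 h2; rewrite ltxx.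
have cont : {within `[E2, E1], continuous SE}.
  apply: continuous_in_subspaceT => x; rewrite inE /= in_itv/= => /andP[h _].
  by apply: SE_continuous; apply: lt_le_trans h.
have [|x] := IVT E21 cont (v := a).
  exact: minmax_aux (ltW S1) (ltW S2).
by rewrite in_itv/= => /andP[h _] <-; exists x => //; apply: lt_le_trans h.
Qed.
End spectral_sup.

Section trace_arith.
Context (R : realType).

Lemma trace_arith (M X Y Z W : R) : 0 <= X -> 0 <= M -> Y = (M + 1)^-1 * X ->
  Z <= M * ((M + 1)^-1 ^+ 2 * X) -> 0 <= Z - 2 * Y + W -> X <= (M + 1) * W.
Proof.
move=> X0 M0 -> hZ h; have M1 : 0 < M + 1 by rewrite ltr_wpDl.
have H : 0 <= M * ((M + 1)^-1 ^+ 2 * X) - 2 * ((M + 1)^-1 * X) + W by apply: (le_trans h); lra.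
have : 0 <= (M + 1) ^+ 2 * (M * ((M + 1)^-1 ^+ 2 * X) - 2 * ((M + 1)^-1 * X) + W).
  by rewrite mulr_ge0// sqr_ge0.
rewrite (_ : _ * _ = (M + 1) ^+ 2 * W - (M + 2) * X); last by field; rewrite gt_eqF.
rewrite subr_ge0 => H2.
have X1 : (M + 1) * X <= (M + 1) * ((M + 1) * W) by nra.
by move: X1; rewrite ler_pM2l.
Qed.

Lemma sum3_aux (x y z k : R) : x <= k -> y <= k -> z <= k -> x + y + z <= 3 * k.
Proof. by move=> h1 h2 h3; lra. Qed.

Lemma ip_zero_l d (T : measurableType d) (m : {measure set T -> \bar R}) (A : set T) (f g : T -> R) :
  (forall x, f x = 0) -> ip m A f g = 0.
Proof. by move=> f0; rewrite /ip /Rintegral integral0_eq// => x _; rewrite f0 mul0r. Qed.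

End trace_arith.

(** * Traces of real H^1 functions on the arc *)

Section real_trace.
Context (R : realType).
Variables (sigma : R -> R * R) (L c : R).
Notation D := (`[0, L]%classic : set mR).
Notation L2D := (L2r mu D).
Notation ipD := (ip mu D).
Hypotheses (L_gt0 : 0 < L) (c_gt0 : 0 < c).
Hypothesis msigma : measT (sigma : mR -> mR * mR).
Hypothesis chord_ge : forall s u, D s -> D u -> (c * (s - u)) ^+ 2 <= sqn (sigma s - sigma u).
Implicit Types (g h : R -> R) (u : R * R -> R).
Local Opaque greenf heat lapc gpot gpot1 gpot2 Qop ker.

Let mD : measurable D. Proof. exact: measurable_itv. Qed.

Lemma weight_restr_L2 g (M : R) : measurable_fun D (g : mR -> mR) -> (forall s, D s -> `|g s| <= M) ->
  weight L (restr L g).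
Proof.
move=> mg gM; split; first exact: restr_meas.
exists M => s; rewrite indicE; have [Ds|nD] := pselect (D s).
  by rewrite mem_set//= mulr1 restrE; move: (Ds); rewrite /= in_itv/= => ->; exact: gM.
by rewrite memNset//= mulr0 restrE; case: ifP => [H|_]; [case: nD; rewrite /= in_itv|rewrite normr0].
Qed.

Lemma restr_D g s : D s -> restr L g s = g s.
Proof. by rewrite restrE /= in_itv/= => ->. Qed.

Lemma ip_restr g f : ipD (restr L g) f = ipD g f.
Proof. by apply: eq_Rintegral => s /set_mem Ds; rewrite restr_D. Qed.

(** Tested with w / (1 + w^2), which is bounded and has the sign of w. *)
Lemma weight_orth w : L2D w -> (forall h, weight L h -> ipD h w = 0) -> ae_eq mu D w (cst 0).
Proof.
move=> Lw H; have [mw _] := Lw.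
pose h s := w s * (1 + w s ^+ 2)^-1.
have p (s : R) : 0 < 1 + w s ^+ 2 by rewrite ltr_wpDr// sqr_ge0.
have mh : measurable_fun D (h : mR -> mR).
  apply: measurable_funM => //; apply: (measurableT_comp (@measurable_inv R)).
  by apply: measurable_funD => //; exact: measurable_funX.
have hb s : `|h s| <= 1.
  rewrite normrM normfV (ger0_norm (ltW (p s))) ler_pdivrMr// mul1r.
  rewrite -real_normK ?num_real//; move: (`|w s|) (normr_ge0 (w s)) => x x0; nra.
have := H _ (weight_restr_L2 mh (fun s _ => hb s)); rewrite ip_restr => H0.
have I : intg D (fun s => h s * w s).
  by apply: L2r_mul => //; exact: L2D_bounded mh (fun s _ => hb s).
have hw0 s : 0 <= h s * w s by rewrite /h mulrAC -expr2 mulr_ge0 ?sqr_ge0// invr_ge0 ltW.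
have : (\int[mu]_(s in D) `|(h s * w s)%:E| = 0)%E.
  transitivity (ipD h w)%:E; last by rewrite H0.
  rewrite /ip /Rintegral fineK; last exact: integrable_fin_num I.
  by apply: eq_integral => s _; rewrite gee0_abs// lee_fin.
move=> /(ae_eq_integral_abs mu mD (measurable_int _ I)).
apply: filterS => s /= Hs Ds; have := Hs Ds => -[/eqP].
rewrite /h mulrAC -expr2 mulf_eq0 invr_eq0 (gt_eqF (p s)) orbF sqrf_eq0 => /eqP ->//.
Qed.

Definition is_trace u (u1 u2 : R * R -> R) tau := L2D tau /\
  exists phi : nat -> R * R -> R, [/\ forall n, test_fun (phi n), cvg2 mu2 setT phi u,
    cvg2 mu2 setT (fun n x => 'D_(e1 R) (phi n) x) u1, cvg2 mu2 setT (fun n x => 'D_(e2 R) (phi n) x) u2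
  & cvg2 mu D (fun n t => phi n (sigma t)) tau].

Lemma test_arc_meas (phi : R * R -> R) : test_fun phi -> measurable_fun D ((phi \o sigma) : mR -> mR).
Proof. by move=> tp; apply: measurable_funTS; exact: measurableT_comp (test_measurable tp) msigma. Qed.

Lemma test_arc_L2 (phi : R * R -> R) : test_fun phi -> L2D (phi \o sigma).
Proof.
move=> tp; have [C HC] := test_bounded tp.
exact: (L2D_bounded (test_arc_meas tp) (fun s _ => HC (sigma s))).
Qed.

Lemma weightZ g (a : R) : weight L g -> weight L (fun s => a * g s).
Proof.
move=> [mg [M HM]]; split; first exact: measurable_funM.
by exists (`|a| * M) => s; rewrite normrM -mulrA; apply: ler_wpM2l.
Qed.

(** Duality: take the potential p of the density a phi on the arc and expand the energy of p - phi,
    which is nonnegative. Its cross term is a multiple of the squared norm of phi on the arc, and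
    the energy of p is controlled by the Schur bound M; a = 1/(M + 1) makes the cross term
    prevail. *)
Lemma trace_ineq : exists C : R, forall phi, test_fun phi ->
  ipD (phi \o sigma) (phi \o sigma) <= C * energy 1 phi (fun x => 'D_(e1 R) phi x) (fun x => 'D_(e2 R) phi x)
     phi (fun x => 'D_(e1 R) phi x) (fun x => 'D_(e2 R) phi x).
Proof.
have E0 : 0 < 1 :> R := ltr01.
have sK := ker_sing c_gt0 msigma chord_ge E0.
pose M := lapc 1 * chord_c c * schur_c L; have M0 : 0 <= M.
  by rewrite mulr_ge0 ?schur_c_ge0//; exact: ker_c_ge0.
exists (M + 1) => phi tp; have [C HC] := test_bounded tp.
pose f := restr L (phi \o sigma); pose a := (M + 1)^-1.
have wf : weight L f := weight_restr_L2 (test_arc_meas tp) (fun s _ => HC (sigma s)).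
have wa := weightZ a wf; have Lf := weight_L2 wf; have La := weight_L2 wa.
have [p [p1 [p2 P]]] := pot_exists L_gt0 c_gt0 E0 msigma chord_ge wa.
have e1E := is_pot_energy L_gt0 c_gt0 E0 msigma chord_ge wa wa P P.
have e2E := is_pot_test L_gt0 E0 msigma wa P tp.
have [[Lp Lp1 Lp2] _] := P.
have T0 := test_L2r tp; have T1 := test_L2r (test_D (e1 R) tp); have T2 := test_L2r (test_D (e2 R) tp).
have S := energy_sub 1 Lp Lp1 Lp2 T0 T1 T2.
have := energy_ge0 (p \- phi) (p1 \- (fun x => 'D_(e1 R) phi x)) (p2 \- (fun x => 'D_(e2 R) phi x)) E0.
rewrite S e1E e2E.
have La' := test_arc_L2 tp.
have X1 : ipD (fun s => a * f s) (phi \o sigma) = a * ipD (phi \o sigma) (phi \o sigma).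
  by apply: (etrans (ipZl mD a Lf La')); rewrite ip_restr.
have X2 : ipD f f = ipD (phi \o sigma) (phi \o sigma).
  by apply: eq_Rintegral => s /set_mem Ds; rewrite /f restr_D.
have X3 : ipD (fun s => a * f s) (Qop L (ker sigma 1 0) (fun s => a * f s)) <= M * (a ^+ 2 * ipD (phi \o sigma) (phi \o sigma)).
  apply: (le_trans (ler_norm _)); apply: (le_trans (Qop_schur L_gt0 sK (ker_c_ge0 _ _) La)).
  apply: ler_wpM2l => //; rewrite -X2 expr2 -mulrA.
  by apply: le_of_eq; apply: (etrans (ipZl mD a Lf La)); congr (_ * _); exact: (ipZr mD a Lf Lf).
exact: (trace_arith (ip_ge0 _ _ _) M0 X1 X3).
Qed.

Lemma trace_exists u (u1 u2 : R * R -> R) : L2p u -> L2p u1 -> L2p u2 ->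
  weak_deriv (e1 R) u u1 -> weak_deriv (e2 R) u u2 -> exists tau, is_trace u u1 u2 tau.
Proof.
move=> Lu Lu1 Lu2 w1 w2; have [phi [tp c0 c1 c2]] := H1_density Lu Lu1 Lu2 w1 w2.
have T0 n := test_L2r (tp n); have T1 n := test_L2r (test_D (e1 R) (tp n)).
have T2 n := test_L2r (test_D (e2 R) (tp n)).
have C0 := cvg2_cauchy2 mT T0 Lu c0; have C1 := cvg2_cauchy2 mT T1 Lu1 c1.
have C2 := cvg2_cauchy2 mT T2 Lu2 c2.
have [C HC] := trace_ineq.
have La n := test_arc_L2 (tp n).
have [|tau Lt ct] := L2_complete mD La; last by exists tau; split=> //; exists phi.
move=> e e0; pose k := e / (3 * (`|C| + 1)).
have C10 : 0 < `|C| + 1 by rewrite ltr_wpDl.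
have k0 : 0 < k by rewrite divr_gt0// mulr_gt0.
have [N0 H0] := C0 k k0; have [N1 H1] := C1 k k0; have [N2 H2] := C2 k k0.
exists (maxn N0 (maxn N1 N2)) => m n; rewrite !geq_max => /and3P[m0 m1 m2] /and3P[n0 n1 n2].
have td := testB (tp m) (tp n).
have D_B v x : 'D_v (phi m \- phi n) x = 'D_v (phi m) x - 'D_v (phi n) x.
  by rewrite -[phi m \- phi n]/(phi m - phi n) deriveB//; apply: smooth_derivable; [have [] := tp m|have [] := tp n].
have B := HC _ td.
have E1 v : ip2 (fun x => 'D_v (phi m \- phi n) x) (fun x => 'D_v (phi m \- phi n) x) =
    ip2 ((fun x => 'D_v (phi m) x) \- (fun x => 'D_v (phi n) x)) ((fun x => 'D_v (phi m) x) \- (fun x => 'D_v (phi n) x)).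
  by apply: eq_Rintegral => x _; rewrite D_B.
apply: (le_trans B); rewrite /energy !E1 mul1r.
have K0 := H0 m n m0 n0; have K1 := H1 m n m1 n1; have K2 := H2 m n m2 n2.
have S3 : forall x y z : R, 0 <= x -> 0 <= y -> 0 <= z -> x <= k -> y <= k -> z <= k -> C * (x + y + z) <= e.
  move=> x y z x0 y0 z0 xk yk zk; apply: (@le_trans _ _ ((`|C| + 1) * (3 * k))).
    apply: (@le_trans _ _ ((`|C| + 1) * (x + y + z))).
      by apply: ler_wpM2r; [rewrite !addr_ge0|rewrite (le_trans (ler_norm _))// lerDl].
    by rewrite ler_pM2l//; exact: sum3_aux.
  by apply: le_of_eq; rewrite /k; move: (`|C| + 1) C10 => q q0; field; rewrite gt_eqF.
exact: (S3 _ _ _ (ip_ge0 _ _ _) (ip_ge0 _ _ _) (ip_ge0 _ _ _) K1 K2 K0).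
Qed.

Section with_E.
Variable E : R.
Hypothesis E_gt0 : 0 < E.

Lemma is_trace_pot g p (p1 p2 : R * R -> R) u (u1 u2 : R * R -> R) tau : weight L g -> is_pot sigma E g p p1 p2 ->
  L2p u -> L2p u1 -> L2p u2 -> is_trace u u1 u2 tau -> energy E p p1 p2 u u1 u2 = ipD g tau.
Proof.
move=> wg P Lu Lu1 Lu2 [Lt [phi [tp c0 c1 c2 ct]]].
have [[Lp Lp1 Lp2] _] := P.
have T0 n := test_L2r (tp n); have T1 n := test_L2r (test_D (e1 R) (tp n)).
have T2 n := test_L2r (test_D (e2 R) (tp n)); have La n := test_arc_L2 (tp n).
have C := @cvg2_energy R E p p1 p2 phi (fun n x => 'D_(e1 R) (phi n) x) (fun n x => 'D_(e2 R) (phi n) x)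
  u u1 u2 Lp Lp1 Lp2 T0 T1 T2 Lu Lu1 Lu2 c0 c1 c2.
have C' := cvg2_ipr mD La Lt (weight_L2 wg) ct.
apply: (cvg_unique _ C); first exact: Rhausdorff.
have EE : (fun n => energy E p p1 p2 (phi n) (fun x => 'D_(e1 R) (phi n) x) (fun x => 'D_(e2 R) (phi n) x)) =
    (fun n => ipD (phi n \o sigma) g).
  by apply/funext => n; rewrite (is_pot_test L_gt0 E_gt0 msigma wg P (tp n)) ipC.
by rewrite /= EE ipC.
Qed.

Definition tri u (u1 u2 : R * R -> R) tau :=
  [/\ L2p u, L2p u1 & L2p u2] /\ [/\ weak_deriv (e1 R) u u1, weak_deriv (e2 R) u u2 & is_trace u u1 u2 tau].

Lemma tri_pot g p (p1 p2 : R * R -> R) u (u1 u2 : R * R -> R) tau : weight L g -> is_pot sigma E g p p1 p2 ->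
  tri u u1 u2 tau -> energy E p p1 p2 u u1 u2 = ipD g tau.
Proof. by move=> wg P [[Lu Lu1 Lu2] [_ _ T]]; exact: is_trace_pot. Qed.

Lemma energy_ae u u' (u1 u1' u2 u2' w w1 w2 : R * R -> R) : L2p u -> L2p u1 -> L2p u2 -> L2p u' -> L2p u1' -> L2p u2' ->
  L2p w -> L2p w1 -> L2p w2 -> ae_eq mu2 setT u u' -> ae_eq mu2 setT u1 u1' -> ae_eq mu2 setT u2 u2' ->
  energy E u u1 u2 w w1 w2 = energy E u' u1' u2' w w1 w2.
Proof.
move=> [m0 _] [m1 _] [m2 _] [m0' _] [m1' _] [m2' _] [n0 _] [n1 _] [n2 _] h0 h1 h2; rewrite /energy.
have I0 := ip_ae_eq mT m0 m0' n0 h0; have I1 := ip_ae_eq mT m1 m1' n1 h1; have I2 := ip_ae_eq mT m2 m2' n2 h2.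
exact: (congr2 +%R (congr2 +%R I1 I2) (congr1 ( *%R E) I0)).
Qed.

Lemma energyC u (u1 u2 w w1 w2 : R * R -> R) : energy E u u1 u2 w w1 w2 = energy E w w1 w2 u u1 u2.
Proof. exact: (congr2 +%R (congr2 +%R (ipC _ _ _ _) (ipC _ _ _ _)) (congr1 ( *%R E) (ipC _ _ _ _))). Qed.

(** Against any density the trace pairs like the energy product with the potential of that density,
    and this product only sees u almost everywhere. Thus potentials separate traces. *)
Lemma tri_eq u (u1 u2 : R * R -> R) tau u' (u1' u2' : R * R -> R) tau' : tri u u1 u2 tau -> tri u' u1' u2' tau' ->
  ae_eq mu2 setT u u' -> [/\ ae_eq mu2 setT u1 u1', ae_eq mu2 setT u2 u2' & ae_eq mu D tau tau'].
Proof.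
move=> T T' uu; have [[Lu Lu1 Lu2] [w1 w2 [Lt _]]] := T; have [[Lu' Lu1' Lu2'] [w1' w2' [Lt' _]]] := T'.
have wt v (z : R * R -> R) : L2p z -> weak_deriv v u' z -> weak_deriv v u z.
  move=> Lz w phi tp; rewrite -(w phi tp); have [mu0 _] := Lu; have [mu0' _] := Lu'.
  have [mphi _] := test_L2r (test_D v tp); exact: (ip_ae_eq mT mu0 mu0' mphi uu).
have a1 := weak_deriv_unique Lu Lu1 Lu1' w1 (wt _ _ Lu1' w1').
have a2 := weak_deriv_unique Lu Lu2 Lu2' w2 (wt _ _ Lu2' w2').
split=> //.
have : ae_eq mu D (tau \- tau') (cst 0).
  apply: weight_orth; first exact: L2rB.
  move=> h wh; have Lh := weight_L2 wh.
  have [p [p1 [p2 P]]] := pot_exists L_gt0 c_gt0 E_gt0 msigma chord_ge wh.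
  have [[Lp Lp1 Lp2] _] := P.
  apply: (etrans (ipBr mD Lt Lt' Lh)).
  have h1 := tri_pot wh P T; have h2 := tri_pot wh P T'.
  have h3 := energy_ae Lu Lu1 Lu2 Lu' Lu1' Lu2' Lp Lp1 Lp2 uu a1 a2.
  have h4 := etrans (energyC _ _ _ _ _ _) (etrans h3 (energyC _ _ _ _ _ _)).
  apply/eqP; rewrite subr_eq0; apply/eqP; exact: (etrans (esym h1) (etrans h4 h2)).
by apply: filterS => x /= H Dx; apply/eqP; rewrite -subr_eq0; apply/eqP; exact: H.
Qed.

Lemma cvg2_ae (f_ : nat -> R -> R) f f' : (forall n, L2D (f_ n)) -> L2D f -> L2D f' -> ae_eq mu D f f' ->
  cvg2 mu D f_ f -> cvg2 mu D f_ f'.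
Proof.
move=> Lf_ Lf Lf' ff' C; rewrite /cvg2.
suff -> : (fun n => ipD (f_ n \- f') (f_ n \- f')) = (fun n => ipD (f_ n \- f) (f_ n \- f)) by exact: C.
apply/funext => n; have [m1 _] := L2rB mD (Lf_ n) Lf; have [m2 _] := L2rB mD (Lf_ n) Lf'.
have A : ae_eq mu D (f_ n \- f') (f_ n \- f) by apply: filterS ff' => x /= H Dx; rewrite H.
apply: (etrans (ip_ae_eq mD m2 m1 m2 A)); apply: (etrans (ipC _ _ _ _)).
exact: (ip_ae_eq mD m2 m1 m1 A).
Qed.

(** Some trace exists; paired with any density h it gives the energy product of two potentials,
    which is also the pairing of h with Q g. *)
Lemma tri_potential g p (p1 p2 : R * R -> R) : weight L g -> is_pot sigma E g p p1 p2 ->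
  tri p p1 p2 (Qop L (ker sigma E 0) g).
Proof.
move=> wg P; have [Lp3 _] := P; have [Lp Lp1 Lp2] := Lp3.
have [w1 w2] := is_pot_weak_deriv E_gt0 msigma wg P.
split=> //; split=> //.
have [tau T] := trace_exists Lp Lp1 Lp2 w1 w2; have [Lt [phi [tp c0 c1 c2 ct]]] := T.
have sK := ker_sing c_gt0 msigma chord_ge E_gt0.
have LQ := Qop_L2 L_gt0 sK (ker_c_ge0 _ _) (weight_L2 wg).
split=> //; exists phi; split=> //.
apply: (cvg2_ae (fun n => test_arc_L2 (tp n)) Lt LQ _ ct).
have : ae_eq mu D (tau \- Qop L (ker sigma E 0) g) (cst 0).
  apply: weight_orth; first exact: L2rB.
  move=> h wh; have Lh := weight_L2 wh.
  have [q [q1 [q2 P']]] := pot_exists L_gt0 c_gt0 E_gt0 msigma chord_ge wh.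
  apply: (etrans (ipBr mD Lt LQ Lh)).
  have h1 := is_trace_pot wh P' Lp Lp1 Lp2 T.
  have h2 := is_pot_energy L_gt0 c_gt0 E_gt0 msigma chord_ge wh wg P' P.
  apply/eqP; rewrite subr_eq0; apply/eqP; exact: (etrans (esym h1) h2).
by apply: filterS => x /= H Dx; apply/eqP; rewrite -subr_eq0; apply/eqP; exact: H.
Qed.

End with_E.

Lemma tri_zero : tri (cst 0) (cst 0) (cst 0) (cst 0).
Proof.
have t0 : test_fun (cst 0 : R * R -> R).
  by apply/test_funP; split; [exact: smooth_cst|exists 0].
have L0 := test_L2r t0.
have i0 (f : R * R -> R) : ip2 (cst 0) f = 0.
  exact: ip_zero_l.
have wd v : weak_deriv v (cst 0) (cst 0 : R * R -> R) by move=> phi tp; rewrite !i0 oppr0.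
have D0 v : (fun (n : nat) (x : R * R) => 'D_v (cst 0 : R * R -> R) x) = (fun=> cst 0).
  by apply/funext => n; apply/funext => x; rewrite derive_cst.
have c2 d (T : measurableType d) (m : {measure set T -> \bar R}) (A : set T) (f : T -> R) :
    cvg2 m A (fun=> f) f.
  rewrite /cvg2 (_ : (fun n => _) = cst 0); first exact: cvg_cst.
  by apply/funext => n; apply: ip_zero_l => x /=; rewrite subrr.
split=> //; split=> //; split; first exact: L2D_cst.
exists (fun=> cst 0); split.
- by [].
- exact: (c2 _ _ mu2 setT (cst 0)).
- apply: (eq_ind_r (fun z => cvg2 mu2 setT z (cst 0)) _ (D0 _)); exact: (c2 _ _ mu2 setT (cst 0)).
- apply: (eq_ind_r (fun z => cvg2 mu2 setT z (cst 0)) _ (D0 _)); exact: (c2 _ _ mu2 setT (cst 0)).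
- exact: (c2 _ _ mu D (cst 0)).
Qed.

End real_trace.

Definition rp (R : realType) (T : Type) (f : T -> R[i]) : T -> R := fun x => complex.Re (f x).
Definition jp (R : realType) (T : Type) (f : T -> R[i]) : T -> R := fun x => complex.Im (f x).

(** * Eigenvalues *)

Section complex_L2.
Local Open Scope complex_scope.
Context (R : realType) d (T : measurableType d) (m : {measure set T -> \bar R}) (A : set T).
Hypothesis mA : measurable A.
Notation Re := complex.Re.
Notation Im := complex.Im.
Implicit Types f g : T -> R[i].

Lemma sqnorm2E f : L2r m A (rp f) -> L2r m A (jp f) ->
  sqnorm2 m A f = (ip m A (rp f) (rp f) + ip m A (jp f) (jp f))%:E.
Proof.
move=> Lr Li; rewrite EFinD (ip_sqr mA Lr) (ip_sqr mA Li).
have [m1 _] := Lr; have [m2 _] := Li.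
rewrite -ge0_integralD//.
- by move=> x _; rewrite lee_fin sqr_ge0.
- by apply/mEFinP; exact: measurable_funX.
- by move=> x _; rewrite lee_fin sqr_ge0.
- by apply/mEFinP; exact: measurable_funX.
Qed.

Lemma L2_ReIm f : L2 m A f <-> L2r m A (rp f) /\ L2r m A (jp f).
Proof.
split=> [[m1 m2 I]|[J1 J2]]; last first.
  have [m1 _] := J1; have [m2 _] := J2; split=> //; by rewrite sqnorm2E// ltry.
split; split=> //; apply: le_lt_trans I; apply: ge0_le_integral => //.
- by move=> x _; rewrite lee_fin sqr_ge0.
- by apply/mEFinP; exact: measurable_funX.
- by apply/mEFinP; apply: measurable_funD; exact: measurable_funX.
- by move=> x _; rewrite lee_fin lerDl sqr_ge0.
- by move=> x _; rewrite lee_fin sqr_ge0.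
- by apply/mEFinP; exact: measurable_funX.
- by apply/mEFinP; apply: measurable_funD; exact: measurable_funX.
- by move=> x _; rewrite lee_fin lerDr sqr_ge0.
Qed.

Lemma innerE f g : L2r m A (rp f) -> L2r m A (jp f) -> L2r m A (rp g) -> L2r m A (jp g) ->
  inner m A f g = (ip m A (rp f) (rp g) + ip m A (jp f) (jp g)) +i*
                  (ip m A (jp f) (rp g) - ip m A (rp f) (jp g)).
Proof.
move=> Lfr Lfi Lgr Lgi.
have I1 := L2r_mul mA Lfr Lgr; have I2 := L2r_mul mA Lfi Lgi.
have I3 := L2r_mul mA Lfi Lgr; have I4 := L2r_mul mA Lfr Lgi.
have E1 := Rintegral_lin mA 1 1 I1 I2; have E2 := Rintegral_lin mA 1 (-1) I3 I4.
rewrite !mul1r in E1; rewrite mul1r mulN1r in E2.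
rewrite /inner /cintegral /ip; congr (_ +i* _).
  apply: etrans (esym E1); apply: eq_Rintegral => x _; rewrite /rp /jp /=.
  by case: (f x) (g x) => [a b] [a' b'] /=; ring.
apply: etrans (esym E2); apply: eq_Rintegral => x _; rewrite /rp /jp /=.
by case: (f x) (g x) => [a b] [a' b'] /=; ring.
Qed.

Lemma sqnorm2_cvg (f_ : nat -> T -> R[i]) f :
  (forall n, L2r m A (rp (f_ n))) -> (forall n, L2r m A (jp (f_ n))) -> L2r m A (rp f) -> L2r m A (jp f) ->
  (fun n => sqnorm2 m A (fun x => f_ n x - f x)) @ \oo --> 0%E <->
  cvg2 m A (fun n => rp (f_ n)) (rp f) /\ cvg2 m A (fun n => jp (f_ n)) (jp f).
Proof.
move=> Lr_ Li_ Lr Li.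
have EE : (fun n => sqnorm2 m A (fun x => f_ n x - f x)) =
  (fun n => (ip m A (rp (f_ n) \- rp f) (rp (f_ n) \- rp f) + ip m A (jp (f_ n) \- jp f) (jp (f_ n) \- jp f))%:E).
  apply/funext => n; have Er : rp (fun x => f_ n x - f x) = rp (f_ n) \- rp f.
    by apply/funext => x; rewrite /rp /=; case: (f_ n x) (f x) => [a b] [a' b'].
  have Ei : jp (fun x => f_ n x - f x) = jp (f_ n) \- jp f.
    by apply/funext => x; rewrite /jp /=; case: (f_ n x) (f x) => [a b] [a' b'].
  have := @sqnorm2E (fun x => f_ n x - f x); rewrite Er Ei; apply.
    exact: (L2rB mA (Lr_ n) Lr).
  exact: (L2rB mA (Li_ n) Li).
rewrite EE; split=> [H|[H1 H2]]; last first.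
  apply/fine_cvgP; split; first by apply: nearW => n; rewrite fin_numE.
  by rewrite -(addr0 (0 : R)); exact: cvgD H1 H2.
have {}H : (fun n => ip m A (rp (f_ n) \- rp f) (rp (f_ n) \- rp f) +
    ip m A (jp (f_ n) \- jp f) (jp (f_ n) \- jp f)) @ \oo --> (0 : R).
  by have /fine_cvgP[_] := H.
split.
- apply: (@squeeze_cvgr _ _ _ _ (cst 0) _ _ _ _ _ H); last exact: cvg_cst.
  by apply: nearW => n; rewrite ip_ge0/= lerDl ip_ge0.
- apply: (@squeeze_cvgr _ _ _ _ (cst 0) _ _ _ _ _ H); last exact: cvg_cst.
  by apply: nearW => n; rewrite ip_ge0/= lerDr ip_ge0.
Qed.

End complex_L2.

Section form_arith.
Context (R : rcfType).
Local Open Scope complex_scope.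
Lemma form_arith (E a b a' b' a2 b2 a2' b2' x y x' y' p q : R) :
  (a + b + (a2 + b2) - p) +i* (a' - b' + (a2' - b2') - q) =
  (- E * x + - E * y) +i* (- E * x' - - E * y') <->
  a + a2 + E * x + (b + b2 + E * y) = p /\ a' + a2' + E * x' - (b' + b2' + E * y') = q.
Proof.
split=> [[h1 h2]|[h1 h2]]; first by split; lra.
by congr (_ +i* _); lra.
Qed.

Lemma cplx_comb (al a b a2 b2 p q : R) :
  (a +i* b) + (a2 +i* b2) - al%:C * (p +i* q) = (a + a2 - al * p) +i* (b + b2 - al * q).
Proof. by apply/eqP; rewrite eq_complex /=; apply/andP; split; apply/eqP; ring. Qed.
End form_arith.

Section complex_H1.
Local Open Scope complex_scope.
Context (R : realType).
Implicit Types u v : R * R -> R[i].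

Lemma weak_partialsP (w : R * R) u g : weak_partials w u g <->
  [/\ L2r mu2 setT (rp g), L2r mu2 setT (jp g), weak_deriv w (rp u) (rp g) & weak_deriv w (jp u) (jp g)].
Proof.
have key (phi : R * R -> R) (f : R * R -> R[i]) :
    cintegral (leb2 R) setT (fun x => f x * (phi x)%:C) =
    (ip mu2 setT (rp f) phi) +i* (ip mu2 setT (jp f) phi).
  rewrite /cintegral /ip; congr (_ +i* _); apply: eq_Rintegral => x _; rewrite /rp /jp.
    by case: (f x) => [a b] /=; ring.
  by case: (f x) => [a b] /=; ring.
split=> [[/(L2_ReIm _ mT)[J1 J2] H]|[J1 J2 H1 H2]].
  split=> // phi tp; have := H phi tp; rewrite !key => -[].
    by [].
  by [].
split; first exact/(L2_ReIm _ mT).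
move=> phi tp; rewrite !key (H1 phi tp) (H2 phi tp).
by [].
Qed.

Lemma weak_partialP (w : R * R) u : weak_partials w u !=set0 ->
  [/\ L2r mu2 setT (rp (weak_partial w u)), L2r mu2 setT (jp (weak_partial w u)),
   weak_deriv w (rp u) (rp (weak_partial w u)) & weak_deriv w (jp u) (jp (weak_partial w u))].
Proof. by move=> [g Hg]; apply/weak_partialsP; exact: (xgetPex (cst 0) (ex_intro _ g Hg)). Qed.

Lemma cpartial_L2r (w : R * R) (phi : nat -> R * R -> R[i]) : (forall n, test_fun (rp (phi n))) ->
  forall n, L2r mu2 setT (rp (cpartial w (phi n))).
Proof. by move=> H n; exact: (test_L2r (test_D w (H n))). Qed.

Lemma cpartial_L2i (w : R * R) (phi : nat -> R * R -> R[i]) : (forall n, test_fun (jp (phi n))) ->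
  forall n, L2r mu2 setT (jp (cpartial w (phi n))).
Proof. by move=> H n; exact: (test_L2r (test_D w (H n))). Qed.

Variables (S : set (R * R)).
Notation sigma := (arc_param S).2.
Notation L := (arc_param S).1.
Notation D := (`[0, L]%classic : set mR).
Variable (c : R).
Hypotheses (L_gt0 : 0 < L) (c_gt0 : 0 < c).
Hypothesis msigma : measT (sigma : mR -> mR * mR).
Hypothesis chord_ge : forall s t : R, D s -> D t -> (c * (s - t)) ^+ 2 <= sqn (sigma s - sigma t).

Let mD : measurable D. Proof. exact: measurable_itv. Qed.

Lemma tracesP u tau : L2 (leb2 R) setT u -> weak_partials (e1 R) u !=set0 -> weak_partials (e2 R) u !=set0 ->
  traces S u tau <->
  is_trace sigma L (rp u) (rp (weak_partial (e1 R) u)) (rp (weak_partial (e2 R) u)) (rp tau) /\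
  is_trace sigma L (jp u) (jp (weak_partial (e1 R) u)) (jp (weak_partial (e2 R) u)) (jp tau).
Proof.
move=> /(L2_ReIm _ mT)[Lr Li] /weak_partialP[Lr1 Li1 _ _] /weak_partialP[Lr2 Li2 _ _].
split=> [[/(L2_ReIm _ mD)[Tr Ti] [phi [tp c0 c1 c2 ct]]]|].
  have tr n : test_fun (rp (phi n)) by have [] := tp n.
  have ti n : test_fun (jp (phi n)) by have [] := tp n.
  have [r0 i0] := (sqnorm2_cvg mT (fun n => test_L2r (tr n)) (fun n => test_L2r (ti n)) Lr Li).1 c0.
  have [r1 i1] := (sqnorm2_cvg mT (cpartial_L2r _ tr) (cpartial_L2i _ ti) Lr1 Li1).1 c1.
  have [r2 i2] := (sqnorm2_cvg mT (cpartial_L2r _ tr) (cpartial_L2i _ ti) Lr2 Li2).1 c2.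
  have [rt it] := (sqnorm2_cvg mD (f_ := fun n t => phi n (sigma t))
    (fun n => test_arc_L2 L msigma (tr n)) (fun n => test_arc_L2 L msigma (ti n)) Tr Ti).1 ct.
  split; split=> //.
    exists (fun n => rp (phi n)); exact: (And5 tr r0 r1 r2 rt).
  exists (fun n => jp (phi n)); exact: (And5 ti i0 i1 i2 it).
move=> [[Tr [phi [tr r0 r1 r2 rt]]] [Ti [psi [ti i0 i1 i2 it]]]].
split; first exact/(L2_ReIm _ mD).
have tr' : forall n, test_fun (rp (fun x => phi n x +i* psi n x)) by [].
have ti' : forall n, test_fun (jp (fun x => phi n x +i* psi n x)) by [].
exists (fun n x => phi n x +i* psi n x); split.
- by move=> n; split; [exact: tr|exact: ti].
- have Tr' n : L2r mu2 setT (rp (fun x => phi n x +i* psi n x)) := test_L2r (tr' n).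
  have Ti' n : L2r mu2 setT (jp (fun x => phi n x +i* psi n x)) := test_L2r (ti' n).
  exact: ((sqnorm2_cvg mT Tr' Ti' Lr Li).2 (conj r0 i0)).
- exact: ((sqnorm2_cvg mT (cpartial_L2r (e1 R) tr' ) (cpartial_L2i (e1 R) ti') Lr1 Li1).2 (conj r1 i1)).
- exact: ((sqnorm2_cvg mT (cpartial_L2r (e2 R) tr' ) (cpartial_L2i (e2 R) ti') Lr2 Li2).2 (conj r2 i2)).
- have Tr' n : L2r mu D (rp (fun t => phi n (sigma t) +i* psi n (sigma t))) := test_arc_L2 L msigma (tr n).
  have Ti' n : L2r mu D (jp (fun t => phi n (sigma t) +i* psi n (sigma t))) := test_arc_L2 L msigma (ti n).
  exact: ((sqnorm2_cvg mD Tr' Ti' Tr Ti).2 (conj rt it)).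
Qed.

(** Existence of traces turns the choices made by [xget] in [weak_partial] and [trace] into objects
    with their defining properties. *)
Lemma H1_tri u : H1 u ->
  tri sigma L (rp u) (rp (weak_partial (e1 R) u)) (rp (weak_partial (e2 R) u)) (rp (trace S u)) /\
  tri sigma L (jp u) (jp (weak_partial (e1 R) u)) (jp (weak_partial (e2 R) u)) (jp (trace S u)).
Proof.
move=> [Lu p1 p2]; have TP := tracesP _ Lu p1 p2.
have [Lr Li] := (L2_ReIm _ mT _).1 Lu.
have [Lr1 Li1 wr1 wi1] := weak_partialP p1; have [Lr2 Li2 wr2 wi2] := weak_partialP p2.
have [tr Htr] := trace_exists L_gt0 c_gt0 msigma chord_ge Lr Lr1 Lr2 wr1 wr2.
have [ti Hti] := trace_exists L_gt0 c_gt0 msigma chord_ge Li Li1 Li2 wi1 wi2.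
have : traces S u (trace S u).
  by apply: (xgetPex (cst 0)); exists (fun x => tr x +i* ti x); apply/TP.
move=> /TP[h1 h2].
split; [exact: (conj (And3 Lr Lr1 Lr2) (And3 wr1 wr2 h1))|exact: (conj (And3 Li Li1 Li2) (And3 wi1 wi2 h2))].
Qed.

Lemma real_H1 (p p1 p2 : R * R -> R) : L2r mu2 setT p -> L2r mu2 setT p1 -> L2r mu2 setT p2 ->
  weak_deriv (e1 R) p p1 -> weak_deriv (e2 R) p p2 -> H1 (fun x => (p x)%:C).
Proof.
move=> Lp Lp1 Lp2 w1 w2.
have [[L0 _ _] [w0 w0' _]] := tri_zero sigma L.
split.
- by apply/(L2_ReIm _ mT).
- by exists (fun x => (p1 x)%:C); apply/weak_partialsP; exact: (And4 Lp1 L0 w1 w0).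
- by exists (fun x => (p2 x)%:C); apply/weak_partialsP; exact: (And4 Lp2 L0 w2 w0').
Qed.

Section eigen.
Variables (alpha E : R).
Hypotheses (alpha_gt0 : 0 < alpha) (E_gt0 : 0 < E).
Notation ipD := (ip mu D).

(** [f] and [g] stand for the real or imaginary part. They are polymorphic in the domain because the
    same two arguments are used for functions on the plane here and on the interval in [arcip]. *)
Definition nrg (f g : forall T : Type, (T -> R[i]) -> T -> R) u v : R :=
  energy E (f _ u) (f _ (weak_partial (e1 R) u)) (f _ (weak_partial (e2 R) u))
           (g _ v) (g _ (weak_partial (e1 R) v)) (g _ (weak_partial (e2 R) v)).

Definition arcip (f g : forall T : Type, (T -> R[i]) -> T -> R) u v : R :=
  ipD (f _ (trace S u)) (g _ (trace S v)).
Notation Re := (@rp R).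
Notation Im := (@jp R).

Lemma form_eigen u v : H1 u -> H1 v ->
  Defs.form alpha S u v = inner (leb2 R) setT (fun x => (- E)%:C * u x) v <->
  nrg Re Re u v + nrg Im Im u v = alpha * (arcip Re Re u v + arcip Im Im u v) /\
  nrg Im Re u v - nrg Re Im u v = alpha * (arcip Im Re u v - arcip Re Im u v).
Proof.
move=> Hu Hv; have [[[Lu Lu1 Lu2] [_ _ [Lt _]]] [[Lu' Lu1' Lu2'] [_ _ [Lt' _]]]] := H1_tri Hu.
have [[[Lv Lv1 Lv2] [_ _ [Ls _]]] [[Lv' Lv1' Lv2'] [_ _ [Ls' _]]]] := H1_tri Hv.
have I1 := innerE mT Lu1 Lu1' Lv1 Lv1'; have I2 := innerE mT Lu2 Lu2' Lv2 Lv2'.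
have I0 := innerE mT Lu Lu' Lv Lv'; have It := innerE mD Lt Lt' Ls Ls'.
have Er : rp (fun x => (- E)%:C * u x) = (fun x => - E * rp u x).
  by apply/funext => x; rewrite /rp; case: (u x) => [a b] /=; ring.
have Ei : jp (fun x => (- E)%:C * u x) = (fun x => - E * jp u x).
  by apply/funext => x; rewrite /jp; case: (u x) => [a b] /=; ring.
have LEr : L2r mu2 setT (rp (fun x => (- E)%:C * u x)) by rewrite Er; exact: L2rZ.
have LEi : L2r mu2 setT (jp (fun x => (- E)%:C * u x)) by rewrite Ei; exact: L2rZ.
have IE := innerE mT LEr LEi Lv Lv'.
have Z1 := etrans (congr1 (fun f => ip mu2 setT f (rp v)) Er) (ipZl mT (- E) Lu Lv); have Z2 := etrans (congr1 (fun f => ip mu2 setT f (jp v)) Ei) (ipZl mT (- E) Lu' Lv').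
have Z3 := etrans (congr1 (fun f => ip mu2 setT f (rp v)) Ei) (ipZl mT (- E) Lu' Lv); have Z4 := etrans (congr1 (fun f => ip mu2 setT f (jp v)) Er) (ipZl mT (- E) Lu Lv').
have -> : inner (leb2 R) setT (fun x => (- E)%:C * u x) v =
  (- E * ip mu2 setT (rp u) (rp v) + - E * ip mu2 setT (jp u) (jp v)) +i*
  (- E * ip mu2 setT (jp u) (rp v) - - E * ip mu2 setT (rp u) (jp v)).
  apply: (etrans IE); congr (_ +i* _); first exact: (congr2 +%R Z1 Z2).
  exact: (congr2 (fun x y => x - y) Z3 Z4).
have -> : Defs.form alpha S u v =
   (ip mu2 setT (rp (weak_partial (e1 R) u)) (rp (weak_partial (e1 R) v)) +
    ip mu2 setT (jp (weak_partial (e1 R) u)) (jp (weak_partial (e1 R) v)) +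
    (ip mu2 setT (rp (weak_partial (e2 R) u)) (rp (weak_partial (e2 R) v)) +
    ip mu2 setT (jp (weak_partial (e2 R) u)) (jp (weak_partial (e2 R) v))) -
    alpha * (arcip Re Re u v + arcip Im Im u v)) +i*
   (ip mu2 setT (jp (weak_partial (e1 R) u)) (rp (weak_partial (e1 R) v)) -
    ip mu2 setT (rp (weak_partial (e1 R) u)) (jp (weak_partial (e1 R) v)) +
    (ip mu2 setT (jp (weak_partial (e2 R) u)) (rp (weak_partial (e2 R) v)) -
    ip mu2 setT (rp (weak_partial (e2 R) u)) (jp (weak_partial (e2 R) v))) -
    alpha * (arcip Im Re u v - arcip Re Im u v)).
  apply: (etrans (congr2 (fun x y => x - alpha%:C * y) (congr2 +%R I1 I2) It)).
  exact: cplx_comb.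
exact: form_arith.
Qed.

End eigen.
End complex_H1.

Section zero_aux.
Context (R : realType).
Lemma zero_aux (E a b e f : R) : 0 < E -> 0 <= a -> 0 <= b -> E * a <= e -> E * b <= f ->
  0 <= e -> 0 <= f -> e + f = 0 -> a = 0 /\ b = 0.
Proof.
move=> E0 a0 b0 h1 h2 e0 f0 ef.
have ee : e = 0 by lra.
have ff : f = 0 by lra.
rewrite ee in h1; rewrite ff in h2.
by split; apply/le_anti; [rewrite a0 andbT -(ler_pM2l E0) mulr0|rewrite b0 andbT -(ler_pM2l E0) mulr0].
Qed.
End zero_aux.

Section eigenvalues.
Local Open Scope complex_scope.
Context (R : realType).
Implicit Types u v : R * R -> R[i].
Variables (S : set (R * R)).
Notation sigma := (arc_param S).2.
Notation L := (arc_param S).1.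
Notation D := (`[0, L]%classic : set mR).
Notation ipD := (ip mu D).
Notation L2D := (L2r mu D).
Variable (c : R).
Hypotheses (L_gt0 : 0 < L) (c_gt0 : 0 < c).
Hypothesis msigma : measT (sigma : mR -> mR * mR).
Hypothesis chord_ge : forall s t : R, D s -> D t -> (c * (s - t)) ^+ 2 <= sqn (sigma s - sigma t).
Hypothesis chord_le : forall s t : R, D s -> D t -> sqn (sigma s - sigma t) <= (s - t) ^+ 2.
Variables (alpha E : R).
Hypotheses (alpha_gt0 : 0 < alpha) (E_gt0 : 0 < E).
Notation Re := (@rp R).
Notation Im := (@jp R).
Notation K := (ker sigma E 0).
Local Opaque greenf heat lapc gpot gpot1 gpot2 Qop ker.

Let mD : measurable D. Proof. exact: measurable_itv. Qed.

Lemma ae_refl d (T : measurableType d) (m : {measure set T -> \bar R}) (A : set T) (f : T -> R) : ae_eq m A f f.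
Proof. exact: ae_eq_refl. Qed.

(** The weak derivatives and trace of [v] are chosen ones, known only almost everywhere, so all that
    is recorded is how they pair with other functions. The imaginary parts pair to zero. *)
Lemma pot_data h p (p1 p2 : R * R -> R) : weight L h -> is_pot sigma E h p p1 p2 ->
  let v := fun x => (p x)%:C in
  [/\ H1 v,
    forall w (w1 w2 : R * R -> R) tau, tri sigma L w w1 w2 tau ->
      energy E (Re v) (Re (weak_partial (e1 R) v)) (Re (weak_partial (e2 R) v)) w w1 w2 = ipD h tau,
    forall w (w1 w2 : R * R -> R) tau, tri sigma L w w1 w2 tau ->
      energy E (Im v) (Im (weak_partial (e1 R) v)) (Im (weak_partial (e2 R) v)) w w1 w2 = 0,
    forall tau, L2D tau -> ipD (Re (trace S v)) tau = ipD (Qop L K h) tau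
  & forall tau, L2D tau -> ipD (Im (trace S v)) tau = 0].
Proof.
move=> wh P v; have [[Lp Lp1 Lp2] _] := P; have [w1 w2] := is_pot_weak_deriv E_gt0 msigma wh P.
have Hv : H1 v := real_H1 S Lp Lp1 Lp2 w1 w2.
have [Tr Ti] := H1_tri L_gt0 c_gt0 msigma chord_ge Hv.
have TP := tri_potential L_gt0 c_gt0 msigma chord_ge E_gt0 wh P.
have T0 := tri_zero sigma L.
have [r1 r2 r3] := tri_eq L_gt0 c_gt0 msigma chord_ge E_gt0 Tr TP (ae_refl _ _ p).
have [i1 i2 i3] := tri_eq L_gt0 c_gt0 msigma chord_ge E_gt0 Ti T0 (ae_refl _ _ (cst 0)).
have [[Lr Lr1 Lr2] [_ _ [Lrt _]]] := Tr; have [[Li Li1 Li2] [_ _ [Lit _]]] := Ti.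
have [[_ _ _] [_ _ [LQ _]]] := TP; have [[L0 _ _] [_ _ [L0t _]]] := T0.
split=> //.
- move=> w w1' w2' tau T; have [[Lw Lw1 Lw2] _] := T.
  apply: etrans (tri_pot L_gt0 msigma E_gt0 wh P T).
  exact: (energy_ae E Lr Lr1 Lr2 Lp Lp1 Lp2 Lw Lw1 Lw2 (ae_refl _ _ p) r1 r2).
- move=> w w1' w2' tau T; have [[Lw Lw1 Lw2] _] := T.
  apply: (etrans (energy_ae E Li Li1 Li2 L0 L0 L0 Lw Lw1 Lw2 (ae_refl _ _ (cst 0)) i1 i2)).
  have z (f : R * R -> R) : ip mu2 setT (cst 0) f = 0 by exact: ip_zero_l.
  by apply: (etrans (congr2 +%R (congr2 +%R (z _) (z _)) (congr1 ( *%R E) (z _)))); rewrite mulr0 !addr0.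
- move=> tau [mt _]; have [m1 _] := Lrt; have [m2 _] := LQ; exact: (ip_ae_eq mD m1 m2 mt r3).
- move=> tau [mt _]; have [m1 _] := Lit; have [m2 _] := L0t.
  by apply: (etrans (ip_ae_eq mD m1 m2 mt i3)); exact: ip_zero_l.
Qed.

Lemma restr_sing_eq h s : Qop L K (restr L h) s = Qop L K h s.
Proof. by apply: eq_Rintegral => t /set_mem Dt; rewrite restr_D. Qed.

Let sK : sing_kernel L K (lapc E * chord_c c). Proof. exact: ker_sing c_gt0 msigma chord_ge _ E_gt0. Qed.

(** The equation tau = alpha Q tau is known only against bounded densities; symmetry of Q and
    [weight_orth] make it hold almost everywhere, so it may be paired with [tau] itself. *)
Lemma fixed_ip tau : L2D tau -> (forall h, weight L h -> ipD h tau = alpha * ipD (Qop L K h) tau) ->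
  ipD tau tau = alpha * ipD tau (Qop L K tau).
Proof.
move=> Lt H; have LQ := Qop_L2 L_gt0 sK (ker_c_ge0 _ _) Lt.
have Ls := L2rZ mD alpha LQ.
have A : ae_eq mu D (tau \- (fun s => alpha * Qop L K tau s)) (cst 0).
  apply: weight_orth; first exact: L2rB.
  move=> h wh; have Lh := weight_L2 wh.
  apply: (etrans (ipBr mD Lt Ls Lh)); rewrite (H h wh).
  have e2 := ipZr mD alpha LQ Lh.
  have e3 := Qop_sym L_gt0 sK (ker_c_ge0 _ _) Lh Lt.
  have e4 := ipC mu D (Qop L K h) tau.
  by apply: (etrans (congr1 (fun z => _ - z) e2)); rewrite e3 e4 subrr.
have [m1 _] := L2rB mD Lt Ls; have [mt _] := Lt.
have Z := ip_ae_eq mD m1 (measurable_cst _) mt A.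
have e5 := ipBl mD Lt Ls Lt; have e6 := ipZl mD alpha LQ Lt.
have e7 : ipD tau tau - alpha * ipD (Qop L K tau) tau = 0.
  by apply: (etrans (congr1 (fun z => _ - z) (esym e6))); apply: (etrans (esym e5)); apply: (etrans Z); exact: ip_zero_l.
by move/eqP: e7; rewrite subr_eq0 => /eqP e7; apply: (etrans e7); congr (_ * _); exact: ipC.
Qed.

(** Testing the eigenvalue equation with potentials shows that the trace is fixed by alpha Q, and
    the Rayleigh bound gives the inequality when the trace is nonzero. The inequality suffices to
    locate the lowest eigenvalue. *)
Lemma eigenvalue_SE : eigenvalues alpha S (- E) -> 1 <= alpha * SE sigma L E.
Proof.
move=> [u [unz [Hu _ G]]].
have [Tr Ti] := H1_tri L_gt0 c_gt0 msigma chord_ge Hu.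
have [_ [_ _ [Lrt _]]] := Tr; have [_ [_ _ [Lit _]]] := Ti.
have fx h : weight L h -> ipD h (Re (trace S u)) = alpha * ipD (Qop L K h) (Re (trace S u)) /\
    ipD h (Im (trace S u)) = alpha * ipD (Qop L K h) (Im (trace S u)).
  move=> wh; have [p [p1 [p2 P]]] := pot_exists L_gt0 c_gt0 E_gt0 msigma chord_ge wh.
  have [Hv n1 n2 a1 a2] := pot_data wh P.
  have [f1 f2] := (form_eigen L_gt0 c_gt0 msigma chord_ge alpha E Hu Hv).1 (G _ Hv).
  rewrite /nrg /arcip in f1 f2.
  have g1 := etrans (energyC _ _ _ _ _ _ _) (n1 _ _ _ _ Tr); have g2 := etrans (energyC _ _ _ _ _ _ _) (n2 _ _ _ _ Tr).
  have g3 := etrans (energyC _ _ _ _ _ _ _) (n1 _ _ _ _ Ti); have g4 := etrans (energyC _ _ _ _ _ _ _) (n2 _ _ _ _ Ti).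
  have b1 := etrans (ipC _ _ _ _) (a1 _ Lrt); have b2 := etrans (ipC _ _ _ _) (a2 _ Lrt).
  have b3 := etrans (ipC _ _ _ _) (a1 _ Lit); have b4 := etrans (ipC _ _ _ _) (a2 _ Lit).
  split.
    apply: (etrans (esym (addr0 _))); apply: (etrans (congr2 +%R (esym g1) (esym g4))); apply: (etrans f1).
    by apply: (etrans (congr1 ( *%R alpha) (congr2 +%R b1 b4))); rewrite addr0.
  apply: (etrans (esym (subr0 _))); apply: (etrans (congr2 (fun x y => x - y) (esym g3) (esym g2))); apply: (etrans f2).
  by apply: (etrans (congr1 ( *%R alpha) (congr2 (fun x y => x - y) b3 b2))); rewrite subr0.
have F1 := fixed_ip Lrt (fun h wh => (fx h wh).1); have F2 := fixed_ip Lit (fun h wh => (fx h wh).2).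
have Q1 := q_le L_gt0 sK (ker_c_ge0 _ _) Lrt; have Q2 := q_le L_gt0 sK (ker_c_ge0 _ _) Lit.
have pos tau : L2D tau -> ipD tau tau = alpha * ipD tau (Qop L K tau) -> ipD tau (Qop L K tau) <= qsup L K * ipD tau tau ->
   ipD tau tau != 0 -> 1 <= alpha * SE sigma L E.
  move=> Lt e1 e2 nz; have t0 : 0 < ipD tau tau by rewrite lt_neqAle eq_sym nz ip_ge0.
  rewrite -(ler_pM2r t0) mul1r {1}e1 -mulrA; apply: ler_wpM2l; [exact: ltW|exact: e2].
(* If both parts of the trace vanish, testing with [u] itself makes its energy zero, hence [u] zero
   almost everywhere. *)
have [r0|r0] := eqVneq (ipD (Re (trace S u)) (Re (trace S u))) 0; last exact: pos Lrt F1 Q1 r0.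
have [i0|i0] := eqVneq (ipD (Im (trace S u)) (Im (trace S u))) 0; last exact: pos Lit F2 Q2 i0.
exfalso; apply: unz.
have [f1 _] := (form_eigen L_gt0 c_gt0 msigma chord_ge alpha E Hu Hu).1 (G _ Hu).
rewrite /nrg /arcip r0 i0 addr0 mulr0 in f1.
have [_ _ c1] := energy_comp (Re u) (Re (weak_partial (e1 R) u)) (Re (weak_partial (e2 R) u)) E_gt0.
have [_ _ c2] := energy_comp (Im u) (Im (weak_partial (e1 R) u)) (Im (weak_partial (e2 R) u)) E_gt0.
have p1 := energy_ge0 (Re u) (Re (weak_partial (e1 R) u)) (Re (weak_partial (e2 R) u)) E_gt0.
have p2 := energy_ge0 (Im u) (Im (weak_partial (e1 R) u)) (Im (weak_partial (e2 R) u)) E_gt0.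
have [z1 z2] : ip mu2 setT (Re u) (Re u) = 0 /\ ip mu2 setT (Im u) (Im u) = 0.
  exact: (zero_aux E_gt0 (ip_ge0 mu2 setT (Re u)) (ip_ge0 mu2 setT (Im u)) c1 c2 p1 p2 f1).
have [[Lr _ _] _] := Tr; have [[Li _ _] _] := Ti.
have y1 := ip_eq0_ae mT Lr z1; have y2 := ip_eq0_ae mT Li z2.
apply: filterS2 y1 y2 => x h1 h2.
have := h1 I; have := h2 I; rewrite /rp /jp /=; case: (u x) => [a b] /= -> ->.
by [].
Qed.

(** The eigenfunction is the potential of the Perron function, whose upper bound M makes it, cut to
    the interval, an admissible density. *)
Lemma SE_eigenvalue : alpha * SE sigma L E = 1 -> eigenvalues alpha S (- E).
Proof.
move=> aS; have [g [m [M [m0 Lg gm Qg]]]] := perron_ker L_gt0 c_gt0 msigma chord_ge chord_le E_gt0.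
have [mg _] := Lg.
have gb s : D s -> `|g s| <= M.
  by move=> Ds; have /andP[h1 h2] := gm s Ds; rewrite ger0_norm// (le_trans (ltW m0)).
have wg := weight_restr_L2 mg gb; have Lwg := weight_L2 wg.
have [p [p1 [p2 P]]] := pot_exists L_gt0 c_gt0 E_gt0 msigma chord_ge wg.
have [Hu n1 n2 a1 a2] := pot_data wg P.
pose u := fun x => (p x)%:C; exists u.
have QE s : D s -> alpha * Qop L K (restr L g) s = g s.
  by move=> Ds; rewrite restr_sing_eq Qg// mulrA aS mul1r.
have Qip tau : L2D tau -> alpha * ipD (Re (trace S u)) tau = ipD (restr L g) tau.
  move=> Lt; rewrite a1//; have LQ := Qop_L2 L_gt0 sK (ker_c_ge0 _ _) Lwg.
  apply: (etrans (esym (ipZl mD alpha LQ Lt))).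
  by apply: eq_Rintegral => s /set_mem Ds /=; rewrite QE// restr_D.
split; last split=> //.
(* Were the potential zero, so would be its trace, which is g / alpha with g bounded below by m >
   0. *)
- move=> u0.
  have [[Lp Lp1 Lp2] _] := P.
  have TP := tri_potential L_gt0 c_gt0 msigma chord_ge E_gt0 wg P; have T0 := tri_zero sigma L.
  have p0 : ae_eq mu2 setT p (cst 0).
    have u0' : {ae mu2, forall x, u x = 0} := u0.
    by apply: filterS u0' => x /= + _; rewrite /u => /eqP; rewrite eq_complex /= => /andP[/eqP].
  have [_ _ z] := tri_eq L_gt0 c_gt0 msigma chord_ge E_gt0 TP T0 p0.
  have [_ [_ _ [LQ _]]] := TP; have [mQ _] := LQ; have [mw _] := Lwg.
  have Z := ip_ae_eq mD mQ (measurable_cst _) mw z.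
  have {}Z : ipD (Qop L K (restr L g)) (restr L g) = 0 by apply: (etrans Z); exact: ip_zero_l.
  have gg : ipD g g = 0.
    transitivity (alpha * ipD (Qop L K (restr L g)) (restr L g)); last by rewrite Z mulr0.
    rewrite -(ipZl mD alpha LQ Lwg); apply: eq_Rintegral => s /set_mem Ds /=.
    by rewrite QE// restr_D.
  have : 0 < ipD g g.
    apply: (@lt_le_trans _ _ (m * m * L)); first by rewrite !mulr_gt0.
    rewrite -(Rint_cstD L_gt0); apply: (le_Rintegral mD); first exact: (int_cstD L _).
      exact: (L2r_mul mD Lg Lg).
    by move=> s Ds; have /andP[gs _] := gm s Ds; apply: ler_pM => //; exact: ltW.
  by rewrite gg ltxx.
- have [[[Lu _ _] _] [[Lu' _ _] _]] := H1_tri L_gt0 c_gt0 msigma chord_ge Hu.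
  have Er : rp (fun x => (- E)%:C * u x) = (fun x => - E * rp u x).
    by apply/funext => x; rewrite /rp /u /=; ring.
  have Ei : jp (fun x => (- E)%:C * u x) = (fun x => - E * jp u x).
    by apply/funext => x; rewrite /jp /u /=; ring.
  apply/(L2_ReIm _ mT); rewrite Er Ei; split; exact: L2rZ.
move=> v Hv; have [Tr Ti] := H1_tri L_gt0 c_gt0 msigma chord_ge Hv.
have [_ [_ _ [Lrt _]]] := Tr; have [_ [_ _ [Lit _]]] := Ti.
apply/(form_eigen L_gt0 c_gt0 msigma chord_ge alpha E Hu Hv); rewrite /nrg /arcip.
split.
  apply: (etrans (congr2 +%R (n1 _ _ _ _ Tr) (n2 _ _ _ _ Ti))); rewrite addr0.
  by apply: (etrans (esym (Qip _ Lrt))); congr (_ * _); apply: (etrans (esym (addr0 _))); congr (_ + _); rewrite a2.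
apply: (etrans (congr2 (fun x y => x - y) (n2 _ _ _ _ Tr) (n1 _ _ _ _ Ti))).
apply: (etrans (congr1 (fun z => 0 - z) (esym (Qip _ Lit)))).
rewrite sub0r -mulrN; congr (_ * _); apply: (etrans (esym (sub0r _))).
by congr (_ - _); rewrite a2.
Qed.

End eigenvalues.

Section tri3.
Context (R : realType).
Lemma tri3_aux (a b x y e : R) : `|a - x| <= e / 3 -> `|b - y| <= e / 3 -> `|a - b| <= e / 3 -> `|x - y| <= e.
Proof. rewrite !ler_norml => /andP[? ?] /andP[? ?] /andP[? ?]; apply/andP; split; lra. Qed.
Lemma half_aux (x : R) : 1 - x <= 2^-1 -> 2^-1 <= x.
Proof. by move=> h; lra. Qed.
End tri3.

(** * Chords of unit-speed curves *)

Section curve.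
Context (R : realType).
Implicit Types (s t u : R) (sigma : R -> R * R).

Notation dot a := (lin2 a.1 a.2).

Lemma dot_CS (a b : R * R) : dot a b ^+ 2 <= sqn a * sqn b.
Proof.
rewrite -subr_ge0 (_ : _ - _ = (a.1 * b.2 - a.2 * b.1) ^+ 2) ?sqr_ge0//.
by rewrite /lin2 /sqn; ring.
Qed.

Lemma dot_self (a : R * R) : dot a a = sqn a. Proof. by rewrite /lin2 /sqn !expr2. Qed.

Lemma dotB (a x y : R * R) : dot a (x - y) = dot a x - dot a y.
Proof. by rewrite /lin2 /=; ring. Qed.

Lemma sqn_enorm (a : R * R) : enorm a ^+ 2 = sqn a.
Proof. by rewrite sqr_sqrtr// sqn_ge0. Qed.

Lemma sqn_eq0 (a : R * R) : sqn a = 0 -> a = 0.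
Proof.
move=> /eqP; rewrite paddr_eq0 ?sqr_ge0// !sqrf_eq0 => /andP[/eqP h1 /eqP h2].
by rewrite [a]surjective_pairing h1 h2.
Qed.

Lemma is_derive_lin2 sigma t A B : smooth sigma ->
  is_derive t (1 : R) (fun t => lin2 A B (sigma t)) (lin2 A B ('D_1 sigma t)).
Proof.
move=> ss; have ds := smooth_differentiable t ss.
have dl : differentiable (lin2 A B) (sigma t) by exact: linear_differentiable (@lin2_continuous R A B).
have dc : differentiable (lin2 A B \o sigma) t by exact: differentiable_comp.
apply: DeriveDef; first exact: diff_derivable.
by rewrite -[fun t => _]/(lin2 A B \o sigma) deriveE// diff_comp//= diff_lin ?deriveE//; exact: lin2_continuous.
Qed.

Lemma lin2_curve_continuous sigma A B : smooth sigma -> continuous (fun t => lin2 A B (sigma t)).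
Proof.
move=> ss t; have [d _] := is_derive_lin2 t A B ss.
by apply/differentiable_continuous/derivable1_diffP.
Qed.

(** The mean value theorem fails for plane curves but holds for each of their linear projections. *)
Lemma dot_MVT sigma A B (s u : R) : smooth sigma -> exists2 t, Num.min s u <= t <= Num.max s u &
  lin2 A B (sigma u) - lin2 A B (sigma s) = lin2 A B ('D_1 sigma t) * (u - s).
Proof.
move=> ss; wlog su : s u / s <= u.
  move=> H; have /orP[su|us] := le_total s u; first exact: H.
  have [t ht e] := H u s us; exists t; first by rewrite minC maxC.
  by rewrite -opprB e -mulrN opprB.
have [t ht e] := MVT_segment su (fun t _ => is_derive_lin2 t A B ss)
  (continuous_subspaceT (@lin2_curve_continuous sigma A B ss)).
by exists t; [rewrite (min_idPl su) (max_idPr su); move: ht; rewrite in_itv|exact: e].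
Qed.

Section unit_speed.
Variables (sigma : R -> R * R) (L : R).
Hypotheses (L_gt0 : 0 < L) (ss : smooth sigma).
Notation D := (`[0, L]%classic : set R).
Hypothesis speed : forall t, D t -> enorm ('D_1 sigma t) = 1.

Lemma between_D s u t : D s -> D u -> Num.min s u <= t <= Num.max s u -> D t.
Proof.
rewrite /= !in_itv/= => /andP[s0 sL] /andP[u0 uL] /andP[h1 h2]; apply/andP; split.
  by apply: le_trans h1; rewrite le_min s0 u0.
by apply: (le_trans h2); rewrite ge_max sL uL.
Qed.

Lemma unit_sqn t : D t -> sqn ('D_1 sigma t) = 1.
Proof. by move=> Dt; rewrite -sqn_enorm speed// expr1n. Qed.

(** Projection on the chord itself, whose squared length is then a tangential component times s - u;
    Cauchy-Schwarz with unit speed concludes. *)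
Lemma arc_chord_le s u : D s -> D u -> sqn (sigma s - sigma u) <= (s - u) ^+ 2.
Proof.
move=> Ds Du; set a := sigma s - sigma u.
have [t ht e] := dot_MVT a.1 a.2 u s ss.
have Dt := between_D Du Ds ht.
have e2 : sqn a = dot a ('D_1 sigma t) * (s - u) by rewrite -e -dotB dot_self.
have [a0|a0] := eqVneq (sqn a) 0; first by rewrite a0 sqr_ge0.
have ap : 0 < sqn a by rewrite lt_neqAle eq_sym a0 sqn_ge0.
have := dot_CS a ('D_1 sigma t); rewrite unit_sqn// mulr1 => cs.
rewrite -(ler_pM2l ap) -expr2 {1}e2 exprMn; apply: ler_wpM2r => //; exact: sqr_ge0.
Qed.

Lemma smooth_measurable_curve : measT (sigma : mR -> mR * mR).
Proof.
apply/measurable_fun_pairP; split.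
  apply: continuous_measurable_fun => t.
  have := @lin2_curve_continuous sigma 1 0 ss t.
  by under eq_fun do rewrite /lin2 mulr1 mulr0 addr0.
apply: continuous_measurable_fun => t.
have := @lin2_curve_continuous sigma 0 1 ss t.
by under eq_fun do rewrite /lin2 mulr1 mulr0 add0r.
Qed.

Hypothesis inj : set_inj `[0, L] sigma.

Lemma ultra_point (U : set_system nat) (s_ : nat -> R) : UltraFilter U -> (forall n, D (s_ n)) ->
  exists2 l, D l & forall e, 0 < e -> U [set n | `|s_ n - l| <= e].
Proof.
move=> UU Ds.
have [|l Hl] := @ultra_bounded R U s_ L UU.
  by move=> n; have := Ds n; rewrite /= in_itv/= => /andP[h1 h2]; rewrite ger0_norm.
exists l => //; rewrite /= in_itv/=; apply/andP; split; apply/ler_addgt0Pl => e e0;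
  have [n /= Hn] := filter_ex (Hl e e0); have := Ds n; rewrite /= in_itv/= => /andP[h1 h2];
  move: Hn; rewrite ler_norml => /andP[h3 h4]; lra.
Qed.

Lemma curve_coord_near A B t e : 0 < e -> exists2 d, 0 < d & forall s, `|s - t| <= d ->
  `|lin2 A B (sigma s) - lin2 A B (sigma t)| <= e.
Proof.
move=> e0; have c := @lin2_curve_continuous sigma A B ss.
have /cvgrPdist_le/(_ e e0)/nbhs_ballP[d /= d0 Hd] := c t.
exists (d / 2) => [|s sd]; first by rewrite divr_gt0.
rewrite distrC; apply: Hd; rewrite /ball /= distrC; apply: (le_lt_trans sd).
by rewrite ltr_pdivrMr// mulr_natr mulr2n ltrDl.
Qed.

Lemma tangent_near t : D t -> exists2 d, 0 < d & forall s, `|s - t| <= d ->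
  2^-1 <= dot ('D_1 sigma t) ('D_1 sigma s).
Proof.
move=> Dt; have s1 : smooth (fun t => 'D_1 sigma t) by exact: smooth_D.
set v := 'D_1 sigma t.
have c := @lin2_curve_continuous (fun t => 'D_1 sigma t) v.1 v.2 s1.
have h : 0 < 2^-1 :> R by rewrite invr_gt0.
have /cvgrPdist_le/(_ _ h)/nbhs_ballP[d /= d0 Hd] := c t.
exists (d / 2) => [|s sd]; first by rewrite divr_gt0.
have : `|dot v v - dot v ('D_1 sigma s)| <= 2^-1.
  apply: Hd; rewrite /ball /= distrC; apply: (le_lt_trans sd).
  by rewrite ltr_pdivrMr// mulr_natr mulr2n ltrDl.
rewrite dot_self unit_sqn// ler_norml => /andP[_]; exact: half_aux.
Qed.

Lemma coord_sub_le A B e : 0 <= e -> forall x : R * R, sqn x <= e ^+ 2 -> A ^+ 2 + B ^+ 2 <= 1 -> `|lin2 A B x| <= e.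
Proof.
move=> e0 x xe AB; apply: sqr_norm_le => //; have := dot_CS (A, B) x => /= h.
apply: (le_trans h); apply: le_trans xe; rewrite ler_piMl ?sqn_ge0//.
Qed.

(** Pairs of parameters violating the bound with constants tending to 0 have limits s and u along an
    ultrafilter. Their images coincide, so s = u by injectivity; but near s the projection on the
    tangent at s makes chords at least half the parameter distance. *)
Lemma arc_chord_ge : exists2 c, 0 < c & forall s u, D s -> D u -> (c * (s - u)) ^+ 2 <= sqn (sigma s - sigma u).
Proof.
apply: contrapT => H.
(* The constant 1/(n + 2) is at most 1/2 for every n, which is what the final contradiction with the
   tangent bound needs. *)
have bad n : exists z : R * R, [/\ D z.1, D z.2 & sqn (sigma z.1 - sigma z.2) < (n.+2%:R^-1 * (z.1 - z.2)) ^+ 2].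
  apply: contrapT => G; apply: H; exists n.+2%:R^-1; first by rewrite invr_gt0.
  by move=> s u Ds Du; rewrite leNgt; apply/negP => lt; apply: G; exists (s, u).
have {bad} [z Hz] := choice bad.
have Dz1 n : D (z n).1 by have [] := Hz n.
have Dz2 n : D (z n).2 by have [] := Hz n.
have lt n : sqn (sigma (z n).1 - sigma (z n).2) < (n.+2%:R^-1 * ((z n).1 - (z n).2)) ^+ 2 by have [] := Hz n.
have [U [UU UF]] := @ultraFilterLemma nat \oo _.
have [s Ds Hs] := ultra_point UU Dz1; have [u Du Hu] := ultra_point UU Dz2.
have zL n : `|(z n).1 - (z n).2| <= L.
  have := Dz1 n; have := Dz2 n; rewrite /= !in_itv/= => /andP[a1 a2] /andP[b1 b2].
  by rewrite ler_norml; apply/andP; split; lra.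
have eq A B : A ^+ 2 + B ^+ 2 <= 1 -> lin2 A B (sigma s) = lin2 A B (sigma u).
  move=> AB; apply/eqP; rewrite -subr_eq0 -normr_le0; apply/ler_addgt0Pl => e e0; rewrite addr0.
  have e30 : 0 < e / 3 by rewrite divr_gt0.
  have [d1 d10 H1] := curve_coord_near A B s e30; have [d2 d20 H2] := curve_coord_near A B u e30.
  have /cvgr0Pnorm_le/(_ (e / 3 / L)) := @cvg_harmonic R; rewrite divr_gt0// => /(_ isT)[N _ HN].
  have UN : U [set n | (N <= n)%N] by apply: UF; exists N.
  have [n [/= n1 [n2 n3]]] := filter_ex (filterI (Hs d1 d10) (filterI (Hu d2 d20) UN)).
  have a1 := H1 _ n1; have a2 := H2 _ n2.
  have a3 : `|lin2 A B (sigma (z n).1) - lin2 A B (sigma (z n).2)| <= e / 3.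
    have -> : lin2 A B (sigma (z n).1) - lin2 A B (sigma (z n).2) = lin2 A B (sigma (z n).1 - sigma (z n).2).
      by rewrite /lin2 /=; ring.
    apply: (coord_sub_le (ltW e30)) => //; apply: (le_trans (ltW (lt n))).
    have i0 : 0 < n.+2%:R^-1 :> R by rewrite invr_gt0.
    rewrite -(real_normK (num_real (_ * _))) lerXn2r ?nnegrE ?(ltW e30)// normrM (ger0_norm (ltW i0)).
    apply: (@le_trans _ _ (e / 3 / L * L)); last by rewrite divfK// gt_eqF.
    apply: ler_pM => //.
    have := HN n n3; rewrite /= ger0_norm// => h; apply: le_trans h.
    by rewrite lef_pV2 ?posrE// ler_nat.
  exact: tri3_aux a1 a2 a3.
have su : sigma s = sigma u.
  have e1 := eq 1 0; have e2 := eq 0 1.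
  rewrite /lin2 !expr1n !expr0n /= !mulr1 !mulr0 !addr0 in e1 e2.
  rewrite [sigma s]surjective_pairing [sigma u]surjective_pairing e1//.
  by have := e2; rewrite !add0r => ->.
have {}su : s = u.
  by apply: inj => //; rewrite inE.
subst u; have [d d0 Hd] := tangent_near Ds.
have [n [/= n1 n2]] := filter_ex (filterI (Hs d d0) (Hu d d0)).
set v := 'D_1 sigma s in Hd.
have [t ht e] := dot_MVT v.1 v.2 (z n).2 (z n).1 ss.
have td : `|t - s| <= d.
  move: ht n1 n2; rewrite ge_min le_max !ler_norml => /andP[/orP h1 /orP h2] /andP[x1 x2] /andP[x3 x4].
  by apply/andP; split; [case: h1 => h1; lra|case: h2 => h2; lra].
have h := Hd t td; have := lt n; apply/negP; rewrite -leNgt.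
have cs := dot_CS v (sigma (z n).1 - sigma (z n).2).
rewrite unit_sqn// mul1r dotB e in cs; apply: le_trans cs.
rewrite !exprMn; apply: ler_wpM2r; first exact: sqr_ge0.
apply: (@le_trans _ _ (2^-1 ^+ 2)).
  by rewrite lerXn2r ?nnegrE ?invr_ge0// lef_pV2 ?posrE// ler_nat.
by rewrite lerXn2r ?nnegrE ?invr_ge0// (le_trans _ h)// invr_ge0.
Qed.

End unit_speed.
End curve.

(** * Comparison of an arc with the segment of the same length *)

Section arcs.
Context (R : realType).
Notation mR := (measurableTypeR R).
Implicit Types (S T : set (R * R)) (s t u : R).

Lemma arc_paramP S : smooth_open_arc S -> arclength_param S (arc_param S).
Proof. by move=> [[p Hp] _]; exact: (xgetPex (0, cst 0) (ex_intro _ p Hp)). Qed.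

Section straight.
Variables (sigma : R -> R * R) (L : R).
Hypothesis L_gt0 : 0 < L.
Notation D := (`[0, L]%classic : set R).
Hypothesis chord_le : forall s u, D s -> D u -> sqn (sigma s - sigma u) <= (s - u) ^+ 2.

Lemma sqnZ k (a : R * R) : sqn (k *: a) = k ^+ 2 * sqn a.
Proof. by rewrite -[sqn (k *: a)]/((k * a.1) ^+ 2 + (k * a.2) ^+ 2) /sqn; ring. Qed.

Lemma sqn_lin (a b : R * R) k : sqn (a - k *: b) = sqn a - 2 * k * lin2 a.1 a.2 b + k ^+ 2 * sqn b.
Proof.
rewrite -[sqn (a - k *: b)]/((a.1 - k * b.1) ^+ 2 + (a.2 - k * b.2) ^+ 2) /sqn /lin2.
ring.
Qed.

Lemma straight_arith (k l P d : R) : 0 <= k -> k <= 1 -> P <= (k * l) ^+ 2 ->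
  l ^+ 2 - 2 * 1 * d + 1 ^+ 2 * P <= (l - k * l) ^+ 2 -> P - 2 * k * d + k ^+ 2 * l ^+ 2 <= 0.
Proof.
move=> k0 k1 h1 h2.
have h3 : 0 <= k * ((l - k * l) ^+ 2 - (l ^+ 2 - 2 * 1 * d + 1 ^+ 2 * P)) by rewrite mulr_ge0// subr_ge0.
have h4 : 0 <= (1 - k) * ((k * l) ^+ 2 - P) by rewrite mulr_ge0// subr_ge0.
lra.
Qed.

(** Equality in the triangle inequality, in squared form. With k = s / L, the chord bounds from the
    start and to the end, weighted by 1 - k and k, show that the point at parameter s has squared
    distance at most 0 from the one at fraction k of the end-to-end chord. *)
Lemma straight_arc s : sqn (sigma L - sigma 0) = L ^+ 2 -> D s ->
  sigma s = sigma 0 + (s / L) *: (sigma L - sigma 0).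
Proof.
move=> H Ds; have := Ds; rewrite /= in_itv/= => /andP[s0 sL].
set w := sigma L - sigma 0; set p := sigma s - sigma 0.
have D0 : D 0 by rewrite /= in_itv/= lexx ltW.
have DL : D L by rewrite /= in_itv/= lexx ltW.
have h1 := chord_le Ds D0; rewrite subr0 -/p in h1.
have h2 := chord_le DL Ds.
have e2 : sigma L - sigma s = w - 1 *: p.
  by rewrite scale1r /w /p; apply/eqP; rewrite opprB addrA subrK.
rewrite e2 sqn_lin H in h2.
have k0 : 0 <= s / L by rewrite divr_ge0// ltW.
have k1 : s / L <= 1 by rewrite ler_pdivrMr// mul1r.
have sk : s = (s / L) * L by rewrite divfK// gt_eqF.
have : sqn (p - (s / L) *: w) <= 0.
  rewrite sqn_lin H; have -> : lin2 p.1 p.2 w = lin2 w.1 w.2 p by rewrite /lin2; ring.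
  by apply: straight_arith => //; rewrite -sk.
move=> H0; have : p - (s / L) *: w = 0 by apply: sqn_eq0; apply/le_anti; rewrite H0 sqn_ge0.
by move=> /eqP; rewrite subr_eq0 /p subr_eq addrC => /eqP.
Qed.

Lemma straight_chord s u : sqn (sigma L - sigma 0) = L ^+ 2 -> D s -> D u ->
  sqn (sigma s - sigma u) = (s - u) ^+ 2.
Proof.
move=> H Ds Du; rewrite (straight_arc H Ds) (straight_arc H Du).
set w := sigma L - sigma 0.
have -> : sigma 0 + (s / L) *: w - (sigma 0 + (u / L) *: w) = ((s - u) / L) *: w.
  by rewrite opprD addrACA subrr add0r -scalerBl -mulrBl.
have -> : sqn (((s - u) / L) *: w) = ((s - u) / L) ^+ 2 * sqn w by exact: sqnZ.
by rewrite H -exprMn divfK// gt_eqF.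
Qed.

End straight.

Section compare_arcs.
Variables (L E : R) (sigma gamma : R -> R * R) (c c' : R).
Hypotheses (L_gt0 : 0 < L) (c_gt0 : 0 < c) (c'_gt0 : 0 < c') (E_gt0 : 0 < E).
Notation D := (`[0, L]%classic : set mR).
Hypothesis msigma : measT (sigma : mR -> mR * mR).
Hypothesis mgamma : measT (gamma : mR -> mR * mR).
Hypothesis chord_ge : forall s t, D s -> D t -> (c * (s - t)) ^+ 2 <= sqn (sigma s - sigma t).
Hypothesis chord_ge' : forall s t, D s -> D t -> (c' * (s - t)) ^+ 2 <= sqn (gamma s - gamma t).
Hypothesis chord_le' : forall s t, D s -> D t -> sqn (gamma s - gamma t) <= (s - t) ^+ 2.
Hypothesis chord_cmp : forall s t, D s -> D t -> sqn (sigma s - sigma t) <= sqn (gamma s - gamma t).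

Lemma ker_cmp s u : D s -> D u -> ker gamma E 0 s u <= ker sigma E 0 s u.
Proof.
move=> Ds Du; rewrite /ker; case: eqVneq => // su.
by apply: greenf_sqn_le => //; [exact: (chord_gt0 c_gt0 chord_ge)|exact: chord_cmp].
Qed.

Lemma SE_cmp : SE gamma L E <= SE sigma L E.
Proof.
have s1 := ker_sing c'_gt0 mgamma chord_ge' E_gt0; have s2 := ker_sing c_gt0 msigma chord_ge E_gt0.
apply: (@qsup_mono R L L_gt0 _ _ _ _ s1 s2 (ker_c_ge0 _ _) (ker_c_ge0 _ _)).
- by move=> s u; exact: ker_ge0.
- by move=> s u; exact: ker_cmp.
Qed.

Lemma SE_cmp_strict (r k1 k2 : R) : 0 < r -> r < L - r -> 0 < k1 -> k1 < k2 ->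
  (forall s u, 0 <= s <= r -> L - r <= u <= L -> sqn (sigma s - sigma u) <= k1 ^+ 2 /\ k2 ^+ 2 <= sqn (gamma s - gamma u)) ->
  SE gamma L E < SE sigma L E.
Proof.
move=> r0 rr k10 k12 H; have k20 := lt_trans k10 k12.
have [g [m [M [m0 Lg gm Qg]]]] := perron_ker L_gt0 c'_gt0 mgamma chord_ge' chord_le' E_gt0.
have s1 := ker_sing c'_gt0 mgamma chord_ge' E_gt0; have s2 := ker_sing c_gt0 msigma chord_ge E_gt0.
have p1 : 0 < sqn (seg k1) by rewrite sqn_seg exprn_gt0.
have p2 : 0 < sqn (seg k2) by rewrite sqn_seg exprn_gt0.
have d0 : 0 < greenf E 0 (seg k1) - greenf E 0 (seg k2).
  rewrite subr_gt0; apply: greenf_sqn_lt => //.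
  by rewrite !sqn_seg ltrXn2r// ?nnegrE ltW.
have rL : r <= L by lra.
apply: (@qsup_strict R L L_gt0 _ _ _ _ s1 s2 (ker_c_ge0 _ _) (ker_c_ge0 _ _) g m M r _ m0 Lg gm Qg d0 r0 rL).
  by move=> s u; exact: ker_cmp.
move=> s u hs hu; have [h1 h2] := H s u hs hu; move: hs hu => /andP[a1 a2] /andP[b1 b2].
have Ds : D s by rewrite /= in_itv/= a1 (le_trans a2).
have Du : D u by rewrite /= in_itv/= b2 andbT; lra.
have su : s != u by rewrite lt_eqF//; lra.
rewrite /ker (negbTE su); apply: lerB.
  by apply: greenf_sqn_le => //; [exact: (chord_gt0 c_gt0 chord_ge)|rewrite sqn_seg].
by apply: greenf_sqn_le => //; rewrite sqn_seg.
Qed.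

End compare_arcs.

(** The root of alpha S(E) = 1 gives an eigenvalue, and since S decreases no eigenvalue can lie
    below it. The value chosen by [xget] is then forced. *)
Lemma lambda1E (alpha : R) S : 0 < alpha -> smooth_open_arc S ->
  exists E, [/\ 0 < E, alpha * SE (arc_param S).2 (arc_param S).1 E = 1 & lambda1 alpha S = - E].
Proof.
move=> a0 HS; have [L0 ss sp inj _] := arc_paramP HS.
have [c c0 cge] := arc_chord_ge L0 ss sp inj; have cle := arc_chord_le ss sp.
have ms := smooth_measurable_curve ss.
have [E E0 SEE] : exists2 E, 0 < E & SE (arc_param S).2 (arc_param S).1 E = alpha^-1.
  by apply: (SE_root L0 c0 ms cge cle); rewrite invr_gt0.
have aE : alpha * SE (arc_param S).2 (arc_param S).1 E = 1 by rewrite SEE mulfV// gt_eqF.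
exists E; split => //.
have inE' := SE_eigenvalue L0 c0 ms cge cle E0 aE.
have lb : lbound (eigenvalues alpha S) (- E).
  (* The Birman-Schwinger inequality concerns negative numbers; the others lie above -E anyway. *)
  move=> lam Hl; have [l0|l0] := leP 0 lam; first by apply: le_trans l0; rewrite oppr_le0 ltW.
  have El : 0 < - lam by rewrite oppr_gt0.
  rewrite -[lam]opprK in Hl *; rewrite lerN2 leNgt; apply/negP => lt.
  have := eigenvalue_SE L0 c0 ms cge a0 El Hl; rewrite -aE ler_pM2l//.
  by rewrite leNgt (SE_anti L0 c0 ms cge cle E0 lt).
have [h1 h2] : (eigenvalues alpha S `&` lbound (eigenvalues alpha S)) (lambda1 alpha S).
  by apply: (xgetPex 0); exists (- E).
by apply/le_anti; rewrite (h2 _ inE') (lb _ h1).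
Qed.

Lemma inD0 (L : R) : 0 < L -> `[0, L]%classic (0 : R).
Proof. by move=> L0; rewrite /= in_itv/= lexx ltW. Qed.

Lemma inDL (L : R) : 0 < L -> `[0, L]%classic L.
Proof. by move=> L0; rewrite /= in_itv/= lexx ltW. Qed.

Lemma is_derive1_cst_on (F : R -> R) (l k : R) : 0 < l -> continuous F ->
  (forall t, 0 < t < l -> is_derive t (1 : R) F k) ->
  forall s u, 0 <= s <= l -> 0 <= u <= l -> F u - F s = k * (u - s).
Proof.
move=> l0 cF dF.
have main s u : 0 <= s <= l -> 0 <= u <= l -> s <= u -> F u - F s = k * (u - s).
  move=> /andP[s0 sl] /andP[u0 ul] su.
  have [|t _ //] := @MVT_segment R F (cst k) s u su _ (continuous_subspaceT cF).
  move=> t; rewrite in_itv/= => /andP[h1 h2]; apply: dF.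
  by rewrite (le_lt_trans s0 h1) (lt_le_trans h2 ul).
move=> s u Ds Du; have /orP[su|us] := le_total s u; first exact: main.
by rewrite -opprB main// -mulrN opprB.
Qed.

Lemma sign_const (G : R -> R) (l : R) : continuous G -> (forall t, 0 < t < l -> G t ^+ 2 = 1) ->
  forall t u, 0 < t < l -> 0 < u < l -> G t = G u.
Proof.
move=> cG G1.
have main t u : 0 < t < l -> 0 < u < l -> t <= u -> G t = G u.
  move=> Dt Du tu; apply: contrapT => ne.
  have : (G t - G u) * (G t + G u) = 0 by rewrite -subr_sqr G1// G1// subrr.
  move=> /eqP; rewrite mulf_eq0 => /orP[]; first by rewrite subr_eq0 => /eqP.
  rewrite addr_eq0 => /eqP Gtu.
  have [|x] := IVT tu (continuous_subspaceT cG) (v := 0).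
    rewrite Gtu ge_min le_max; have [u0|/ltW u0] := leP 0 (G u).
      by rewrite oppr_le0 u0 orbT.
    by rewrite oppr_ge0 u0 orbT.
  rewrite in_itv/= => /andP[h1 h2] Gx.
  have : G x ^+ 2 = 1.
    by apply: G1; move: Dt Du => /andP[t0 _] /andP[_ ul]; rewrite (lt_le_trans t0 h1) (le_lt_trans h2 ul).
  by rewrite Gx expr0n => /esym/eqP; rewrite oner_eq0.
move=> t u Dt Du; have /orP[tu|ut] := le_total t u; first exact: main.
by apply/esym; exact: main.
Qed.

Section segment.
Variables (gamma : R -> R * R) (l L : R) (a b : R * R).
Hypotheses (l_gt0 : 0 < l) (L_gt0 : 0 < L) (sg : smooth gamma).
Hypothesis speed : forall t, t \in `[0, l] -> enorm ('D_1 gamma t) = 1.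
Hypothesis ab : enorm (b - a) = L.
Hypothesis im : gamma @` `[0, l] = [set x | exists2 t : R, t \in `[0, 1] & x = a + t *: (b - a)].

Let e := L^-1 *: (b - a).

Let sqn_e : sqn e = 1.
Proof. by rewrite sqnZ -sqn_enorm ab -exprMn mulVf ?expr1n// gt_eqF. Qed.

Let F t := lin2 e.1 e.2 (gamma t) - lin2 e.1 e.2 a.

Let on_line t : 0 <= t <= l -> gamma t = a + F t *: e /\ 0 <= F t <= L.
Proof.
move=> tl; have : (gamma @` `[0, l]) (gamma t) by exists t; rewrite //= in_itv.
rewrite im /= => -[k kI E]; move: kI; rewrite in_itv/= => /andP[k0 k1].
have Fk : F t = k * L.
  rewrite /F -dotB E (_ : a + k *: (b - a) - a = (k * L) *: e).
    rewrite (_ : lin2 e.1 e.2 ((k * L) *: e) = (k * L) * sqn e); first by rewrite sqn_e mulr1.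
    rewrite -[lin2 _ _ ((k * L) *: e)]/((k * L * e.1) * e.1 + (k * L * e.2) * e.2) /sqn; ring.
  by rewrite /e scalerA addrAC subrr add0r mulfK// gt_eqF.
split; last by rewrite Fk mulr_ge0 ?(ltW L_gt0)//= ler_piMl// ltW.
by rewrite {1}E Fk /e scalerA mulfK// gt_eqF.
Qed.

(** The parametrization of a segment is a chosen one, so it must be shown to be linear. Its
    coordinate F along the segment is differentiable with F'^2 = 1, and continuity of F' fixes the
    sign. *)
Lemma segment_param : l = L /\ forall s u, 0 <= s <= l -> 0 <= u <= l -> sqn (gamma s - gamma u) = (s - u) ^+ 2.
Proof.
have sub s u : 0 <= s <= l -> 0 <= u <= l -> gamma s - gamma u = (F s - F u) *: e.
  move=> /on_line[{1}-> _] /on_line[{1}-> _].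
  by rewrite opprD addrACA subrr add0r -scalerBl.
have cF : continuous F.
  move=> t; apply: cvgB; last exact: cvg_cst.
  exact: (@lin2_curve_continuous R gamma e.1 e.2 sg t).
pose F' t := lin2 e.1 e.2 ('D_1 gamma t).
have dF t : is_derive t (1 : R) F (F' t).
  by have := is_deriveB (is_derive_lin2 t e.1 e.2 sg) (is_derive_cst (lin2 e.1 e.2 a) t 1); rewrite subr0.
have cF' : continuous F' := @lin2_curve_continuous R (fun t => 'D_1 gamma t) e.1 e.2 (smooth_D (1 : R) sg).
(* Only interior parameters: the two-sided derivative at an endpoint involves values outside [0, l],
   where the curve may leave the line. Inside, the normal component of the velocity vanishes. *)
have F'1 t : 0 < t < l -> F' t ^+ 2 = 1.
  move=> tl; have tI : t \in `]0, l[ by rewrite in_itv.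
  pose n : R * R := (- e.2, e.1).
  have G0 : lin2 n.1 n.2 ('D_1 gamma t) = 0.
    have [_ <-] := is_derive_lin2 t n.1 n.2 sg.
    rewrite (@near_eq_derive _ _ _ _ (cst (lin2 n.1 n.2 a))); first exact: derive_cst.
    have := near_in_itvoo tI; apply: filterS => s; rewrite in_itv/= => /andP[s0 sl].
    have [-> _] : gamma s = a + F s *: e /\ 0 <= F s <= L by apply: on_line; rewrite !ltW.
    rewrite -[LHS]/((a.1 + F s * e.1) * - e.2 + (a.2 + F s * e.2) * e.1) /lin2 /=; ring.
  have : sqn ('D_1 gamma t) = 1.
    rewrite -sqn_enorm speed ?expr1n// in_itv/=; move: tl => /andP[/ltW -> /ltW ->//].
  have : sqn ('D_1 gamma t) * sqn e = F' t ^+ 2 + lin2 n.1 n.2 ('D_1 gamma t) ^+ 2.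
    by rewrite /F' /sqn /lin2 /n /=; ring.
  by rewrite G0 sqn_e mulr1 expr0n addr0 => -> .
have lh : 0 < l / 2 < l by rewrite divr_gt0//= ltr_pdivrMr// mulr_natr mulr2n ltrDl.
have [k k1 Fk] : exists2 k, k ^+ 2 = 1 & forall s u, 0 <= s <= l -> 0 <= u <= l -> F u - F s = k * (u - s).
  exists (F' (l / 2)); first exact: F'1.
  apply: is_derive1_cst_on => // t tl.
  by rewrite -(sign_const cF' F'1 tl lh); exact: dF.
have chord s u : 0 <= s <= l -> 0 <= u <= l -> sqn (gamma s - gamma u) = (s - u) ^+ 2.
  by move=> Ds Du; rewrite sub// sqnZ sqn_e mulr1 Fk// exprMn k1 mul1r.
(* The coordinate stays in [0, L], so l <= L; and a and b are reached at two parameters of [0, l],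
   so L <= l. *)
split=> //; apply/le_anti/andP; split.
  have D0 : 0 <= (0 : R) <= l by rewrite lexx ltW.
  have Dl : 0 <= l <= l by rewrite lexx ltW.
  have [_ /andP[a1 a2]] := on_line D0; have [_ /andP[b1 b2]] := on_line Dl.
  have : `|l| <= L.
    apply: sqr_norm_le; first exact: ltW.
    have := Fk _ _ D0 Dl; rewrite subr0 => El; have : (F l - F 0) ^+ 2 = l ^+ 2 by rewrite El exprMn k1 mul1r.
    move=> <-; rewrite -(real_normK (num_real (F l - F 0))) lerXn2r ?nnegrE ?(ltW L_gt0)//.
    by rewrite ler_norml; apply/andP; split; lra.
  by rewrite ger0_norm// ltW.
have [s Ds Es] : (gamma @` `[0, l]) a by rewrite im; exists 0; rewrite ?in_itv/= ?lexx ?ler01// scale0r addr0.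
have [u Du Eu] : (gamma @` `[0, l]) b by rewrite im; exists 1; rewrite ?in_itv/= ?lexx ?ler01// scale1r addrC subrK.
move: Ds Du; rewrite /= !in_itv/= => Ds Du.
have := chord u s Du Ds; rewrite Es Eu -sqn_enorm ab => H.
have : `|L| <= l.
  apply: sqr_norm_le; first exact: ltW.
  rewrite H -(real_normK (num_real (u - s))) lerXn2r ?nnegrE ?(ltW l_gt0)//.
  by move: Ds Du => /andP[? ?] /andP[? ?]; rewrite ler_norml; apply/andP; split; lra.
by rewrite ger0_norm// ltW.
Qed.

End segment.

Lemma enorm_eq (x y : R * R) : sqn x = sqn y -> enorm x = enorm y.
Proof. by rewrite /enorm /sqn => ->. Qed.

Lemma enorm_le (x : R * R) (k : R) : 0 <= k -> sqn x <= k ^+ 2 -> enorm x <= k.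
Proof. by move=> k0 h; rewrite -(ger0_norm k0) -sqrtr_sqr; exact: ler_wsqrtr. Qed.

Lemma enormD (x y : R * R) : enorm (x + y) <= enorm x + enorm y.
Proof.
apply: enorm_le; first by rewrite addr_ge0// sqrtr_ge0.
have h : lin2 x.1 x.2 y <= enorm x * enorm y.
  apply: (le_trans (ler_norm _)); apply: sqr_norm_le; first by rewrite mulr_ge0// sqrtr_ge0.
  by rewrite exprMn !sqn_enorm; exact: dot_CS.
have -> : sqn (x + y) = sqn x + 2 * lin2 x.1 x.2 y + sqn y.
  by rewrite -[sqn (x + y)]/((x.1 + y.1) ^+ 2 + (x.2 + y.2) ^+ 2) /sqn /lin2; ring.
by rewrite sqrrD !sqn_enorm mulr2n; move: h; move: (enorm x * enorm y) => p h; lra.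
Qed.

Lemma enormB (x y : R * R) : enorm (x - y) <= enorm x + enorm y.
Proof. by rewrite -[enorm y](enorm_eq (sqnN y)); exact: enormD. Qed.

(** In complex notation the isometry is x |-> a + z (x - x0) with z = d times the conjugate of w,
    divided by L^2, a number of modulus 1. *)
Lemma congruent_segments (S T : set (R * R)) (x0 w a d : R * R) (L : R) : 0 < L ->
  sqn w = L ^+ 2 -> sqn d = L ^+ 2 ->
  S = [set x0 + k *: w | k in `[0%R, 1%R]%classic] -> T = [set a + k *: d | k in `[0%R, 1%R]%classic] -> congruent S T.
Proof.
move=> L0 wL dL -> ->.
have L2p : L ^+ 2 != 0 by rewrite expf_neq0// gt_eqF.
pose z1 := (d.1 * w.1 + d.2 * w.2) / L ^+ 2; pose z2 := (d.2 * w.1 - d.1 * w.2) / L ^+ 2.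
pose f (x : R * R) : R * R := (a.1 + (z1 * (x.1 - x0.1) - z2 * (x.2 - x0.2)), a.2 + (z1 * (x.2 - x0.2) + z2 * (x.1 - x0.1))).
have fE k : f (x0 + k *: w) = a + k *: d.
  rewrite /f -[RHS]/(a.1 + k * d.1, a.2 + k * d.2) /=.
  have e (p q : R) : p + k * q - p = k * q by ring.
  rewrite !e; congr (_, _); congr (_ + _).
    transitivity (k * d.1 * (sqn w / L ^+ 2)); last by rewrite wL mulfV ?mulr1.
    by rewrite /z1 /z2 /sqn; move: (L ^+ 2)^-1 => q; ring.
  transitivity (k * d.2 * (sqn w / L ^+ 2)); last by rewrite wL mulfV ?mulr1.
  by rewrite /z1 /z2 /sqn; move: (L ^+ 2)^-1 => q; ring.
exists f.
  move=> x y; apply: enorm_eq.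
  have zz : z1 ^+ 2 + z2 ^+ 2 = 1.
    transitivity ((sqn d / L ^+ 2) * (sqn w / L ^+ 2)); last by rewrite dL wL mulfV ?mulr1.
    by rewrite /z1 /z2 /sqn; move: (L ^+ 2)^-1 => q; ring.
  transitivity ((z1 ^+ 2 + z2 ^+ 2) * sqn (x - y)); last by rewrite zz mul1r.
  by rewrite /sqn /f /=; ring.
apply/seteqP; split=> [_ [_ [k kI <-] <-]|_ [k kI <-]]; first by exists k.
by exists (x0 + k *: w); [exists k|].
Qed.

Lemma lt_mul_absurd (al x y : R) : 0 < al -> x < y -> al * x = 1 -> al * y = 1 -> False.
Proof. by move=> a0 xy h1 h2; move: xy; rewrite -(ltr_pM2l a0) h1 h2 ltxx. Qed.

Lemma anti_le (x y : R) : x <= y -> y <= x -> x = y.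
Proof. by move=> h1 h2; apply/le_anti; rewrite h1 h2. Qed.

Section main_compare.
Variables (alpha L : R) (Sigma Gamma : set (R * R)).
Hypotheses (alpha_gt0 : 0 < alpha) (L_gt0 : 0 < L) (seg_Gamma : line_segment L Gamma).
Hypotheses (arc_Gamma : smooth_open_arc Gamma) (arc_Sigma : smooth_open_arc Sigma).
Hypothesis len_Sigma : arc_length Sigma = L.
Notation sigma := (arc_param Sigma).2.
Notation gamma := (arc_param Gamma).2.
Notation D := (`[0, L]%classic : set mR).

Lemma segment_length : arc_length Gamma = L.
Proof.
have [l0 sg sp _ im] := arc_paramP arc_Gamma; have [a [b [ab GE]]] := seg_Gamma.
by have [] := segment_param l0 L_gt0 sg sp ab (etrans im GE).
Qed.

Lemma segment_chord s u : D s -> D u -> sqn (gamma s - gamma u) = (s - u) ^+ 2.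
Proof.
have lG := segment_length; move: lG.
have [l0 sg sp _ im] := arc_paramP arc_Gamma; have [a [b [ab GE]]] := seg_Gamma.
rewrite /arc_length => lG.
have [_ H] := segment_param l0 L_gt0 sg sp ab (etrans im GE); rewrite lG in H.
by rewrite /= !in_itv/=; exact: H.
Qed.

Lemma arc_facts S : smooth_open_arc S -> arc_length S = L -> [/\ smooth (arc_param S).2,
  measT ((arc_param S).2 : mR -> mR * mR),
  (exists2 c, 0 < c & forall s u, D s -> D u -> (c * (s - u)) ^+ 2 <= sqn ((arc_param S).2 s - (arc_param S).2 u)),
  (forall s u, D s -> D u -> sqn ((arc_param S).2 s - (arc_param S).2 u) <= (s - u) ^+ 2)
  & (arc_param S).2 @` `[0, L] = S].
Proof.
move=> HS lS; have := arc_paramP HS; rewrite /arc_length in lS; rewrite /arclength_param lS => -[l0 ss sp inj im].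
split=> //; [exact: smooth_measurable_curve|exact: arc_chord_ge|exact: arc_chord_le].
Qed.

Notation straight := (sqn (sigma L - sigma 0) = L ^+ 2).

(** For the converse, the preimages of the ends of the segment are two points of the arc at distance
    L; their parameters differ by at least L, hence are 0 and L in some order. *)
Lemma straight_congruent : straight <-> congruent Sigma Gamma.
Proof.
have [ss ms cge cle im] := arc_facts arc_Sigma len_Sigma.
have [a [b [ab GE]]] := seg_Gamma.
have abL : sqn (b - a) = L ^+ 2 by rewrite -sqn_enorm ab.
split=> [st|[f fiso fim]].
  apply: (congruent_segments L_gt0 st abL (x0 := sigma 0) (a := a)).
    apply: (etrans (esym im)); apply/seteqP; split=> [_ [s sI <-]|_ [k kI <-]].
      exists (s / L); last by rewrite (straight_arc L_gt0 cle st sI).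
      move: sI; rewrite /= !in_itv/= => /andP[s0 sL]; rewrite divr_ge0 ?(ltW L_gt0)//=.
      by rewrite ler_pdivrMr// mul1r.
    have kD : D (k * L).
      move: kI; rewrite /= !in_itv/= => /andP[k0 k1]; rewrite mulr_ge0 ?(ltW L_gt0)//=.
      by rewrite ler_piMl// ltW.
    by exists (k * L) => //; rewrite (straight_arc L_gt0 cle st kD) mulfK// gt_eqF.
  rewrite GE; apply/seteqP; split=> [x [k kI ->]|_ [k kI <-]]; first by exists k.
  by exists k.
have Ga : Gamma a by rewrite GE; exists 0; rewrite ?in_itv/= ?lexx ?ler01// scale0r addr0.
have Gb : Gamma b by rewrite GE; exists 1; rewrite ?in_itv/= ?lexx ?ler01// scale1r addrC subrK.
move: Ga Gb; rewrite -fim => -[x Sx fx] [y Sy fy].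
have [s sI sx] : (sigma @` `[0, L]) x by rewrite im.
have [u uI uy] : (sigma @` `[0, L]) y by rewrite im.
have e1 : sqn (sigma u - sigma s) = L ^+ 2.
  by rewrite sx uy -sqn_enorm -fiso fx fy ab.
have := cle u s uI sI; rewrite e1 => h.
move: sI uI; rewrite /= !in_itv/= => /andP[s0 sL] /andP[u0 uL].
have h2 : L <= `|u - s|.
  by rewrite -(@ler_pXn2r _ 2)// ?nnegrE ?(ltW L_gt0)// real_normK ?num_real.
have /orP[su|us] := le_total s u.
  rewrite ger0_norm ?subr_ge0// in h2.
  have [e2 e3] : s = 0 /\ u = L by split; apply/le_anti; apply/andP; split; lra.
  by rewrite e2 e3 in e1.
rewrite ler0_norm ?subr_le0// in h2.
have [e2 e3] : u = 0 /\ s = L by split; apply/le_anti; apply/andP; split; lra.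
by rewrite -sqnN opprB; rewrite e2 e3 in e1.
Qed.

Lemma chord_cmp_segment s t : D s -> D t -> sqn (sigma s - sigma t) <= sqn (gamma s - gamma t).
Proof.
have [_ _ _ cle _] := arc_facts arc_Sigma len_Sigma.
by move=> Ds Dt; rewrite segment_chord//; exact: cle.
Qed.

(* continuity keeps chords between the two ends short *)
Lemma ends_gap : ~ straight -> exists r k1 k2, [/\ 0 < r, r < L - r, 0 < k1, k1 < k2
  & forall s u, 0 <= s <= r -> L - r <= u <= L -> sqn (sigma s - sigma u) <= k1 ^+ 2 /\ k2 ^+ 2 <= sqn (gamma s - gamma u)].
Proof.
have [ss _ _ cle _] := arc_facts arc_Sigma len_Sigma.
have D0 := inD0 L_gt0; have DL := inDL L_gt0.
move=> ns; have lt : sqn (sigma L - sigma 0) < L ^+ 2.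
  by rewrite lt_neqAle; apply/andP; split; [exact/eqP|have := cle L 0 DL D0; rewrite subr0].
pose q := Num.sqrt (sqn (sigma L - sigma 0)).
have q0 : 0 <= q := sqrtr_ge0 _.
have qq : q ^+ 2 = sqn (sigma L - sigma 0) by rewrite sqr_sqrtr// sqn_ge0.
have qL : q < L by rewrite -(@ltr_pXn2r _ 2)// ?nnegrE ?(ltW L_gt0)// qq.
(* Moving each end by at most r changes both chords by at most 2 r, so of the gap L - q = 8 r at
   least 4 r remains between k1 and k2. *)
pose r := (L - q) / 8; have r0 : 0 < r by rewrite divr_gt0// subr_gt0.
exists r, (q + 2 * r), (L - 2 * r).
have rE : 8 * r = L - q by rewrite /r mulrC divfK.
split=> //; try lra.
move=> s u /andP[s0 sr] /andP[ur uL].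
have Ds : D s by rewrite /= in_itv/= s0; lra.
have Du : D u by rewrite /= in_itv/= uL andbT; lra.
split; last first.
  rewrite segment_chord// (_ : (s - u) ^+ 2 = (u - s) ^+ 2); last by ring.
  by rewrite lerXn2r ?nnegrE//; lra.
have h1 : enorm (sigma s - sigma 0) <= r by apply: enorm_le; [exact: ltW|apply: (le_trans (cle s 0 Ds D0)); rewrite subr0 lerXn2r ?nnegrE ?(ltW r0)].
have h2 : enorm (sigma L - sigma u) <= r.
  apply: enorm_le; [exact: ltW|apply: (le_trans (cle L u DL Du))].
  by rewrite lerXn2r ?nnegrE; lra.
have h3 : enorm (sigma L - sigma 0) = q by [].
rewrite -sqn_enorm lerXn2r ?nnegrE ?sqrtr_ge0//; first lra.
rewrite (_ : sigma s - sigma u = (sigma s - sigma 0) + ((sigma L - sigma u) - (sigma L - sigma 0))); last first.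
  apply/eqP; rewrite opprB addrCA -addrA; apply/eqP.
  rewrite -[LHS]/((sigma s).1 - (sigma u).1, (sigma s).2 - (sigma u).2).
  by congr (_, _) => /=; ring.
apply: (le_trans (enormD _ _)); have := enormB (sigma L - sigma u) (sigma L - sigma 0).
rewrite h3; lra.
Qed.

(** If E1 < E2, then S_Gamma(E2) <= S_Sigma(E2) < S_Sigma(E1), although both ends equal 1/alpha. *)
Lemma lambda1_le : lambda1 alpha Sigma <= lambda1 alpha Gamma.
Proof.
have [E1 [E10 S1 ->]] := lambda1E alpha_gt0 arc_Sigma.
have [E2 [E20 S2 ->]] := lambda1E alpha_gt0 arc_Gamma.
have lS := len_Sigma; rewrite /arc_length in lS; have lG := segment_length; rewrite /arc_length in lG.
rewrite lS in S1; rewrite lG in S2.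
have [ss ms [c c0 cge] cle _] := arc_facts arc_Sigma len_Sigma.
have [sg mg [c' c'0 cge'] cle' _] := arc_facts arc_Gamma lG.
rewrite lerN2 leNgt; apply/negP => lt.
have h1 := SE_cmp L_gt0 c0 c'0 E20 ms mg cge cge' chord_cmp_segment.
have h2 := SE_anti L_gt0 c0 ms cge cle E10 lt.
exact: (lt_mul_absurd alpha_gt0 (le_lt_trans h1 h2) S2 S1).
Qed.

Lemma lambda1_eq : lambda1 alpha Sigma = lambda1 alpha Gamma <-> congruent Sigma Gamma.
Proof.
rewrite -straight_congruent.
have [E1 [E10 S1 ->]] := lambda1E alpha_gt0 arc_Sigma.
have [E2 [E20 S2 ->]] := lambda1E alpha_gt0 arc_Gamma.
have lS := len_Sigma; rewrite /arc_length in lS; have lG := segment_length; rewrite /arc_length in lG.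
rewrite lS in S1; rewrite lG in S2.
have [ss ms [c c0 cge] cle _] := arc_facts arc_Sigma len_Sigma.
have [sg mg [c' c'0 cge'] cle' _] := arc_facts arc_Gamma lG.
split=> [/oppr_inj EE|st].
  apply: contrapT => ns; have [r [k1 [k2 [r0 rr k10 k12 H]]]] := ends_gap ns.
  have lt := SE_cmp_strict L_gt0 c0 c'0 E20 ms mg cge cge' cle' chord_cmp_segment r0 rr k10 k12 H.
  by rewrite EE in S1; exact: (lt_mul_absurd alpha_gt0 lt S2 S1).
congr (- _).
(* For a straight arc all chords agree with those of the segment, so the comparison works in both
   directions and the two functions S coincide. *)
have cmp' s t : D s -> D t -> sqn (gamma s - gamma t) <= sqn (sigma s - sigma t).
  by move=> Ds Dt; rewrite segment_chord// (straight_chord L_gt0 cle st Ds Dt).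
have key : SE sigma L E1 = SE gamma L E1.
  have a1 := SE_cmp L_gt0 c'0 c0 E10 mg ms cge' cge cmp'.
  have a2 := SE_cmp L_gt0 c0 c'0 E10 ms mg cge cge' chord_cmp_segment.
  exact: (anti_le a1 a2).
rewrite key in S1; apply/le_anti/andP; split; rewrite leNgt; apply/negP => lt.
  exact: (lt_mul_absurd alpha_gt0 (SE_anti L_gt0 c'0 mg cge' cle' E20 lt) S1 S2).
exact: (lt_mul_absurd alpha_gt0 (SE_anti L_gt0 c'0 mg cge' cle' E10 lt) S2 S1).
Qed.

End main_compare.
End arcs.

(** * A line segment is a smooth open arc *)

Section convex_profile.
Context (R : realType).
Implicit Types (s t x m : R).

(** The function [eta] is bounded and cannot be convex; the factor t makes it convex while keeping
    it smooth and zero on the negative half-line. *)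
Definition hh t : R := t * eta t.
Definition hh' t : R := eta_poly (1 + 'X) t.

Lemma hh_le0 t : t <= 0 -> hh t = 0.
Proof. by move=> t0; rewrite /hh eta_le0// mulr0. Qed.

Lemma hh_ge0 t : 0 <= hh t.
Proof.
have [t0|/ltW t0] := leP t 0; first by rewrite hh_le0.
by rewrite mulr_ge0// eta_ge0.
Qed.

Lemma smooth_hh : smooth hh.
Proof.
apply: (@smoothM R _ (fun t : R => t) (@eta R)); last exact: smooth_eta.
have := @smooth_affine R R R 0 (@idfun R : {linear R -> R}) (fun x => @cvg_id _ (nbhs x)).
by congr smooth; apply/funext => x; rewrite add0r.
Qed.

Lemma hh'E t : 0 < t -> hh' t = (1 + t^-1) * expR (- t^-1).
Proof. by move=> t0; rewrite /hh' /eta_poly t0 hornerD hornerX hornerC. Qed.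

Lemma hh'_le0 t : t <= 0 -> hh' t = 0.
Proof. by rewrite /hh' /eta_poly leNgt => /negbTE ->. Qed.

Lemma is_derive_hh t : is_derive t (1 : R) hh (hh' t).
Proof.
have de := is_derive_eta_poly 1 t; rewrite -etaE in de.
have d := is_deriveM (is_derive_id t (1 : R)) de.
apply: (is_derive_eq d); rewrite derivC subr0 mul1r.
have sc (a b : R) : a *: (b : R) = a * b by [].
rewrite !sc mulr1; have [t0|t0] := leP t 0.
  by rewrite hh'_le0// eta_le0// addr0 /eta_poly ltNge t0 mulr0.
rewrite hh'E// /eta_poly /eta t0 hornerXn.
rewrite expr2 !mulrA mulfV ?mul1r ?gt_eqF// mulrDl mul1r.
by rewrite addrC.
Qed.

Lemma hh'_mono s t : s <= t -> hh' s <= hh' t.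
Proof.
move=> st; have [s0|s0] := leP s 0.
  rewrite (hh'_le0 s0); have [t0|t0] := leP t 0; first by rewrite hh'_le0.
  by rewrite hh'E// mulr_ge0 ?expR_ge0// addr_ge0// invr_ge0 ltW.
have t0 := lt_le_trans s0 st; rewrite !hh'E//.
have i0 : 0 < t^-1 by rewrite invr_gt0.
have ts : t^-1 <= s^-1 by rewrite lef_pV2.
move: (t^-1) (s^-1) i0 ts => x y x0 xy.
have -> : expR (- x) = expR (- y) * expR (y - x).
  by rewrite -expRD; congr expR; rewrite addrA addNr add0r.
rewrite mulrCA mulrC ler_pM2l ?expR_gt0//.
apply: (@le_trans _ _ ((1 + x) * (1 + (y - x)))); first by nra.
by apply: ler_wpM2l; [rewrite addr_ge0// ltW|exact: expR_ge1Dx].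
Qed.

Lemma hh_tangent m x : hh m + hh' m * (x - m) <= hh x.
Proof.
have ch : continuous hh.
  move=> t; have [d _] := is_derive_hh t.
  by apply/differentiable_continuous/derivable1_diffP.
have /orP[mx|xm] := le_total m x.
  have [t ht e] := MVT_segment mx (fun t _ => is_derive_hh t) (continuous_subspaceT ch).
  move: ht; rewrite in_itv/= => /andP[mt _].
  rewrite -[leRHS](subrK (hh m)) e addrC lerD2r; apply: ler_wpM2r; first by rewrite subr_ge0.
  exact: hh'_mono.
have [t ht e] := MVT_segment xm (fun t _ => is_derive_hh t) (continuous_subspaceT ch).
move: ht; rewrite in_itv/= => /andP[_ tm].
rewrite -lerBrDl -opprB -[leRHS]opprB e mulrN lerN2.
by apply: ler_wpM2r; [rewrite subr_ge0|exact: hh'_mono].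
Qed.

Lemma hh_big t : expR 1 <= t -> 1 <= hh t.
Proof.
move=> et; have e1 : 1 <= expR 1 :> R by rewrite -expR0 ler_expR.
have t1 := le_trans e1 et; have t0 := lt_le_trans ltr01 t1.
rewrite /hh /eta t0; apply: (@le_trans _ _ (expR 1 * expR (- 1))).
  by rewrite -expRD subrr expR0.
apply: ler_pM; rewrite ?expR_ge0// ler_expR lerN2.
by rewrite invf_le1.
Qed.

End convex_profile.

Section segment_domain.
Context (R : realType).
Variables (a e : R * R) (L : R).
Hypotheses (L_gt0 : 0 < L) (e1 : sqn e = 1).
Implicit Types (x y z v : R * R).

Let nn : R * R := (- e.2, e.1).
Let P z : R := - lin2 e.1 e.2 a + lin2 e.1 e.2 z.
Let Y z : R := - lin2 nn.1 nn.2 a + lin2 nn.1 nn.2 z.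
Definition phi (p : R) : R := hh (p - L) + hh (- p).
Definition phi' (p : R) : R := hh' (p - L) - hh' (- p).
(** [P] and [Y] are coordinates along the segment and its normal. For P in [0, L] the term [phi]
    vanishes and the sublevel set is the strip 0 < Y < 1, whose lower edge is the segment; outside,
    [phi] closes the strip smoothly. Convexity of [level] then gives the topological properties of
    the domain. *)
Definition level z : R := phi (P z) + Y z ^+ 2 - Y z.
Definition seg_dom : set (R * R) := [set z | level z < 0].

Lemma smooth_lin A B k : smooth (fun z : R * R => k + lin2 A B z).
Proof. exact: (smooth_affine k (@lin2_continuous R A B)). Qed.

Lemma diff_lin2 A B k z : differentiable (fun z : R * R => k + lin2 A B z) z.
Proof. exact: smooth_differentiable (smooth_lin A B k). Qed.

Lemma D_lin2 A B k z v : 'D_v (fun z : R * R => k + lin2 A B z) z = lin2 A B v.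
Proof.
have dl : differentiable (lin2 A B) z by exact: linear_differentiable (@lin2_continuous R A B).
rewrite deriveD//; last exact: diff_derivable.
by rewrite derive_cst add0r deriveE// diff_lin//; exact: lin2_continuous.
Qed.

Lemma phi1E : (fun z => hh (P z - L)) = (@hh R) \o (fun z => (- L - lin2 e.1 e.2 a) + lin2 e.1 e.2 z).
Proof. by apply/funext => z; rewrite /P /=; congr hh; ring. Qed.

Lemma phi2E : (fun z => hh (- P z)) = (@hh R) \o (fun z => lin2 e.1 e.2 a + lin2 (- e.1) (- e.2) z).
Proof. by apply/funext => z; rewrite /P /lin2 /=; congr hh; ring. Qed.

Lemma smooth_phi1 : smooth (fun z => hh (P z - L)).
Proof.
rewrite phi1E; apply: (smooth_comp_affine (dl := lin2 e.1 e.2)); last exact: smooth_hh.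
  by move=> x; exact: diff_lin2.
by move=> x v; exact: D_lin2.
Qed.

Lemma smooth_phi2 : smooth (fun z => hh (- P z)).
Proof.
rewrite phi2E; apply: (smooth_comp_affine (dl := lin2 (- e.1) (- e.2))); last exact: smooth_hh.
  by move=> x; exact: diff_lin2.
by move=> x v; exact: D_lin2.
Qed.

Lemma smooth_level : smooth level.
Proof.
apply: smoothB; last exact: smooth_lin.
apply: smoothD; first by apply: smoothD; [exact: smooth_phi1|exact: smooth_phi2].
have := smoothM (smooth_lin nn.1 nn.2 (- lin2 nn.1 nn.2 a)) (smooth_lin nn.1 nn.2 (- lin2 nn.1 nn.2 a)).
by congr smooth; apply/funext => z; rewrite expr2.
Qed.

Definition level' z v : R := phi' (P z) * lin2 e.1 e.2 v + (2 * Y z - 1) * lin2 nn.1 nn.2 v.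

Lemma level_line z v : is_derive (0 : R) (1 : R) (fun s : R => level (z + s *: v)) (level' z v).
Proof.
have Pl s : P (z + s *: v) = P z + s * lin2 e.1 e.2 v.
  by rewrite /P -[lin2 _ _ (z + _)]/((z.1 + s * v.1) * e.1 + (z.2 + s * v.2) * e.2) /lin2; ring.
have Yl s : Y (z + s *: v) = Y z + s * lin2 nn.1 nn.2 v.
  by rewrite /Y -[lin2 _ _ (z + _)]/((z.1 + s * v.1) * nn.1 + (z.2 + s * v.2) * nn.2) /lin2; ring.
have -> : (fun s : R => level (z + s *: v)) = (fun s => (hh ((P z - L) + lin2 e.1 e.2 v * s) + hh (- P z + - lin2 e.1 e.2 v * s))
   + (Y z ^+ 2 - Y z + (2 * Y z - 1) * lin2 nn.1 nn.2 v * s + lin2 nn.1 nn.2 v ^+ 2 * (s * s))).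
  apply/funext => s; rewrite /level /phi Pl Yl.
  rewrite (_ : P z + s * lin2 e.1 e.2 v - L = P z - L + lin2 e.1 e.2 v * s); last by ring.
  rewrite (_ : - (P z + s * lin2 e.1 e.2 v) = - P z + - lin2 e.1 e.2 v * s); last by ring.
  by ring.
have aff (k b : R) : is_derive (0 : R) (1 : R) (fun s => k + b * s) b.
  have := is_deriveD (is_derive_cst k (0 : R) (1 : R)) (is_deriveCl b (is_derive_id (0 : R) (1 : R))).
  by rewrite add0r mulr1.
have hc (k b : R) : is_derive (0 : R) (1 : R) (fun s => hh (k + b * s)) (hh' k * b).
  have d := @is_derive1_comp R (@hh R) (fun s => k + b * s) 0 _ _ (is_derive_hh (k + b * 0)) (aff k b).
  by apply: (is_derive_eq d); rewrite mulr0 addr0.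
have sq (b : R) : is_derive (0 : R) (1 : R) (fun s => b * (s * s)) 0.
  have := is_deriveCl b (is_deriveM (is_derive_id (0 : R) (1 : R)) (is_derive_id (0 : R) (1 : R))).
  by rewrite !scale0r addr0 mulr0.
have d := is_deriveD (is_deriveD (hc (P z - L) (lin2 e.1 e.2 v)) (hc (- P z) (- lin2 e.1 e.2 v)))
  (is_deriveD (aff (Y z ^+ 2 - Y z) ((2 * Y z - 1) * lin2 nn.1 nn.2 v)) (sq (lin2 nn.1 nn.2 v ^+ 2))).
apply: (is_derive_eq d); rewrite /level' /phi' addr0; ring.
Qed.

Lemma D_level z v : 'D_v level z = level' z v.
Proof.
have dr : derivable level (z + 0 *: v) v by apply: smooth_derivable; exact: smooth_level.
have [_ <-] := level_line z v.
by have [_ ->] := is_derive_line dr; rewrite scale0r addr0.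
Qed.

Lemma level_tangent m x : level m + level' m (x - m) <= level x.
Proof.
have Pb : lin2 e.1 e.2 (x - m) = P x - P m by rewrite /P dotB; ring.
have Yb : lin2 nn.1 nn.2 (x - m) = Y x - Y m by rewrite /Y dotB; ring.
rewrite /level' /level Pb Yb /phi /phi'.
have h1 := hh_tangent (P m - L) (P x - L); have h2 := hh_tangent (- P m) (- P x).
have h3 := sqr_ge0 (Y x - Y m); move: h1 h2 h3.
move: (P m) (P x) (Y m) (Y x) => p q r s; rewrite (_ : q - L - (p - L) = q - p); last by ring.
move: (hh _) (hh _) (hh _) (hh _) (hh' _) (hh' _) => a1 a2 a3 a4 b1 b2; nra.
Qed.

Lemma level_convex x y (k : R) : 0 <= k -> k <= 1 -> level (x + k *: (y - x)) <= (1 - k) * level x + k * level y.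
Proof.
move=> k0 k1; set m := x + k *: (y - x).
have h1 := level_tangent m x; have h2 := level_tangent m y.
have lx A B : lin2 A B (x - m) = - (k * lin2 A B (y - x)).
  by rewrite -[lin2 A B (x - m)]/((x.1 - (x.1 + k * (y.1 - x.1))) * A + (x.2 - (x.2 + k * (y.2 - x.2))) * B) /lin2 /=; ring.
have ly A B : lin2 A B (y - m) = (1 - k) * lin2 A B (y - x).
  by rewrite -[lin2 A B (y - m)]/((y.1 - (x.1 + k * (y.1 - x.1))) * A + (y.2 - (x.2 + k * (y.2 - x.2))) * B) /lin2 /=; ring.
rewrite /level' !lx in h1; rewrite /level' !ly in h2.
have g1 := ler_wpM2l (_ : 0 <= 1 - k) h1; have g2 := ler_wpM2l k0 h2.
have {}g1 := g1 ltac:(by rewrite subr_ge0).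
move: (lin2 _ _ _) (lin2 _ _ _) (phi' _) (2 * Y m - 1) g1 g2 => A B C D' g1 g2.
by move: (lerD g1 g2); nra.
Qed.

Lemma seg_dom_convex x y (k : R) : 0 <= k -> k <= 1 -> seg_dom x -> seg_dom y -> seg_dom (x + k *: (y - x)).
Proof.
move=> k0 k1; rewrite /seg_dom /= => rx ry; apply: (le_lt_trans (level_convex x y k0 k1)).
have [->|kn] := eqVneq k 0; first by rewrite subr0 mul1r mul0r addr0.
have kp : 0 < k by rewrite lt_neqAle eq_sym kn.
have : k * level y < 0 by rewrite pmulr_rlt0.
have : (1 - k) * level x <= 0 by rewrite mulr_ge0_le0// ?subr_ge0// ltW.
move=> h1 h2; have := ler_ltD h1 h2; by rewrite addr0.
Qed.

Definition pt (p y : R) : R * R := (a.1 + p * e.1 + y * nn.1, a.2 + p * e.2 + y * nn.2).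

Lemma pt_P (p y : R) : P (pt p y) = p.
Proof.
rewrite /P /pt /lin2 /nn /=; transitivity (p * sqn e); last by rewrite e1 mulr1.
by rewrite /sqn; ring.
Qed.

Lemma pt_Y (p y : R) : Y (pt p y) = y.
Proof.
rewrite /Y /pt /lin2 /nn /=; transitivity (y * sqn e); last by rewrite e1 mulr1.
by rewrite /sqn; ring.
Qed.

Lemma pt_PY z : z = pt (P z) (Y z).
Proof.
rewrite /pt /P /Y /lin2 /nn /= [LHS]surjective_pairing; congr (_, _).
  transitivity (a.1 + (z.1 - a.1) * sqn e); first by rewrite e1; ring.
  by rewrite /sqn; ring.
transitivity (a.2 + (z.2 - a.2) * sqn e); first by rewrite e1; ring.
by rewrite /sqn; ring.
Qed.

Lemma phi_mid p : 0 <= p -> p <= L -> phi p = 0.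
Proof. by move=> p0 pL; rewrite /phi !hh_le0 ?addr0 ?oppr_le0// subr_le0. Qed.

Lemma level_pt (p y : R) : level (pt p y) = phi p + y ^+ 2 - y.
Proof. by rewrite /level pt_P pt_Y. Qed.

Lemma level_center : level (pt (L / 2) 2^-1) = - 4^-1.
Proof.
rewrite level_pt phi_mid; [by field|by rewrite divr_ge0// ltW|].
by rewrite ler_pdivrMr// ler_peMr ?(ltW L_gt0)// ler1n.
Qed.

Lemma seg_dom_open : open seg_dom.
Proof.
rewrite (_ : seg_dom = level @^-1` [set x | x < 0])//; apply: open_comp; last exact: open_lt.
by move=> x _; exact: smooth_continuous smooth_level x.
Qed.

Lemma seg_dom_bounded : bounded_set seg_dom.
Proof.
have ec : `|e.1| <= 1 /\ `|e.2| <= 1 by apply: coord_le => //; rewrite e1 expr1n.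
have [c1 c2] := ec.
exists (`|a| + (expR 1 + L + 1)); split; first exact: num_real.
move=> M ltM z; rewrite /seg_dom /= => rz; apply: le_trans (ltW ltM).
rewrite /level in rz; have p0 := addr_ge0 (hh_ge0 (P z - L)) (hh_ge0 (- P z)); rewrite -/(phi _) in p0.
(* Since [phi] is nonnegative, Y^2 - Y is negative; since Y^2 - Y >= -1/4, [phi] is below 1, which
   bounds P through [hh_big]. *)
have [Y0 Y1] : 0 <= Y z /\ Y z <= 1 by split; nra.
have pl : phi (P z) < 1 by nra.
have q1 : hh (P z - L) < 1 by apply: le_lt_trans pl; rewrite /phi lerDl hh_ge0.
have q2 : hh (- P z) < 1 by apply: le_lt_trans pl; rewrite /phi lerDr hh_ge0.
have b1 : P z - L < expR 1 by rewrite ltNge; apply/negP => /hh_big; rewrite leNgt q1.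
have b2 : - P z < expR 1 by rewrite ltNge; apply/negP => /hh_big; rewrite leNgt q2.
have Pb : `|P z| <= expR 1 + L.
  by rewrite ler_norml; apply/andP; split; move: L_gt0; clear -b1 b2 => ?; lra.
have co (k u w : R) : `|u| <= 1 -> `|w| <= 1 -> `|k| <= `|a| -> `|k + P z * u + Y z * w| <= `|a| + (expR 1 + L + 1).
  move=> u1 w1 ka; apply: (le_trans (ler_normD _ _)); rewrite addrA; apply: lerD.
    apply: (le_trans (ler_normD _ _)); apply: lerD => //; rewrite normrM -[leRHS]mulr1; exact: ler_pM.
  rewrite normrM -[leRHS]mulr1; apply: ler_pM => //; by rewrite ger0_norm.
rewrite {1}(pt_PY z) prod_normE /pt /= ge_max; apply/andP; split.
  by apply: co => //; rewrite ?normrN//; exact: norm1_le.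
by apply: co => //; exact: norm2_le.
Qed.

Lemma segment_path_continuous x v : continuous (fun k : R => x + k *: v).
Proof. by move=> k; apply: cvgD; [exact: cvg_cst|apply: cvgZr_tmp; exact: cvg_id]. Qed.

Lemma center_in : seg_dom (pt (L / 2) 2^-1).
Proof. by rewrite /seg_dom /= level_center oppr_lt0 invr_gt0. Qed.

Lemma seg_dom_connected : connected seg_dom.
Proof.
pose z0 := pt (L / 2) 2^-1.
have -> : seg_dom = \bigcup_(z in seg_dom) ((fun k : R => z0 + k *: (z - z0)) @` `[0, 1]).
  apply/seteqP; split=> [z Az|_ [z Az [k kI <-]]].
    exists z => //; exists 1; first by rewrite /= in_itv/= ler01 lexx.
    by rewrite scale1r addrC subrK.
  move: kI; rewrite /= in_itv/= => /andP[k0 k1].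
  exact: seg_dom_convex center_in Az.
apply: bigcup_connected.
  exists z0 => z Az; exists 0; first by rewrite /= in_itv/= ler01 lexx.
  by rewrite scale0r addr0.
move=> z Az; apply: connected_continuous_connected; first exact: segment_connected.
exact: continuous_subspaceT (@segment_path_continuous z0 (z - z0)).
Qed.

(** The loop is continuous only relative to [0, 1]; composing with [clamp] makes it continuous on
    the line, so the straight-line homotopy is continuous on the plane. *)
Definition clamp (t : R) : R := Num.max 0 (Num.min t 1).

Lemma clamp_in t : clamp t \in `[0, 1].
Proof. by rewrite in_itv/= /clamp le_max lexx/= ge_max ler01 ge_min lexx orbT. Qed.

Lemma clampE t : t \in `[0, 1] -> clamp t = t.
Proof. by rewrite in_itv/= => /andP[t0 t1]; rewrite /clamp (min_idPl t1) (max_idPr t0). Qed.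

Lemma clamp_continuous : continuous clamp.
Proof.
move=> t; apply: (@continuous_max R R (cst 0) (fun t => Num.min t 1) t); first exact: cst_continuous.
apply: (@continuous_min R R id (cst 1) t); first exact: cvg_id.
exact: cst_continuous.
Qed.

Lemma clamp_path_continuous (c : R -> R * R) : {within `[0, 1], continuous c} -> continuous (c \o clamp).
Proof.
move=> /subspace_continuousP cc t.
have H := cc (clamp t) (clamp_in t).
apply: cvg_trans H => B /= HB; rewrite /= !nbhs_simpl /= in HB *.
have := clamp_continuous (x := t) HB; rewrite /= nbhs_simpl /=; apply: filterS => u /= Hu.
by apply: Hu; exact: clamp_in.
Qed.

Lemma seg_dom_loops : loops_contract seg_dom.
Proof.
move=> c cc cA c01.
have cA' t : seg_dom (c (clamp t)) by apply: cA; exists (clamp t); [exact: clamp_in|].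
have I0 : (0 : R) \in `[0, 1] by rewrite in_itv/= lexx ler01.
have I1 : (1 : R) \in `[0, 1] by rewrite in_itv/= lexx ler01.
exists (fun z => c (clamp z.2) + clamp z.1 *: (c 0 - c (clamp z.2))); split.
- apply: continuous_subspaceT => z.
  have k1 : (fun z : R * R => c (clamp z.2)) @ z --> c (clamp z.2).
    exact: (@cvg_comp _ _ _ (@snd R R) (c \o clamp) _ _ _ cvg_snd (clamp_path_continuous cc (x := z.2))).
  have k2 : (fun z : R * R => clamp z.1) @ z --> clamp z.1.
    exact: (@cvg_comp _ _ _ (@fst R R) clamp _ _ _ cvg_fst (clamp_continuous (x := z.1))).
  by apply: cvgD => //; apply: cvgZ => //; apply: cvgB => //; exact: cvg_cst.
- move=> _ [z _ <-]; have := clamp_in z.1; rewrite in_itv/= => /andP[h0 h1].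
  by apply: seg_dom_convex => //; rewrite -[0](clampE I0); exact: cA'.
move=> t tI; rewrite /= !clampE//; split.
- by rewrite scale0r addr0.
- by rewrite scale1r addrC subrK.
- by rewrite subrr scaler0 addr0.
- by rewrite -c01 subrr scaler0 addr0.
Qed.

Lemma boundary_level z : boundary seg_dom z -> level z = 0.
Proof.
move=> [cz iz]; apply/le_anti/andP; split.
  have cl : closed (level @^-1` [set x | x <= 0]).
    by apply: preimage_closed; [move=> x _; exact: smooth_continuous smooth_level x|exact: closed_le].
  have : seg_dom `<=` level @^-1` [set x | x <= 0] by move=> x /ltW.
  by move=> /closure_subset/(_ _ cz); rewrite -(closure_id _).1.
rewrite leNgt; apply/negP => rz; apply: iz.
by rewrite (interior_id _).1 //; exact: seg_dom_open.
Qed.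

(** At a boundary point [level] is 0, while at the centre it is -1/4; by the tangent inequality the
    derivative towards the centre is negative, so the differential does not vanish. *)
Lemma seg_dom_smooth : smooth_boundary seg_dom.
Proof.
move=> z bz; have rz := boundary_level bz; exists level; split.
- exact: smooth_level.
- exists (pt (L / 2) 2^-1 - z); rewrite D_level.
  have := level_tangent z (pt (L / 2) 2^-1); rewrite rz add0r level_center => h.
  by rewrite lt_eqF//; apply: (le_lt_trans h); rewrite oppr_lt0 invr_gt0.
- by apply/nbhs_ballP; exists 1 => //= x _.
Qed.

Lemma seg_boundary k : 0 <= k -> k <= L -> boundary seg_dom (a + k *: e).
Proof.
move=> k0 kL; have zE : a + k *: e = pt k 0.
  by rewrite /pt !mul0r !addr0.
have rz : level (pt k 0) = 0 by rewrite level_pt phi_mid// expr0n subr0 addr0.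
rewrite zE; split; last first.
  by move=> /interior_subset; rewrite /seg_dom /= rz ltxx.
move=> B /nbhs_ballP[d /= d0 dB].
(* Moving by s along the normal stays in the ball, and s^2 - s < 0 puts the point in the domain. *)
pose s := Num.min 2^-1 (d / 2).
have s0 : 0 < s by rewrite lt_min invr_gt0/= ltr0n divr_gt0.
have s1 : s <= 2^-1 by rewrite ge_min lexx.
have sd : s < d.
  by apply: (@le_lt_trans _ _ (d / 2)); [rewrite ge_min lexx orbT|rewrite ltr_pdivrMr// mulr_natr mulr2n ltrDl].
exists (pt k s); split.
  rewrite /seg_dom /= level_pt phi_mid// add0r subr_lt0 expr2 gtr_pMl//.
  by apply: (le_lt_trans s1); rewrite invf_lt1// ltr1n.
apply: dB; rewrite -ball_normE /ball_ /=.
have [c1 c2] : `|e.1| <= 1 /\ `|e.2| <= 1 by apply: coord_le => //; rewrite e1 expr1n.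
have -> : pt k 0 - pt k s = (- (s * nn.1), - (s * nn.2)).
  by rewrite /pt -[LHS]/(a.1 + k * e.1 + 0 * nn.1 - (a.1 + k * e.1 + s * nn.1), a.2 + k * e.2 + 0 * nn.2 - (a.2 + k * e.2 + s * nn.2)); congr (_, _); ring.
rewrite prod_normE /= gt_max !normrN !normrM (gtr0_norm s0) normrN.
by apply/andP; split; apply: (le_lt_trans _ sd); rewrite ler_piMr// ltW.
Qed.

Lemma seg_dom_domain : smooth_bounded_sc_domain seg_dom.
Proof.
split; [exact: seg_dom_open|exact: seg_dom_connected|by exists (pt (L / 2) 2^-1); exact: center_in|exact: seg_dom_bounded|].
by split; [exact: seg_dom_loops|exact: seg_dom_smooth].
Qed.

End segment_domain.

Section segment_arc.
Context (R : realType).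

Definition ray (e : R * R) (t : R) : R * R := t *: e.

Fact ray_is_linear e : linear (ray e).
Proof. by move=> k x y; rewrite /ray scalerDl scalerA. Qed.

HB.instance Definition _ e :=
  GRing.isLinear.Build R R (R * R)%type *:%R (ray e) (ray_is_linear e).

Lemma ray_continuous e : continuous (ray e).
Proof. by move=> t; apply: cvgZr_tmp; exact: cvg_id. Qed.

Lemma segment_is_arc (L : R) (Gamma : set (R * R)) : 0 < L -> line_segment L Gamma -> smooth_open_arc Gamma.
Proof.
move=> L0 [a [b [ab ->]]]; have Ln : L != 0 by rewrite gt_eqF.
pose e := L^-1 *: (b - a).
have e1 : sqn e = 1 by rewrite sqnZ -sqn_enorm ab -exprMn mulVf ?expr1n.
split; last first.
  exists (seg_dom a e L); first exact: seg_dom_domain.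
  move=> _ [t tI ->]; move: tI; rewrite in_itv/= => /andP[t0 t1].
  have -> : a + t *: (b - a) = a + (t * L) *: e by rewrite /e scalerA mulfK.
  by apply: seg_boundary => //; [rewrite mulr_ge0// ltW|rewrite ler_piMl// ltW].
exists (L, fun t => a + t *: e); rewrite /arclength_param /=.
have De t : 'D_1 (fun t : R => a + t *: e) t = e.
  have dl : differentiable (ray e) t by exact: linear_differentiable (@ray_continuous e).
  have d1 : is_derive t (1 : R) (ray e) e.
    apply: DeriveDef; first exact: diff_derivable.
    rewrite deriveE// diff_lin; last exact: ray_continuous.
    exact: scale1r.
  have [_ d] := is_deriveD (is_derive_cst a t (1 : R)) d1.
  exact: (etrans d (add0r e)).
split => //.
- exact: (@smooth_affine R R (R * R)%type a (ray e)) (@ray_continuous e).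
- by move=> t _; rewrite De /enorm -/(sqn e) e1 sqrtr1.
- move=> s t _ _ /addrI/eqP; rewrite -subr_eq0 -scalerBl => /eqP H.
  have : sqn ((s - t) *: e) = 0 by rewrite H /sqn /= expr0n addr0.
  by rewrite sqnZ e1 mulr1 => /eqP; rewrite sqrf_eq0 subr_eq0 => /eqP.
- apply/seteqP; split=> [_ [t tI <-]|_ [t tI ->]].
    exists (t / L); last by rewrite /e scalerA.
    move: tI; rewrite /= !in_itv/= => /andP[t0 t1].
    by rewrite divr_ge0 ?(ltW L0)//= ler_pdivrMr// mul1r.
  exists (t * L); last by rewrite /e scalerA mulfK.
  by move: tI; rewrite /= !in_itv/= => /andP[t0 t1]; rewrite mulr_ge0 ?(ltW L0)//= ler_piMl// ltW.
Qed.

End segment_arc.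

Theorem theorem1p1 (R : realType) (alpha L : R) (Gamma : set (R * R)) :
  0 < alpha -> 0 < L -> line_segment L Gamma ->
  let arcs := [set Sigma : set (R * R) |
                smooth_open_arc Sigma /\ arc_length Sigma = L] in
  let lambdas := lambda1 alpha @` arcs in
  (* the maximum is attained at Gamma *)
  [/\ arcs Gamma,
      ubound lambdas (lambda1 alpha Gamma)
    & forall Sigma, arcs Sigma ->
        (lambda1 alpha Sigma = lambda1 alpha Gamma <-> congruent Sigma Gamma)].
Proof.
move=> a0 L0 sG arcs lambdas; have aG := segment_is_arc L0 sG.
split.
- by split; [exact: aG|exact: segment_length L0 sG aG].
- by move=> _ [S [aS lS] <-]; exact: (lambda1_le a0 L0 sG aG aS lS).
- by move=> S [aS lS]; exact: (lambda1_eq a0 L0 sG aG aS lS).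
Qed.
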